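(* Let $-1<\beta<1$ and $\theta=\frac{\pi}{2}(1-\beta)$. Let $T>0$ and let $\gamma:[0,T]\to\mathbb H\cup\{0\}$ be a simple continuous curve, parametrized by half-plane capacity, with $\gamma(0)=0$ and $\operatorname{Im}\gamma(t)>0$ for $t>0$. Write $\gamma_t=\gamma[0,t]$. Assume that $\gamma$ is of class $C^4$ with respect to its arc-length parameter $s$ (up to and including $s=0$) and that it has at least 4-order tangency at the origin to the straight line that makes the angle $\theta=\frac{\pi}{2}(1-\beta)$ with the real axis $\mathbb R$, i.e. $$\gamma(t(s))=e^{i\theta}s+o(s^4),\qquad s\to+0.$$ Let $f(\cdot,t)$ map $\mathbb H\setminus\gamma_t$ conformally onto $\mathbb H$ and solve the chordal Löwner equation $$\frac{df(z,t)}{dt}=\frac{2}{f(z,t)-\lambda(t)},\qquad f(z,0)\equiv z,$$ with the continuous real-valued driving function $\lambda$ determined by $\gamma$. Let $\gamma_{1t}$ be the left side and $\gamma_{2t}$ the right side of $\gamma_t$, and let $$m_k(t):=\omega\bigl(f^{-1}(i,t);\gamma_{kt},\mathbb H\setminus\gamma_t\bigr),\qquad k=1,2,$$ be the harmonic measures of these sides at the point $f^{-1}(i,t)$ with respect to $\mathbb H\setminus\gamma_t$. Then $$\lim_{t\to+0}\frac{m_1(t)}{m_2(t)}=\frac{1+\beta}{1-\beta}.$$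
   Context: $\mathbb H=\{z\in\mathbb C:\operatorname{Im}z>0\}$, $\mathbb R=\partial\mathbb H$. Löwner maps and capacity parametrization: for a simple continuous curve $\gamma_t=\gamma[0,t]=\{\gamma(x):0\le x\le t\}$ in $\mathbb H\cup\{0\}$ with $\gamma(0)=0$, $f(\cdot,t)$ denotes the unique conformal map of $\mathbb H\setminus\gamma_t$ onto $\mathbb H$ normalized near infinity by $f(z,t)=z+\frac{2t}{z}+O(z^{-2})$. The value $t$ is called the half-plane capacity of $\gamma_t$, and $\gamma$ is parametrized so that the piece $\gamma[0,t]$ has half-plane capacity $t$, $0\le t\le T$. Then $f$ satisfies the chordal Löwner equation with a continuous real-valued $\lambda$ uniquely determined by $\gamma$. The map $f(\cdot,t)$ extends continuously to the tip, with $f(\gamma(t),t)=\lambda(t)$. $f^{-1}(\cdot,t)$ denotes the inverse of $f(\cdot,t)$. Smoothness: $s$ is the arc-length parameter of $\gamma$ measured from $\gamma(0)=0$, and $t(s)$ is the half-plane capacity of the initial piece of $\gamma$ of length $s$, with $t(S)=T$. $\gamma$ is of class $C^n$ if $s\mapsto\gamma(t(s))$ has a continuous $n$-th derivative on $[0,S]$, where derivatives at $s=0$ are one-sided. Sides: the curve $\gamma_t$ has two sides, which define different prime ends of $\mathbb H\setminus\gamma_t$ at the same points, except at the tip. The left side $\gamma_{1t}$ is the one met first when going along the boundary of $\mathbb H\setminus\gamma_t$ starting along $\mathbb R$ from $-\infty$ to $0$; the other one is the right side $\gamma_{2t}$. Equivalently, $f(\cdot,t)$ maps $\gamma_t$ (both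 sides, in the sense of prime ends) onto a segment $[f_2(0,t),f_1(0,t)]\subset\mathbb R$ containing $\lambda(t)$, with $\gamma_{1t}$ corresponding to $[f_2(0,t),\lambda(t)]$ and $\gamma_{2t}$ to $[\lambda(t),f_1(0,t)]$. Harmonic measure: $\omega(z;\gamma_{kt},\mathbb H\setminus\gamma_t)$ is the value at $z$ of the bounded harmonic function $\omega_k$ on $\mathbb H\setminus\gamma_t$ that extends continuously to the boundary (in the sense of prime ends) except at the endpoints of $\gamma_t$, equals $1$ on $\gamma_{kt}$, and equals $0$ on $\mathbb R$ and on the other side of $\gamma_t$. *)

(* Defs.v *)
From Stdlib Require Export Reals ClassicalEpsilon.
From Coquelicot Require Export Coquelicot.

Open Scope R_scope.

(** ** Functions of a real variable on a closed interval *)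

Definition Icc (a b : R) : R -> Prop := fun x => a <= x <= b.

Definition continuous_within (D : R -> Prop) (g : R -> C) (x : R) : Prop :=
  filterlim g (within D (locally x)) (locally (g x)).

(** Derivative relative to [D]: one-sided at an endpoint of an interval. *)
Definition is_derive_within (D : R -> Prop) (g : R -> C) (x : R) (l : C) : Prop :=
  filterlim (fun y => ((g y - g x) / RtoC (y - x))%C)
            (within D (locally' x)) (locally l).

(** [G k] is the [k]-th derivative of [g]. *)
Definition class_C (n : nat) (a b : R) (g : R -> C) : Prop :=
  exists G : nat -> R -> C,
    (forall x, Icc a b x -> G 0%nat x = g x) /\
    (forall k x, (k < n)%nat -> Icc a b x ->
       is_derive_within (Icc a b) (G k) x (G (S k) x)) /\
    (forall x, Icc a b x -> continuous_within (Icc a b) (G n) x).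

Definition polygon_length (g : R -> C) (a b l : R) : Prop :=
  exists (n : nat) (p : nat -> R),
    p 0%nat = a /\ p (S n) = b /\ (forall k, (k <= n)%nat -> p k <= p (S k)) /\
    l = sum_n (fun k => Cmod (g (p (S k)) - g (p k))%C) n.

Definition is_arc_length (g : R -> C) (a b l : R) : Prop :=
  is_lub (polygon_length g a b) l.

(** ** Holomorphic and harmonic functions *)

Definition Hplane (z : C) : Prop := 0 < Im z.

Definition conformal_onto (D E : C -> Prop) (g : C -> C) : Prop :=
  (forall z, D z -> ex_derive (K := C_AbsRing) (V := C_NormedModule) g z) /\
  (forall z w, D z -> D w -> g z = g w -> z = w) /\
  (forall w, E w <-> exists z, D z /\ g z = w).

Definition inverse_on (D : C -> Prop) (g : C -> C) (w : C) : C :=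
  epsilon (inhabits (RtoC 0)) (fun z => D z /\ g z = w).

Definition harmonic_on (D : C -> Prop) (u : C -> R) : Prop :=
  let v := fun x y => u (x, y) in
  forall z, D z ->
    ex_diff_n v 2 (Re z) (Im z) /\
    partial_derive 2 0 v (Re z) (Im z) + partial_derive 0 2 v (Re z) (Im z) = 0.

(** ** Prime ends, by null-chains of crosscuts *)

Definition boundary (G : C -> Prop) (z : C) : Prop :=
  forall eps, 0 < eps ->
    (exists w, G w /\ Cmod (w - z)%C < eps) /\
    (exists w, ~ G w /\ Cmod (w - z)%C < eps).

(** The crosscut itself is the image of the open interval; its two endpoints
    lie on the boundary and are allowed to coincide. *)
Definition crosscut (G : C -> Prop) (c : R -> C) : Prop :=
  (forall x, Icc 0 1 x -> continuous_within (Icc 0 1) c x) /\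
  (forall x, 0 < x < 1 -> G (c x)) /\
  (forall x y, 0 < x < 1 -> 0 < y < 1 -> c x = c y -> x = y) /\
  boundary G (c 0) /\ boundary G (c 1).

Definition arc (c : R -> C) (z : C) : Prop := exists x, 0 < x < 1 /\ z = c x.

Definition closed_arc (c : R -> C) (z : C) : Prop :=
  exists x, Icc 0 1 x /\ z = c x.

Definition joined (D : C -> Prop) (z w : C) : Prop :=
  exists p : R -> C,
    (forall x, Icc 0 1 x -> continuous_within (Icc 0 1) p x /\ D (p x)) /\
    p 0 = z /\ p 1 = w.

Definition cut (G : C -> Prop) (c : R -> C) (z : C) : Prop := G z /\ ~ arc c z.

Definition separates (G : C -> Prop) (c : R -> C) (A B : C -> Prop) : Prop :=
  forall z w, A z -> B w -> cut G c z /\ cut G c w /\ ~ joined (cut G c) z w.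

(** Diameters are Euclidean, so only prime ends at finite points are
    represented. *)
Definition null_chain (G : C -> Prop) (c : nat -> R -> C) : Prop :=
  (forall n, crosscut G (c n)) /\
  (forall n z, ~ (closed_arc (c n) z /\ closed_arc (c (S n)) z)) /\
  (forall n, (1 <= n)%nat ->
     separates G (c n) (arc (c 0%nat)) (arc (c (S n)))) /\
  (forall eps, 0 < eps -> exists N, forall n, (N <= n)%nat ->
     forall z w, arc (c n) z -> arc (c n) w -> Cmod (z - w)%C < eps).

(** The part of [G] cut off by the [n]-th crosscut from the initial one. *)
Definition chain_nbhd (G : C -> Prop) (c : nat -> R -> C) (n : nat) (z : C) : Prop :=
  cut G (c n) z /\
  forall w, arc (c 0%nat) w -> ~ joined (cut G (c n)) z w.

(** Convergence to the prime end represented by [c].  Equivalent null-chains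
    give the same filter, so prime ends are handled through representatives. *)
Definition prime_end (G : C -> Prop) (c : nat -> R -> C) : (C -> Prop) -> Prop :=
  fun P => exists n, (1 <= n)%nat /\ forall z, chain_nbhd G c n z -> P z.

Definition prime_end_at (G : C -> Prop) (c : nat -> R -> C) (zeta : C) : Prop :=
  filterlim (fun z : C => z) (prime_end G c) (locally zeta).

(** ** Harmonic measure *)

(** [A] is a set of prime ends; no boundary condition is imposed at the prime
    ends over the points of [E]. *)
Definition is_harmonic_measure (G : C -> Prop) (A : (nat -> R -> C) -> Prop)
    (E : C -> Prop) (u : C -> R) : Prop :=
  harmonic_on G u /\
  (exists M, forall z, G z -> Rabs (u z) <= M) /\
  (forall c zeta, null_chain G c -> prime_end_at G c zeta -> ~ E zeta ->
     (A c -> filterlim u (prime_end G c) (locally 1)) /\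
     (~ A c -> filterlim u (prime_end G c) (locally 0))).

Definition harmonic_measure (z : C) (A : (nat -> R -> C) -> Prop)
    (G : C -> Prop) (E : C -> Prop) : R :=
  epsilon (inhabits (fun _ : C => 0)) (is_harmonic_measure G A E) z.

(** ** Slit half-planes *)

Definition trace (gamma : R -> C) (t : R) (z : C) : Prop :=
  exists x, Icc 0 t x /\ z = gamma x.

Definition slit (gamma : R -> C) (t : R) (z : C) : Prop :=
  Hplane z /\ ~ trace gamma t z.

(** [g z = z + 2 t / z + O(z^(-2))] near infinity in [D]. *)
Definition hydrodynamic (D : C -> Prop) (g : C -> C) (t : R) : Prop :=
  exists M K, 0 < M /\ forall z, D z -> M < Cmod z ->
    Cmod (g z - (z + RtoC (2 * t) / z))%C <= K / Cmod z ^ 2.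

(** Prime ends of the slit half-plane over the slit which [g] maps to the left,
    respectively to the right, of the image [l] of the tip. *)
Definition left_side (gamma : R -> C) (t : R) (g : C -> C) (l : R)
    (c : nat -> R -> C) : Prop :=
  exists zeta x, trace gamma t zeta /\ prime_end_at (slit gamma t) c zeta /\
    filterlim g (prime_end (slit gamma t) c) (locally (RtoC x)) /\ x <= l.

Definition right_side (gamma : R -> C) (t : R) (g : C -> C) (l : R)
    (c : nat -> R -> C) : Prop :=
  exists zeta x, trace gamma t zeta /\ prime_end_at (slit gamma t) c zeta /\
    filterlim g (prime_end (slit gamma t) c) (locally (RtoC x)) /\ l <= x.

Definition slit_ends (gamma : R -> C) (t : R) (z : C) : Prop :=
  z = gamma 0 \/ z = gamma t.

Definition side_measure
    (side : (R -> C) -> R -> (C -> C) -> R -> (nat -> R -> C) -> Prop)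
    (gamma : R -> C) (f : C -> R -> C) (lambda : R -> R) (t : R) : R :=
  let D := slit gamma t in
  let g := fun z => f z t in
  harmonic_measure (inverse_on D g Ci) (side gamma t g (lambda t)) D
    (slit_ends gamma t).

(* Main.v *)
(** Let x2(t) < lambda(t) < x1(t) be the two images of the origin under f(.,t) and put p = (1 - beta) / 2, so that
    theta = pi p. The harmonic measures at f^-1(i, t) are the angles at which i sees [x2, lambda] and [lambda, x1],
    divided by pi, so their ratio is asymptotically (lambda - x2) / (x1 - lambda), and the claim becomes
    (x1 - lambda) / (x1 - x2) -> p.

    Near the origin the curve is almost the ray of angle theta. Hence arg z is compared, by the maximum principle in
    the slit domain, with p arg (f - x1) + (1 - p) arg (f - x2): both are 0 and pi on the two half-axes, and about theta
    on the curve. Expanding at infinity, where f = z + O(1/z), shows that the centre of mass p x1 + (1 - p) x2 is o(x1 - x2).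
    Along the Loewner flow x1' = 2 / (x1 - lambda) and x2' = 2 / (x2 - lambda), so if (x1 - lambda) / (x1 - x2) stayed
    away from p, the centre of mass would drift by a fixed proportion of the width during a time in which lambda cannot
    compensate, a contradiction. Boundary values of f on the two sides of the curve and on the real line are obtained
    directly from the flow, without a general theory of prime ends. *)

Require Import Defs.
From Stdlib Require Import Lra Lia Psatz List.

Local Notation lra := ltac:(lra) (only parsing).
Local Notation "<| z |>" := (Cmod z%C) (format "<| z |>").
Local Notation lia := ltac:(lia) (only parsing).

(** The parameters are chosen in the order [k] (accuracy of the ratio), [d] (relative growth of the
    curve in one episode of drift), [eps] (slope of the curve against the ray), then the time; [eps]
    has to be small against the drift that one episode produces. The scale is [A t], the coordinate
    of the tip along the ray: the width [x1 - x2] lies between fixed multiples of it, growth from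
    [A] to [(1 + d) A] takes at least a multiple of [(d A)^2], and meanwhile [lambda] moves by a
    small multiple of [A], because the new arc has harmonic measure of order [d^(1/4)] from a far
    point. All comparisons use one maximum principle with finitely many exceptional points, so they
    need boundary values of [f]. The obstacle is the curve: limits on its sides exist because two
    trajectories that leave the driving point on the same side approach each other, and this rests
    on [tip_only], which says that [f] is near [lambda t] only near the tip. Since harmonic measure
    is an [epsilon] choice, the explicit candidate must also be shown to be the only one; for that,
    null-chains are translated into ordinary neighbourhoods. *)

Lemma Rminl {x a b} : x < Rmin a b -> x < a.
Proof. apply Rmin_Rgt_l. Qed.

Lemma Rminr {x a b} : x < Rmin a b -> x < b.
Proof. apply Rmin_Rgt_l. Qed.

Lemma Rmin2 x a b : x < Rmin a b -> x < a /\ x < b.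
Proof. apply Rmin_Rgt_l. Qed.

Lemma Rmin3 x a b c : x < Rmin a (Rmin b c) -> x < a /\ x < b /\ x < c.
Proof. intros H. apply Rmin2 in H as (H1 & H2). apply Rmin2 in H2. tauto. Qed.

(** * Complex derivatives *)

Section ComplexDifferentiation.

Implicit Types (g h e L : C -> C) (z w l m : C).

Lemma Ceq (z w : C) : Re z = Re w -> Im z = Im w -> z = w.
Proof. destruct z, w; simpl; intros -> ->; reflexivity. Qed.

Lemma Csub0 (z w : C) : (z - w)%C = 0%C -> z = w.
Proof.
  intros H. apply Ceq; apply (f_equal Re) in H as H1; apply (f_equal Im) in H as H2;
  unfold Re, Im in *; simpl in *; lra.
Qed.

Lemma Ceq_dec (z w : C) : {z = w} + {z <> w}.
Proof.
  destruct z as [a b], w as [c d].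
  destruct (Req_EM_T a c) as [->|H]; [destruct (Req_EM_T b d) as [->|H]|].
  - now left.
  - right; intros E; injection E; auto.
  - right; intros E; injection E; auto.
Qed.

Lemma Cmod_sub_sym (z w : C) : <|z - w|> = <|w - z|>.
Proof. rewrite <- Cmod_opp. f_equal. ring. Qed.

Lemma Cmod_sub_0 (z : C) : <|z - z|> = 0.
Proof. replace (z - z)%C with (RtoC 0) by ring. apply Cmod_0. Qed.

Lemma Cmod_tri3 (z w v : C) : <|z - v|> <= <|z - w|> + <|w - v|>.
Proof. replace (z - v)%C with ((z - w) + (w - v))%C by ring. apply Cmod_triangle. Qed.

Lemma Cmod_rev (z w : C) : Cmod z - Cmod w <= <|z - w|>.
Proof.
  assert (H := Cmod_triangle (z - w)%C w).
  replace (z - w + w)%C with z in H by ring. lra.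
Qed.

Lemma Cmod_sqr (z : C) : Cmod z * Cmod z = Re z * Re z + Im z * Im z.
Proof. assert (H := Cmod2_alt z).  lra. Qed.

Lemma im_le_Cmod (c : C) : Rabs (Im c) <= Cmod c.
Proof.
   eapply Rle_trans; [|apply Rmax_Cmod]. apply Rmax_r.
Qed.

Lemma Cmod_le_sum (c : C) : Cmod c <= Rabs (Re c) + Rabs (Im c).
Proof.
  assert (H := Cmod_sqr c).
  assert (H1 := Rabs_pos (Re c)). assert (H2 := Rabs_pos (Im c)).
  assert (Rabs (Re c) * Rabs (Re c) = Re c * Re c) by (rewrite <- Rabs_mult; apply Rabs_pos_eq; nra).
  assert (Rabs (Im c) * Rabs (Im c) = Im c * Im c) by (rewrite <- Rabs_mult; apply Rabs_pos_eq; nra).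
  nra.
Qed.

Lemma re_minus (a b : C) : Re (a - b)%C = Re a - Re b.
Proof. reflexivity. Qed.
Lemma im_minus (a b : C) : Im (a - b)%C = Im a - Im b.
Proof. reflexivity. Qed.

Definition ccont (g : C -> C) (z : C) : Prop :=
  forall eps, 0 < eps -> exists d, 0 < d /\
    forall w, <|w - z|> < d -> <|g w - g z|> < eps.

Definition rcont (u : C -> R) (z : C) : Prop :=
  forall eps, 0 < eps -> exists d, 0 < d /\
    forall w, <|w - z|> < d -> Rabs (u w - u z) < eps.

(** Caratheodory's formulation: the difference quotient extends continuously. *)
Definition cderiv (g : C -> C) (z l : C) : Prop :=
  exists phi, ccont phi z /\ phi z = l /\ forall w, g w = (g z + phi w * (w - z))%C.

Definition copen (W : C -> Prop) : Prop :=
  forall z, W z -> exists d, 0 < d /\ forall w, <|w - z|> < d -> W w.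

Lemma ccont_const (c z : C) : ccont (fun _ => c) z.
Proof. intros e He. exists 1. split; [lra|]. intros w _. rewrite Cmod_sub_0. lra. Qed.

Lemma ccont_id (z : C) : ccont (fun w => w) z.
Proof. intros e He. exists e. split; [lra|]. auto. Qed.

Lemma ccont_plus g h z : ccont g z -> ccont h z -> ccont (fun w => g w + h w)%C z.
Proof.
  intros Hg Hh e He.
  destruct (Hg (e/2) lra) as (d1 & Hd1 & H1).
  destruct (Hh (e/2) lra) as (d2 & Hd2 & H2).
  exists (Rmin d1 d2). split; [apply Rmin_pos; lra|]. intros w Hw.
  assert (Hw1 := H1 w ltac:(eapply Rlt_le_trans; [exact Hw|apply Rmin_l])).
  assert (Hw2 := H2 w ltac:(eapply Rlt_le_trans; [exact Hw|apply Rmin_r])).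
  replace (g w + h w - (g z + h z))%C with ((g w - g z) + (h w - h z))%C by ring.
  eapply Rle_lt_trans; [apply Cmod_triangle|lra].
Qed.

Lemma ccont_mult g h z : ccont g z -> ccont h z -> ccont (fun w => g w * h w)%C z.
Proof.
  intros Hg Hh e He.
  assert (Pg := Cmod_ge_0 (g z)). assert (Ph := Cmod_ge_0 (h z)).
  set (K := 1 + Cmod (g z) + Cmod (h z)).
  assert (HK : 1 <= K) by (unfold K; lra).
  set (e' := Rmin 1 (e / (2 * K))).
  assert (He' : 0 < e') by (apply Rmin_pos; [lra|apply Rdiv_lt_0_compat; lra]).
  assert (E1 : e' <= 1) by apply Rmin_l.
  assert (E2 : e' * (2 * K) <= e).
  { assert (e' <= e / (2 * K)) by apply Rmin_r.
    apply Rmult_le_compat_r with (r := 2 * K) in H; [|lra].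
    unfold Rdiv in H. rewrite Rmult_assoc, Rinv_l in H; lra. }
  destruct (Hg e' He') as (d1 & Hd1 & H1).
  destruct (Hh e' He') as (d2 & Hd2 & H2).
  exists (Rmin d1 d2). split; [apply Rmin_pos; lra|]. intros w Hw.
  assert (Hw1 := H1 w ltac:(eapply Rlt_le_trans; [exact Hw|apply Rmin_l])).
  assert (Hw2 := H2 w ltac:(eapply Rlt_le_trans; [exact Hw|apply Rmin_r])).
  replace (g w * h w - (g z * h z))%C
    with ((g w - g z) * (h w - h z) + g z * (h w - h z) + (g w - g z) * h z)%C by ring.
  eapply Rle_lt_trans; [apply Cmod_triangle|].
  eapply Rle_lt_trans; [apply Rplus_le_compat_r, Cmod_triangle|].
  rewrite !Cmod_mult.
   assert (Q2 := Cmod_ge_0 (h w - h z)%C).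
  set (x := <|g w - g z|>) in *. set (y := <|h w - h z|>) in *.
  unfold K in *. nra.
Qed.

Lemma ccont_inv_id (z : C) : z <> 0%C -> ccont (fun w => / w)%C z.
Proof.
  intros Hz e He. assert (Hm := proj1 (Cmod_gt_0 z) Hz).
  set (d := Rmin (Cmod z / 2) (e * (Cmod z * Cmod z) / 2)).
  assert (0 < e * (Cmod z * Cmod z)) by (apply Rmult_lt_0_compat; nra).
  exists d. split; [apply Rmin_pos; lra|]. intros w Hw.
  assert (D1 : d <= Cmod z / 2) by apply Rmin_l.
  assert (D2 : d <= e * (Cmod z * Cmod z) / 2) by apply Rmin_r.
  assert (Hw2 : Cmod z / 2 < Cmod w).
  { assert (H0 := Cmod_rev z w). rewrite Cmod_sub_sym in H0. lra. }
  assert (Hw0 : w <> 0%C) by (intros ->; rewrite Cmod_0 in Hw2; lra).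
  replace (/ w - / z)%C with ((z - w) / (w * z))%C by (field; auto).
  rewrite Cmod_div by (apply Cmult_neq_0; auto). rewrite Cmod_mult, Cmod_sub_sym.
  apply Rmult_lt_reg_r with (Cmod w * Cmod z); [nra|].
  unfold Rdiv. rewrite Rmult_assoc, Rinv_l by nra. nra.
Qed.

Lemma ccont_comp g h z : ccont g z -> ccont h (g z) -> ccont (fun w => h (g w)) z.
Proof.
  intros Hg Hh e He. destruct (Hh e He) as (d1 & Hd1 & H1).
  destruct (Hg d1 Hd1) as (d2 & Hd2 & H2). exists d2. split; auto.
Qed.

Lemma ccont_inv g z : g z <> 0%C -> ccont g z -> ccont (fun w => / g w)%C z.
Proof. intros H Hg. apply (ccont_comp g (fun w => / w)%C); [exact Hg|]. apply ccont_inv_id; exact H. Qed.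

Lemma ccont_ext_loc g h z d : 0 < d -> (forall w, <|w - z|> < d -> g w = h w) ->
  ccont g z -> ccont h z.
Proof.
  intros Hd E Hg e He. destruct (Hg e He) as (d1 & Hd1 & H1).
  exists (Rmin d d1). split; [apply Rmin_pos; lra|]. intros w Hw.
  rewrite <- !E; try (rewrite Cmod_sub_0; lra).
  - apply H1. eapply Rlt_le_trans; [exact Hw|apply Rmin_r].
  - eapply Rlt_le_trans; [exact Hw|apply Rmin_l].
Qed.

Lemma cderiv_cont g z l : cderiv g z l -> ccont g z.
Proof.
  intros (phi & Hc & _ & E).
  apply (ccont_ext_loc (fun w => g z + phi w * (w - z))%C g z 1); [lra|intros; symmetry; apply E|].
  apply ccont_plus; [apply ccont_const|]. apply ccont_mult; auto.
  apply ccont_plus; [apply ccont_id|apply ccont_const].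
Qed.

Lemma cderiv_eq g z l m : l = m -> cderiv g z l -> cderiv g z m.
Proof. intros ->; auto. Qed.

Lemma cderiv_const (c z : C) : cderiv (fun _ => c) z 0%C.
Proof. exists (fun _ => 0%C). split; [apply ccont_const|]. split; auto. intros; ring. Qed.

Lemma cderiv_id (z : C) : cderiv (fun w => w) z 1%C.
Proof. exists (fun _ => 1%C). split; [apply ccont_const|]. split; auto. intros; ring. Qed.

Lemma cderiv_plus g h z l m : cderiv g z l -> cderiv h z m ->
  cderiv (fun w => g w + h w)%C z (l + m)%C.
Proof.
  intros (p & P1 & P2 & P3) (q & Q1 & Q2 & Q3).
  exists (fun w => p w + q w)%C. split; [apply ccont_plus; auto|]. split; [congruence|].
  intros w. rewrite (P3 w), (Q3 w). ring.
Qed.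

Lemma cderiv_mult g h z l m : cderiv g z l -> cderiv h z m ->
  cderiv (fun w => g w * h w)%C z (l * h z + g z * m)%C.
Proof.
  intros Hg Hh. assert (Cg := cderiv_cont _ _ _ Hg).
  destruct Hg as (p & P1 & P2 & P3). destruct Hh as (q & Q1 & Q2 & Q3).
  exists (fun w => p w * h z + g w * q w)%C. split; [|split].
  - apply ccont_plus; apply ccont_mult; auto. apply ccont_const.
  - congruence.
  - intros w. rewrite (Q3 w) at 1. rewrite (P3 w). ring.
Qed.

Lemma cderiv_comp g h z l m : cderiv g z l -> cderiv h (g z) m ->
  cderiv (fun w => h (g w)) z (m * l)%C.
Proof.
  intros Hg Hh. assert (Cg := cderiv_cont _ _ _ Hg).
  destruct Hg as (p & P1 & P2 & P3). destruct Hh as (q & Q1 & Q2 & Q3).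
  exists (fun w => q (g w) * p w)%C. split; [|split].
  - apply ccont_mult; auto. apply (ccont_comp g q); auto.
  - congruence.
  - intros w. rewrite (Q3 (g w)). rewrite (P3 w) at 2. ring.
Qed.

Lemma cderiv_eps g z l :
  (forall eps, 0 < eps -> exists d, 0 < d /\ forall w, <|w - z|> < d ->
     <|g w - g z - l * (w - z)|> <= eps * <|w - z|>) -> cderiv g z l.
Proof.
  intros H.
  exists (fun w => if Ceq_dec w z then l else ((g w - g z) / (w - z))%C).
  split; [|split].
  - intros e He. destruct (H (e/2) lra) as (d & Hd & Hw). exists d; split; auto.
    intros w W. destruct (Ceq_dec z z) as [_|]; [|congruence].
    destruct (Ceq_dec w z) as [E|E]; [rewrite Cmod_sub_0; lra|].
    assert (N : (w - z)%C <> 0%C) by (intros K; apply E, Csub0; auto).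
    assert (N' := proj1 (Cmod_gt_0 _) N).
    replace ((g w - g z) / (w - z) - l)%C with ((g w - g z - l * (w - z)) / (w - z))%C by (field; auto).
    rewrite Cmod_div by auto. specialize (Hw w W).
    apply Rle_lt_trans with (e/2); [|lra].
    apply Rmult_le_reg_r with (<|w - z|>); auto.
    unfold Rdiv at 1. rewrite Rmult_assoc, Rinv_l by lra. lra.
  - destruct (Ceq_dec z z); congruence.
  - intros w. destruct (Ceq_dec w z) as [->|E]; [ring|]. field.
    intros K; apply E, Csub0; auto.
Qed.

Lemma cderiv_eps_inv g z l : cderiv g z l ->
  forall eps, 0 < eps -> exists d, 0 < d /\ forall w, <|w - z|> < d ->
     <|g w - g z - l * (w - z)|> <= eps * <|w - z|>.
Proof.
  intros (p & P1 & P2 & P3) e He. destruct (P1 e He) as (d & Hd & H).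
  exists d; split; auto. intros w W. rewrite (P3 w).
  replace (g z + p w * (w - z) - g z - l * (w - z))%C with ((p w - p z) * (w - z))%C
    by (rewrite P2; ring).
  rewrite Cmod_mult. specialize (H w W). apply Rmult_le_compat_r; [apply Cmod_ge_0|lra].
Qed.

Lemma cderiv_ext_loc g h z l d : 0 < d -> (forall w, <|w - z|> < d -> g w = h w) ->
  cderiv g z l -> cderiv h z l.
Proof.
  intros Hd E Hg. apply cderiv_eps. intros e He.
  destruct (cderiv_eps_inv _ _ _ Hg e He) as (d1 & Hd1 & H1).
  exists (Rmin d d1). split; [apply Rmin_pos; lra|]. intros w Hw.
  rewrite <- !E; try (rewrite Cmod_sub_0; lra).
  - apply H1. eapply Rlt_le_trans; [exact Hw|apply Rmin_r].
  - eapply Rlt_le_trans; [exact Hw|apply Rmin_l].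
Qed.

Lemma cderiv_inv_id (z : C) : z <> 0%C -> cderiv (fun w => / w)%C z (- (/ z * / z))%C.
Proof.
  intros Hz. assert (Hm := proj1 (Cmod_gt_0 z) Hz).
  (* The factorization behind [cderiv] must hold at every [w], also at [w = 0]. There the inverse is
     replaced by its affine expansion at [z], which changes nothing near [z]. *)
  apply (cderiv_ext_loc (fun w => if Ceq_dec w 0%C then (/ z)%C + (- (/ z * / z)) * (w - z) else / w)%C _ z _ (Cmod z)); auto.
  - intros w Hw. destruct (Ceq_dec w 0) as [->|]; auto.
    exfalso. rewrite Cmod_sub_sym in Hw. replace (z - 0)%C with z in Hw by ring. lra.
  - exists (fun w => if Ceq_dec w 0%C then (- (/ z * / z))%C else (- (/ z * / w))%C).
    destruct (Ceq_dec z 0) as [E|_]; [congruence|]. split; [|split]; auto.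
    + apply (ccont_ext_loc (fun w => (- (/ z)) * / w)%C _ z (Cmod z)); auto.
      * intros w Hw. destruct (Ceq_dec w 0) as [->|]; [|ring].
        exfalso. rewrite Cmod_sub_sym in Hw. replace (z - 0)%C with z in Hw by ring. lra.
      * apply ccont_mult; [apply ccont_const|apply ccont_inv_id; auto].
    + intros w. destruct (Ceq_dec w 0) as [->|]; field; auto.
Qed.

(** If [p] is the difference quotient of [e] at [L z], then [w - z = p (L w) * (L w - L z)], so
    [/ p (L w)] is the difference quotient of [L]. It is continuous because [L] is, and near [z] it
    is finite because [l <> 0]. *)
Lemma cderiv_right_inverse e L z l : cderiv e (L z) l -> l <> 0%C -> ccont L z ->
  (exists d, 0 < d /\ forall w, <|w - z|> < d -> e (L w) = w) -> cderiv L z (/ l)%C.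
Proof.
  intros (p & P1 & P2 & P3) Hl CL (d & Hd & E).
  assert (Cp : ccont (fun w => p (L w)) z) by (apply (ccont_comp L p); auto).
  assert (Hl' := proj1 (Cmod_gt_0 l) Hl).
  destruct (Cp (Cmod l) Hl') as (d1 & Hd1 & H1).
  set (m := Rmin d d1).
  assert (Hm : 0 < m) by (apply Rmin_pos; auto).
  assert (K : forall w, <|w - z|> < m -> p (L w) <> 0%C /\ (w - z = p (L w) * (L w - L z))%C).
  { intros w Hw. split.
    - intros E0. specialize (H1 w ltac:(eapply Rlt_le_trans; [exact Hw|apply Rmin_r])).
       rewrite E0, P2 in H1. rewrite Cmod_sub_sym in H1.
      replace (l - 0)%C with l in H1 by ring. lra.
    - assert (Hw' : <|w - z|> < d) by (eapply Rlt_le_trans; [exact Hw|apply Rmin_l]).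
      rewrite <- (E w Hw') at 1. rewrite <- (E z) at 1 by (rewrite Cmod_sub_0; auto).
      rewrite (P3 (L w)). ring. }
  apply cderiv_eps. intros ee Hee.
  assert (Ci' : ccont (fun w => / p (L w))%C z).
  { apply (ccont_inv (fun w => p (L w)) z); auto. rewrite P2; auto. }
  destruct (Ci' ee Hee) as (d2 & Hd2 & H2).
  exists (Rmin m d2). split; [apply Rmin_pos; auto|]. intros w Hw.
  destruct (K w ltac:(eapply Rlt_le_trans; [exact Hw|apply Rmin_l])) as (N & EQ).
  specialize (H2 w ltac:(eapply Rlt_le_trans; [exact Hw|apply Rmin_r])).
  replace (L w - L z - / l * (w - z))%C with ((/ p (L w) - / p (L z)) * (w - z))%C.
  - rewrite Cmod_mult. apply Rmult_le_compat_r; [apply Cmod_ge_0|lra].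
  - rewrite P2. rewrite EQ. field. auto.
Qed.

(** A stand-in for analyticity without power series or Cauchy's formula: [n] successive complex
    derivatives, the last one continuous. Order 2 is what the Laplacian consumes, and the closure
    properties go by induction on [n]. *)
Fixpoint holo (n : nat) (W : C -> Prop) (g : C -> C) : Prop :=
  match n with
  | O => forall z, W z -> ccont g z
  | S n => exists g', (forall z, W z -> cderiv g z (g' z)) /\ holo n W g'
  end.

Lemma holo_S n W g : holo (S n) W g -> holo n W g.
Proof.
  revert g. induction n as [|n IH]; intros g (g' & H1 & H2).
  - intros z Hz. eapply cderiv_cont; eauto.
  - exists g'. split; auto.
Qed.

Lemma holo_const n W c : holo n W (fun _ => c).
Proof.
  revert c. induction n as [|n IH]; intros c.
  - intros z _. apply ccont_const.
  - exists (fun _ => 0%C). split; auto. intros; apply cderiv_const.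
Qed.

Lemma holo_id n W : holo n W (fun z => z).
Proof.
  destruct n as [|n]; [intros z _; apply ccont_id|].
  exists (fun _ => 1%C). split; [intros; apply cderiv_id|apply holo_const].
Qed.

Lemma holo_plus n W g h : holo n W g -> holo n W h -> holo n W (fun z => g z + h z)%C.
Proof.
  revert g h. induction n as [|n IH]; intros g h Hg Hh.
  - intros z Hz. apply ccont_plus; auto.
  - destruct Hg as (g' & G1 & G2), Hh as (h' & H1 & H2).
    exists (fun z => g' z + h' z)%C. split; auto. intros; apply cderiv_plus; auto.
Qed.

Lemma holo_mult n W g h : holo n W g -> holo n W h -> holo n W (fun z => g z * h z)%C.
Proof.
  revert g h. induction n as [|n IH]; intros g h Hg Hh.
  - intros z Hz. apply ccont_mult; auto.
  - assert (Sg := holo_S _ _ _ Hg). assert (Sh := holo_S _ _ _ Hh).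
    destruct Hg as (g' & G1 & G2), Hh as (h' & H1 & H2).
    exists (fun z => g' z * h z + g z * h' z)%C. split.
    + intros; apply cderiv_mult; auto.
    + apply holo_plus; auto.
Qed.

Lemma holo_comp n W V g h : (forall z, W z -> V (g z)) -> holo n W g -> holo n V h ->
  holo n W (fun z => h (g z)).
Proof.
  intros M. revert g h M. induction n as [|n IH]; intros g h M Hg Hh.
  - intros z Hz. apply (ccont_comp g h); auto.
  - assert (Sg := holo_S _ _ _ Hg).
    destruct Hg as (g' & G1 & G2), Hh as (h' & H1 & H2).
    exists (fun z => h' (g z) * g' z)%C. split.
    + intros; apply (cderiv_comp g h); auto.
    + apply (holo_mult n W (fun z => h' (g z))); auto.
Qed.

Lemma holo_sub n W V g : (forall z, W z -> V z) -> holo n V g -> holo n W g.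
Proof.
  revert g. induction n as [|n IH]; intros g S Hg; [intros z Hz; auto|].
  destruct Hg as (g' & G1 & G2). exists g'. split; auto.
Qed.

Lemma holo_inv_id n : holo n (fun z => z <> 0%C) (fun z => / z)%C.
Proof.
  induction n as [|n IH]; [intros z Hz; apply ccont_inv_id; auto|].
  exists (fun z => - (1) * (/ z * / z))%C. split.
  - intros z Hz. replace (- (1) * (/ z * / z))%C with (- (/ z * / z))%C by ring.
    apply cderiv_inv_id; auto.
  - apply holo_mult; [apply holo_const|]. apply holo_mult; auto.
Qed.

Lemma holo_cont n W g z : holo n W g -> W z -> ccont g z.
Proof.
  revert g. induction n as [|n IH]; intros g H Hz; [auto|].
  apply IH; auto. apply holo_S; auto.
Qed.

End ComplexDifferentiation.

(** * Exponential, logarithm and argument *)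

Section Logarithms.

Implicit Types (g h e L : C -> C) (z w l m : C).

Lemma ccont_of_parts g z : rcont (fun w => Re (g w)) z -> rcont (fun w => Im (g w)) z -> ccont g z.
Proof.
  intros H1 H2 eps He.
  destruct (H1 (eps/2) lra) as (d1 & D1 & K1).
  destruct (H2 (eps/2) lra) as (d2 & D2 & K2).
  exists (Rmin d1 d2). split; [apply Rmin_pos; auto|]. intros w Hw.
  assert (A := K1 w ltac:(eapply Rlt_le_trans; [exact Hw|apply Rmin_l])).
  assert (B := K2 w ltac:(eapply Rlt_le_trans; [exact Hw|apply Rmin_r])).
  eapply Rle_lt_trans; [apply Cmod_le_sum|]. rewrite re_minus, im_minus. lra.
Qed.

Lemma rcont_Re g z : ccont g z -> rcont (fun w => Re (g w)) z.
Proof.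
  intros H eps He. destruct (H eps He) as (d & D & K). exists d. split; auto. intros w Hw.
  eapply Rle_lt_trans; [|apply (K w Hw)]. rewrite <- re_minus. apply re_le_Cmod.
Qed.

Lemma rcont_Im g z : ccont g z -> rcont (fun w => Im (g w)) z.
Proof.
  intros H eps He. destruct (H eps He) as (d & D & K). exists d. split; auto. intros w Hw.
  eapply Rle_lt_trans; [|apply (K w Hw)]. rewrite <- im_minus. apply im_le_Cmod.
Qed.

Lemma rcont_Cmod g z : ccont g z -> rcont (fun w => Cmod (g w)) z.
Proof.
  intros H eps He. destruct (H eps He) as (d & D & K). exists d. split; auto. intros w Hw.
  eapply Rle_lt_trans; [|apply (K w Hw)].
  apply Rabs_le. assert (A := Cmod_rev (g w) (g z)). assert (B := Cmod_rev (g z) (g w)).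
  rewrite (Cmod_sub_sym (g z)) in B. lra.
Qed.

Lemma ccont_R (u : C -> R) z : rcont u z -> ccont (fun w => RtoC (u w)) z.
Proof.
  intros H. apply ccont_of_parts; simpl; auto.
  intros eps He; exists 1; split; [lra|]; intros. rewrite Rminus_diag, Rabs_R0. auto.
Qed.

Lemma rcont_const (c : R) z : rcont (fun _ => c) z.
Proof. intros eps He; exists 1; split; [lra|]; intros. rewrite Rminus_diag, Rabs_R0. auto. Qed.

Lemma rcont_plus (u v : C -> R) z : rcont u z -> rcont v z -> rcont (fun w => u w + v w) z.
Proof.
  intros H1 H2. apply (rcont_Re (fun w => RtoC (u w) + RtoC (v w))%C).
  apply ccont_plus; apply ccont_R; auto.
Qed.

Lemma rcont_ext (u v : C -> R) z : (forall w, u w = v w) -> rcont u z -> rcont v z.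
Proof.
  intros E H eps He. destruct (H eps He) as (d & D & K). exists d. split; auto.
  intros w Hw. rewrite <- !E. auto.
Qed.

Lemma rcont_ext_loc (u v : C -> R) z d : 0 < d -> (forall w, <|w - z|> < d -> u w = v w) ->
  rcont u z -> rcont v z.
Proof.
  intros Hd E H eps He. destruct (H eps He) as (d1 & D & K). exists (Rmin d d1).
  split; [apply Rmin_pos; auto|].
  intros w Hw. rewrite <- !E; try (rewrite Cmod_sub_0; auto).
  - apply K. eapply Rlt_le_trans; [exact Hw|apply Rmin_r].
  - eapply Rlt_le_trans; [exact Hw|apply Rmin_l].
Qed.

Lemma rcont_mult (u v : C -> R) z : rcont u z -> rcont v z -> rcont (fun w => u w * v w) z.
Proof.
  intros H1 H2. apply (rcont_ext (fun w => Re (RtoC (u w) * RtoC (v w))%C)).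
  - intros w; simpl; ring.
  - apply (rcont_Re (fun w => RtoC (u w) * RtoC (v w))%C), ccont_mult; apply ccont_R; auto.
Qed.

Lemma rcont_comp (u : C -> R) (p : R -> R) z : rcont u z -> continuity_pt p (u z) ->
  rcont (fun w => p (u w)) z.
Proof.
  intros H Hp eps He. destruct (Hp eps He) as (a & Ha & K).
  destruct (H a Ha) as (d & D & K'). exists d. split; auto. intros w Hw.
  destruct (Req_dec (u w) (u z)) as [E|N]; [rewrite E, Rminus_diag, Rabs_R0; auto|].
  apply (K (u w)). split; [split; [exact I|auto]|]. apply (K' w Hw).
Qed.

Lemma rcont_inv (u : C -> R) z : u z <> 0 -> rcont u z -> rcont (fun w => / u w) z.
Proof.
  intros N H. apply (rcont_comp u Rinv); auto.
  apply (continuity_pt_inv (fun x => x)); auto. apply derivable_continuous_pt, derivable_pt_id.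
Qed.

Lemma rcont_Cmod_id z : rcont (fun w => Cmod w) z.
Proof. apply (rcont_Cmod (fun w => w)), ccont_id. Qed.
Lemma rcont_Re_id z : rcont (fun w => Re w) z.
Proof. apply (rcont_Re (fun w => w)), ccont_id. Qed.
Lemma rcont_Im_id z : rcont (fun w => Im w) z.
Proof. apply (rcont_Im (fun w => w)), ccont_id. Qed.

Lemma derivable_eps (g : R -> R) (x l : R) : derivable_pt_lim g x l ->
  forall eps, 0 < eps -> exists d, 0 < d /\ forall k, Rabs k < d -> Rabs (g (x + k) - g x - l * k) <= eps * Rabs k.
Proof.
  intros H eps He. destruct (H eps He) as (d & K). exists d. split; [apply cond_pos|].
  intros k Hk. destruct (Req_dec k 0) as [->|N].
  - rewrite Rplus_0_r. replace (g x - g x - l * 0) with 0 by ring. rewrite Rabs_R0. lra.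
  - specialize (K k N Hk).
    replace (g (x + k) - g x - l * k) with (((g (x + k) - g x) / k - l) * k) by (field; auto).
    rewrite Rabs_mult. apply Rmult_le_compat_r; [apply Rabs_pos|lra].
Qed.

Lemma eps_derive (g : R -> R) (x l : R) :
  (forall eps, 0 < eps -> exists d, 0 < d /\ forall k, Rabs k < d -> Rabs (g (x + k) - g x - l * k) <= eps * Rabs k) ->
  is_derive g x l.
Proof.
  intros H. apply is_derive_Reals. intros eps He. destruct (H (eps/2) lra) as (d & D & K).
  exists (mkposreal d D). intros k N Hk.  specialize (K k Hk).
  assert (0 < Rabs k) by (apply Rabs_pos_lt; auto).
  replace ((g (x + k) - g x) / k - l) with ((g (x + k) - g x - l * k) / k) by (field; auto).
  unfold Rdiv. rewrite Rabs_mult, Rabs_inv.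
  apply Rle_lt_trans with (eps / 2); [|lra].
  apply Rmult_le_reg_r with (Rabs k); auto. rewrite Rmult_assoc, Rinv_l by lra. lra.
Qed.

Definition cexp (z : C) : C := (exp (Re z) * cos (Im z), exp (Re z) * sin (Im z)).

Lemma cexp_plus z w : cexp (z + w)%C = (cexp z * cexp w)%C.
Proof.
  apply Ceq; unfold cexp, Re, Im; simpl; rewrite exp_plus, ?cos_plus, ?sin_plus; ring.
Qed.

Lemma cexp_0 : cexp 0%C = 1%C.
Proof. apply Ceq; unfold cexp, Re, Im; simpl; rewrite exp_0, ?cos_0, ?sin_0; ring. Qed.

Lemma Cmod_cexp z : Cmod (cexp z) = exp (Re z).
Proof.
  assert (H := Cmod_sqr (cexp z)). assert (H0 := Cmod_ge_0 (cexp z)).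
  assert (E := exp_pos (Re z)). assert (T := sin2_cos2 (Im z)). unfold Rsqr in T.
   simpl in H.
  replace (exp (Re z) * cos (Im z) * (exp (Re z) * cos (Im z)) + exp (Re z) * sin (Im z) * (exp (Re z) * sin (Im z)))
    with (exp (Re z) * exp (Re z)) in H by nra. nra.
Qed.

(** The real expansions of [exp], [sin] and [cos] at 0 are combined here once; the functional
    equation then carries the derivative to every other point. *)
Lemma cderiv_cexp_0 : cderiv cexp 0%C 1%C.
Proof.
  apply cderiv_eps. intros eps He.
  set (r := Rmin 1 (eps / 12)).
  assert (Hr : 0 < r) by (apply Rmin_pos; lra).
  assert (R1 : r <= 1) by apply Rmin_l. assert (R2 : r <= eps / 12) by apply Rmin_r.  clearbody r.
  destruct (derivable_eps exp 0 (exp 0) (derivable_pt_lim_exp 0) r Hr) as (d1 & D1 & K1).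
  destruct (derivable_eps sin 0 (cos 0) (derivable_pt_lim_sin 0) r Hr) as (d2 & D2 & K2).
  destruct (derivable_eps cos 0 (- sin 0) (derivable_pt_lim_cos 0) r Hr) as (d3 & D3 & K3).
  exists (Rmin r (Rmin d1 (Rmin d2 d3))).
  split; [repeat apply Rmin_pos; auto|]. intros w Hw.
  assert (M1 := Rmin_l r (Rmin d1 (Rmin d2 d3))). assert (M2 := Rmin_r r (Rmin d1 (Rmin d2 d3))).
  assert (M3 := Rmin_l d1 (Rmin d2 d3)). assert (M4 := Rmin_r d1 (Rmin d2 d3)).
  assert (M5 := Rmin_l d2 d3). assert (M6 := Rmin_r d2 d3).
  replace (w - 0)%C with w in * by ring.
  assert (X := re_le_Cmod w). assert (Y := im_le_Cmod w). set (x := Re w) in *. set (y := Im w) in *.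
  specialize (K1 x lra). specialize (K2 y lra). specialize (K3 y lra).
  rewrite !Rplus_0_l, exp_0 in K1. rewrite !Rplus_0_l, cos_0, sin_0 in K2.
  rewrite !Rplus_0_l, cos_0, sin_0 in K3.
  rewrite Ropp_0, Rmult_0_l, Rminus_0_r in K3. rewrite Rminus_0_r in K2. rewrite Rmult_1_l in *.
  eapply Rle_trans; [apply Cmod_le_sum|].
  rewrite cexp_0.
  replace (Re (cexp w - 1 - 1 * w)%C) with ((exp x - 1 - x) * cos y + (1 + x) * (cos y - 1))
    by (unfold cexp, Re, Im, x, y; simpl; unfold Re, Im; ring).
  replace (Im (cexp w - 1 - 1 * w)%C) with ((exp x - 1 - x) * sin y + x * sin y + (sin y - y))
    by (unfold cexp, Re, Im, x, y; simpl; unfold Re, Im; ring).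
  assert (C1 := COS_bound y). assert (S1 := SIN_bound y).
  assert (Ac : Rabs (cos y) <= 1) by (apply Rabs_le; lra).
  assert (As : Rabs (sin y) <= 1) by (apply Rabs_le; lra).
  assert (As2 : Rabs (sin y) <= 2 * Rabs y).
  { replace (sin y) with ((sin y - y) + y) by ring. eapply Rle_trans; [apply Rabs_triang|].
    assert (P := Rabs_pos y). nra. }
   assert (Py := Rabs_pos y).
  assert (A1 : Rabs ((exp x - 1 - x) * cos y + (1 + x) * (cos y - 1)) <= r * Rabs x + 2 * (r * Rabs y)).
  { eapply Rle_trans; [apply Rabs_triang|]. rewrite !Rabs_mult.
    assert (Rabs (1 + x) <= 2) by (eapply Rle_trans; [apply Rabs_triang|]; rewrite Rabs_R1; lra).
    assert (P1 := Rabs_pos (exp x - 1 - x)). assert (P2 := Rabs_pos (cos y - 1)).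
    assert (P3 := Rabs_pos (cos y)). assert (P4 := Rabs_pos (1 + x)). nra. }
  assert (A2 : Rabs ((exp x - 1 - x) * sin y + x * sin y + (sin y - y)) <= r * Rabs x + r * (2 * Rabs y) + r * Rabs y).
  { eapply Rle_trans; [apply Rabs_triang|]. apply Rplus_le_compat; auto.
    eapply Rle_trans; [apply Rabs_triang|]. rewrite !Rabs_mult.
    assert (P1 := Rabs_pos (exp x - 1 - x)). assert (P3 := Rabs_pos (sin y)).
    apply Rplus_le_compat; nra. }
  nra.
Qed.

Lemma cderiv_cexp z : cderiv cexp z (cexp z).
Proof.
  apply (cderiv_ext_loc (fun w => cexp z * cexp (w + - z))%C _ _ _ 1 Rlt_0_1).
  - intros w _. rewrite <- cexp_plus. f_equal. ring.
  - assert (E : cexp z = (0 * cexp (z + - z) + cexp z * (1 * (1 + 0)))%C) by ring.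
    refine (cderiv_eq _ _ _ _ (eq_sym E) _). apply (cderiv_mult (fun _ => cexp z) (fun w => cexp (w + - z)%C)); [apply cderiv_const|].
    apply (cderiv_comp (fun w => w + - z)%C cexp).
    + apply cderiv_plus; [apply cderiv_id|apply cderiv_const].
    + replace (z + - z)%C with (RtoC 0) by ring. apply cderiv_cexp_0.
Qed.

Lemma holo_cexp n W : holo n W cexp.
Proof.
  induction n as [|n IH].
  - intros z _. eapply cderiv_cont, cderiv_cexp.
  - exists cexp. split; auto. intros; apply cderiv_cexp.
Qed.

(** The plane cut along the closed negative real axis, in the form that makes the denominator of
    [Arg] positive. *)
Definition slitp (z : C) : Prop := 0 < Cmod z + Re z.
(** Half-angle formula: a single expression on the whole cut plane, without cases on the signs of
    the coordinates. *)
Definition Arg (z : C) : R := 2 * atan (Im z / (Cmod z + Re z)).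
Definition Log (z : C) : C := (ln (Cmod z), Arg z).

Lemma slitp_pos z : slitp z -> 0 < Cmod z.
Proof.
  unfold slitp. intros H.  assert (H1 := re_le_Cmod z).
  assert (H2 := Rle_abs (Re z)). lra.
Qed.

Lemma slitp_neq z : slitp z -> z <> 0%C.
Proof. intros H. apply Cmod_gt_0, slitp_pos; auto. Qed.

Lemma Arg_bound z : - PI < Arg z < PI.
Proof. unfold Arg. assert (H := atan_bound (Im z / (Cmod z + Re z))). lra. Qed.

Lemma cexp_Log z : slitp z -> cexp (Log z) = z.
Proof.
  intros H. assert (P := slitp_pos z H). unfold slitp in H.
  assert (S := Cmod_sqr z).
  apply Ceq; unfold cexp, Log, Arg; simpl; rewrite exp_ln by auto;
  set (r := Cmod z) in *; set (x := Re z) in *; set (y := Im z) in *;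
  set (u := y / (r + x)); [rewrite cos_2a|rewrite sin_2a]; rewrite sin_atan, cos_atan;
  assert (U : 0 < 1 + Rsqr u) by (unfold Rsqr; nra);
  assert (Q := sqrt_sqrt (1 + Rsqr u) lra); assert (Q' := sqrt_lt_R0 _ U);
  set (s := sqrt (1 + Rsqr u)) in *;
  assert (EU : u * (r + x) = y) by (unfold u; field; lra).
  - replace (1 / s * (1 / s) - u / s * (u / s)) with ((1 - u * u) / (s * s)) by (field; lra).
    rewrite Q. unfold Rsqr.
    apply Rmult_eq_reg_r with ((1 + u * u) * ((r + x) * (r+x))); [|unfold Rsqr in U; apply Rgt_not_eq; apply Rmult_lt_0_compat; nra].
    replace (r * ((1 - u * u) / (1 + u * u)) * ((1 + u * u) * ((r + x) * (r + x))))
      with (r * ((r+x)*(r+x) - (u * (r+x)) * (u * (r+x)))) by (field; unfold Rsqr in U; lra).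
    replace (x * ((1 + u * u) * ((r + x) * (r + x)))) with (x * ((r+x)*(r+x) + (u * (r+x)) * (u * (r+x)))) by ring.
    rewrite EU. nra.
  - replace (2 * (u / s) * (1 / s)) with ((2 * u) / (s * s)) by (field; lra).
    rewrite Q. unfold Rsqr.
    apply Rmult_eq_reg_r with ((1 + u * u) * ((r + x) * (r+x))); [|unfold Rsqr in U; apply Rgt_not_eq; apply Rmult_lt_0_compat; nra].
    replace (r * ((2 * u) / (1 + u * u)) * ((1 + u * u) * ((r + x) * (r + x))))
      with (r * (2 * (u * (r+x)) * (r + x))) by (field; unfold Rsqr in U; lra).
    replace (y * ((1 + u * u) * ((r + x) * (r + x)))) with (y * ((r+x)*(r+x) + (u * (r+x)) * (u * (r+x)))) by ring.
    rewrite EU. replace ((r + x) * (r + x) + y * y) with (2 * r * (r + x)) by lra. ring.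
Qed.

Lemma rcont_Arg z : slitp z -> rcont Arg z.
Proof.
  intros H.
  apply (rcont_mult (fun _ => 2)); [apply rcont_const|].
  apply (rcont_comp (fun w => Im w / (Cmod w + Re w)) atan).
  - apply (rcont_mult (fun w => Im w)); [apply rcont_Im_id|].
    apply (rcont_inv (fun w => Cmod w + Re w)); [unfold slitp in H; lra|].
    apply rcont_plus; [apply rcont_Cmod_id|apply rcont_Re_id].
  - apply derivable_continuous_pt, derivable_pt_atan.
Qed.

Lemma rcont_lnCmod g z : g z <> 0%C -> ccont g z -> rcont (fun w => ln (Cmod (g w))) z.
Proof.
  intros N H. apply (rcont_comp (fun w => Cmod (g w)) ln).
  - apply rcont_Cmod; auto.
  - apply derivable_continuous_pt. exists (/ Cmod (g z)). apply derivable_pt_lim_ln. apply Cmod_gt_0; auto.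
Qed.

Lemma slitp_open : copen slitp.
Proof.
  intros z Hz. unfold slitp in *.
  destruct (rcont_plus _ _ z (rcont_Cmod_id z) (rcont_Re_id z) _ Hz) as (d & D & K).
  exists d; split; auto. intros w Hw. specialize (K w Hw). apply Rabs_def2 in K. lra.
Qed.

Lemma cderiv_Log z : slitp z -> cderiv Log z (/ z)%C.
Proof.
  intros H. apply (cderiv_right_inverse cexp).
  - rewrite <- (cexp_Log z H) at 2. apply cderiv_cexp.
  - apply slitp_neq; auto.
  - apply ccont_of_parts; simpl.
    + apply (rcont_lnCmod (fun w => w)); [apply slitp_neq; auto|apply ccont_id].
    + apply rcont_Arg; auto.
  - destruct (slitp_open z H) as (d & D & K). exists d. split; auto. intros; apply cexp_Log; auto.
Qed.

Lemma holo_Log n : holo n slitp Log.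
Proof.
  destruct n as [|n].
  - intros z Hz. eapply cderiv_cont, cderiv_Log; auto.
  - exists (fun z => / z)%C. split; [apply cderiv_Log|].
    apply (holo_sub n slitp (fun z => z <> 0%C)); [apply slitp_neq|apply holo_inv_id].
Qed.

(** The plane cut along the closed negative imaginary axis. The argument [argH] is then continuous
    on the closed upper half-plane without 0, with the values 0 and [PI] on the two half-axes; it is
    [Arg] after a quarter turn. *)
Definition slitH (z : C) : Prop := 0 < Cmod z + Im z.
Definition argH (z : C) : R := PI / 2 - 2 * atan (Re z / (Cmod z + Im z)).
Definition LogH (z : C) : C := (Log (- Ci * z) + Ci * RtoC (PI / 2))%C.

Lemma mCi_re z : Re (- Ci * z)%C = Im z.
Proof. unfold Re, Im; simpl; ring. Qed.
Lemma mCi_im z : Im (- Ci * z)%C = - Re z.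
Proof. unfold Re, Im; simpl; ring. Qed.
Lemma mCi_mod z : <|- Ci * z|> = Cmod z.
Proof. rewrite Cmod_mult, Cmod_opp, Cmod_Ci. ring. Qed.

Lemma LogH_im z : Im (LogH z) = argH z.
Proof.
  unfold LogH. rewrite im_plus. unfold Log, argH, Arg. rewrite mCi_re, mCi_im, mCi_mod.
  unfold Im at 1 3; simpl. rewrite Rdiv_opp_l, atan_opp. lra.
Qed.

Lemma LogH_re z : Re (LogH z) = ln (Cmod z).
Proof. unfold LogH. rewrite re_plus. unfold Log. rewrite mCi_mod. unfold Re; simpl. ring. Qed.

Lemma holo_LogH n : holo n slitH LogH.
Proof.
  apply holo_plus; [|apply holo_const].
  apply (holo_comp n slitH slitp (fun z => - Ci * z)%C Log).
  - intros z Hz. unfold slitp, slitH in *. rewrite mCi_mod, mCi_re. auto.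
  - apply holo_mult; [apply holo_const|apply holo_id].
  - apply holo_Log.
Qed.

Lemma rcont_argH z : slitH z -> rcont argH z.
Proof.
  intros H. apply (rcont_ext (fun w => Im (LogH w))); [apply LogH_im|].
  apply rcont_Im. apply (holo_LogH 0); auto.
Qed.

Lemma argH_H z : 0 < Im z -> 0 < argH z < PI.
Proof.
  intros H. unfold argH.  assert (P := Cmod_ge_0 z).
  assert (A := atan_increasing (Re z / (Cmod z + Im z)) 1).
  assert (B := atan_increasing (-1) (Re z / (Cmod z + Im z))).
  replace (-1) with (-(1)) in B by ring. rewrite atan_opp, atan_1 in B. rewrite atan_1 in A.
  assert (Re z / (Cmod z + Im z) < 1).
  { apply Rmult_lt_reg_r with (Cmod z + Im z); [lra|]. unfold Rdiv. rewrite Rmult_assoc, Rinv_l by lra.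
    assert (Q := re_le_Cmod z). assert (Q' := Rle_abs (Re z)). lra. }
  assert (-(1) < Re z / (Cmod z + Im z)).
  { apply Rmult_lt_reg_r with (Cmod z + Im z); [lra|]. unfold Rdiv. rewrite Rmult_assoc, Rinv_l by lra.
    assert (Q := re_le_Cmod z). assert (Q' := Rle_abs (- Re z)). rewrite Rabs_Ropp in Q'. lra. }
    lra.
Qed.

Lemma argH_pos (x : R) : 0 < x -> argH (RtoC x) = 0.
Proof.
  intros H. unfold argH. rewrite Cmod_R, Rabs_pos_eq by lra. simpl.
  replace (x / (x + 0)) with 1 by (field; lra). rewrite atan_1. lra.
Qed.
Lemma argH_neg (x : R) : x < 0 -> argH (RtoC x) = PI.
Proof.
  intros H. unfold argH. rewrite Cmod_R, Rabs_left by lra. simpl.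
  replace (x / (- x + 0)) with (- (1)) by (field; lra). rewrite atan_opp, atan_1. lra.
Qed.

Lemma slitH_real (x : R) : x <> 0 -> slitH (RtoC x).
Proof. intros H. unfold slitH. rewrite Cmod_R. simpl. assert (H1 := Rabs_pos_lt x H). lra. Qed.
Lemma slitH_H z : 0 < Im z -> slitH z.
Proof. intros H. unfold slitH. assert (P := Cmod_ge_0 z). lra. Qed.
Lemma argH_scal (r : R) z : 0 < r -> argH (RtoC r * z)%C = argH z.
Proof.
  intros Hr. unfold argH. rewrite Cmod_mult, Cmod_R, Rabs_pos_eq, re_scal_l, im_scal_l by lra.
  replace (r * Cmod z + r * Im z) with (r * (Cmod z + Im z)) by ring.
  destruct (Req_dec (Cmod z + Im z) 0) as [E|N].
  - rewrite E, Rmult_0_r. unfold Rdiv. rewrite Rinv_0. now rewrite !Rmult_0_r.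
  - replace (r * Re z / (r * (Cmod z + Im z))) with (Re z / (Cmod z + Im z)) by (field; lra). reflexivity.
Qed.

Lemma argH_polar (t : R) : 0 < t < PI -> argH (cos t, sin t) = t.
Proof.
  intros Ht. unfold argH.
  assert (Cmod (cos t, sin t) = 1).
  { assert (T := sin2_cos2 t). unfold Rsqr in T. unfold Cmod. cbn [fst snd].
    replace (cos t ^ 2 + sin t ^ 2) with 1 by (simpl; lra). apply sqrt_1. }
  rewrite H.  unfold Re, Im; simpl.
  replace (cos t / (1 + sin t)) with (tan ((PI / 2 - t) / 2)).
  - rewrite atan_tan by lra. lra.
  - set (s := (PI / 2 - t) / 2).
    assert (Hs : - (PI / 4) < s < PI / 4) by (unfold s; lra).
    replace t with (PI / 2 - 2 * s) by (unfold s; lra).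
    rewrite cos_shift, sin_shift, sin_2a, cos_2a. unfold tan.
    assert (0 < cos s) by (apply cos_gt_0; lra).
    assert (T := sin2_cos2 s). unfold Rsqr in T.
    replace (1 + (cos s * cos s - sin s * sin s)) with (2 * (cos s * cos s)) by lra.
    field. lra.
Qed.

Definition pw (a : R) (z : C) : C := cexp (RtoC a * Log z)%C.

Lemma holo_pw n a : holo n slitp (pw a).
Proof.
   apply (holo_comp n slitp (fun _ => True) (fun z => RtoC a * Log z)%C cexp); auto.
  - apply holo_mult; [apply holo_const|apply holo_Log].
  - apply holo_cexp.
Qed.

Lemma pw_re a z : Re (pw a z) = exp (a * ln (Cmod z)) * cos (a * Arg z).
Proof. unfold pw, cexp. rewrite re_scal_l, im_scal_l. reflexivity. Qed.

End Logarithms.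

(** * Harmonic functions and a maximum principle with exceptional points *)

Section HarmonicFunctions.

Implicit Types (g h : C -> C) (z w e : C).

(** A second derivative at the single point [x]: the first derivative exists around [x] and has the
    derivative [l] there. This is all that the second derivative test uses. *)
Definition sd (g : R -> R) (x l : R) : Prop :=
  exists g1 : R -> R, (exists d, 0 < d /\ forall y, Rabs (y - x) < d -> is_derive g y (g1 y)) /\
    is_derive g1 x l.

Lemma sd_plus (g k : R -> R) (x l m : R) : sd g x l -> sd k x m -> sd (fun y => g y + k y) x (l + m).
Proof.
  intros (g1 & (d & D & H) & H') (k1 & (d' & D' & K) & K').
  exists (fun y => g1 y + k1 y). split.
  - exists (Rmin d d'). split; [apply Rmin_pos; auto|]. intros y Hy.
    apply (is_derive_plus (K := R_AbsRing) (V := R_NormedModule)).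
    + apply H. eapply Rlt_le_trans; [exact Hy|apply Rmin_l].
    + apply K. eapply Rlt_le_trans; [exact Hy|apply Rmin_r].
  - apply (is_derive_plus (K := R_AbsRing) (V := R_NormedModule)); auto.
Qed.

Lemma sd_scal (g : R -> R) (c x l : R) : sd g x l -> sd (fun y => c * g y) x (c * l).
Proof.
  intros (g1 & (d & D & H) & H'). exists (fun y => c * g1 y). split.
  - exists d. split; auto. intros y Hy. apply (is_derive_scal g y c). auto.
  - apply (is_derive_scal g1 x c). auto.
Qed.

Lemma sd_ext (g k : R -> R) (x l d : R) : 0 < d -> (forall y, Rabs (y - x) < d -> g y = k y) -> sd g x l -> sd k x l.
Proof.
  intros D E (g1 & (d1 & D1 & H) & H'). exists g1. split; auto.
  exists (Rmin d d1). split; [apply Rmin_pos; auto|]. intros y Hy.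
  assert (M1 := Rmin_l d d1). assert (M2 := Rmin_r d d1).
  apply (is_derive_ext_loc g).
  - assert (P : 0 < d - Rabs (y - x)) by lra.
    exists (mkposreal _ P). intros t Ht. apply E.
    change (Rabs (t - y) < d - Rabs (y - x)) in Ht.
    replace (t - x) with ((t - y) + (y - x)) by ring.
    eapply Rle_lt_trans; [apply Rabs_triang|]. lra.
  - apply H. lra.
Qed.

Lemma deriv_pos_incr (g : R -> R) (x l : R) : is_derive g x l -> 0 < l ->
  exists d, 0 < d /\ forall y, x < y < x + d -> g x < g y.
Proof.
  intros H P. apply is_derive_Reals in H.
  destruct (derivable_eps g x l H (l/2) lra) as (d & D & K).
  exists d. split; auto. intros y Hy. specialize (K (y - x)).
  rewrite Rabs_pos_eq in K by lra. specialize (K lra).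
  replace (x + (y - x)) with y in K by ring. apply Rabs_le_between in K. nra.
Qed.

(** Second derivative test. The first derivative vanishes at a maximum; if [l] were positive, it
    would be positive just to the right of [x], and by the mean value theorem [g] would grow
    there. *)
Lemma sd_max (g : R -> R) (x l d : R) : sd g x l -> 0 < d ->
  (forall y, Rabs (y - x) < d -> g y <= g x) -> l <= 0.
Proof.
  intros (g1 & (d1 & D1 & H) & H') D M.
  destruct (Rle_lt_dec l 0) as [|P]; auto. exfalso.
  assert (Z : g1 x = 0).
  { assert (Hx := H x ltac:(rewrite Rminus_diag, Rabs_R0; auto)).
    destruct (Rtotal_order (g1 x) 0) as [N|[|N]]; auto; exfalso.
    - assert (Hn : is_derive (fun y => g (- y)) (- x) (- g1 x)).
      { evar_last. apply (is_derive_comp (K := R_AbsRing) (V := R_NormedModule) g (fun y => - y)).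
        - rewrite Ropp_involutive. apply Hx.
        - apply (is_derive_opp (K := R_AbsRing) (V := R_NormedModule) (fun y => y)). apply is_derive_id.
        - unfold scal, opp; simpl; unfold mult, opp, one; simpl.  ring. }
      destruct (deriv_pos_incr _ _ _ Hn lra) as (d2 & D2 & K).
      set (t := Rmin d d2 / 2).
      assert (T : 0 < Rmin d d2) by (apply Rmin_pos; auto).
      assert (M1 := Rmin_l d d2). assert (M2 := Rmin_r d d2).
      specialize (K (- x + t) ltac:(unfold t; lra)). rewrite Ropp_involutive in K.
      specialize (M (- (- x + t))). replace (- (- x + t) - x) with (- t) in M by ring.
      rewrite Rabs_Ropp, Rabs_pos_eq in M by (unfold t; lra). specialize (M ltac:(unfold t; lra)). lra.
    - destruct (deriv_pos_incr _ _ _ Hx lra) as (d2 & D2 & K).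
      set (t := Rmin d d2 / 2).
      assert (T : 0 < Rmin d d2) by (apply Rmin_pos; auto).
      assert (M1 := Rmin_l d d2). assert (M2 := Rmin_r d d2).
      specialize (K (x + t) ltac:(unfold t; lra)).
      specialize (M (x + t)). replace (x + t - x) with t in M by ring.
      rewrite Rabs_pos_eq in M by (unfold t; lra). specialize (M ltac:(unfold t; lra)). lra. }
  destruct (deriv_pos_incr _ _ _ H' P) as (d2 & D2 & K).
  assert (T : 0 < Rmin d (Rmin d1 d2)) by (repeat apply Rmin_pos; auto).
  assert (M1 := Rmin_l d (Rmin d1 d2)). assert (M2 := Rmin_r d (Rmin d1 d2)).
  assert (M3 := Rmin_l d1 d2). assert (M4 := Rmin_r d1 d2).
  set (t := Rmin d (Rmin d1 d2) / 2).
  assert (Ht : 0 < t) by (unfold t; lra).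
  destruct (MVT_gen g x (x + t) g1) as (c & Hc & E).
  - rewrite Rmin_left, Rmax_right by lra. intros y Hy. apply H. rewrite Rabs_pos_eq; unfold t in *; lra.
  - rewrite Rmin_left, Rmax_right by lra. intros y Hy.
    apply derivable_continuous_pt. exists (g1 y). apply is_derive_Reals, H.
    rewrite Rabs_pos_eq; unfold t in *; lra.
  - rewrite Rmin_left, Rmax_right in Hc by lra.
    specialize (M (x + t)). replace (x + t - x) with t in * by ring.
    rewrite Rabs_pos_eq in M by lra. specialize (M ltac:(unfold t; lra)).
    destruct (Req_dec c x) as [->|N].
    + (* the mean value point is [x] itself: strict growth fails on a shorter interval *)
      rewrite Z in E.
      assert (MV : forall y, x < y <= x + t -> 0 < g1 y) by (intros y Hy; rewrite <- Z; apply K; unfold t in *; lra).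
      destruct (MVT_gen g (x + t / 2) (x + t) g1) as (c2 & Hc2 & E3).
      * rewrite Rmin_left, Rmax_right by lra. intros y Hy. apply H. rewrite Rabs_pos_eq; unfold t in *; lra.
      * rewrite Rmin_left, Rmax_right by lra. intros y Hy.
        apply derivable_continuous_pt. exists (g1 y). apply is_derive_Reals, H.
        rewrite Rabs_pos_eq; unfold t in *; lra.
      * rewrite Rmin_left, Rmax_right in Hc2 by lra. assert (P2 := MV c2 lra).
        destruct (MVT_gen g x (x + t / 2) g1) as (c3 & Hc3 & E4).
        -- rewrite Rmin_left, Rmax_right by lra. intros y Hy. apply H. rewrite Rabs_pos_eq; unfold t in *; lra.
        -- rewrite Rmin_left, Rmax_right by lra. intros y Hy.
           apply derivable_continuous_pt. exists (g1 y). apply is_derive_Reals, H.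
           rewrite Rabs_pos_eq; unfold t in *; lra.
        -- rewrite Rmin_left, Rmax_right in Hc3 by lra.
           assert (0 <= g1 c3).
           { destruct (Req_dec c3 x) as [->|N3]; [lra|]. left. apply MV. lra. }
           nra.
    + assert (0 < g1 c) by (rewrite <- Z; apply K; unfold t in *; lra). nra.
Qed.

(** The form of harmonicity that the maximum principle consumes: continuity, and pure second
    derivatives that cancel at each point. It is local, and on open sets [harmonic_on] implies
    it. *)
Definition harm (W : C -> Prop) (u : C -> R) : Prop :=
  forall z, W z -> rcont u z /\ exists A,
    sd (fun x => u (x, Im z)) (Re z) A /\ sd (fun y => u (Re z, y)) (Im z) (- A).

Lemma harm_plus W (u v : C -> R) : harm W u -> harm W v -> harm W (fun z => u z + v z).
Proof.
  intros Hu Hv z Hz. destruct (Hu z Hz) as (c1 & A & A1 & A2). destruct (Hv z Hz) as (c2 & B & B1 & B2).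
  split; [apply rcont_plus; auto|]. exists (A + B). split; [apply sd_plus; auto|].
  replace (- (A + B)) with (- A + - B) by ring. apply sd_plus; auto.
Qed.

Lemma harm_scal W (u : C -> R) (c : R) : harm W u -> harm W (fun z => c * u z).
Proof.
  intros Hu z Hz. destruct (Hu z Hz) as (c1 & A & A1 & A2).
  split; [apply rcont_mult; auto; apply rcont_const|]. exists (c * A). split; [apply (sd_scal (fun x => u (x, Im z))); auto|].
  replace (- (c * A)) with (c * - A) by ring. apply (sd_scal (fun y => u (Re z, y))); auto.
Qed.

Lemma harm_ext W (u v : C -> R) : (forall z, u z = v z) -> harm W u -> harm W v.
Proof.
  intros E Hu z Hz. destruct (Hu z Hz) as (c1 & A & A1 & A2). split.
  - apply (rcont_ext u); auto.
  - exists A. split; eapply sd_ext; try apply Rlt_0_1; try eassumption; intros; apply E.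
Qed.

Lemma harm_const W (c : R) : harm W (fun _ => c).
Proof.
  intros z Hz. split; [apply rcont_const|]. exists 0. rewrite Ropp_0.
  split; exists (fun _ => 0); (split; [exists 1; split; [lra|intros; apply (is_derive_const (K := R_AbsRing) (V := R_NormedModule))]|apply (is_derive_const (K := R_AbsRing) (V := R_NormedModule))]).
Qed.

Lemma harm_minus W (u v : C -> R) : harm W u -> harm W v -> harm W (fun z => u z - v z).
Proof.
  intros Hu Hv. apply (harm_ext _ (fun z => u z + (-1) * v z)); [intros; ring|].
  apply harm_plus; auto. apply harm_scal; auto.
Qed.

Lemma harm_sub W V (u : C -> R) : (forall z, W z -> V z) -> harm V u -> harm W u.
Proof. intros S H z Hz. apply H; auto. Qed.

Lemma Cmod_pair_re (z : C) (y : R) : <|(y, Im z) - z|> = Rabs (y - Re z).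
Proof.
  replace ((y, Im z) - z)%C with (RtoC (y - Re z)) by (apply Ceq; unfold Re, Im; simpl; ring). apply Cmod_R.
Qed.
Lemma Cmod_pair_im (z : C) (y : R) : <|(Re z, y) - z|> = Rabs (y - Im z).
Proof.
  replace ((Re z, y) - z)%C with (Ci * RtoC (y - Im z))%C by (apply Ceq; unfold Re, Im; simpl; ring).
  rewrite Cmod_mult, Cmod_Ci, Cmod_R. ring.
Qed.

Lemma harm_loc W (u : C -> R) :
  (forall z, W z -> exists d V v, 0 < d /\ V z /\ harm V v /\ forall w, <|w - z|> < d -> u w = v w) -> harm W u.
Proof.
  intros H z Hz. destruct (H z Hz) as (d & V & v & D & Vz & Hv & E).
  destruct (Hv z Vz) as (c1 & A & A1 & A2). split.
  - apply (rcont_ext_loc v u z d); auto. intros; symmetry; auto.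
  - exists A. split.
    + apply (sd_ext (fun x => v (x, Im z)) _ _ _ d); auto. intros y Hy. symmetry. apply E.
      rewrite Cmod_pair_re. auto.
    + apply (sd_ext (fun y => v (Re z, y)) _ _ _ d); auto. intros y Hy. symmetry. apply E.
      rewrite Cmod_pair_im. auto.
Qed.

Lemma cderiv_re_x g (x y : R) (l : C) : cderiv g (x, y) l -> is_derive (fun t => Re (g (t, y))) x (Re l).
Proof.
  intros H. apply eps_derive. intros eps He. destruct (cderiv_eps_inv _ _ _ H eps He) as (d & D & K).
  exists d. split; auto. intros k Hk. specialize (K ((x + k)%R, y)).
  replace (((x + k)%R, y) - (x, y))%C with (RtoC k) in K by (apply Ceq; unfold Re, Im; simpl; ring).
  rewrite Cmod_R in K. eapply Rle_trans; [|apply (K Hk)].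
  eapply Rle_trans; [|apply re_le_Cmod]. right. f_equal. rewrite !re_minus, re_scal_r. reflexivity.
Qed.
Lemma cderiv_re_y g (x y : R) (l : C) : cderiv g (x, y) l -> is_derive (fun t => Re (g (x, t))) y (- Im l).
Proof.
  intros H. apply eps_derive. intros eps He. destruct (cderiv_eps_inv _ _ _ H eps He) as (d & D & K).
  exists d. split; auto. intros k Hk. specialize (K (x, (y + k)%R)).
  replace ((x, (y + k)%R) - (x, y))%C with (Ci * RtoC k)%C in K by (apply Ceq; unfold Re, Im; simpl; ring).
  rewrite Cmod_mult, Cmod_Ci, Cmod_R, Rmult_1_l in K. eapply Rle_trans; [|apply (K Hk)].
  eapply Rle_trans; [|apply re_le_Cmod]. right. rewrite !re_minus.
  replace (Re (l * (Ci * RtoC k))%C) with (- Im l * k) by (unfold Re, Im; simpl; ring). reflexivity.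
Qed.

(** Differentiating in [y] multiplies the complex derivative by [Ci]; twice gives the factor -1, so
    the two second derivatives cancel. *)
Lemma harm_Re W g : copen W -> holo 2 W g -> harm W (fun z => Re (g z)).
Proof.
  intros OW (g1 & H1 & (g2 & H2 & H3)) z Hz. split.
  - apply rcont_Re. eapply cderiv_cont; eauto.
  - destruct (OW z Hz) as (d & D & K). exists (Re (g2 z)). split.
    + exists (fun x => Re (g1 (x, Im z))). split.
      * exists d. split; auto. intros y Hy. apply cderiv_re_x. apply H1, K. rewrite Cmod_pair_re; auto.
      * apply cderiv_re_x. destruct z; apply H2; auto.
    + exists (fun y => - Im (g1 (Re z, y))). split.
      * exists d. split; auto. intros y Hy. apply cderiv_re_y. apply H1, K. rewrite Cmod_pair_im; auto.
      * apply (is_derive_ext (fun y => Re (Ci * g1 (Re z, y))%C)).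
        { intros t. unfold Re, Im; simpl.  ring. }
        replace (- Re (g2 z)) with (- Im (0 * g1 z + Ci * g2 z)%C) by (unfold Re, Im; simpl; unfold Re; ring).
        apply (cderiv_re_y (fun w => Ci * g1 w)%C).
        destruct z as [a b]; apply (cderiv_mult (fun _ => Ci)); [apply cderiv_const|apply H2; auto].
Qed.

Lemma harm_Im W g : copen W -> holo 2 W g -> harm W (fun z => Im (g z)).
Proof.
  intros OW H. apply (harm_ext _ (fun z => Re (- Ci * g z)%C)); [intros; apply mCi_re|].
  apply (harm_Re W (fun z => - Ci * g z)%C); auto. apply holo_mult; auto. apply holo_const.
Qed.

(** Near [z0] the quotient [g z / g z0] stays close to 1, hence in the cut plane, and [ln |g|] is
    [ln |g z0|] plus the real part of the logarithm of that quotient. *)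
Lemma harm_lnCmod W g : copen W -> (forall z, W z -> g z <> 0%C) -> holo 2 W g ->
  harm W (fun z => ln (Cmod (g z))).
Proof.
  intros OW N H z0 Hz0.
  assert (N0 := N z0 Hz0). assert (P0 := proj1 (Cmod_gt_0 _) N0).
  set (k := fun z => (g z * / g z0)%C).
  assert (Hk : holo 2 W k) by (apply holo_mult; auto; apply holo_const).
  assert (Sk : slitp (k z0)).
  { unfold k. replace (g z0 * / g z0)%C with (RtoC 1) by (field; auto). unfold slitp. rewrite Cmod_1. simpl. lra. }
  destruct (slitp_open _ Sk) as (d & D & K).
  destruct (holo_cont 2 W k z0 Hk Hz0 d D) as (d1 & D1 & K1).
  destruct (OW z0 Hz0) as (d2 & D2 & K2).
  set (V := fun z => W z /\ <|z - z0|> < Rmin d1 d2).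
  assert (OV : copen V).
  { intros z (V1 & V2). destruct (OW z V1) as (e1 & E1 & F1).
    exists (Rmin e1 (Rmin d1 d2 - <|z - z0|>)). split; [apply Rmin_pos; lra|].
    intros w Hw. split.
    - apply F1. eapply Rlt_le_trans; [exact Hw|apply Rmin_l].
    - assert (Hw' := Rminr Hw).
      eapply Rle_lt_trans; [apply (Cmod_tri3 w z z0)|]. lra. }
  assert (HV : harm V (fun z => ln (Cmod (g z0)) + Re (Log (k z)))).
  { apply harm_plus; [apply harm_const|].
    apply (harm_Re V (fun z => Log (k z))); auto.
    apply (holo_comp 2 V slitp k Log).
    - intros z (V1 & V2). apply K, K1. eapply Rlt_le_trans; [exact V2|apply Rmin_l].
    - apply (holo_sub 2 V W); [intros z []; auto|auto].
    - apply holo_Log. }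
  assert (HH : harm V (fun z => ln (Cmod (g z)))).
  { apply harm_loc. intros z (V1 & V2). destruct (OV z (conj V1 V2)) as (e1 & E1 & F1).
    exists e1, V. eexists. split; [auto|split; [split; auto|split; [exact HV|]]]. intros w Hw. destruct (F1 w Hw) as (G1 & G2).
     unfold Log, Re; simpl. unfold k. rewrite Cmod_mult, Cmod_inv by auto.
    assert (Pw := proj1 (Cmod_gt_0 _) (N w G1)).
    rewrite ln_mult, ln_Rinv; auto; [ring|apply Rinv_0_lt_compat; auto]. }
  apply HH. split; auto. rewrite Cmod_sub_0. apply Rmin_pos; auto.
Qed.

Lemma cluster_point (zn : nat -> C) (M : R) : (forall n, Cmod (zn n) <= M) ->
  exists ze, forall eps N, 0 < eps -> exists n, (N <= n)%nat /\ <|zn n - ze|> < eps.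
Proof.
  intros B. apply NNPP. intros Hn.
  assert (Hx : forall ze : C, exists p : R * nat, 0 < fst p /\ forall n, (snd p <= n)%nat -> fst p <= <|zn n - ze|>).
  { intros ze. apply NNPP. intros H. apply Hn. exists ze. intros eps N He. apply NNPP. intros H1.
    apply H. exists (eps, N).  split; auto. intros n Hle. apply Rnot_lt_le. intros Hl. apply H1. exists n. auto. }
  destruct (ClassicalEpsilon.choice _ Hx) as (P & HP).
  (* The gauge also encodes the index [N] from which the sequence avoids a neighbourhood, as
     [/ (N + 1)]. A uniform lower bound [d] of the gauge therefore bounds all these indices by
     [/ d], and one term beyond [/ d] contradicts the covering. *)
  set (dl := fun ze => Rmin (fst (P ze) / 2) (/ (INR (snd (P ze)) + 1))).
  assert (Hdl : forall x y : R, 0 < dl (x, y)).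
  { intros x y.  apply Rmin_pos; [destruct (HP (x, y)); lra|].
    apply Rinv_0_lt_compat. assert (H := pos_INR (snd (P (x, y)))). lra. }
  destruct (compactness_value_2d (- M) M (- M) M (fun x y => mkposreal _ (Hdl x y))) as (d & Hd).
  destruct (INR_unbounded (/ d)) as (n & Hnn).
  assert (Zr := re_le_Cmod (zn n)). assert (Zi := im_le_Cmod (zn n)). specialize (B n).
  apply (Hd (Re (zn n)) (Im (zn n))).
  - apply Rabs_le_between in Zr. lra.
  - apply Rabs_le_between in Zi. lra.
  - intros (i & j & _ & _ & I1 & I2 & I3). simpl in I1, I2, I3.
    destruct (HP (i, j)) as (Q1 & Q2).
    assert (D1 : dl (i, j) <= fst (P (i, j)) / 2) by apply Rmin_l.
    assert (D2 : dl (i, j) <= / (INR (snd (P (i, j))) + 1)) by apply Rmin_r.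
    assert (d > 0) by apply cond_pos.
    assert (INR (snd (P (i, j))) + 1 <= / d).
    { rewrite <- (Rinv_inv (INR (snd (P (i, j))) + 1)). apply Rinv_le_contravar; lra. }
    assert (snd (P (i, j)) <= n)%nat by (apply INR_le; lra).
    specialize (Q2 n H1). assert (T := Cmod_le_sum (zn n - (i, j))%C).
    rewrite re_minus, im_minus in T.  simpl in T. lra.
Qed.

Lemma harm_continuous W (u : C -> R) z : harm W u -> W z -> rcont u z.
Proof. intros H Hz. apply (H z Hz). Qed.

Definition Ctwo_i : C := (0, 2).

(** The point [-2i] lies below the half-plane, so [ln |z + 2i| >= ln 2] there. The constant in each
    further term comes from [|z - e| <= |z + 2i| (1 + |e + 2i|)]; it makes that term at least
    [ln |z + 2i|] while keeping its pole at [e]. *)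
Fixpoint barrier (E : list C) (z : C) : R :=
  match E with
  | nil => ln (<|z + Ctwo_i|>)
  | e :: E => barrier E z + (2 * ln (<|z + Ctwo_i|>) - ln (<|z - e|>) + ln (1 + <|e + Ctwo_i|>))
  end.

Lemma Cmod_2i z : 0 <= Im z -> 2 <= <|z + Ctwo_i|>.
Proof.
  intros H. assert (A := im_le_Cmod (z + Ctwo_i)%C). rewrite im_plus in A.
  replace (Im Ctwo_i) with 2 in A by reflexivity. assert (B := Rle_abs (Im z + 2)). lra.
Qed.

Lemma barrier_term (z e : C) : 0 <= Im z -> z <> e ->
  ln (<|z + Ctwo_i|>) <= 2 * ln (<|z + Ctwo_i|>) - ln (<|z - e|>) + ln (1 + <|e + Ctwo_i|>).
Proof.
  intros H N. assert (A := Cmod_2i z H). assert (Pe := Cmod_ge_0 (e + Ctwo_i)%C).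
  assert (P : 0 < <|z - e|>) by (apply Cmod_gt_0; intros K; apply N, Csub0; auto).
  enough (ln (<|z - e|>) <= ln (<|z + Ctwo_i|> * (1 + <|e + Ctwo_i|>))).
  { rewrite ln_mult in H0; lra. }
  apply ln_le; auto.
  replace (z - e)%C with ((z + Ctwo_i) - (e + Ctwo_i))%C by ring.
  eapply Rle_trans; [apply Cmod_triangle|]. rewrite Cmod_opp. nra.
Qed.

Lemma barrier_ge E z : 0 <= Im z -> ~ In z E -> ln (<|z + Ctwo_i|>) <= barrier E z.
Proof.
  intros H. induction E as [|e E IH]; intros N; simpl; [lra|].
  assert (T := barrier_term z e H). simpl in N.
  assert (A := Cmod_2i z H). assert (0 < ln (<|z + Ctwo_i|>)).
  { rewrite <- ln_1. apply ln_increasing; lra. }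
  specialize (IH ltac:(tauto)). specialize (T ltac:(intros ->; apply N; auto)). lra.
Qed.

Lemma barrier_near E (e : C) : In e E -> forall K, exists d, 0 < d /\
  forall z, 0 <= Im z -> ~ In z E -> <|z - e|> < d -> K <= barrier E z.
Proof.
  induction E as [|e' E IH]; intros I K; [destruct I|].
  destruct (in_dec Ceq_dec e E) as [I'|I'].
  - destruct (IH I' K) as (d & D & H). exists d. split; auto. intros z Hz N Hd. simpl.
    simpl in N. specialize (H z Hz ltac:(tauto) Hd).
    assert (T := barrier_term z e' Hz ltac:(intros ->; apply N; auto)).
    assert (A := Cmod_2i z Hz). assert (0 < ln (<|z + Ctwo_i|>)).
    { rewrite <- ln_1. apply ln_increasing; lra. } lra.
  - destruct I as [->|I]; [|contradiction].
    exists (exp (- K)). split; [apply exp_pos|]. intros z Hz N Hd. simpl. simpl in N.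
    assert (B := barrier_ge E z Hz ltac:(tauto)).
    assert (A := Cmod_2i z Hz). assert (0 < ln (<|z + Ctwo_i|>)).
    { rewrite <- ln_1. apply ln_increasing; lra. }
    assert (P : 0 < <|z - e|>) by (apply Cmod_gt_0; intros Q; apply N; left; symmetry; apply Csub0; auto).
    assert (L : ln (<|z - e|>) < - K).
    { rewrite <- (ln_exp (- K)). apply ln_increasing; auto. }
    assert (0 <= ln (1 + <|e + Ctwo_i|>)).
    { rewrite <- ln_1. apply ln_le; [lra|]. assert (Pe := Cmod_ge_0 (e + Ctwo_i)%C). lra. }
    lra.
Qed.

Lemma harm_barrier W E : copen W -> (forall z, W z -> 0 < Im z /\ ~ In z E) -> harm W (barrier E).
Proof.
  intros OW. induction E as [|e E IH]; intros H; simpl.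
  - apply harm_lnCmod; auto.
    + intros z Hz K. assert (A := Cmod_2i z (Rlt_le _ _ (proj1 (H z Hz)))). rewrite K, Cmod_0 in A. lra.
    + apply holo_plus; [apply holo_id|apply holo_const].
  - apply harm_plus; [apply IH; intros z Hz; destruct (H z Hz); simpl in *; tauto|].
    apply harm_plus; [|apply harm_const]. apply harm_minus.
    + apply harm_scal. apply harm_lnCmod; auto.
      * intros z Hz K. assert (A := Cmod_2i z (Rlt_le _ _ (proj1 (H z Hz)))). rewrite K, Cmod_0 in A. lra.
      * apply holo_plus; [apply holo_id|apply holo_const].
    + apply harm_lnCmod; auto.
      * intros z Hz K. apply (proj2 (H z Hz)). left. symmetry. apply Csub0. auto.
      * apply holo_plus; [apply holo_id|apply holo_const].
Qed.

Lemma sd_sqrt1 (y : R) : 0 < y -> exists l, l < 0 /\ sd (fun t => sqrt (1 + t)) y l.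
Proof.
  intros Hy. exists (- / (4 * (1 + y) * sqrt (1 + y))).
  assert (S := sqrt_lt_R0 (1 + y) lra). split.
  { apply Ropp_lt_gt_0_contravar, Rinv_0_lt_compat. nra. }
  exists (fun t => / (2 * sqrt (1 + t))). split.
  - exists y. split; auto. intros t Ht. apply Rabs_def2 in Ht.
    assert (St := sqrt_lt_R0 (1 + t) lra).
    auto_derive; [lra|]. field; lra.
  - auto_derive; [lra|].
    assert (Q := sqrt_sqrt (1 + y) lra).
    set (s := sqrt (1 + y)) in *. rewrite <- Q. field. lra.
Qed.

Lemma sd_const (c x : R) : sd (fun _ => c) x 0.
Proof.
  exists (fun _ => 0). split; [exists 1; split; [lra|intros; apply (is_derive_const (K := R_AbsRing) (V := R_NormedModule))]|apply (is_derive_const (K := R_AbsRing) (V := R_NormedModule))].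
Qed.

(** Phragmen-Lindelof principle: [barrier E] is positive, and infinite at the exceptional
    points and at infinity; [sqrt (1 + Im z)] makes the comparison function strictly superharmonic. *)
Lemma max_principle (W : C -> Prop) (u : C -> R) (M : R) (E : list C) :
  copen W -> (forall z, W z -> 0 < Im z) -> (forall e, In e E -> ~ W e) -> harm W u ->
  (forall z, W z -> u z <= M) ->
  (forall ze eps, ~ W ze -> ~ In ze E -> 0 <= Im ze -> 0 < eps ->
     exists d, 0 < d /\ forall z, W z -> <|z - ze|> < d -> u z <= eps) ->
  forall z, W z -> u z <= 0.
Proof.
  intros OW HW HE Hu HM HB z0 Hz0. apply Rnot_lt_le. intros U0.
  set (B := fun z => barrier E z + sqrt (1 + Im z)).
  assert (NE : forall z, W z -> ~ In z E) by (intros z Hz I; apply (HE z I); auto).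
  assert (PB : forall z, W z -> 0 < B z).
  { intros z Hz. unfold B. assert (A := barrier_ge E z (Rlt_le _ _ (HW z Hz)) (NE z Hz)).
    assert (A2 := Cmod_2i z (Rlt_le _ _ (HW z Hz))).
    assert (0 <= ln (<|z + Ctwo_i|>)) by (rewrite <- ln_1; apply ln_le; lra).
    assert (S := sqrt_lt_R0 (1 + Im z) ltac:(specialize (HW z Hz); lra)). lra. }
  assert (P0 := PB z0 Hz0).
  (* With this [eta] the perturbed function [v] still has the positive value [u z0 / 2] at [z0]. *)
  set (eta := u z0 / (2 * B z0)).
  assert (Heta : 0 < eta) by (unfold eta; apply Rdiv_lt_0_compat; lra).
  set (v := fun z => u z - eta * B z).
  assert (V0 : v z0 = u z0 / 2) by (unfold v, eta; field; lra).
  destruct (completeness (fun x => exists z, W z /\ x = v z)) as (m & Hm1 & Hm2).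
  { exists M. intros x (z & Hz & ->). unfold v. specialize (HM z Hz). specialize (PB z Hz). nra. }
  { exists (v z0), z0. auto. }
  assert (Mm : u z0 / 2 <= m) by (rewrite <- V0; apply Hm1; exists z0; auto).
  assert (Hs : forall n : nat, exists z, W z /\ Rmax (u z0 / 4) (m - / (INR n + 1)) < v z).
  { intros n. apply NNPP. intros K.
    assert (0 < / (INR n + 1)) by (apply Rinv_0_lt_compat; assert (H := pos_INR n); lra).
    assert (m <= Rmax (u z0 / 4) (m - / (INR n + 1))).
    { apply Hm2. intros x (z & Hz & ->). apply Rnot_lt_le. intros Q. apply K. exists z. auto. }
    unfold Rmax in H0. destruct (Rle_dec (u z0 / 4) (m - / (INR n + 1))); lra. }
  destruct (ClassicalEpsilon.choice _ Hs) as (zn & Hzn).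
  assert (Q1 : forall n, u z0 / 4 < v (zn n)).
  { intros n. eapply Rle_lt_trans; [apply Rmax_l|apply (Hzn n)]. }
  assert (Q2 : forall n, m - / (INR n + 1) < v (zn n)).
  { intros n. eapply Rle_lt_trans; [apply Rmax_r|apply (Hzn n)]. }
  (* Along a maximizing sequence [v] stays positive and [u <= M], so the barrier stays bounded. This
     keeps the sequence in a bounded set and away from the exceptional points. *)
  assert (BD : forall n, B (zn n) <= M / eta).
  { intros n. destruct (Hzn n) as (Hz & _). specialize (Q1 n). unfold v in Q1. specialize (HM _ Hz).
    apply Rmult_le_reg_l with eta; auto. unfold Rdiv. rewrite (Rmult_comm M), <- Rmult_assoc, Rinv_r by lra. lra. }
  destruct (cluster_point zn (exp (M / eta) + 2)) as (ze & Hze).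
  { intros n. destruct (Hzn n) as (Hz & _). specialize (BD n). unfold B in BD.
    assert (A := barrier_ge E _ (Rlt_le _ _ (HW _ Hz)) (NE _ Hz)).
    assert (S := sqrt_lt_R0 (1 + Im (zn n)) ltac:(specialize (HW _ Hz); lra)).
    assert (A2 := Cmod_2i _ (Rlt_le _ _ (HW _ Hz))).
    assert (<|zn n + Ctwo_i|> <= exp (M / eta)).
    { rewrite <- (exp_ln (<|zn n + Ctwo_i|>)) by lra. left. apply exp_increasing. lra. }
    assert (Cmod Ctwo_i = 2).
    { unfold Ctwo_i. replace (0, 2)%R with (Ci * RtoC 2)%C by (apply Ceq; unfold Re, Im; simpl; ring).
      rewrite Cmod_mult, Cmod_Ci, Cmod_R, Rabs_pos_eq; lra. }
    assert (T := Cmod_triangle (zn n + Ctwo_i)%C (- Ctwo_i)%C). rewrite Cmod_opp in T.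
    replace (zn n + Ctwo_i + - Ctwo_i)%C with (zn n) in T by ring. lra. }
  assert (Ize : 0 <= Im ze).
  { apply Rnot_lt_le. intros N. destruct (Hze (- Im ze) 0%nat lra) as (n & _ & K).
    assert (A := im_le_Cmod (zn n - ze)%C). rewrite im_minus in A.
    assert (A2 := Rle_abs (Im (zn n) - Im ze)). assert (A3 := HW _ (proj1 (Hzn n))). lra. }
  destruct (classic (W ze)) as [Wze|NWze].
  - assert (SB : harm W (barrier E)) by (apply harm_barrier; auto).
    assert (Cv : rcont v ze).
    {  apply (rcont_plus u (fun z => - (eta * B z))); [apply (harm_continuous W); auto|].
      apply (rcont_ext (fun z => (- eta) * B z)); [intros; ring|].
      apply (rcont_mult (fun _ => - eta)); [apply rcont_const|].
      apply rcont_plus; [apply (harm_continuous W); auto|].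
      apply (rcont_comp (fun z => Im z) (fun t => sqrt (1 + t))); [apply rcont_Im_id|].
      apply (continuity_pt_comp (fun t => 1 + t) sqrt).
      - apply continuity_pt_plus; [apply continuity_pt_const; intros ? ?; auto|apply derivable_continuous_pt, derivable_pt_id].
      - apply continuity_pt_sqrt. lra. }
    assert (Vm : m <= v ze).
    { apply Rnot_lt_le. intros N. destruct (Cv ((m - v ze) / 2) lra) as (d & D & K).
      destruct (INR_unbounded (/ ((m - v ze) / 2))) as (N0 & HN0).
      destruct (Hze d N0 D) as (n & Hn & Hd). specialize (K _ Hd). apply Rabs_def2 in K.
      specialize (Q2 n).
      assert (INR N0 <= INR n) by (apply le_INR; auto).
      assert (/ (INR n + 1) < (m - v ze) / 2).
      { rewrite <- (Rinv_inv ((m - v ze) / 2)). apply Rinv_lt_contravar; [|lra].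
        apply Rmult_lt_0_compat; [apply Rinv_0_lt_compat; lra|]. assert (PN := pos_INR n). lra. }
      lra. }
    assert (MX : forall w, W w -> v w <= v ze).
    { intros w Hw. apply Rle_trans with m; auto. apply Hm1. exists w. auto. }
    destruct (OW ze Wze) as (d & D & K).
    destruct (Hu ze Wze) as (_ & A & A1 & A2). destruct (SB ze Wze) as (_ & A' & A1' & A2').
    destruct (sd_sqrt1 (Im ze) (HW _ Wze)) as (l & Hl & Sl).
    (* At an interior maximum the inequalities [X1] and [X2] for the two directions add up to
       [- eta * l <= 0], whereas [l < 0] is the second derivative of [sqrt (1 + y)]. *)
    assert (X1 : A + (- eta) * (A' + 0) <= 0).
    { apply (sd_max (fun x => u (x, Im ze) + (- eta) * (barrier E (x, Im ze) + sqrt (1 + Im ze))) (Re ze) _ d).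
      - apply (sd_plus (fun x => u (x, Im ze))); auto.
        apply (sd_scal (fun x => barrier E (x, Im ze) + sqrt (1 + Im ze))).
        apply (sd_plus (fun x => barrier E (x, Im ze)) (fun _ => sqrt (1 + Im ze))); auto. apply sd_const.
      - auto.
      - intros y Hy. specialize (MX (y, Im ze)). unfold v, B in MX.
        replace (Re ze, Im ze) with ze by (destruct ze; reflexivity).
        replace (Im (y, Im ze)) with (Im ze) in MX by reflexivity.
        specialize (MX ltac:(apply K; rewrite Cmod_pair_re; auto)). lra. }
    assert (X2 : - A + (- eta) * (- A' + l) <= 0).
    { apply (sd_max (fun y => u (Re ze, y) + (- eta) * (barrier E (Re ze, y) + sqrt (1 + y))) (Im ze) _ d).
      - apply (sd_plus (fun y => u (Re ze, y))); auto.
        apply (sd_scal (fun y => barrier E (Re ze, y) + sqrt (1 + y))).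
        apply (sd_plus (fun y => barrier E (Re ze, y)) (fun y => sqrt (1 + y))); auto.
      - auto.
      - intros y Hy. specialize (MX (Re ze, y)). unfold v, B in MX.
        replace (Re ze, Im ze) with ze by (destruct ze; reflexivity).
        replace (Im (Re ze, y)) with y in MX by reflexivity.
        specialize (MX ltac:(apply K; rewrite Cmod_pair_im; auto)). lra. }
    nra.
  - destruct (in_dec Ceq_dec ze E) as [I|NI].
    + destruct (barrier_near E ze I (M / eta + 1)) as (d & D & K).
      destruct (Hze d 0%nat D) as (n & _ & Hd). destruct (Hzn n) as (Hz & _).
      specialize (K _ (Rlt_le _ _ (HW _ Hz)) (NE _ Hz) Hd). specialize (BD n). unfold B in BD.
      assert (S := sqrt_lt_R0 (1 + Im (zn n)) ltac:(specialize (HW _ Hz); lra)). lra.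
    + destruct (HB ze (u z0 / 8) NWze NI Ize lra) as (d & D & K).
      destruct (Hze d 0%nat D) as (n & _ & Hd). destruct (Hzn n) as (Hz & _).
      specialize (K _ Hz Hd). specialize (Q1 n). specialize (PB _ Hz). unfold v in Q1. nra.
Qed.

End HarmonicFunctions.

(** * Continuity on closed intervals, mean value and Gronwall inequalities *)

Section RealFunctions.

Implicit Types (g h : C -> C) (z w : C).

Lemma locally_Cmod (l : C) (eps : R) : 0 < eps -> locally l (fun w : C => <|w - l|> < eps).
Proof.
  intros He. assert (He2 : 0 < eps / 2) by lra. exists (mkposreal _ He2). intros w (B1 & B2).
  change (Rabs (Re w - Re l) < eps / 2) in B1. change (Rabs (Im w - Im l) < eps / 2) in B2.
  eapply Rle_lt_trans; [apply Cmod_le_sum|]. rewrite re_minus, im_minus. lra.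
Qed.

Lemma locally_Cmod_inv (l : C) (P : C -> Prop) : locally l P ->
  exists d, 0 < d /\ forall w, <|w - l|> < d -> P w.
Proof.
  intros (d & H). exists d. split; [apply cond_pos|]. intros w Hw. apply H. split.
  - change (Rabs (Re w - Re l) < d). rewrite <- re_minus. eapply Rle_lt_trans; [apply re_le_Cmod|auto].
  - change (Rabs (Im w - Im l) < d). rewrite <- im_minus. eapply Rle_lt_trans; [apply im_le_Cmod|auto].
Qed.

Lemma filterlim_Cmod {T} (F : (T -> Prop) -> Prop) (k : T -> C) (l : C) :
  filterlim k F (locally l) -> forall eps, 0 < eps -> F (fun x => <|k x - l|> < eps).
Proof. intros H eps He. apply (H (fun w => <|w - l|> < eps)). apply locally_Cmod; auto. Qed.

Lemma Cmod_filterlim {T} (F : (T -> Prop) -> Prop) (k : T -> C) (l : C) :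
  (forall P Q : T -> Prop, (forall x, P x -> Q x) -> F P -> F Q) ->
  (forall eps, 0 < eps -> F (fun x => <|k x - l|> < eps)) -> filterlim k F (locally l).
Proof.
  intros UP H P HP. destruct (locally_Cmod_inv l P HP) as (d & D & K).
  apply (UP (fun x => <|k x - l|> < d)); [intros; apply K; auto|apply H; auto].
Qed.

Lemma filterlim_Rabs {T} (F : (T -> Prop) -> Prop) (k : T -> R) (l : R) :
  filterlim k F (locally l) -> forall eps, 0 < eps -> F (fun x => Rabs (k x - l) < eps).
Proof.
  intros H eps He. apply (H (fun y : R => Rabs (y - l) < eps)). exists (mkposreal _ He). intros y Hy. apply Hy.
Qed.

Lemma Rabs_filterlim {T} (F : (T -> Prop) -> Prop) (k : T -> R) (l : R) :
  (forall P Q : T -> Prop, (forall x, P x -> Q x) -> F P -> F Q) ->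
  (forall eps, 0 < eps -> F (fun x => Rabs (k x - l) < eps)) -> filterlim k F (locally l).
Proof.
  intros UP H P (d & K). apply (UP (fun x => Rabs (k x - l) < d)); [intros x Hx; apply K; auto|apply H, cond_pos].
Qed.

Lemma within_eps (D : R -> Prop) (x : R) (P : R -> Prop) :
  within D (locally x) P -> exists d, 0 < d /\ forall y, D y -> Rabs (y - x) < d -> P y.
Proof. intros (d & H). exists d. split; [apply cond_pos|]. intros y Dy Hy. apply H; auto. Qed.

Lemma eps_within (D : R -> Prop) (x d : R) (P : R -> Prop) : 0 < d ->
  (forall y, D y -> Rabs (y - x) < d -> P y) -> within D (locally x) P.
Proof. intros Hd H. exists (mkposreal d Hd). intros y Hy Dy. apply H; auto. Qed.

Definition wcont (a b : R) (G : R -> R) : Prop :=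
  forall x eps, a <= x <= b -> 0 < eps -> exists d, 0 < d /\
    forall y, a <= y <= b -> Rabs (y - x) < d -> Rabs (G y - G x) < eps.

Definition wcontC (a b : R) (G : R -> C) : Prop :=
  forall x eps, a <= x <= b -> 0 < eps -> exists d, 0 < d /\
    forall y, a <= y <= b -> Rabs (y - x) < d -> <|G y - G x|> < eps.

Lemma wcontC_within a b (G : R -> C) :
  (forall x, Icc a b x -> continuous_within (Icc a b) G x) <-> wcontC a b G.
Proof.
  split.
  - intros H x eps Hx He. destruct (within_eps _ _ _ (filterlim_Cmod _ _ _ (H x Hx) eps He)) as (d & D & K).
    exists d. split; auto.
  - intros H x Hx. apply Cmod_filterlim.
    + intros P Q PQ. apply filter_imp. auto.
    + intros eps He. destruct (H x eps Hx He) as (d & D & K). apply (eps_within _ _ d); auto.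
Qed.

(** Projection onto [[a, b]]. Composition with it turns continuity relative to the interval into
    continuity on the line, the form in which the mean value and intermediate value theorems are
    applied. *)
Definition clamp (a b x : R) : R := Rmax a (Rmin b x).

Lemma clamp_in a b x : a <= b -> a <= clamp a b x <= b.
Proof. intros H. unfold clamp, Rmax, Rmin. repeat destruct Rle_dec; lra. Qed.
Lemma clamp_id a b x : a <= x <= b -> clamp a b x = x.
Proof. intros H. unfold clamp, Rmax, Rmin. repeat destruct Rle_dec; lra. Qed.
Lemma clamp_lip a b x y : Rabs (clamp a b y - clamp a b x) <= Rabs (y - x).
Proof. unfold clamp, Rmax, Rmin, Rabs. repeat destruct Rle_dec; repeat destruct Rcase_abs; lra. Qed.

Lemma wcont_clamp a b G x : a <= b -> wcont a b G -> continuity_pt (fun y => G (clamp a b y)) x.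
Proof.
  intros Hab H eps He. destruct (H (clamp a b x) eps (clamp_in a b x Hab) He) as (d & D & K).
  exists d. split; auto. intros y (_ & Hy). apply K; [apply clamp_in; auto|].
  eapply Rle_lt_trans; [apply clamp_lip|]. apply Hy.
Qed.

Lemma wcont_sub a b c d G : wcont a b G -> a <= c -> d <= b -> wcont c d G.
Proof.
  intros H Ha Hb x eps Hx He. destruct (H x eps lra He) as (e & E & K).
  exists e. split; auto. intros y Hy. apply K. lra.
Qed.

Lemma mvt_le (G : R -> R) (a b k : R) : a <= b -> wcont a b G ->
  (forall x, a < x < b -> exists l, is_derive G x l /\ l <= k) -> G b - G a <= k * (b - a).
Proof.
  intros Hab HG HD. destruct (Req_dec a b) as [->|N]; [lra|].
  set (Gc := fun y => G (clamp a b y)).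
  assert (DC : forall x, a < x < b -> exists l, is_derive Gc x l /\ l <= k).
  { intros x Hx. destruct (HD x Hx) as (l & Hl & Hk). exists l. split; auto.
    apply (is_derive_ext_loc G); auto.
    assert (P : 0 < Rmin (x - a) (b - x)) by (apply Rmin_pos; lra).
    exists (mkposreal _ P). intros y Hy. change (Rabs (y - x) < Rmin (x - a) (b - x)) in Hy.
    assert (Q1 := Rmin_l (x-a) (b-x)). assert (Q2 := Rmin_r (x-a) (b-x)). apply Rabs_def2 in Hy.
    unfold Gc. rewrite clamp_id; auto. lra. }
  assert (ED : forall c, a < c < b -> ex_derive Gc c) by (intros c P; destruct (DC c P) as (l & Hl & _); exists l; auto).
  destruct (MVT Gc (fun y => y) a b (fun c P => ex_derive_Reals_0 Gc c (ED c P)) (fun c P => derivable_pt_id c))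
    as (c & P & E).
  - lra.
  - intros; apply wcont_clamp; auto.
  - intros; apply derivable_continuous_pt, derivable_pt_id.
  - rewrite !Derive_Reals, Derive_id in E. unfold Gc in E at 2 3. rewrite !clamp_id in E by lra.
    destruct (DC c P) as (l & Hl & Hk). apply is_derive_unique in Hl. rewrite Hl in E.
    nra.
Qed.

(** The derivative is controlled only while [G] exceeds [c]. After the last time at which [G] is at
    most [Rmax (G a) c], the function stays above [c] and the mean value inequality applies. *)
Lemma growth_le (G : R -> R) (a b c k : R) : a <= b -> 0 <= k -> wcont a b G ->
  (forall x, a < x < b -> c < G x -> exists l, is_derive G x l /\ l <= k) ->
  G b <= Rmax (G a) c + k * (b - a).
Proof.
  intros Hab Hk HG HD. set (m := Rmax (G a) c). apply Rnot_lt_le. intros Hlt.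
  assert (Ma : G a <= m) by apply Rmax_l. assert (Mc : c <= m) by apply Rmax_r.
  destruct (completeness (fun x => a <= x <= b /\ G x <= m)) as (x0 & U1 & U2).
  { exists b. intros x ((_ & H) & _). auto. }
  { exists a. split; lra. }
  assert (Hx0 : a <= x0 <= b).
  { split; [apply U1; split; lra|]. apply U2. intros x ((_ & H) & _). auto. }
  assert (G0 : G x0 <= m).
  { apply Rnot_lt_le. intros N. destruct (HG x0 (G x0 - m) Hx0 lra) as (d & D & K).
    assert (x0 <= x0 - d); [|lra]. apply U2. intros x (Hx & Gx). apply Rnot_lt_le. intros N2.
    assert (x <= x0) by (apply U1; auto). specialize (K x Hx). rewrite Rabs_left1 in K by lra.
    specialize (K lra). apply Rabs_def2 in K. lra. }
  assert (H := mvt_le G x0 b k (proj2 Hx0)).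
  assert (G b - G x0 <= k * (b - x0)).
  { apply H; [apply (wcont_sub a b); auto; lra|]. intros x Hx. apply HD; [lra|].
    apply Rnot_le_lt. intros N. assert (x <= x0) by (apply U1; split; lra). lra. }
  nra.
Qed.

Lemma wcont_rev a b G : wcont a b G -> wcont a b (fun x => G (a + b - x)).
Proof.
  intros H x eps Hx He. destruct (H (a + b - x) eps lra He) as (d & D & K).
  exists d. split; auto. intros y Hy1 Hy2. apply K; [lra|].
  replace (a + b - y - (a + b - x)) with (- (y - x)) by ring. rewrite Rabs_Ropp. auto.
Qed.

Lemma derive_rev (G : R -> R) (s x l : R) : is_derive G (s - x) l -> is_derive (fun y => G (s - y)) x (- l).
Proof.
  intros H. evar_last.
  - apply (is_derive_comp (K := R_AbsRing) (V := R_NormedModule) G (fun y => s - y)); [exact H|].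
    apply (is_derive_minus (K := R_AbsRing) (V := R_NormedModule) (fun _ => s) (fun y => y)).
    + apply is_derive_const.
    + apply is_derive_id.
  - unfold scal, minus, plus, opp, zero, one; simpl. unfold mult; simpl. ring.
Qed.

Lemma growth_le_rev (G : R -> R) (a b c k : R) : a <= b -> 0 <= k -> wcont a b G ->
  (forall x, a < x < b -> c < G x -> exists l, is_derive G x l /\ - k <= l) ->
  G a <= Rmax (G b) c + k * (b - a).
Proof.
  intros Hab Hk HG HD.
  assert (H := growth_le (fun x => G (a + b - x)) a b c k Hab Hk (wcont_rev _ _ _ HG)).
  cbv beta in H. replace (a + b - b) with a in H by ring. replace (a + b - a) with b in H by ring. apply H.
  intros x Hx Hc. destruct (HD (a + b - x) lra Hc) as (l & Hl & Hlk).
  exists (- l). split; [apply derive_rev; auto|lra].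
Qed.

Lemma wcont_of_continuity a b G : (forall x, a <= x <= b -> continuity_pt G x) -> wcont a b G.
Proof.
  intros H x eps Hx He. destruct (H x Hx eps He) as (d & D & K). exists d. split; auto.
  intros y Hy Hd. destruct (Req_dec y x) as [->|N]; [rewrite Rminus_diag, Rabs_R0; auto|].
  apply (K y). split; [split; [exact I|auto]|exact Hd].
Qed.

Lemma wcont_C2 a b (P : C -> R) (G : R -> C) : (forall x, a <= x <= b -> rcont P (G x)) -> wcontC a b G -> wcont a b (fun x => P (G x)).
Proof.
  intros HP HG x eps Hx He. destruct (HP x Hx eps He) as (d & D & K).
  destruct (HG x d Hx D) as (d' & D' & K'). exists d'. split; auto.
Qed.

Lemma wcont_plus a b F G : wcont a b F -> wcont a b G -> wcont a b (fun x => F x + G x).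
Proof.
  intros HF HG x eps Hx He. destruct (HF x (eps/2) Hx lra) as (d & D & K).
  destruct (HG x (eps/2) Hx lra) as (d' & D' & K').
  exists (Rmin d d'). split; [apply Rmin_pos; auto|]. intros y Hy Hd.
  assert (M1 := Rmin_l d d'). assert (M2 := Rmin_r d d').
  specialize (K y Hy lra). specialize (K' y Hy lra).
  replace (F y + G y - (F x + G x)) with ((F y - F x) + (G y - G x)) by ring.
  eapply Rle_lt_trans; [apply Rabs_triang|]. lra.
Qed.

Lemma wcontC_pair a b F G : wcont a b F -> wcont a b G -> wcontC a b (fun x => (F x, G x)).
Proof.
  intros HF HG x eps Hx He. destruct (HF x (eps/2) Hx lra) as (d & D & K).
  destruct (HG x (eps/2) Hx lra) as (d' & D' & K').
  exists (Rmin d d'). split; [apply Rmin_pos; auto|]. intros y Hy Hd.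
  assert (M1 := Rmin_l d d'). assert (M2 := Rmin_r d d').
  specialize (K y Hy lra). specialize (K' y Hy lra).
  eapply Rle_lt_trans; [apply Cmod_le_sum|]. rewrite re_minus, im_minus. unfold Re, Im; simpl. lra.
Qed.

Lemma wcont_mult a b F G : wcont a b F -> wcont a b G -> wcont a b (fun x => F x * G x).
Proof.
  intros HF HG.
  apply (wcont_C2 a b (fun z => Re z * Im z) (fun x => (F x, G x))); [|apply wcontC_pair; auto].
  intros x _. apply rcont_mult; [apply rcont_Re_id|apply rcont_Im_id].
Qed.

Lemma wcont_cst a b c : wcont a b (fun _ => c).
Proof. intros x eps _ He. exists 1. split; [lra|]. intros. rewrite Rminus_diag, Rabs_R0. auto. Qed.

Lemma gronwall_le (G : R -> R) (a b k : R) : a <= b -> wcont a b G ->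
  (forall x, a < x < b -> exists l, is_derive G x l /\ l <= k * G x) ->
  G b <= G a * exp (k * (b - a)).
Proof.
  intros Hab HG HD.
  assert (H := mvt_le (fun x => G x * exp (- k * x)) a b 0 Hab).
  assert (E1 : G b * exp (- k * b) - G a * exp (- k * a) <= 0 * (b - a)).
  { apply H.
    - apply wcont_mult; auto. apply wcont_of_continuity. intros x _.
      apply derivable_continuous_pt. exists (- k * exp (- k * x)). apply is_derive_Reals.
      auto_derive; auto; ring.
    - intros x Hx. destruct (HD x Hx) as (l & Hl & Hk).
      exists (l * exp (- k * x) + G x * (- k * exp (- k * x))). split.
      + apply (is_derive_mult G (fun y => exp (- k * y))); auto.
        * auto_derive; auto; ring.
        * intros; apply Rmult_comm.
      + assert (P := exp_pos (- k * x)). nra. }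
  replace (k * (b - a)) with (k * b + (- k * a)) by ring. rewrite exp_plus.
  assert (P := exp_pos (k * b)). assert (Q : exp (- k * b) * exp (k * b) = 1).
  { rewrite <- exp_plus. replace (- k * b + k * b) with 0 by ring. apply exp_0. }
  replace (G b) with (G b * exp (- k * b) * exp (k * b)) by (rewrite Rmult_assoc, Q; ring). nra.
Qed.

Lemma gronwall_ge (G : R -> R) (a b k : R) : a <= b -> wcont a b G ->
  (forall x, a < x < b -> exists l, is_derive G x l /\ - k * G x <= l) ->
  G a <= G b * exp (k * (b - a)).
Proof.
  intros Hab HG HD.
  assert (H := gronwall_le (fun x => G (a + b - x)) a b k Hab (wcont_rev _ _ _ HG)).
  cbv beta in H. replace (a + b - b) with a in H by ring. replace (a + b - a) with b in H by ring. apply H.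
  intros x Hx. destruct (HD (a + b - x) lra) as (l & Hl & Hlk).
  exists (- l). split; [apply derive_rev; auto|lra].
Qed.

End RealFunctions.

(** * Trajectories of the Loewner equation for a given driving function *)

Section Trajectories.

Implicit Types (z w : C).

Lemma Cpair_cs (a b : C) : Rabs (Re a * Re b + Im a * Im b) <= Cmod a * Cmod b.
Proof.
  replace (Re a * Re b + Im a * Im b) with (Re (Cconj a * b)%C) by (unfold Re, Im; simpl; ring).
  eapply Rle_trans; [apply re_le_Cmod|]. rewrite Cmod_mult, Cmod_conj. lra.
Qed.

Definition vel (lam : R -> R) (phi : R -> C) (r : R) : C := (RtoC 2 / (phi r - RtoC (lam r)))%C.

Definition sol (lam : R -> R) (s t : R) (phi : R -> C) : Prop :=
  wcontC s t phi /\
  (forall r, s < r < t -> is_derive (fun x => Re (phi x)) r (Re (vel lam phi r)) /\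
                          is_derive (fun x => Im (phi x)) r (Im (vel lam phi r))) /\
  (forall r, s <= r <= t -> phi r <> RtoC (lam r)).

Lemma wcontC_sub a b c d G : wcontC a b G -> a <= c -> d <= b -> wcontC c d G.
Proof.
  intros H Ha Hb x eps Hx He. destruct (H x eps lra He) as (e & E & K).
  exists e. split; auto. intros y Hy. apply K. lra.
Qed.

Lemma sol_sub lam s t s' t' phi : sol lam s t phi -> s <= s' -> t' <= t -> sol lam s' t' phi.
Proof.
  intros (H1 & H2 & H3) Hs Ht. split; [apply (wcontC_sub s t); auto|].
  split; intros r Hr; [apply H2; lra|apply H3; lra].
Qed.

Lemma sol_neq lam s t phi r : sol lam s t phi -> s <= r <= t -> (phi r - RtoC (lam r))%C <> 0%C.
Proof. intros (_ & _ & H) Hr K. apply (H r Hr), Csub0; auto. Qed.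

Lemma Cmod_vel lam s t phi r : sol lam s t phi -> s <= r <= t ->
  Cmod (vel lam phi r) = 2 / <|phi r - RtoC (lam r)|>.
Proof.
  intros H Hr. unfold vel. rewrite Cmod_div by (apply (sol_neq lam s t); auto).
  rewrite Cmod_R, Rabs_pos_eq; lra.
Qed.

Lemma Im_div (k : R) w : w <> 0%C -> Im (RtoC k / w)%C = - (k * Im w) / (Cmod w * Cmod w).
Proof.
  intros N. apply Cmod_gt_0 in N. assert (S := Cmod_sqr w). rewrite S.
  destruct w as [x y].  simpl in *. field. nra.
Qed.

Lemma Im_vel lam s t phi r : sol lam s t phi -> s <= r <= t ->
  Im (vel lam phi r) = - (2 * Im (phi r)) / (<|phi r - RtoC (lam r)|> * <|phi r - RtoC (lam r)|>).
Proof.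
  intros H Hr. assert (N := sol_neq lam s t phi r H Hr).
  unfold vel. rewrite Im_div by auto. rewrite im_minus. simpl. f_equal. ring.
Qed.

Lemma sqdist_deriv lam s t phi (l0 : R) r : sol lam s t phi -> s < r < t ->
  exists l, is_derive (fun x => <|phi x - RtoC l0|> * <|phi x - RtoC l0|>) r l /\
    Rabs l <= 4 * <|phi r - RtoC l0|> / <|phi r - RtoC (lam r)|>.
Proof.
  intros H Hr. destruct H as (H1 & H2 & H3) eqn:EH. destruct (H2 r Hr) as (D1 & D2).
  exists (2 * (Re (phi r - RtoC l0)%C * Re (vel lam phi r) + Im (phi r - RtoC l0)%C * Im (vel lam phi r))). split.
  - apply (is_derive_ext (fun x => (Re (phi x) - l0) * (Re (phi x) - l0) + Im (phi x) * Im (phi x))).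
    { intros x. rewrite Cmod_sqr, re_minus, im_minus. simpl. ring. }
    evar_last.
    + apply (is_derive_plus (K := R_AbsRing) (V := R_NormedModule)).
      * apply (is_derive_mult (fun x => Re (phi x) - l0) (fun x => Re (phi x) - l0)).
        -- apply (is_derive_minus (K := R_AbsRing) (V := R_NormedModule)); [exact D1|apply is_derive_const].
        -- apply (is_derive_minus (K := R_AbsRing) (V := R_NormedModule)); [exact D1|apply is_derive_const].
        -- intros; apply Rmult_comm.
      * apply (is_derive_mult (fun x => Im (phi x)) (fun x => Im (phi x))); [exact D2|exact D2|intros; apply Rmult_comm].
    + rewrite re_minus, im_minus.  unfold plus, minus, mult, opp, zero; simpl.
      unfold plus, opp; simpl. ring.
  - rewrite Rabs_mult, Rabs_pos_eq by lra.
    eapply Rle_trans; [apply Rmult_le_compat_l; [lra|apply Cpair_cs]|].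
    rewrite (Cmod_vel lam s t) by (try lra; exact H). right.
    assert (P := proj1 (Cmod_gt_0 _) (sol_neq lam s t phi r H lra)). field. lra.
Qed.

Lemma wcont_sqdist a b (phi : R -> C) (c : C) : wcontC a b phi ->
  wcont a b (fun x => <|phi x - c|> * <|phi x - c|>).
Proof.
  intros H. apply (wcont_C2 a b (fun z => <|z - c|> * <|z - c|>)); auto.
  intros x _. assert (Hc : ccont (fun w => w - c)%C (phi x)).
  { apply ccont_plus; [apply ccont_id|apply ccont_const]. }
  apply rcont_mult; apply (rcont_Cmod (fun w => w - c)%C); auto.
Qed.

(** While the distance to [l0] exceeds [2 o], the distance to [lam r] is at least half of it, so the
    squared distance to [l0] changes at rate at most 8. This replaces a Lipschitz bound close to the
    singularity of the equation. *)
Lemma short_time lam s t phi (l0 o : R) : s <= t -> sol lam s t phi -> 0 <= o ->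
  (forall r, s < r < t -> Rabs (lam r - l0) <= o) ->
  let d r := <|phi r - RtoC l0|> in
  d t * d t <= Rmax (d s * d s) (4 * o * o) + 8 * (t - s) /\
  d s * d s <= Rmax (d t * d t) (4 * o * o) + 8 * (t - s).
Proof.
  intros Hst H Ho HO d.
  assert (WC : wcont s t (fun r => d r * d r)) by (apply wcont_sqdist; apply H).
  assert (K : forall r, s < r < t -> 4 * o * o < d r * d r -> exists l,
    is_derive (fun r => d r * d r) r l /\ Rabs l <= 8).
  { intros r Hr Hd. destruct (sqdist_deriv lam s t phi l0 r H Hr) as (l & Hl & B).
    exists l. split; auto. eapply Rle_trans; [exact B|]. fold (d r).
    assert (P := proj1 (Cmod_gt_0 _) (sol_neq lam s t phi r H lra)).
    assert (D0 : 0 <= d r) by apply Cmod_ge_0.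
    assert (D1 : 2 * o < d r) by nra.
    assert (D2 : d r <= <|phi r - RtoC (lam r)|> + Rabs (lam r - l0)).
    {  rewrite <- Cmod_R. rewrite RtoC_minus. apply Cmod_tri3. }
    specialize (HO r Hr).
    apply Rmult_le_reg_r with (<|phi r - RtoC (lam r)|>); auto.
    unfold Rdiv. rewrite Rmult_assoc, Rinv_l by lra. lra. }
  split.
  - apply (growth_le (fun r => d r * d r)); auto; [lra|]. intros r Hr Hd.
    destruct (K r Hr Hd) as (l & L1 & L2). exists l. split; auto. apply Rabs_le_between in L2. lra.
  - apply (growth_le_rev (fun r => d r * d r)); auto; [lra|]. intros r Hr Hd.
    destruct (K r Hr Hd) as (l & L1 & L2). exists l. split; auto. apply Rabs_le_between in L2. lra.
Qed.

Lemma Im_decr lam s t phi : s <= t -> sol lam s t phi -> (forall r, s <= r <= t -> 0 <= Im (phi r)) ->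
  Im (phi t) <= Im (phi s).
Proof.
  intros Hst H Hp.
  assert (X := mvt_le (fun x => Im (phi x)) s t 0 Hst).
  enough (Im (phi t) - Im (phi s) <= 0 * (t - s)) by lra. apply X.
  - apply (wcont_C2 s t Im); [intros; apply rcont_Im_id|apply H].
  - intros r Hr. exists (Im (vel lam phi r)). split; [apply H; auto|].
    rewrite (Im_vel lam s t) by (try lra; auto).
    assert (P := proj1 (Cmod_gt_0 _) (sol_neq lam s t phi r H lra)).
    specialize (Hp r lra).
    set (d := <|phi r - RtoC (lam r)|>) in *.
    apply Rmult_le_reg_r with (d * d); [nra|].
    replace (- (2 * Im (phi r)) / (d * d) * (d * d)) with (- (2 * Im (phi r))) by (field; lra). lra.
Qed.

(** The derivative of [Im^2] is [- 4 Im^2 / |phi - lam|^2], hence at least -4: a point of height [y]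
    cannot reach the real line before time [y^2 / 4]. *)
Lemma Im_sqr_ge lam s t phi : s <= t -> sol lam s t phi -> (forall r, s <= r <= t -> 0 <= Im (phi r)) ->
  Im (phi s) * Im (phi s) <= Im (phi t) * Im (phi t) + 4 * (t - s).
Proof.
  intros Hst H Hp.
  assert (X := mvt_le (fun x => (-1) * (Im (phi x) * Im (phi x))) s t 4 Hst).
  enough (-1 * (Im (phi t) * Im (phi t)) - -1 * (Im (phi s) * Im (phi s)) <= 4 * (t - s)) by lra. apply X.
  - assert (wcont s t (fun x => Im (phi x))) by (apply (wcont_C2 s t Im); [intros; apply rcont_Im_id|apply H]).
    apply wcont_mult; [apply wcont_cst|apply wcont_mult; auto].
  - intros r Hr. exists (-1 * (2 * Im (phi r) * Im (vel lam phi r))). split.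
    + apply (is_derive_scal (fun x => Im (phi x) * Im (phi x)) r (-1)).
      evar_last.
      * apply (is_derive_mult (fun x => Im (phi x)) (fun x => Im (phi x))); [apply H; auto|apply H; auto|intros; apply Rmult_comm].
      * unfold plus, mult; simpl. ring.
    + rewrite (Im_vel lam s t) by (try lra; auto).
      assert (P := proj1 (Cmod_gt_0 _) (sol_neq lam s t phi r H lra)).
      assert (S := Cmod_sqr (phi r - RtoC (lam r))%C). rewrite re_minus, im_minus in S. simpl in S.
      set (d := <|phi r - RtoC (lam r)|>) in *.
      apply Rmult_le_reg_r with (d * d); [nra|].
      replace (-1 * (2 * Im (phi r) * (- (2 * Im (phi r)) / (d * d))) * (d * d))
        with (4 * (Im (phi r) * Im (phi r))) by (field; lra).
      assert (Q := Rle_0_sqr (Re (phi r) - lam r)). unfold Rsqr in Q. rewrite Rminus_0_r in S. lra.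
Qed.

(** The difference of two trajectories solves a linear equation with coefficient [- 2 / (a b)]. Its
    modulus therefore obeys Gronwall bounds when [a] and [b] stay away from 0, and it decreases when
    [Re (/ (a b)) >= 0]. *)
Lemma pair_deriv lam s t phi psi r : sol lam s t phi -> sol lam s t psi -> s < r < t ->
  let a := (phi r - RtoC (lam r))%C in let b := (psi r - RtoC (lam r))%C in
  let D := <|phi r - psi r|> in
  is_derive (fun x => <|phi x - psi x|> * <|phi x - psi x|>) r
    (- 4 * (D * D) * Re (/ (a * b))%C).
Proof.
  intros H1 H2 Hr a b D.
  destruct (proj1 (proj2 H1) r Hr) as (P1 & P2). destruct (proj1 (proj2 H2) r Hr) as (Q1 & Q2).
  apply (is_derive_ext (fun x => (Re (phi x) - Re (psi x)) * (Re (phi x) - Re (psi x)) + (Im (phi x) - Im (psi x)) * (Im (phi x) - Im (psi x)))).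
  { intros x. rewrite Cmod_sqr, re_minus, im_minus. reflexivity. }
  assert (D1 := is_derive_minus (K := R_AbsRing) (V := R_NormedModule) _ _ _ _ _ P1 Q1).
  assert (D2 := is_derive_minus (K := R_AbsRing) (V := R_NormedModule) _ _ _ _ _ P2 Q2).
  evar_last.
  - apply (is_derive_plus (K := R_AbsRing) (V := R_NormedModule)).
    + apply (is_derive_mult (fun x => Re (phi x) - Re (psi x)) (fun x => Re (phi x) - Re (psi x))); [exact D1|exact D1|intros; apply Rmult_comm].
    + apply (is_derive_mult (fun x => Im (phi x) - Im (psi x)) (fun x => Im (phi x) - Im (psi x))); [exact D2|exact D2|intros; apply Rmult_comm].
  - assert (Na : a <> 0%C) by (apply (sol_neq lam s t); auto; lra).
    assert (Nb : b <> 0%C) by (apply (sol_neq lam s t); auto; lra).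
    assert (E : (vel lam phi r - vel lam psi r = - (2) * (phi r - psi r) * / (a * b))%C).
    { unfold vel. fold a b. replace (phi r - psi r)%C with (a - b)%C by (unfold a, b; ring). field. auto. }
    assert (E1 := f_equal Re E). assert (E2 := f_equal Im E). rewrite re_minus in E1. rewrite im_minus in E2.
    change ((Re (vel lam phi r) - Re (vel lam psi r)) * (Re (phi r) - Re (psi r)) +
      (Re (phi r) - Re (psi r)) * (Re (vel lam phi r) - Re (vel lam psi r)) +
      ((Im (vel lam phi r) - Im (vel lam psi r)) * (Im (phi r) - Im (psi r)) +
      (Im (phi r) - Im (psi r)) * (Im (vel lam phi r) - Im (vel lam psi r))) =
      - 4 * (D * D) * Re (/ (a * b))%C).
    rewrite E1, E2. unfold D. rewrite Cmod_sqr, re_minus, im_minus.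
    set (k := (/ (a * b))%C). unfold Re, Im. simpl. ring.
Qed.

Lemma wcont_pair a b (phi psi : R -> C) : wcontC a b phi -> wcontC a b psi ->
  wcont a b (fun x => <|phi x - psi x|> * <|phi x - psi x|>).
Proof.
  intros H K. apply (wcont_C2 a b (fun z => Cmod z * Cmod z) (fun x => phi x - psi x)%C).
  - intros; apply rcont_mult; apply rcont_Cmod_id.
  - intros x eps Hx He. destruct (H x (eps/2) Hx lra) as (d & D & H').
    destruct (K x (eps/2) Hx lra) as (d' & D' & K').
    exists (Rmin d d'). split; [apply Rmin_pos; auto|]. intros y Hy Hd.
    assert (M1 := Rmin_l d d'). assert (M2 := Rmin_r d d').
    specialize (H' y Hy lra). specialize (K' y Hy lra).
    replace (phi y - psi y - (phi x - psi x))%C with ((phi y - phi x) - (psi y - psi x))%C by ring.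
    eapply Rle_lt_trans; [apply Cmod_triangle|]. rewrite Cmod_opp. lra.
Qed.

Lemma sqr_exp_le (x y k : R) : 0 <= y -> x * x <= y * y * exp (2 * k) -> x <= y * exp k.
Proof.
  intros Hy H. replace (2 * k) with (k + k) in H by ring. rewrite exp_plus in H.
  assert (P := exp_pos k). assert (0 <= y * exp k) by nra.
  apply Rnot_lt_le. intros N. nra.
Qed.

Lemma pair_gronwall lam s t phi psi (K : R) : s <= t -> 0 <= K -> sol lam s t phi -> sol lam s t psi ->
  (forall r, s < r < t -> 1 <= K * (<|phi r - RtoC (lam r)|> * <|psi r - RtoC (lam r)|>)) ->
  <|phi t - psi t|> <= <|phi s - psi s|> * exp (2 * K * (t - s)) /\
  <|phi s - psi s|> <= <|phi t - psi t|> * exp (2 * K * (t - s)).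
Proof.
  intros Hst HK H1 H2 HB.
  assert (WC := wcont_pair s t phi psi (proj1 H1) (proj1 H2)).
  assert (B : forall r, s < r < t -> Rabs (Re (/ ((phi r - RtoC (lam r)) * (psi r - RtoC (lam r))))%C) <= K).
  { intros r Hr. eapply Rle_trans; [apply re_le_Cmod|].
    assert (Na := sol_neq lam s t phi r H1 lra). assert (Nb := sol_neq lam s t psi r H2 lra).
    rewrite Cmod_inv by (apply Cmult_neq_0; auto). rewrite Cmod_mult.
    apply Cmod_gt_0 in Na. apply Cmod_gt_0 in Nb. specialize (HB r Hr).
    assert (PP := Rmult_lt_0_compat _ _ Na Nb).
    apply Rmult_le_reg_r with (<|phi r - RtoC (lam r)|> * <|psi r - RtoC (lam r)|>); auto.
    rewrite Rinv_l by lra. lra. }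
  split; apply sqr_exp_le; try apply Cmod_ge_0.
  - replace (2 * (2 * K * (t - s))) with (4 * K * (t - s)) by ring.
    apply (gronwall_le (fun x => <|phi x - psi x|> * <|phi x - psi x|>)); auto.
    intros r Hr. eexists. split; [apply (pair_deriv lam s t); auto|].
    specialize (B r Hr). apply Rabs_le_between in B.
    set (D := <|phi r - psi r|>) in *.  nra.
  - replace (2 * (2 * K * (t - s))) with (4 * K * (t - s)) by ring.
    apply (gronwall_ge (fun x => <|phi x - psi x|> * <|phi x - psi x|>)); auto.
    intros r Hr. eexists. split; [apply (pair_deriv lam s t); auto|].
    specialize (B r Hr). apply Rabs_le_between in B.
    set (D := <|phi r - psi r|>) in *.  nra.
Qed.

Lemma pair_contract lam s t phi psi : s <= t -> sol lam s t phi -> sol lam s t psi ->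
  (forall r, s < r < t -> 0 <= Re (/ ((phi r - RtoC (lam r)) * (psi r - RtoC (lam r))))%C) ->
  <|phi t - psi t|> <= <|phi s - psi s|>.
Proof.
  intros Hst H1 H2 HB.
  assert (WC := wcont_pair s t phi psi (proj1 H1) (proj1 H2)).
  assert (X := mvt_le _ s t 0 Hst WC).
  enough (<|phi t - psi t|> * <|phi t - psi t|> <= <|phi s - psi s|> * <|phi s - psi s|>).
  { assert (Q := Cmod_ge_0 (phi s - psi s)%C). assert (Q' := Cmod_ge_0 (phi t - psi t)%C). nra. }
  enough (<|phi t - psi t|> * <|phi t - psi t|> - <|phi s - psi s|> * <|phi s - psi s|> <= 0 * (t - s)) by lra.
  apply X. intros r Hr. eexists. split; [apply (pair_deriv lam s t); auto|].
  specialize (HB r Hr).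
  set (D := <|phi r - psi r|>) in *.  nra.
Qed.

End Trajectories.

(** * Complex primitives, and families depending on a complex parameter *)

Definition cprim (t : R) (Phi psi : R -> C) : Prop :=
  wcontC 0 t Phi /\ forall r, 0 < r < t ->
    is_derive (fun x => Re (Phi x)) r (Re (psi r)) /\ is_derive (fun x => Im (Phi x)) r (Im (psi r)).

Lemma wcont_re a b G : wcontC a b G -> wcont a b (fun x => Re (G x)).
Proof. intros H. apply (wcont_C2 a b Re); auto. intros; apply rcont_Re_id. Qed.
Lemma wcont_im a b G : wcontC a b G -> wcont a b (fun x => Im (G x)).
Proof. intros H. apply (wcont_C2 a b Im); auto. intros; apply rcont_Im_id. Qed.
Lemma wcontC_of a b G : wcont a b (fun x => Re (G x)) -> wcont a b (fun x => Im (G x)) -> wcontC a b G.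
Proof.
  intros H1 H2 x eps Hx He. destruct (wcontC_pair a b _ _ H1 H2 x eps Hx He) as (d & D & K).
  exists d. split; [auto|exact K].
Qed.

Lemma mvt_abs (G : R -> R) (a b k : R) : a <= b -> wcont a b G ->
  (forall x, a < x < b -> exists l, is_derive G x l /\ Rabs l <= k) -> Rabs (G b - G a) <= k * (b - a).
Proof.
  intros Hab HG HD. apply Rabs_le. split.
  - assert (H := mvt_le (fun x => (-1) * G x) a b k Hab).
    enough (-1 * G b - -1 * G a <= k * (b - a)) by lra. apply H.
    + apply (wcont_mult a b (fun _ => -1) G); auto. apply wcont_cst.
    + intros x Hx. destruct (HD x Hx) as (l & Hl & B). exists ((-1) * l).
      split; [apply (is_derive_scal G x (-1)); auto|]. apply Rabs_le_between in B. lra.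
  - apply mvt_le; auto. intros x Hx. destruct (HD x Hx) as (l & Hl & B). exists l. split; auto.
    apply Rabs_le_between in B. lra.
Qed.

(** The factor 2 comes from treating real and imaginary parts separately. With [M = 0] this says
    that a primitive of 0 is constant, which is how identities between integrals are proved
    below. *)
Lemma cprim_bound t Phi psi M r : cprim t Phi psi -> 0 <= r <= t ->
  (forall x, 0 < x < t -> Cmod (psi x) <= M) -> <|Phi r - Phi 0|> <= 2 * M * r.
Proof.
  intros (H1 & H2) Hr HM. eapply Rle_trans; [apply Cmod_le_sum|]. rewrite re_minus, im_minus.
  assert (A : Rabs (Re (Phi r) - Re (Phi 0)) <= M * (r - 0)).
  { apply (mvt_abs (fun x => Re (Phi x))); [lra| |].
    - apply (wcont_sub 0 t); try lra. apply wcont_re; auto.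
    - intros x Hx. exists (Re (psi x)). split; [apply H2; lra|]. eapply Rle_trans; [apply re_le_Cmod|apply HM; lra]. }
  assert (B : Rabs (Im (Phi r) - Im (Phi 0)) <= M * (r - 0)).
  { apply (mvt_abs (fun x => Im (Phi x))); [lra| |].
    - apply (wcont_sub 0 t); try lra. apply wcont_im; auto.
    - intros x Hx. exists (Im (psi x)). split; [apply H2; lra|]. eapply Rle_trans; [apply im_le_Cmod|apply HM; lra]. }
  lra.
Qed.

Definition RI (t : R) (k : R -> R) (r : R) : R := RInt (fun x => k (clamp 0 t x)) 0 r.
Definition CI (t : R) (psi : R -> C) (r : R) : C := (RI t (fun x => Re (psi x)) r, RI t (fun x => Im (psi x)) r).

Lemma continuous_continuity_pt (k : R -> R) (x : R) : continuity_pt k x -> continuous k x.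
Proof. intros H. apply continuity_pt_filterlim; auto. Qed.

Lemma RI_deriv t k r : 0 <= t -> wcont 0 t k -> is_derive (RI t k) r (k (clamp 0 t r)).
Proof.
  intros Ht Hk. apply (is_derive_RInt (fun x => k (clamp 0 t x)) (RI t k) 0).
  - exists (mkposreal 1 Rlt_0_1). intros y _.
    apply (RInt_correct (V := R_CompleteNormedModule)). apply ex_RInt_continuous.
    intros x _. apply continuous_continuity_pt, wcont_clamp; auto.
  - apply continuous_continuity_pt, (wcont_clamp 0 t k); auto.
Qed.

Lemma CI_prim t psi : 0 <= t -> wcontC 0 t psi -> cprim t (CI t psi) psi.
Proof.
  intros Ht H. assert (H1 := wcont_re _ _ _ H). assert (H2 := wcont_im _ _ _ H). split.
  - apply wcontC_pair; apply wcont_of_continuity; intros x _; apply derivable_continuous_pt; eexists;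
      apply is_derive_Reals, RI_deriv; auto.
  - intros r Hr. split.
    + assert (D := RI_deriv t _ r Ht H1). rewrite clamp_id in D by lra. exact D.
    + assert (D := RI_deriv t _ r Ht H2). rewrite clamp_id in D by lra. exact D.
Qed.

Lemma CI_0 t psi : CI t psi 0 = 0%C.
Proof. apply Ceq; exact (RInt_point (V := R_CompleteNormedModule) 0 _). Qed.

Lemma cprim_plus t P p Q q : cprim t P p -> cprim t Q q -> cprim t (fun r => P r + Q r)%C (fun r => p r + q r)%C.
Proof.
  intros (H1 & H2) (K1 & K2). split.
  - apply wcontC_of; simpl; apply wcont_plus; try apply wcont_re; try apply wcont_im; auto.
  - intros r Hr. destruct (H2 r Hr), (K2 r Hr).
    split; apply (is_derive_plus (K := R_AbsRing) (V := R_NormedModule)); auto.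
Qed.

Lemma wcontC_C2 a b (P : C -> C) (G : R -> C) : (forall x, a <= x <= b -> ccont P (G x)) -> wcontC a b G ->
  wcontC a b (fun x => P (G x)).
Proof.
  intros HP HG x eps Hx He. destruct (HP x Hx eps He) as (d & D & K).
  destruct (HG x d Hx D) as (d' & D' & K'). exists d'. split; auto.
Qed.

Lemma wcontC_mult a b F G : wcontC a b F -> wcontC a b G -> wcontC a b (fun x => F x * G x)%C.
Proof.
  intros HF HG.
  assert (F1 := wcont_re _ _ _ HF). assert (F2 := wcont_im _ _ _ HF).
  assert (G1 := wcont_re _ _ _ HG). assert (G2 := wcont_im _ _ _ HG).
  apply wcontC_of.
  - intros x eps Hx He.
    assert (W : wcont a b (fun x => Re (F x) * Re (G x) + (-1) * (Im (F x) * Im (G x)))).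
    { apply wcont_plus; [|apply wcont_mult; [apply wcont_cst|]]; apply wcont_mult; auto. }
    destruct (W x eps Hx He) as (d & D & K). exists d. split; [auto|]. intros y Hy Hd. specialize (K y Hy Hd).
    rewrite !re_mult. eapply Rle_lt_trans; [|exact K]. right. f_equal. ring.
  - intros x eps Hx He.
    assert (W : wcont a b (fun x => Re (F x) * Im (G x) + Im (F x) * Re (G x))).
    { apply wcont_plus; apply wcont_mult; auto. }
    destruct (W x eps Hx He) as (d & D & K). exists d. split; [auto|]. intros y Hy Hd. specialize (K y Hy Hd).
    rewrite !im_mult. exact K.
Qed.

Lemma wcontC_cst a b c : wcontC a b (fun _ => c).
Proof. intros x eps _ He. exists 1. split; [lra|]. intros. rewrite Cmod_sub_0. auto. Qed.

Lemma wcontC_plus a b F G : wcontC a b F -> wcontC a b G -> wcontC a b (fun x => F x + G x)%C.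
Proof.
  intros HF HG. apply wcontC_of; simpl; apply wcont_plus; try apply wcont_re; try apply wcont_im; auto.
Qed.

Lemma cprim_scal t P p (c : C) : cprim t P p -> cprim t (fun r => c * P r)%C (fun r => c * p r)%C.
Proof.
  intros (H1 & H2). split; [apply wcontC_mult; auto; apply wcontC_cst|].
  intros r Hr. destruct (H2 r Hr) as (D1 & D2). split.
  - apply (is_derive_ext (fun x => Re c * Re (P x) - Im c * Im (P x))); [intros x; rewrite re_mult; reflexivity|].
    rewrite re_mult.
    apply (is_derive_minus (K := R_AbsRing) (V := R_NormedModule)).
    + apply (is_derive_scal (fun x => Re (P x)) r (Re c)); auto.
    + apply (is_derive_scal (fun x => Im (P x)) r (Im c)); auto.
  - apply (is_derive_ext (fun x => Re c * Im (P x) + Im c * Re (P x))); [intros x; rewrite im_mult; reflexivity|].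
    rewrite im_mult.
    apply (is_derive_plus (K := R_AbsRing) (V := R_NormedModule)).
    + apply (is_derive_scal (fun x => Im (P x)) r (Re c)); auto.
    + apply (is_derive_scal (fun x => Re (P x)) r (Im c)); auto.
Qed.

Lemma cprim_mult t P p Q q : cprim t P p -> cprim t Q q ->
  cprim t (fun r => P r * Q r)%C (fun r => p r * Q r + P r * q r)%C.
Proof.
  intros (H1 & H2) (K1 & K2). split; [apply wcontC_mult; auto|].
  intros r Hr. destruct (H2 r Hr) as (D1 & D2), (K2 r Hr) as (E1 & E2). split.
  - apply (is_derive_ext (fun x => Re (P x) * Re (Q x) - Im (P x) * Im (Q x))); [intros x; rewrite re_mult; reflexivity|].
    evar_last.
    + apply (is_derive_minus (K := R_AbsRing) (V := R_NormedModule)).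
      * apply (is_derive_mult (fun x => Re (P x)) (fun x => Re (Q x))); [exact D1|exact E1|intros; apply Rmult_comm].
      * apply (is_derive_mult (fun x => Im (P x)) (fun x => Im (Q x))); [exact D2|exact E2|intros; apply Rmult_comm].
    + rewrite re_plus, !re_mult. unfold minus, plus, opp, mult; simpl.  ring.
  - apply (is_derive_ext (fun x => Re (P x) * Im (Q x) + Im (P x) * Re (Q x))); [intros x; rewrite im_mult; reflexivity|].
    evar_last.
    + apply (is_derive_plus (K := R_AbsRing) (V := R_NormedModule)).
      * apply (is_derive_mult (fun x => Re (P x)) (fun x => Im (Q x))); [exact D1|exact E2|intros; apply Rmult_comm].
      * apply (is_derive_mult (fun x => Im (P x)) (fun x => Re (Q x))); [exact D2|exact E1|intros; apply Rmult_comm].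
    + rewrite im_plus, !im_mult.  unfold plus, mult; simpl. ring.
Qed.

Lemma cprim_exp t P p : cprim t P p -> cprim t (fun r => cexp (P r)) (fun r => p r * cexp (P r))%C.
Proof.
  intros (H1 & H2). split.
  - apply wcontC_C2; auto. intros x _. eapply cderiv_cont, cderiv_cexp.
  - intros r Hr. destruct (H2 r Hr) as (D1 & D2). split.
    +  evar_last.
      * apply (is_derive_mult (fun x => exp (Re (P x))) (fun x => cos (Im (P x)))).
        -- apply (is_derive_comp exp (fun x => Re (P x))); [apply is_derive_exp|exact D1].
        -- apply (is_derive_comp cos (fun x => Im (P x))); [apply is_derive_cos|exact D2].
        -- intros; apply Rmult_comm.
      * change (Re (p r) * exp (Re (P r)) * cos (Im (P r)) + exp (Re (P r)) * (Im (p r) * - sin (Im (P r))) =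
          Re (p r) * (exp (Re (P r)) * cos (Im (P r))) - Im (p r) * (exp (Re (P r)) * sin (Im (P r)))). ring.
    +  evar_last.
      * apply (is_derive_mult (fun x => exp (Re (P x))) (fun x => sin (Im (P x)))).
        -- apply (is_derive_comp exp (fun x => Re (P x))); [apply is_derive_exp|exact D1].
        -- apply (is_derive_comp sin (fun x => Im (P x))); [apply is_derive_sin|exact D2].
        -- intros; apply Rmult_comm.
      * change (Re (p r) * exp (Re (P r)) * sin (Im (P r)) + exp (Re (P r)) * (Im (p r) * cos (Im (P r))) =
          Re (p r) * (exp (Re (P r)) * sin (Im (P r))) + Im (p r) * (exp (Re (P r)) * cos (Im (P r)))). ring.
Qed.

Lemma is_derive_affine (c k s : R) : is_derive (fun x : R => c + k * x) s k.
Proof. auto_derive; auto; ring. Qed.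
Lemma is_derive_linear (k s : R) : is_derive (fun x : R => k * x) s k.
Proof. auto_derive; auto; ring. Qed.

Lemma cexp_lip (a b : C) (M : R) : Cmod a <= M -> Cmod b <= M -> <|cexp a - cexp b|> <= 2 * exp M * <|a - b|>.
Proof.
  intros Ha Hb.
  set (P := fun s : R => (b + (a - b) * RtoC s)%C).
  assert (HP : cprim 1 P (fun _ => (a - b)%C)).
  { split.
    - apply wcontC_plus; [apply wcontC_cst|]. apply wcontC_mult; [apply wcontC_cst|].
      apply wcontC_of; simpl; [|apply wcont_cst]. apply wcont_of_continuity. intros; apply derivable_continuous_pt, derivable_pt_id.
    - intros r _. split.
      + apply (is_derive_ext (fun s => Re b + Re (a - b)%C * s)); [intros s; unfold P; rewrite re_plus, re_scal_r; reflexivity|].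
        apply is_derive_affine.
      + apply (is_derive_ext (fun s => Im b + Im (a - b)%C * s)); [intros s; unfold P; rewrite im_plus, im_scal_r; reflexivity|].
        apply is_derive_affine. }
  assert (B := cprim_bound 1 _ _ (exp M * <|a - b|>) 1 (cprim_exp _ _ _ HP) lra).
  assert (E1 : P 1 = a) by (unfold P; ring). assert (E0 : P 0 = b) by (unfold P; ring). cbv beta in B. rewrite E1, E0 in B.
  replace (2 * exp M * <|a - b|>) with (2 * (exp M * <|a - b|>) * 1) by ring. apply B.
  intros x Hx. rewrite Cmod_mult, Cmod_cexp, Rmult_comm. apply Rmult_le_compat_r; [apply Cmod_ge_0|].
  assert (Re (P x) <= M).
  { unfold P. rewrite re_plus, re_scal_r, re_minus.
    assert (A1 := re_le_Cmod a). assert (A2 := Rle_abs (Re a)). assert (B1 := re_le_Cmod b). assert (B2 := Rle_abs (Re b)). nra. }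
  destruct H as [H| ->]; [left; apply exp_increasing; auto|lra].
Qed.

Section UniformFamilies.
Context (t : R) (O : C -> Prop) (Ht : 0 <= t).

(** One constant bounds the family and its Lipschitz dependence on the parameter. The class is
    closed under sums, products, exponentials and integration in time. The difference quotients of
    the flow are built with these operations, so their continuity in the parameter comes for
    free. *)
Definition U0 (phi : C -> R -> C) : Prop :=
  exists M, 0 < M /\ (forall y r, O y -> 0 <= r <= t -> Cmod (phi y r) <= M) /\
   (forall y, O y -> wcontC 0 t (phi y)) /\
   (forall z y r, O z -> O y -> 0 <= r <= t -> <|phi z r - phi y r|> <= M * <|z - y|>).

Lemma U0_plus p q : U0 p -> U0 q -> U0 (fun y r => p y r + q y r)%C.
Proof.
  intros (M & M0 & P1 & P2 & P3) (N & N0 & Q1 & Q2 & Q3). exists (M + N). split; [lra|]. split; [|split].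
  - intros y r Hy Hr. eapply Rle_trans; [apply Cmod_triangle|]. specialize (P1 y r Hy Hr). specialize (Q1 y r Hy Hr). lra.
  - intros y Hy. apply wcontC_plus; auto.
  - intros z y r Hz Hy Hr. replace (p z r + q z r - (p y r + q y r))%C with ((p z r - p y r) + (q z r - q y r))%C by ring.
    eapply Rle_trans; [apply Cmod_triangle|]. specialize (P3 z y r Hz Hy Hr). specialize (Q3 z y r Hz Hy Hr). lra.
Qed.

Lemma U0_mult p q : U0 p -> U0 q -> U0 (fun y r => p y r * q y r)%C.
Proof.
  intros (M & M0 & P1 & P2 & P3) (N & N0 & Q1 & Q2 & Q3). exists (2 * M * N). split; [nra|]. split; [|split].
  - intros y r Hy Hr. rewrite Cmod_mult. specialize (P1 y r Hy Hr). specialize (Q1 y r Hy Hr).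
     assert (B := Cmod_ge_0 (q y r)). nra.
  - intros y Hy. apply wcontC_mult; auto.
  - intros z y r Hz Hy Hr. replace (p z r * q z r - p y r * q y r)%C with ((p z r - p y r) * q z r + p y r * (q z r - q y r))%C by ring.
    eapply Rle_trans; [apply Cmod_triangle|]. rewrite !Cmod_mult.
    assert (X := Q1 z r Hz Hr). assert (Y := P1 y r Hy Hr). specialize (P3 z y r Hz Hy Hr). specialize (Q3 z y r Hz Hy Hr).
    assert (A := Cmod_ge_0 (p y r)). assert (B := Cmod_ge_0 (q z r)). assert (D := Cmod_ge_0 (z - y)%C).
    assert (A' := Cmod_ge_0 (p z r - p y r)%C). assert (B' := Cmod_ge_0 (q z r - q y r)%C).
    apply Rle_trans with (M * <|z - y|> * N + M * (N * <|z - y|>)); [|right; ring].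
    apply Rplus_le_compat; apply Rmult_le_compat; auto.
Qed.

Lemma U0_exp p : U0 p -> U0 (fun y r => cexp (p y r)).
Proof.
  intros (M & M0 & P1 & P2 & P3).
  assert (E := exp_pos M). exists (exp M + 2 * exp M * M). split; [nra|]. split; [|split].
  - intros y r Hy Hr. rewrite Cmod_cexp. specialize (P1 y r Hy Hr).
    assert (A := re_le_Cmod (p y r)). assert (A2 := Rle_abs (Re (p y r))).
    assert (exp (Re (p y r)) <= exp M).
    { destruct (Req_dec (Re (p y r)) M) as [->|N]; [lra|]. left. apply exp_increasing. lra. }
    nra.
  - intros y Hy. apply (wcontC_C2 0 t cexp (p y)); auto. intros. eapply cderiv_cont, cderiv_cexp.
  - intros z y r Hz Hy Hr. eapply Rle_trans; [apply (cexp_lip _ _ M); auto|].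
     assert (D0 := Cmod_ge_0 (z - y)%C).
    apply Rle_trans with (2 * exp M * (M * <|z - y|>)); [apply Rmult_le_compat_l; [lra|auto]|]. nra.
Qed.

Lemma U0_int p : U0 p -> U0 (fun y r => CI t (p y) r).
Proof.
  intros (M & M0 & P1 & P2 & P3). exists (2 * M * t + 1). assert (0 <= 2 * M * t) by (repeat apply Rmult_le_pos; lra).
  split; [lra|]. split; [|split].
  - intros y r Hy Hr. assert (B := cprim_bound t _ _ M r (CI_prim t (p y) Ht (P2 y Hy)) Hr).
    rewrite CI_0 in B. replace (CI t (p y) r - 0)%C with (CI t (p y) r) in B by ring.
    eapply Rle_trans; [apply B; intros; apply P1; auto; lra|]. nra.
  - intros y Hy. apply (CI_prim t (p y) Ht (P2 y Hy)).
  - intros z y r Hz Hy Hr.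
    assert (PR := cprim_plus _ _ _ _ _ (CI_prim t (p z) Ht (P2 z Hz)) (cprim_scal _ _ _ (- (1))%C (CI_prim t (p y) Ht (P2 y Hy)))).
    assert (B := cprim_bound t _ _ (M * <|z - y|>) r PR Hr). cbv beta in B. rewrite !CI_0 in B.
    replace (CI t (p z) r + - (1) * CI t (p y) r - (0 + - (1) * 0))%C with (CI t (p z) r - CI t (p y) r)%C in B by ring.
    eapply Rle_trans; [apply B|].
    + intros x Hx. replace (p z x + - (1) * p y x)%C with (p z x - p y x)%C by ring. apply P3; auto; lra.
    + assert (D0 := Cmod_ge_0 (z - y)%C). assert (0 <= M * <|z - y|>) by (apply Rmult_le_pos; lra). nra.
Qed.

Lemma U0_const c : U0 (fun _ _ => c).
Proof.
  assert (P := Cmod_ge_0 c). exists (Cmod c + 1). split; [lra|]. split; [intros; lra|]. split; [intros; apply wcontC_cst|].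
  intros. rewrite Cmod_sub_0. apply Rmult_le_pos; [lra|apply Cmod_ge_0].
Qed.

Lemma U0_fix p z : U0 p -> O z -> U0 (fun _ => p z).
Proof.
  intros (M & M0 & P1 & P2 & _) Hz. exists M. repeat split; auto.
  intros. rewrite Cmod_sub_0. apply Rmult_le_pos; [lra|apply Cmod_ge_0].
Qed.

Lemma U0_ccont p z : copen O -> U0 p -> O z -> ccont (fun y => p y t) z.
Proof.
  intros OO (M & M0 & _ & _ & P3) Hz eps He.
  destruct (OO z Hz) as (d & D & K). exists (Rmin d (eps / M)).
  split; [apply Rmin_pos; auto; apply Rdiv_lt_0_compat; auto|]. intros w Hw.
  destruct (Rmin2 _ _ _ Hw) as (W1 & W2).
  eapply Rle_lt_trans; [apply P3; auto; lra|].
  apply Rmult_lt_reg_l with (/ M); [apply Rinv_0_lt_compat; auto|].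
  rewrite <- Rmult_assoc, Rinv_l by lra.  lra.
Qed.

End UniformFamilies.

(** The analytic hypotheses in epsilon-delta form, without arc length. Of conformality, bijectivity
    and continuity are recorded; the derivatives of [f] in [z] are recovered from the flow in
    [f_holo]. *)
Record chain (T : R) (lam : R -> R) (gamma : R -> C) (f : C -> R -> C) : Prop := {
  ch_T : 0 < T;
  ch_lam : wcont 0 T lam;
  ch_gam : wcontC 0 T gamma;
  ch_simple : forall t t', 0 <= t <= T -> 0 <= t' <= T -> gamma t = gamma t' -> t = t';
  ch_g0 : gamma 0 = 0%C;
  ch_gH : forall t, 0 < t <= T -> 0 < Im (gamma t);
  ch_map : forall t z, 0 <= t <= T -> slit gamma t z -> 0 < Im (f z t);
  ch_inj : forall t z w, 0 <= t <= T -> slit gamma t z -> slit gamma t w -> f z t = f w t -> z = w;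
  ch_onto : forall t w, 0 <= t <= T -> 0 < Im w -> exists z, slit gamma t z /\ f z t = w;
  ch_cont : forall t z, 0 <= t <= T -> slit gamma t z -> ccont (fun y => f y t) z;
  ch_hyd : forall t, 0 <= t <= T -> exists M K, 0 < M /\ forall z, slit gamma t z -> M < Cmod z ->
    <|f z t - (z + RtoC (2 * t) / z)|> <= K / Cmod z ^ 2;
  ch_0 : forall z, 0 < Im z -> f z 0 = z;
  ch_sol : forall t z, 0 <= t <= T -> slit gamma t z -> sol lam 0 t (f z);
  ch_tip : forall t eps, 0 <= t <= T -> 0 < eps -> exists d, 0 < d /\ forall z, slit gamma t z ->
    <|z - gamma t|> < d -> <|f z t - RtoC (lam t)|> < eps }.
Arguments ch_T {T lam gamma f} _.
Arguments ch_lam {T lam gamma f} _.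
Arguments ch_gam {T lam gamma f} _.
Arguments ch_simple {T lam gamma f} _.
Arguments ch_g0 {T lam gamma f} _.
Arguments ch_gH {T lam gamma f} _.
Arguments ch_map {T lam gamma f} _.
Arguments ch_inj {T lam gamma f} _.
Arguments ch_onto {T lam gamma f} _.
Arguments ch_cont {T lam gamma f} _.
Arguments ch_hyd {T lam gamma f} _.
Arguments ch_0 {T lam gamma f} _.
Arguments ch_sol {T lam gamma f} _.
Arguments ch_tip {T lam gamma f} _.

Lemma seq_by_contra {A} (P : R -> A -> Prop) (Q : A -> Prop) :
  ~ (exists d, 0 < d /\ forall z, P d z -> Q z) ->
  exists zn : nat -> A, forall n, P (/ (INR n + 1)) (zn n) /\ ~ Q (zn n).
Proof.
  intros H.
  assert (X : forall n : nat, exists z, P (/ (INR n + 1)) z /\ ~ Q z).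
  { intros n. apply NNPP. intros K. apply H. exists (/ (INR n + 1)). split.
    - apply Rinv_0_lt_compat. assert (A0 := pos_INR n). lra.
    - intros z Hz. apply NNPP. intros N. apply K. exists z. auto. }
  destruct (ClassicalEpsilon.choice _ X) as (zn & Hz). exists zn. auto.
Qed.

Lemma inv_small eps : 0 < eps -> exists N : nat, forall n, (N <= n)%nat -> / (INR n + 1) < eps.
Proof.
  intros He. destruct (INR_unbounded (/ eps)) as (N & HN). exists N. intros n Hn.
  assert (INR N <= INR n) by (apply le_INR; auto).
  rewrite <- (Rinv_inv eps). assert (0 < / eps) by (apply Rinv_0_lt_compat; auto).
  apply Rinv_lt_contravar; [|lra]. apply Rmult_lt_0_compat; auto.  lra.
Qed.

Lemma wcont_bounded a b G : a <= b -> wcont a b G -> exists M, 0 < M /\ forall x, a <= x <= b -> Rabs (G x) <= M.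
Proof.
  intros Hab H.
  destruct (continuity_ab_maj (fun y => G (clamp a b y)) a b Hab) as (x1 & H1 & _).
  { intros; apply wcont_clamp; auto. }
  destruct (continuity_ab_min (fun y => G (clamp a b y)) a b Hab) as (x2 & H2 & _).
  { intros; apply wcont_clamp; auto. }
  exists (Rabs (G (clamp a b x1)) + Rabs (G (clamp a b x2)) + 1).
  assert (P1 := Rabs_pos (G (clamp a b x1))). assert (P2 := Rabs_pos (G (clamp a b x2))).
  split; [lra|]. intros x Hx. specialize (H1 x Hx). specialize (H2 x Hx).  rewrite (clamp_id a b x Hx) in H1, H2.
  assert (Q1 := Rle_abs (G (clamp a b x1))). assert (Q2 := Rle_abs (- G (clamp a b x2))). rewrite Rabs_Ropp in Q2.
  apply Rabs_le. lra.
Qed.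

Lemma wcont_min a b G : a <= b -> wcont a b G -> (forall x, a <= x <= b -> 0 < G x) ->
  exists c, 0 < c /\ forall x, a <= x <= b -> c <= G x.
Proof.
  intros Hab H HP.
  destruct (continuity_ab_min (fun y => G (clamp a b y)) a b Hab) as (x2 & H2 & H3).
  { intros; apply wcont_clamp; auto. }
  exists (G (clamp a b x2)). split; [apply HP, clamp_in; auto|].
  intros x Hx. specialize (H2 x Hx).  rewrite (clamp_id a b x) in H2; auto.
Qed.

(** * The conformal maps as a flow: bounds, inverse and holomorphy *)

Section Flow.
Context {T : R} {lam : R -> R} {gamma : R -> C} {f : C -> R -> C} (CH : chain T lam gamma f).

Lemma slit_mono s t z : 0 <= s <= t -> slit gamma t z -> slit gamma s z.
Proof. intros Hs (H1 & H2). split; auto. intros (x & Hx & E). apply H2. exists x. split; auto. unfold Icc in *. lra. Qed.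

Lemma slit_H t z : slit gamma t z -> 0 < Im z.
Proof. intros (H & _). exact H. Qed.

Lemma gamma_cluster t (sn : nat -> R) (zn : nat -> C) ze : 0 <= t <= T -> (forall n, 0 <= sn n <= t) ->
  (forall eps, 0 < eps -> exists N, forall n, (N <= n)%nat -> <|zn n - gamma (sn n)|> < eps) ->
  (forall eps N, 0 < eps -> exists n, (N <= n)%nat /\ <|zn n - ze|> < eps) ->
  exists s, 0 <= s <= t /\ gamma s = ze.
Proof.
  intros Ht Hs H1 H2. apply NNPP. intros N.
  assert (P : forall s, 0 <= s <= t -> 0 < <|gamma s - ze|>).
  { intros s Hs'. apply Cmod_gt_0. intros K. apply N. exists s. split; auto. apply Csub0; auto. }
  destruct (wcont_min 0 t (fun s => <|gamma s - ze|>)) as (c & C0 & Hc); auto; [lra| |].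
  { apply (wcont_C2 0 t (fun w => <|w - ze|>)).
    - intros x _. apply (rcont_Cmod (fun w => w - ze)%C), ccont_plus; [apply ccont_id|apply ccont_const].
    - apply (wcontC_sub 0 T); try lra. apply (ch_gam CH). }
  destruct (H1 (c/2) lra) as (N1 & HN1). destruct (H2 (c/2) N1 lra) as (n & Hn & Hd).
  specialize (HN1 n Hn). specialize (Hc (sn n) (Hs n)).
  assert (X := Cmod_tri3 (gamma (sn n)) (zn n) ze). rewrite (Cmod_sub_sym (gamma (sn n)) (zn n)) in X. lra.
Qed.

Lemma slit_open t : 0 <= t <= T -> copen (slit gamma t).
Proof.
  intros Ht z (HzH & HzT).
  enough (exists d, 0 < d /\ forall w, <|w - z|> < d -> ~ trace gamma t w) as (d & D & K).
  { exists (Rmin d (Im z)). split; [apply Rmin_pos; auto|]. intros w Hw. split.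
    - assert (A := im_le_Cmod (w - z)%C). rewrite im_minus in A. assert (B := Rmin_r d (Im z)).
      assert (A2 := Rle_abs (- (Im w - Im z))). rewrite Rabs_Ropp in A2. unfold Hplane in *. lra.
    - apply K. eapply Rlt_le_trans; [exact Hw|apply Rmin_l]. }
  apply NNPP. intros N. destruct (seq_by_contra _ _ N) as (zn & Hz).
  assert (X : forall n, exists s, 0 <= s <= t /\ zn n = gamma s).
  { intros n. destruct (Hz n) as (_ & H). apply NNPP in H. destruct H as (s & H1 & H2). exists s. split; auto. }
  destruct (ClassicalEpsilon.choice _ X) as (sn & Hs).
  destruct (gamma_cluster t sn zn z Ht) as (s & Hs1 & Hs2).
  - intros n; apply Hs.
  - intros eps He. exists 0%nat. intros n _. rewrite <- (proj2 (Hs n)), Cmod_sub_0. auto.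
  - intros eps N0 He. destruct (inv_small eps He) as (N1 & HN1). exists (max N0 N1). split; [lia|].
    eapply Rlt_trans; [apply (Hz (max N0 N1))|apply HN1; lia].
  - apply HzT. exists s. split; auto.
Qed.

Lemma lam_bounded : exists M, 0 < M /\ forall r, 0 <= r <= T -> Rabs (lam r) <= M.
Proof. apply wcont_bounded; [assert (H := ch_T CH); lra|apply (ch_lam CH)]. Qed.

Lemma Imf_decr t z s : 0 <= s <= t -> t <= T -> slit gamma t z -> Im (f z t) <= Im (f z s).
Proof.
  intros Hs Ht Hz. apply (Im_decr lam); [lra| |].
  - apply (sol_sub lam 0 t); try lra. apply (ch_sol CH); auto; lra.
  - intros r Hr. left. apply (ch_map CH); [lra|]. apply (slit_mono r t); auto. lra.
Qed.

Lemma Imf_le t z : 0 <= t <= T -> slit gamma t z -> Im (f z t) <= Im z.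
Proof.
  intros Ht Hz. rewrite <- (ch_0 CH z) at 2; [apply Imf_decr; auto; lra|apply (slit_H t); auto].
Qed.

(** [short_time] around 0 with a bound for the driving function: the squared modulus changes by at
    most a constant, uniformly in [t] and [z]. *)
Lemma f_growth : exists B, 0 < B /\ forall t z, 0 <= t <= T -> slit gamma t z ->
  Cmod (f z t) <= Cmod z + B /\ Cmod z <= Cmod (f z t) + B.
Proof.
  destruct lam_bounded as (M & M0 & HM). assert (HT := ch_T CH).
  set (B := 4 * M * M + 8 * T). assert (B0 : 0 < B) by (unfold B; nra).
  exists (B + 1). split; [lra|]. intros t z Ht Hz.
  assert (S := short_time lam 0 t (f z) 0 M lra (ch_sol CH t z Ht Hz) lra).
  cbv zeta beta in S. rewrite (ch_0 CH z (slit_H t z Hz)) in S.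
  replace (f z t - RtoC 0)%C with (f z t) in S by ring. replace (z - RtoC 0)%C with z in S by ring.
  destruct S as (S1 & S2). { intros r Hr. rewrite Rminus_0_r. apply HM; lra. }
  assert (P1 := Cmod_ge_0 z). assert (P2 := Cmod_ge_0 (f z t)).
  assert (BB : 4 * M * M + 8 * (t - 0) <= B) by (unfold B; lra).
  set (x := Cmod (f z t)) in *. set (y := Cmod z) in *.
  assert (Y : x * x <= y * y + B /\ y * y <= x * x + B).
  { unfold Rmax in S1, S2. destruct (Rle_dec (y*y) (4*M*M)); destruct (Rle_dec (x*x) (4*M*M)); nra. }
  split; apply Rnot_lt_le; intros N; nra.
Qed.

Definition F (t : R) (w : C) : C := inverse_on (slit gamma t) (fun z => f z t) w.

Lemma F_spec t w : 0 <= t <= T -> 0 < Im w -> slit gamma t (F t w) /\ f (F t w) t = w.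
Proof.
  intros Ht Hw. unfold F, inverse_on. apply epsilon_spec. apply (ch_onto CH); auto.
Qed.

Lemma F_f t z : 0 <= t <= T -> slit gamma t z -> F t (f z t) = z.
Proof.
  intros Ht Hz. destruct (F_spec t (f z t) Ht (ch_map CH t z Ht Hz)) as (H1 & H2).
  apply (ch_inj CH t); auto.
Qed.

Lemma Im_le_dist z (l : R) : 0 < Im z -> Im z <= <|z - RtoC l|>.
Proof.
  intros H. assert (A := im_le_Cmod (z - RtoC l)%C). rewrite im_minus in A.
  rewrite Rminus_0_r, Rabs_pos_eq in A; lra.
Qed.

(** Imaginary parts decrease along the flow, so a lower bound [c] at time [t] keeps both
    trajectories at distance [c] from the driving function at all earlier times. Gronwall backwards
    bounds the inverse map, forwards the map itself. *)
Lemma pull_lip t z y c : 0 <= t <= T -> slit gamma t z -> slit gamma t y -> 0 < c ->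
  c <= Im (f z t) -> c <= Im (f y t) ->
  <|z - y|> <= <|f z t - f y t|> * exp (2 * / (c * c) * t) /\
  forall r, 0 <= r <= t -> <|f z r - f y r|> <= <|z - y|> * exp (2 * / (c * c) * t).
Proof.
  intros Ht Hz Hy Hc H1 H2.
  assert (K0 : 0 < / (c * c)) by (apply Rinv_0_lt_compat; nra).
  assert (K1 : forall r, 0 < r < t -> 1 <= / (c * c) * (<|f z r - RtoC (lam r)|> * <|f y r - RtoC (lam r)|>)).
  { intros r Hr. assert (A := Imf_decr t z r lra lra Hz). assert (B := Imf_decr t y r lra lra Hy).
    assert (A' := Im_le_dist (f z r) (lam r) lra). assert (B' := Im_le_dist (f y r) (lam r) lra).
    apply Rmult_le_reg_l with (c * c); [nra|]. rewrite <- Rmult_assoc, Rinv_r by nra.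
    rewrite Rmult_1_r, Rmult_1_l. apply Rmult_le_compat; lra. }
  assert (Sz := ch_sol CH t z Ht Hz). assert (Sy := ch_sol CH t y Ht Hy). split.
  - destruct (pair_gronwall lam 0 t (f z) (f y) (/ (c * c)) lra lra Sz Sy K1) as (_ & G).
    rewrite (ch_0 CH z), (ch_0 CH y), Rminus_0_r in G; auto; apply (slit_H t); auto.
  - intros r Hr.
    destruct (pair_gronwall lam 0 r (f z) (f y) (/ (c * c)) lra lra) as (G & _).
    + apply (sol_sub lam 0 t); auto; lra.
    + apply (sol_sub lam 0 t); auto; lra.
    + intros x Hx. apply K1. lra.
    + rewrite (ch_0 CH z), (ch_0 CH y), Rminus_0_r in G; try (apply (slit_H t); auto).
      eapply Rle_trans; [exact G|]. apply Rmult_le_compat_l; [apply Cmod_ge_0|].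
      assert (Q : 2 * / (c * c) * r <= 2 * / (c * c) * t) by (apply Rmult_le_compat_l; lra).
      destruct Q as [Q| ->]; [left; apply exp_increasing; auto|lra].
Qed.

Lemma F_cont t w : 0 <= t <= T -> 0 < Im w -> ccont (F t) w.
Proof.
  intros Ht Hw eps He.
  set (E := exp (2 * / (Im w / 2 * (Im w / 2)) * t)). assert (E0 : 0 < E) by apply exp_pos.
  exists (Rmin (Im w / 2) (eps / E)). split; [apply Rmin_pos; [lra|apply Rdiv_lt_0_compat; auto]|].
  intros v Hv. destruct (Rmin2 _ _ _ Hv) as (V1 & V2).
  assert (A := im_le_Cmod (v - w)%C). rewrite im_minus in A.
  assert (A2 := Rle_abs (- (Im v - Im w))). rewrite Rabs_Ropp in A2.
  destruct (F_spec t w Ht Hw) as (W1 & W2). destruct (F_spec t v Ht lra) as (U1 & U2).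
  destruct (pull_lip t (F t v) (F t w) (Im w / 2) Ht U1 W1) as (P & _); [lra|rewrite U2; lra|rewrite W2; lra|].
  rewrite U2, W2 in P.  eapply Rle_lt_trans; [exact P|].
  apply Rmult_lt_reg_r with (/ E); [apply Rinv_0_lt_compat; auto|].
  rewrite Rmult_assoc, Rinv_r by lra.  lra.
Qed.

(** Otherwise some points tending to [ze] have images with a cluster value [w] in the open
    half-plane, and continuity of the inverse at [w] gives [ze = F t w], a point of the domain. *)
Lemma f_proper t ze eps : 0 <= t <= T -> ~ slit gamma t ze -> 0 < eps ->
  exists d, 0 < d /\ forall z, slit gamma t z /\ <|z - ze|> < d -> Im (f z t) < eps.
Proof.
  intros Ht Hze He. apply NNPP. intros N.
  destruct (seq_by_contra (fun d z => slit gamma t z /\ <|z - ze|> < d) (fun z => Im (f z t) < eps) N) as (zn & Hz).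
  destruct f_growth as (B & B0 & HB).
  assert (Small : forall d, 0 < d -> exists N, forall n, (N <= n)%nat -> <|zn n - ze|> < d).
  { intros d D. destruct (inv_small d D) as (N1 & HN1). exists N1. intros n Hn.
    eapply Rlt_trans; [apply (Hz n)|auto]. }
  destruct (cluster_point (fun n => f (zn n) t) (Cmod ze + 1 + B)) as (w & Hw).
  { intros n. destruct (Hz n) as ((S1 & S2) & _). destruct (HB t (zn n) Ht S1) as (G & _).
    assert (X := Cmod_rev (zn n) ze).
    assert (/ (INR n + 1) <= 1). { rewrite <- Rinv_1 at 2. apply Rinv_le_contravar; [lra|]. assert (P := pos_INR n). lra. }
    lra. }
  assert (Iw : eps <= Im w).
  { apply Rnot_lt_le. intros L. destruct (Hw (eps - Im w) 0%nat lra) as (n & _ & Hd).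
    destruct (Hz n) as (_ & K). apply Rnot_lt_le in K. assert (A := im_le_Cmod (f (zn n) t - w)%C).
    rewrite im_minus in A. assert (A2 := Rle_abs (Im (f (zn n) t) - Im w)). lra. }
  apply Hze. replace ze with (F t w); [apply F_spec; auto; lra|].
  apply Csub0. apply Cmod_eq_0. apply Rle_antisym; [|apply Cmod_ge_0]. apply Rnot_lt_le. intros L.
  set (e := <|F t w - ze|>) in *.
  destruct (F_cont t w Ht lra (e/2) lra) as (d & D & K).
  destruct (Small (e/2) lra) as (N1 & HN1).
  destruct (Hw d N1 D) as (n & Hn & Hd). specialize (K _ Hd). specialize (HN1 n Hn).
  rewrite F_f in K by (auto; apply (Hz n)).
  assert (X := Cmod_tri3 (F t w) (zn n) ze). rewrite Cmod_sub_sym in K. fold e in X. lra.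
Qed.

Lemma slit_near t z : 0 <= t <= T -> slit gamma t z -> exists (O : C -> Prop) c, 0 < c /\ O z /\ copen O /\
  forall y, O y -> slit gamma t y /\ forall r, 0 <= r <= t -> c <= <|f y r - RtoC (lam r)|> /\ c <= Im (f y r).
Proof.
  intros Ht Hz. assert (P := ch_map CH t z Ht Hz).
  destruct (ch_cont CH t z Ht Hz (Im (f z t) / 2) lra) as (d & D & K).
  destruct (slit_open t Ht z Hz) as (d0 & D0 & K').
  set (d' := Rmin d0 1). assert (D' : 0 < d') by (apply Rmin_pos; lra).
  exists (fun y => <|y - z|> < Rmin d d'), (Im (f z t) / 2). split; [lra|].
  assert (M0 : 0 < Rmin d d') by (apply Rmin_pos; auto).
  split; [rewrite Cmod_sub_0; auto|]. split.
  - intros y Hy. exists (Rmin d d' - <|y - z|>). split; [lra|]. intros w Hw.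
    eapply Rle_lt_trans; [apply (Cmod_tri3 w y z)|]. lra.
  - intros y Hy. assert (Sy : slit gamma t y) by (apply K'; eapply Rlt_le_trans; [exact Hy|eapply Rle_trans; [apply Rmin_r|apply Rmin_l]]).
    split; auto. intros r Hr.
    assert (A := K y ltac:(eapply Rlt_le_trans; [exact Hy|apply Rmin_l])).
    assert (A1 := im_le_Cmod (f y t - f z t)%C). rewrite im_minus in A1.
    assert (A2 := Rle_abs (- (Im (f y t) - Im (f z t)))). rewrite Rabs_Ropp in A2.
    assert (A3 := Imf_decr t y r Hr lra Sy).
    assert (A4 := Im_le_dist (f y r) (lam r)). split; [|lra].  lra.
Qed.

Let g (z : C) (r : R) : C := (/ (f z r - RtoC (lam r)))%C.
(** The propagator of the linear equation solved by [f z - f y], equal to 1 at time 0; its exponent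
    is minus the integral of [2 / ((f z - lam) (f y - lam))]. *)
Let E (t : R) (z y : C) (s : R) : C := cexp (- (1) * CI t (fun r => 2 * (g z r * g y r)) s)%C.

Lemma inv_wcont t z : 0 <= t <= T -> slit gamma t z -> wcontC 0 t (g z).
Proof.
  intros Ht Hz. assert (S := ch_sol CH t z Ht Hz).
  apply (wcontC_C2 0 t (fun z => / z)%C (fun r => f z r - RtoC (lam r))%C).
  - intros r Hr. apply ccont_inv_id. apply (sol_neq lam 0 t); auto.
  - apply (wcontC_plus 0 t (f z) (fun r => - RtoC (lam r))%C); [apply S|].
    apply (wcontC_C2 0 t (fun w => - w)%C (fun r => RtoC (lam r))).
    + intros x _. apply (ccont_ext_loc (fun w => - (1) * w)%C _ _ 1); [lra|intros; ring|].
      apply ccont_mult; [apply ccont_const|apply ccont_id].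
    + apply wcontC_of; simpl; [|apply wcont_cst]. apply (wcont_sub 0 T); try lra. apply (ch_lam CH).
Qed.

(** Both trajectories solve the same Loewner equation, so their difference solves a linear one. *)
Lemma diff_formula t s z y : 0 <= t <= T -> 0 <= s <= t -> slit gamma t z -> slit gamma t y ->
  (f z s - f y s)%C = ((z - y) * E t z y s)%C.
Proof.
  intros Ht Hs Hz Hy.
  assert (Sz := ch_sol CH t z Ht Hz). assert (Sy := ch_sol CH t y Ht Hy). unfold E.
  set (k := fun r => (2 * (g z r * g y r))%C).
  assert (Wk : wcontC 0 t k).
  { apply (wcontC_mult 0 t (fun _ => RtoC 2)); [apply wcontC_cst|]. apply wcontC_mult; apply inv_wcont; auto. }
  assert (PI := CI_prim t k (proj1 Ht) Wk).
  assert (PD : cprim t (fun r => f z r + - (1) * f y r)%C (fun r => vel lam (f z) r + - (1) * vel lam (f y) r)%C).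
  { apply cprim_plus; [|apply (cprim_scal t (f y) (vel lam (f y)))]; (split; [|intros r Hr]); [apply Sz|apply Sz; auto|apply Sy|apply Sy; auto]. }
  assert (PE := cprim_mult _ _ _ _ _ PD (cprim_exp _ _ _ PI)).
  assert (B := cprim_bound t _ _ 0 s PE lra). cbv beta in B.
  rewrite CI_0, cexp_0, (ch_0 CH z), (ch_0 CH y) in B by (apply (slit_H t); auto).
  match type of B with ?A -> _ => assert (HA : A) end.
  { intros r Hr. right. rewrite <- Cmod_0. f_equal. unfold vel, k, g.
    assert (Na := sol_neq lam 0 t (f z) r Sz lra). assert (Nb := sol_neq lam 0 t (f y) r Sy lra).
    set (e := cexp (CI t _ r)). field. auto. }
  specialize (B HA). rewrite Rmult_0_r, Rmult_0_l in B.
  assert (E0 : ((f z s + - (1) * f y s) * cexp (CI t k s) - (z + - (1) * y) * 1)%C = 0%C).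
  { apply Cmod_eq_0, Rle_antisym; [exact B|apply Cmod_ge_0]. }
  apply Csub0 in E0.
  replace (f z s - f y s)%C with ((f z s + - (1) * f y s) * (cexp (CI t k s) * cexp (- (1) * CI t k s)))%C.
  - rewrite Cmult_assoc, E0. ring.
  - rewrite <- cexp_plus. replace (CI t k s + - (1) * CI t k s)%C with (RtoC 0) by ring. rewrite cexp_0. ring.
Qed.

Lemma cderiv_quotient (h q : C -> C) z d : 0 < d -> (forall w, <|w - z|> < d -> h w = (h z + q w * (w - z))%C) ->
  ccont q z -> cderiv h z (q z).
Proof.
  intros D H Q. apply (cderiv_ext_loc (fun w => h z + q w * (w - z))%C _ _ _ d); auto; [intros; symmetry; auto|].
  exists q. split; auto. split; auto. intros. ring.
Qed.

(** [E t z y t] is the difference quotient of [f _ t]; its own difference quotients are explicit as well. *)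
Lemma f_holo t : 0 <= t <= T -> holo 2 (slit gamma t) (fun z => f z t).
Proof.
  intros Ht.
  (* Since [g_z^2 - g_w^2 = (f w - f z) g_w g_z (g_w + g_z)] and [f w - f z = (w - z) E], the
     exponent of [E t w w t] is that of [E t z z t] plus [(w - z) * H w z t]. *)
  set (H := fun z y => CI t (fun r => 2 * (E t z y r * (g z r * g y r) * (g z r + g y r)))%C).
  assert (LOC : forall z0, slit gamma t z0 -> exists O : C -> Prop, O z0 /\ copen O /\
    (forall y, O y -> slit gamma t y) /\ U0 t O g).
  { intros z0 Hz0. destruct (slit_near t z0 Ht Hz0) as (O & c & C0 & Oz & OO & HO).
    exists O. repeat split; auto; [apply HO; auto..|].
    set (K := exp (2 * / (c * c) * t)). assert (K0 : 0 < K) by apply exp_pos. assert (I := Rinv_0_lt_compat _ C0).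
    assert (B : forall y r, O y -> 0 <= r <= t -> <|g y r|> <= / c /\ (f y r - RtoC (lam r) <> 0)%C).
    { intros y r Hy Hr. destruct (HO y Hy) as (_ & G). destruct (G r Hr) as (G1 & _).
      assert (N : (f y r - RtoC (lam r) <> 0)%C) by (apply Cmod_gt_0; lra). split; auto.
      unfold g. rewrite Cmod_inv by auto. apply Rinv_le_contravar; auto. }
    assert (0 < K * (/ c * / c)) by (repeat apply Rmult_lt_0_compat; auto).
    exists (/ c + K * (/ c * / c)). split; [lra|]. split; [|split].
    - intros y r Hy Hr. destruct (B y r Hy Hr). lra.
    - intros y Hy. apply inv_wcont; auto. apply HO; auto.
    - intros z y r Hz Hy Hr. destruct (B z r Hz Hr) as (B1 & N1), (B y r Hy Hr) as (B2 & N2).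
      replace (g z r - g y r)%C with (- (f z r - f y r) * (g z r * g y r))%C by (unfold g; field; auto).
      rewrite Cmod_mult, Cmod_opp, Cmod_mult. assert (D0 := Cmod_ge_0 (z - y)%C).
      destruct (HO z Hz) as (Sz & Gz), (HO y Hy) as (Sy & Gy).
      destruct (pull_lip t z y c Ht Sz Sy C0) as (_ & G); [apply Gz; lra|apply Gy; lra|].
      apply Rle_trans with (<|z - y|> * K * (/ c * / c)); [|nra].
      apply Rmult_le_compat; auto using Cmod_ge_0; [apply Rmult_le_pos; apply Cmod_ge_0|].
      apply Rmult_le_compat; auto using Cmod_ge_0. }
  assert (T0 := proj1 Ht).
  assert (UE : forall O p q, U0 t O p -> U0 t O q -> U0 t O (fun y r => cexp (- (1) * CI t (fun x => 2 * (p y x * q y x)) r)%C)).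
  { intros O p q Up Uq. apply U0_exp, (U0_mult t O (fun _ _ => - (1))%C); [apply U0_const|].
    apply (U0_int t O T0 (fun y x => 2 * (p y x * q y x))%C), (U0_mult t O (fun _ _ => RtoC 2)); [apply U0_const|apply U0_mult; auto]. }
  assert (UH : forall O p q, U0 t O p -> U0 t O q -> U0 t O (fun y r => CI t (fun r =>
      2 * (cexp (- (1) * CI t (fun x => 2 * (p y x * q y x)) r) * (p y r * q y r) * (p y r + q y r)))%C r)).
  { intros O p q Up Uq.  assert (Y := U0_mult t O p q Up Uq). assert (Z := U0_plus t O p q Up Uq).
    apply (U0_int t O T0 (fun y r => 2 * (cexp (- (1) * CI t (fun x => 2 * (p y x * q y x)) r) * (p y r * q y r) * (p y r + q y r)))%C).
    apply (U0_mult t O (fun _ _ => RtoC 2)); [apply U0_const|].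
    apply (U0_mult t O (fun y r => cexp (- (1) * CI t (fun x => 2 * (p y x * q y x)) r) * (p y r * q y r))%C); auto.
    apply (U0_mult t O (fun y r => cexp (- (1) * CI t (fun x => 2 * (p y x * q y x)) r))%C); auto. }
  exists (fun z => E t z z t). split; [|exists (fun z => H z z t * E t z z t)%C; split]; intros z Hz;
    destruct (LOC z Hz) as (O & Oz & OO & OS & Ug); destruct (OO z Oz) as (d & D & KO); assert (Ugz := U0_fix t O g z Ug Oz).
  - apply (cderiv_quotient _ (fun w => E t w z t) z d); auto.
    + intros w Hw. rewrite Cmult_comm, <- diff_formula; auto; [ring|lra].
    + apply (U0_ccont t O T0 (fun w => E t w z)); auto. apply (UE O g (fun _ => g z)); auto.
  - set (h := fun w => ((w - z) * H w z t)%C).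
    assert (Dh : cderiv h z (H z z t)).
    { apply (cderiv_quotient h (fun w => H w z t) z 1); [lra|intros; unfold h; ring|].
      apply (U0_ccont t O T0 (fun w => H w z)); auto. apply (UH O g (fun _ => g z)); auto. }
    apply (cderiv_ext_loc (fun w => E t z z t * cexp (h w))%C _ _ _ d); auto.
    + intros w Hw. assert (Ow := KO w Hw). assert (Ugw := U0_fix t O g w Ug Ow). unfold h, E, H. rewrite <- cexp_plus. f_equal.
      assert (W : forall p q, U0 t O p -> U0 t O q -> wcontC 0 t (fun x => 2 * (p z x * q z x))%C).
      { intros p q Up Uq. destruct (U0_mult t O (fun _ _ => RtoC 2) _ (U0_const t O _) (U0_mult t O p q Up Uq)) as (_ & _ & _ & X & _). apply (X z Oz). }
      assert (WX : wcontC 0 t (fun r => 2 * (E t w z r * (g w r * g z r) * (g w r + g z r)))%C).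
      { assert (X := U0_mult t O _ _ (U0_mult t O _ _ (UE O (fun _ => g w) g Ugw Ug) (U0_mult t O _ _ Ugw Ug)) (U0_plus t O _ _ Ugw Ug)).
        destruct (U0_mult t O (fun _ _ => RtoC 2) _ (U0_const t O _) X) as (_ & _ & _ & Y & _). apply (Y z Oz). }
      assert (P1 := CI_prim t _ T0 (W _ _ Ug Ug)). assert (P2 := CI_prim t _ T0 (W _ _ Ugw Ugw)).
      assert (P3 := CI_prim t _ T0 WX).
      assert (B := cprim_bound t _ _ 0 t (cprim_plus _ _ _ _ _ P1 (cprim_plus _ _ _ _ _ (cprim_scal _ _ _ (- (1))%C P2) (cprim_scal _ _ _ (- (w - z))%C P3))) lra).
      cbv beta in B. rewrite !CI_0 in B.
      match type of B with ?A -> _ => assert (HA : A) end.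
      { intros r Hr. right. rewrite <- Cmod_0. f_equal.
        assert (DF := diff_formula t r w z Ht lra (OS w Ow) Hz).
        assert (Na := sol_neq lam 0 t (f z) r (ch_sol CH t z Ht Hz) lra).
        assert (Nb := sol_neq lam 0 t (f w) r (ch_sol CH t w Ht (OS w Ow)) lra).
        replace (g z r * g z r)%C with (g w r * g w r + (f w r - f z r) * (g w r * g z r) * (g w r + g z r))%C
          by (unfold g; field; auto).
        rewrite DF. ring. }
      specialize (B HA). rewrite Rmult_0_r, Rmult_0_l in B.
      apply Rle_antisym in B; [|apply Cmod_ge_0]. symmetry in B. apply Cmod_eq_0, Csub0 in B. symmetry. apply Csub0.
      etransitivity; [|etransitivity; [exact B|ring]]. ring.
    + eapply cderiv_eq; [|apply cderiv_mult; [apply cderiv_const|apply (cderiv_comp h cexp); [exact Dh|apply cderiv_cexp]]].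
       unfold h. replace ((z - z) * H z z t)%C with (RtoC 0) by ring. rewrite cexp_0. ring.
  - apply ccont_mult; [apply (U0_ccont t O T0 (fun w => H w w))|apply (U0_ccont t O T0 (fun w => E t w w))]; auto; [apply UH|apply UE]; auto.
Qed.

End Flow.

(** * Real trajectories, the boundary values of the flow *)

Definition rsol (lam : R -> R) (s t : R) (phi : R -> R) : Prop := sol lam s t (fun r => RtoC (phi r)).

Lemma vel_R lam (phi : R -> R) r : phi r <> lam r -> vel lam (fun r => RtoC (phi r)) r = RtoC (2 / (phi r - lam r)).
Proof.
  intros N. unfold vel. rewrite <- RtoC_minus, <- RtoC_div by lra. reflexivity.
Qed.

Lemma RtoC_neq (x y : R) : x <> y -> RtoC x <> RtoC y.
Proof. intros N E. apply N. apply (f_equal Re) in E. exact E. Qed.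

Lemma rsol_elim lam s t phi : rsol lam s t phi -> wcont s t phi /\
  (forall r, s < r < t -> is_derive phi r (2 / (phi r - lam r))) /\ (forall r, s <= r <= t -> phi r <> lam r).
Proof.
  intros (H1 & H2 & H3).
  assert (N : forall r, s <= r <= t -> phi r <> lam r) by (intros r Hr E; apply (H3 r Hr); rewrite E; auto).
  split; [apply (wcont_re s t (fun r => RtoC (phi r))); auto|]. split; auto.
  intros r Hr. destruct (H2 r Hr) as (D & _). rewrite vel_R in D by (apply N; lra). exact D.
Qed.

Lemma rsol_intro lam s t phi : wcont s t phi -> (forall r, s < r < t -> is_derive phi r (2 / (phi r - lam r))) ->
  (forall r, s <= r <= t -> phi r <> lam r) -> rsol lam s t phi.
Proof.
  intros H1 H2 N. split; [|split].
  - apply wcontC_of; simpl; auto. apply wcont_cst.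
  - intros r Hr. rewrite vel_R by (apply N; lra). split; [apply H2; auto|].
    change (is_derive (fun _ : R => 0) r 0). apply (is_derive_const (K := R_AbsRing) (V := R_NormedModule)).
  - intros r Hr. apply RtoC_neq; auto.
Qed.

Lemma wcont_minus a b F G : wcont a b F -> wcont a b G -> wcont a b (fun x => F x - G x).
Proof.
  intros HF HG x eps Hx He.
  destruct (wcont_plus a b F (fun x => (-1) * G x) HF (wcont_mult a b (fun _ => -1) G (wcont_cst _ _ _) HG) x eps Hx He) as (d & D & K).
  exists d. split; auto. intros y Hy Hd. specialize (K y Hy Hd).
  replace (F y - G y - (F x - G x)) with (F y + -1 * G y - (F x + -1 * G x)) by ring. exact K.
Qed.

Lemma sign_const g a b : wcont a b g -> (forall x, a <= x <= b -> g x <> 0) -> a <= b ->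
  (exists x, a <= x <= b /\ 0 < g x) -> forall y, a <= y <= b -> 0 < g y.
Proof.
  intros Hg N Hab (x & Hx & Px) y Hy. apply Rnot_le_lt. intros Q.
  destruct (IVT_gen_consistent (fun z => g (clamp a b z)) x y 0) as (z & Hz & E).
  - intros z. apply continuous_continuity_pt, wcont_clamp; auto.
  - rewrite !clamp_id by auto. rewrite Rmin_right, Rmax_left by lra. lra.
  - apply (N (clamp a b z)); auto. apply clamp_in; auto.
Qed.

Lemma rsol_sign lam s t phi : s <= t -> wcont s t lam -> rsol lam s t phi ->
  (exists r, s <= r <= t /\ lam r < phi r) -> forall r, s <= r <= t -> lam r < phi r.
Proof.
  intros Hst HL H (r0 & H0 & P) r Hr. destruct (rsol_elim _ _ _ _ H) as (W & _ & N).
  assert (0 < phi r - lam r); [|lra].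
  apply (sign_const (fun r => phi r - lam r) s t); auto; [apply wcont_minus; auto| |].
  - intros x Hx E. apply (N x Hx). lra.
  - exists r0. split; auto. lra.
Qed.

Lemma rsol_sub lam s t s' t' phi : rsol lam s t phi -> s <= s' -> t' <= t -> rsol lam s' t' phi.
Proof. apply sol_sub. Qed.

Lemma Cmod_RR (x y : R) : <|RtoC x - RtoC y|> = Rabs (x - y).
Proof. rewrite <- RtoC_minus. apply Cmod_R. Qed.

Lemma rsol_mono lam s t phi : s <= t -> rsol lam s t phi -> (forall r, s <= r <= t -> lam r < phi r) -> phi s <= phi t.
Proof.
  intros Hst H P. destruct (rsol_elim _ _ _ _ H) as (W & D & _).
  assert (X := mvt_le (fun x => (-1) * phi x) s t 0 Hst).
  enough (-1 * phi t - -1 * phi s <= 0 * (t - s)) by lra. apply X.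
  - apply (wcont_mult s t (fun _ => -1)); auto. apply wcont_cst.
  - intros r Hr. exists ((-1) * (2 / (phi r - lam r))). split; [apply (is_derive_scal phi r (-1)); auto|].
    specialize (P r lra). assert (0 < 2 / (phi r - lam r)) by (apply Rdiv_lt_0_compat; lra). lra.
Qed.

(** Order is preserved because by Gronwall a positive gap cannot close in finite time. The gap
    shrinks because both trajectories lie on the same side of the driving function. *)
Lemma rsol_pair lam s t phi psi : s <= t -> wcont s t lam -> rsol lam s t phi -> rsol lam s t psi ->
  (forall r, s <= r <= t -> lam r < phi r) -> (forall r, s <= r <= t -> lam r < psi r) -> phi s < psi s ->
  phi t < psi t /\ psi t - phi t <= psi s - phi s /\
  forall c, 0 < c -> (forall r, s <= r <= t -> c <= phi r - lam r) -> psi s - phi s <= (psi t - phi t) * exp (2 * / (c * c) * (t - s)).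
Proof.
  intros Hst HL H1 H2 P1 P2 Hs.
  destruct (rsol_elim _ _ _ _ H1) as (W1 & _ & _). destruct (rsol_elim _ _ _ _ H2) as (W2 & _ & _).
  destruct (wcont_min s t (fun r => (phi r - lam r) * (psi r - lam r)) Hst) as (m & M0 & HM).
  { apply wcont_mult; apply wcont_minus; auto. }
  { intros x Hx. specialize (P1 x Hx). specialize (P2 x Hx). apply Rmult_lt_0_compat; lra. }
  assert (Lt : forall r, s <= r <= t -> phi r < psi r).
  { intros r Hr. assert (0 < psi r - phi r); [|lra].
    apply (sign_const (fun r => psi r - phi r) s t); auto; [apply wcont_minus; auto| |exists s; split; lra].
    intros x Hx E.
    destruct (pair_gronwall lam s x (fun r => RtoC (phi r)) (fun r => RtoC (psi r)) (/ m) lra) as (_ & G).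
    - apply Rlt_le, Rinv_0_lt_compat; auto.
    - apply (rsol_sub lam s t); auto; lra.
    - apply (rsol_sub lam s t); auto; lra.
    - intros r0 Hr0. rewrite !Cmod_RR. specialize (HM r0 lra). specialize (P1 r0 lra). specialize (P2 r0 lra).
      rewrite !Rabs_pos_eq by lra. apply Rmult_le_reg_l with m; auto. rewrite <- Rmult_assoc, Rinv_r by lra. lra.
    - rewrite !Cmod_RR in G. replace (phi x - psi x) with 0 in G by lra. rewrite Rabs_R0, Rmult_0_l in G.
      assert (A := Rabs_pos_lt (phi s - psi s) lra). lra. }
  assert (Lt_t := Lt t lra). split; auto. split.
  - assert (C := pair_contract lam s t (fun r => RtoC (phi r)) (fun r => RtoC (psi r)) Hst H1 H2).
    cbv beta in C. rewrite !Cmod_RR, !Rabs_left in C by lra. enough (- (phi t - psi t) <= - (phi s - psi s)) by lra. apply C.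
    intros r Hr. rewrite <- !RtoC_minus, <- RtoC_mult, <- RtoC_inv.
    +  specialize (P1 r lra). specialize (P2 r lra). apply Rlt_le, Rinv_0_lt_compat, Rmult_lt_0_compat; lra.
    + specialize (P1 r lra). specialize (P2 r lra). apply Rgt_not_eq, Rmult_lt_0_compat; lra.
  - intros c Hc HC.
    destruct (pair_gronwall lam s t (fun r => RtoC (phi r)) (fun r => RtoC (psi r)) (/ (c * c)) Hst) as (_ & G); auto.
    + apply Rlt_le, Rinv_0_lt_compat; nra.
    + intros r0 Hr0. rewrite !Cmod_RR. specialize (HC r0 lra).
      specialize (Lt r0 lra). rewrite !Rabs_pos_eq by lra. apply Rmult_le_reg_l with (c * c); [nra|].
      rewrite <- Rmult_assoc, Rinv_r by nra. nra.
    + rewrite !Cmod_RR, !Rabs_left in G by lra. lra.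
Qed.

(** Real trajectories arise as uniform limits of trajectories in the half-plane. The distance [c]
    from the driving function keeps the velocities of the approximants close to that of the limit,
    so the mean value inequality passes to the limit [eta -> 0]. *)
Lemma sol_limit lam s t (phi : R -> R) (c : R) : s <= t -> wcont s t lam -> 0 < c ->
  (forall r, s <= r <= t -> c <= Rabs (phi r - lam r)) ->
  (forall eta, 0 < eta -> exists psi, sol lam s t psi /\ forall r, s <= r <= t -> <|psi r - RtoC (phi r)|> <= eta) ->
  rsol lam s t phi.
Proof.
  intros Hst HL Hc HC HA.
  assert (W : wcont s t phi).
  { intros x e Hx He. destruct (HA (e/4) lra) as (psi & S & B).
    destruct (proj1 S x (e/4) Hx lra) as (d & D & K). exists d. split; auto. intros y Hy Hd.
    specialize (K y Hy Hd). assert (B1 := B x Hx). assert (B2 := B y Hy). rewrite <- Cmod_RR.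
    replace (RtoC (phi y) - RtoC (phi x))%C with (- (psi y - RtoC (phi y)) + (psi y - psi x) + (psi x - RtoC (phi x)))%C by ring.
    eapply Rle_lt_trans; [apply Cmod_triangle|]. eapply Rle_lt_trans; [apply Rplus_le_compat_r, Cmod_triangle|].
    rewrite Cmod_opp. lra. }
  assert (N : forall r, s <= r <= t -> phi r <> lam r).
  { intros r Hr E. specialize (HC r Hr). rewrite E, Rminus_diag, Rabs_R0 in HC. lra. }
  apply rsol_intro; auto. intros r0 Hr0. apply eps_derive. intros e He.
  set (v := 2 / (phi r0 - lam r0)).
  (* An error [3 k] in the distance to the driving function changes the velocity by at most
     [2 * 3 k / (c / 4 * c)], which is at most [e] for this [k]. *)
  set (k := Rmin (c / 4) (e * (c * c) / 24)).
  assert (k0 : 0 < k). { apply Rmin_pos; [lra|]. assert (0 < e * (c * c)) by (apply Rmult_lt_0_compat; nra). lra. }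
  assert (k1 : k <= c / 4) by apply Rmin_l. assert (k2 : k <= e * (c * c) / 24) by apply Rmin_r.
  destruct (W r0 k lra k0) as (d1 & D1 & K1). destruct (HL r0 k lra k0) as (d2 & D2 & K2).
  set (d := Rmin (Rmin d1 d2) (Rmin (r0 - s) (t - r0))).
  assert (d0 : 0 < d) by (repeat apply Rmin_pos; lra).
  assert (m1 : d <= d1) by (eapply Rle_trans; [apply Rmin_l|apply Rmin_l]).
  assert (m2 : d <= d2) by (eapply Rle_trans; [apply Rmin_l|apply Rmin_r]).
  assert (m3 : d <= r0 - s) by (eapply Rle_trans; [apply Rmin_r|apply Rmin_l]).
  assert (m4 : d <= t - r0) by (eapply Rle_trans; [apply Rmin_r|apply Rmin_r]).
  exists d. split; auto. intros kk Hkk.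
  assert (Main : forall eta, 0 < eta -> eta <= k -> Rabs (phi (r0 + kk) - phi r0 - v * kk) <= e * Rabs kk + 2 * eta).
  { intros eta He1 He2. destruct (HA eta He1) as (psi & S & B).
    assert (Dv : forall r, Rabs (r - r0) < d -> s <= r <= t -> Rabs (Re (vel lam psi r) - v) <= e).
    { intros r Hr Hrst. assert (A1 := K1 r Hrst lra). assert (A2 := K2 r Hrst lra). assert (A3 := B r Hrst).
      assert (Na := sol_neq lam s t psi r S Hrst). assert (Nb : phi r0 - lam r0 <> 0) by (specialize (N r0 lra); lra).
      replace (Re (vel lam psi r) - v) with (Re (vel lam psi r - RtoC v)%C) by (rewrite re_minus; reflexivity).
      eapply Rle_trans; [apply re_le_Cmod|].
      set (a := (psi r - RtoC (lam r))%C) in *. set (b := RtoC (phi r0 - lam r0)).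
      assert (Nb' : b <> 0%C) by (unfold b; apply RtoC_neq; auto).
      assert (E : (vel lam psi r - RtoC v)%C = (2 * (b - a) / (a * b))%C).
      { unfold vel, v. fold a. rewrite RtoC_div by auto. fold b. field. auto. }
      rewrite E. rewrite Cmod_div, !Cmod_mult by (apply Cmult_neq_0; auto). rewrite Cmod_R, Rabs_pos_eq by lra.
      assert (X : <|b - a|> <= 3 * k).
      { replace (b - a)%C with (- (psi r - RtoC (phi r)) + (- RtoC (phi r - phi r0) + RtoC (lam r - lam r0)))%C.
        - eapply Rle_trans; [apply Cmod_triangle|]. rewrite Cmod_opp.
          assert (X2 := Cmod_triangle (- RtoC (phi r - phi r0))%C (RtoC (lam r - lam r0))). rewrite Cmod_opp, !Cmod_R in X2. lra.
        - unfold a, b. rewrite !RtoC_minus. ring. }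
      assert (Cb : c <= Cmod b) by (unfold b; rewrite Cmod_R; apply HC; lra).
      assert (Ca : c / 4 <= Cmod a). { assert (X3 := Cmod_rev b a). lra. }
      assert (Pab : 0 < Cmod a * Cmod b) by (apply Rmult_lt_0_compat; lra).
      apply Rmult_le_reg_r with (Cmod a * Cmod b); auto. unfold Rdiv. rewrite Rmult_assoc, Rinv_l by lra.
      assert (c / 4 * c <= Cmod a * Cmod b) by (apply Rmult_le_compat; lra).
      assert (e * (c / 4 * c) <= e * (Cmod a * Cmod b)) by (apply Rmult_le_compat_l; lra). lra. }
    assert (Gm : Rabs (Re (psi (r0 + kk)) - v * (r0 + kk) - (Re (psi r0) - v * r0)) <= e * Rabs kk).
    { assert (Wg : forall a b, s <= a -> b <= t -> wcont a b (fun r => Re (psi r) - v * r)).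
      { intros a b Ha Hb. apply wcont_minus.
        - apply wcont_re. apply (wcontC_sub s t); auto. apply S.
        - apply (wcont_mult a b (fun _ => v)); [apply wcont_cst|]. apply wcont_of_continuity. intros; apply derivable_continuous_pt, derivable_pt_id. }
      assert (Dg : forall r, s < r < t -> is_derive (fun r => Re (psi r) - v * r) r (Re (vel lam psi r) - v)).
      { intros r Hr. apply (is_derive_minus (K := R_AbsRing) (V := R_NormedModule)); [apply S; auto|apply is_derive_linear]. }
      apply Rabs_def2 in Hkk as Hkk2. destruct (Rle_lt_dec 0 kk) as [L|L].
      - rewrite (Rabs_pos_eq kk) in * by auto. replace (e * kk) with (e * (r0 + kk - r0)) by ring.
        apply (mvt_abs (fun r => Re (psi r) - v * r)); [lra|apply Wg; lra|]. intros r Hr. eexists. split; [apply Dg; lra|].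
        apply Dv; [rewrite Rabs_pos_eq; lra|lra].
      - rewrite (Rabs_left kk) in * by auto. replace (e * - kk) with (e * (r0 - (r0 + kk))) by ring. rewrite Rabs_minus_sym.
        apply (mvt_abs (fun r => Re (psi r) - v * r)); [lra|apply Wg; lra|]. intros r Hr. eexists. split; [apply Dg; lra|].
        apply Dv; [rewrite Rabs_left; lra|lra]. }
    apply Rabs_def2 in Hkk. assert (B1 := B (r0 + kk) lra). assert (B2 := B r0 lra).
    assert (C1 := re_le_Cmod (psi (r0 + kk)%R - RtoC (phi (r0 + kk)%R))%C). assert (C2 := re_le_Cmod (psi r0 - RtoC (phi r0))%C).
    rewrite re_minus in C1, C2. simpl in C1, C2.
    apply Rabs_le_between in Gm. apply Rabs_le_between in C1. apply Rabs_le_between in C2. apply Rabs_le. lra. }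
  apply Rnot_lt_le. intros L. set (g := Rabs (phi (r0 + kk) - phi r0 - v * kk) - e * Rabs kk) in *.
  specialize (Main (Rmin k (g / 4)) ltac:(apply Rmin_pos; unfold g; lra) (Rmin_l _ _)).
  assert (Rmin k (g / 4) <= g / 4) by apply Rmin_r. unfold g in *. lra.
Qed.

(** * Prime ends *)

Lemma joined_elim D z w : joined D z w -> exists p, wcontC 0 1 p /\ (forall x, 0 <= x <= 1 -> D (p x)) /\ p 0 = z /\ p 1 = w.
Proof.
  intros (p & H & E). exists p. split; [|split; auto].
  - apply wcontC_within. intros x Hx. apply H; auto.
  - intros x Hx. apply H; auto.
Qed.

Lemma wcontC_affine a b m k p : wcontC a b p -> (forall x, 0 <= x <= 1 -> a <= m + k * x <= b) -> wcontC 0 1 (fun x => p (m + k * x)).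
Proof.
  intros Hp H x e Hx He. destruct (Hp (m + k * x) e (H x Hx) He) as (d & D & K).
  assert (A := Rabs_pos k). exists (d / (Rabs k + 1)). split; [apply Rdiv_lt_0_compat; lra|].
  intros y Hy Hd. apply K; auto. replace (m + k * y - (m + k * x)) with (k * (y - x)) by ring. rewrite Rabs_mult.
  apply Rle_lt_trans with ((Rabs k + 1) * Rabs (y - x)); [assert (B := Rabs_pos (y - x)); nra|].
  apply Rlt_le_trans with ((Rabs k + 1) * (d / (Rabs k + 1))); [apply Rmult_lt_compat_l; lra|right; field; lra].
Qed.

Lemma joined_01 (D : C -> Prop) p : wcontC 0 1 p -> (forall x, 0 <= x <= 1 -> D (p x)) -> joined D (p 0) (p 1).
Proof.
  intros Hp H. exists p. split; auto. intros x Hx. split; [|apply H; auto]. revert x Hx. apply wcontC_within; auto.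
Qed.

Lemma joined_intro (D : C -> Prop) p a b : a <= b -> wcontC a b p -> (forall x, a <= x <= b -> D (p x)) -> joined D (p a) (p b).
Proof.
  intros L Hp H. assert (B : forall x, 0 <= x <= 1 -> a <= a + (b - a) * x <= b) by (intros; nra).
  assert (J := joined_01 D (fun x => p (a + (b - a) * x)) (wcontC_affine a b a (b - a) p Hp B) (fun x Hx => H _ (B x Hx))).
  cbv beta in J. replace (a + (b - a) * 0) with a in J by ring. replace (a + (b - a) * 1) with b in J by ring. auto.
Qed.

Lemma joined_sym D z w : joined D z w -> joined D w z.
Proof.
  intros J. destruct (joined_elim _ _ _ J) as (p & P & H & <- & <-).
  assert (B : forall x, 0 <= x <= 1 -> 0 <= 1 + -1 * x <= 1) by (intros; lra).
  assert (K := joined_01 D (fun x => p (1 + -1 * x)) (wcontC_affine 0 1 1 (-1) p P B) (fun x Hx => H _ (B x Hx))).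
  cbv beta in K. replace (1 + -1 * 0) with 1 in K by ring. replace (1 + -1 * 1) with 0 in K by ring. auto.
Qed.

Lemma wcontC_clamp p m : wcontC 0 1 p -> wcontC 0 1 (fun x => p (clamp 0 1 (m + 2 * x))).
Proof.
  intros P x e Hx He. destruct (P (clamp 0 1 (m + 2 * x)) e (clamp_in 0 1 _ lra) He) as (d & D & K).
  exists (d / 2). split; [lra|]. intros y Hy Hd. apply K; [apply clamp_in; lra|].
  eapply Rle_lt_trans; [apply clamp_lip|]. replace (m + 2 * y - (m + 2 * x)) with (2 * (y - x)) by ring.
  rewrite Rabs_mult, (Rabs_pos_eq 2) by lra. lra.
Qed.

Lemma joined_trans D z w v : joined D z w -> joined D w v -> joined D z v.
Proof.
  intros J K. destruct (joined_elim _ _ _ J) as (p & P & HP & <- & <-). destruct (joined_elim _ _ _ K) as (q & Q & HQ & E & <-).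
  assert (C0 : forall x, x <= 0 -> clamp 0 1 x = 0) by (intros x Hx; unfold clamp; rewrite Rmin_right, Rmax_left by lra; auto).
  assert (C1 : forall x, 1 <= x -> clamp 0 1 x = 1) by (intros x Hx; unfold clamp; rewrite Rmin_left, Rmax_right by lra; auto).
  (* The concatenated path as a sum: in each half of the interval one clamped factor is constant, so
     continuity needs no gluing. *)
  set (r := fun x => (p (clamp 0 1 (0 + 2 * x)) + (q (clamp 0 1 (-1 + 2 * x)) + - p 1))%C).
  replace (p 0) with (r 0); [replace (q 1) with (r 1)|].
  - apply joined_01.
    + apply wcontC_plus; [apply wcontC_clamp; auto|]. apply wcontC_plus; [apply wcontC_clamp; auto|apply wcontC_cst].
    + intros x Hx. unfold r. destruct (Rle_lt_dec x (1/2)) as [L|L].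
      * rewrite (C0 (-1 + 2 * x)) by lra. rewrite E, Cplus_opp_r, Cplus_0_r. apply HP. apply clamp_in; lra.
      * rewrite (C1 (0 + 2 * x)) by lra. replace (p 1 + (q (clamp 0 1 (-1 + 2 * x)) + - p 1))%C with (q (clamp 0 1 (-1 + 2 * x))) by ring.
        apply HQ. apply clamp_in; lra.
  - unfold r. rewrite (C1 (0 + 2 * 1)), (C1 (-1 + 2 * 1)) by lra. ring.
  - unfold r. rewrite (C0 (0 + 2 * 0)), (C0 (-1 + 2 * 0)) by lra. rewrite E. ring.
Qed.

(** The supremum of the times before which [K] is avoided belongs to [K], because the complement of
    [K] is open at the points of the path. *)
Lemma first_hit (K : C -> Prop) p : wcontC 0 1 p -> ~ K (p 0) -> K (p 1) ->
  (forall x, 0 <= x <= 1 -> ~ K (p x) -> exists r, 0 < r /\ forall w, <|w - p x|> < r -> ~ K w) ->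
  exists tau, 0 <= tau <= 1 /\ K (p tau) /\ forall x, 0 <= x < tau -> ~ K (p x).
Proof.
  intros P N0 K1 Cl.
  set (E := fun x => 0 <= x <= 1 /\ forall y, 0 <= y <= x -> ~ K (p y)).
  assert (E0 : E 0). { split; [lra|]. intros y Hy. replace y with 0 by lra. auto. }
  destruct (completeness E) as (tau & UB & LB).
  { exists 1. intros x (Hx & _). lra. } { exists 0; auto. }
  assert (T1 : 0 <= tau <= 1). { split; [apply UB; auto|]. apply LB. intros x (Hx & _). lra. }
  assert (Bel : forall x, 0 <= x < tau -> ~ K (p x)).
  { intros x Hx Kx. assert (tau <= x); [|lra]. apply LB. intros e (He & Hy). apply Rnot_lt_le. intros L. apply (Hy x); auto; lra. }
  exists tau. split; auto. split; auto. apply NNPP. intros NK.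
  destruct (Cl tau T1 NK) as (r & R0 & Hr). destruct (P tau r T1 R0) as (d & D & Hd).
  assert (tau < 1). { destruct (Req_dec tau 1) as [Q|Q]; [rewrite Q in NK; contradiction|lra]. }
  set (x := Rmin 1 (tau + d / 2)). assert (X1 : x <= 1) by apply Rmin_l. assert (X2 : x <= tau + d / 2) by apply Rmin_r.
  assert (X3 : tau < x) by (apply Rmin_glb_lt; lra).
  assert (x <= tau); [|lra]. apply UB. split; [lra|]. intros y Hy. destruct (Rle_lt_dec tau y) as [L|L]; [|apply Bel; lra].
  apply Hr, Hd; [lra|]. rewrite Rabs_pos_eq; lra.
Qed.

Section PrimeEnds.
Context {D : C -> Prop} (Hop : copen D) (Hconn : forall z w, D z -> D w -> joined D z w).

(** The closed arc is compact, and its end points are boundary points of the open set [D], so they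
    differ from [z]. *)
Lemma arc_closed c z : crosscut D c -> D z -> ~ arc c z -> exists r, 0 < r /\ forall w, <|w - z|> < r -> ~ arc c w.
Proof.
  intros (C1 & _ & _ & B0 & B1) Hz NA. apply wcontC_within in C1.
  assert (NB : forall ze, boundary D ze -> ze <> z).
  { intros ze B ->. destruct (Hop z Hz) as (d & D0 & Hd). destruct (B d D0) as (_ & w & Nw & Hw). apply Nw, Hd; auto. }
  destruct (wcont_min 0 1 (fun x => <|c x - z|>)) as (m & M0 & HM); [lra| | |].
  - apply (wcont_C2 0 1 (fun w => <|w - z|>)); auto. intros x _.
    apply (rcont_Cmod (fun w => w - z)%C), ccont_plus; [apply ccont_id|apply ccont_const].
  - intros x Hx. apply Cmod_gt_0. intros E. apply Csub0 in E.
    destruct (Req_dec x 0) as [->|X0]; [apply (NB _ B0 E)|]. destruct (Req_dec x 1) as [->|X1]; [apply (NB _ B1 E)|].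
    apply NA. exists x. split; [lra|auto].
  - exists m. split; auto. intros w Hw (x & Hx & ->). specialize (HM x lra). lra.
Qed.

Lemma arc_joined c (P : C -> Prop) z w : crosscut D c -> (forall y, arc c y -> P y) -> arc c z -> arc c w -> joined P z w.
Proof.
  intros (C1 & _) HP (x & Hx & ->) (y & Hy & ->). apply wcontC_within in C1.
  assert (K : forall x y, 0 < x < 1 -> 0 < y < 1 -> x <= y -> joined P (c x) (c y)).
  { intros x' y' Hx' Hy' L. apply joined_intro; auto; [apply (wcontC_sub 0 1); auto; lra|]. intros v Hv. apply HP. exists v. split; auto; lra. }
  destruct (Rle_lt_dec x y) as [L|L]; [apply K; auto|apply joined_sym, K; auto; lra].
Qed.

Lemma arc_mid c : arc c (c (1/2)).
Proof. exists (1/2). split; [lra|auto]. Qed.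

Lemma arc_in_nbhd c n z : null_chain D c -> (1 <= n)%nat -> arc (c (S n)) z -> chain_nbhd D c n z.
Proof.
  intros (_ & _ & Sep & _) Hn Hz. destruct (Sep n Hn (c 0%nat (1/2)) z (arc_mid _) Hz) as (_ & Cz & _).
  split; auto. intros w Hw J. destruct (Sep n Hn w z Hw Hz) as (_ & _ & NJ). apply NJ, joined_sym; auto.
Qed.

(** Every point of the crosscut [c n] can be joined to the initial crosscut without meeting
    [c (S n)]: follow a path from the initial crosscut until it first hits [c n], then run along
    [c n]. Before the hit it cannot meet [c (S n)], which lies on the other side of [c n]. A point
    cut off by [c (S n)] is hence also cut off by [c n]. *)
Lemma nbhd_nested c n z : null_chain D c -> (1 <= n)%nat -> chain_nbhd D c (S n) z -> chain_nbhd D c n z.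
Proof.
  intros (Cr & Dis & Sep & _) Hn ((Dz & Nz) & NJ).
  assert (Sep' := Sep n Hn).
  assert (AD : forall y, arc (c n) y -> cut D (c (S n)) y).
  { intros y Hy.  destruct Hy as (x & Hx & ->). split; [apply (Cr n); auto|].
    intros (x' & Hx' & E). apply (Dis n (c n x)). split; [exists x|exists x']; split; auto; unfold Icc; lra. }
  assert (Q1 : forall y, arc (c n) y -> exists w, arc (c 0%nat) w /\ joined (cut D (c (S n))) y w).
  { intros y Hy. set (w := c 0%nat (1/2)). destruct (Sep' w _ (arc_mid _) (arc_mid _)) as ((Dw & Nw) & _).
    exists w. split; [apply arc_mid|]. apply joined_sym.
    destruct (joined_elim _ _ _ (Hconn w y Dw (proj1 (AD y Hy)))) as (p & P & HP & P0 & P1).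
    destruct (first_hit (arc (c n)) p P) as (tau & Ht & Kt & HB); [rewrite P0; auto|rewrite P1; auto| |].
    { intros x Hx NA. apply arc_closed; auto. }
    apply joined_trans with (p tau); [|apply (arc_joined (c n)); auto].
    rewrite <- P0. apply joined_intro; [lra|apply (wcontC_sub 0 1); auto; lra|]. intros x Hx.
    destruct (Req_dec x tau) as [->|NE]; [apply AD; auto|]. split; [apply HP; lra|]. intros Ax.
    destruct (Sep' w (p x) (arc_mid _) Ax) as (_ & _ & NJ'). apply NJ'. rewrite <- P0.
    apply joined_intro; [lra|apply (wcontC_sub 0 1); auto; lra|]. intros v Hv. split; [apply HP; lra|apply HB; lra]. }
  split.
  - split; auto. intros Hz. destruct (Q1 z Hz) as (w & Hw & J). apply (NJ w Hw J).
  - intros w Hw J. apply (NJ w Hw). destruct (joined_elim _ _ _ J) as (p & P & HP & <- & <-).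
    apply joined_01; auto. intros x Hx. split; [apply HP; auto|]. intros Ax.
    destruct (Sep' (p 1) (p x) Hw Ax) as (_ & _ & NJ'). apply NJ', joined_sym.
    apply joined_intro; [lra|apply (wcontC_sub 0 1); auto; lra|]. intros v Hv. apply HP; lra.
Qed.

Lemma nbhd_mono c n m z : null_chain D c -> (1 <= n)%nat -> (n <= m)%nat -> chain_nbhd D c m z -> chain_nbhd D c n z.
Proof. intros N Hn L. induction L as [|m L IH]; auto. intros H. apply IH, nbhd_nested; auto. lia. Qed.

Lemma pe_mono c (P Q : C -> Prop) : (forall z, P z -> Q z) -> prime_end D c P -> prime_end D c Q.
Proof. intros H (n & Hn & K). exists n. auto. Qed.

Lemma pe_and c (P Q : C -> Prop) : null_chain D c -> prime_end D c P -> prime_end D c Q -> prime_end D c (fun z => P z /\ Q z).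
Proof.
  intros N (n & Hn & K) (m & Hm & L). exists (max n m). split; [lia|]. intros z Hz.
  split; [apply K|apply L]; apply (nbhd_mono c _ (max n m)); auto; lia.
Qed.

Lemma pe_dom c : null_chain D c -> prime_end D c D.
Proof. intros N. exists 1%nat. split; auto. intros z ((H & _) & _). auto. Qed.

Lemma pe_proper c (P : C -> Prop) : null_chain D c -> prime_end D c P -> exists z, D z /\ P z.
Proof.
  intros N (n & Hn & K). assert (H := arc_in_nbhd c n _ N Hn (arc_mid _)). exists (c (S n) (1/2)). split; auto. apply H.
Qed.

Lemma pe_at c ze eps : prime_end_at D c ze -> 0 < eps -> prime_end D c (fun z => <|z - ze|> < eps).
Proof. intros H He. apply (filterlim_Cmod _ _ _ H eps He). Qed.

Lemma pe_lim_unique c (g : C -> C) l m : null_chain D c -> filterlim g (prime_end D c) (locally l) -> filterlim g (prime_end D c) (locally m) -> l = m.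
Proof.
  intros N H1 H2. apply NNPP. intros NE. assert (P : 0 < <|l - m|>) by (apply Cmod_gt_0; intros E; apply NE, Csub0; auto).
  destruct (pe_proper c _ N (pe_and c _ _ N (filterlim_Cmod _ _ _ H1 (<|l - m|> / 2) lra) (filterlim_Cmod _ _ _ H2 (<|l - m|> / 2) lra)))
    as (z & _ & A & B).
   assert (T3 := Cmod_tri3 l (g z) m). rewrite (Cmod_sub_sym l (g z)) in T3. lra.
Qed.

(** The end points of far crosscuts lie on the boundary of [D] and come arbitrarily close to [ze],
    which is impossible around an interior point. *)
Lemma pe_boundary c ze : null_chain D c -> prime_end_at D c ze -> ~ D ze.
Proof.
  intros N H Dz. destruct (Hop ze Dz) as (d & D0 & Hd).
  destruct (pe_at c ze (d / 2) H lra) as (n & Hn & K).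
  destruct (proj1 N (S n)) as (C1 & _ & _ & B0 & _). apply wcontC_within in C1.
  assert (NB : ~ D (c (S n) 0)).
  { intros D1. destruct (Hop _ D1) as (d1 & D2 & Hd1). destruct (B0 d1 D2) as (_ & w & Nw & Hw). apply Nw, Hd1; auto. }
  apply NB, Hd. destruct (C1 0 (d / 2) lra lra) as (e & E0 & He).
  set (x := Rmin e 1 / 2). assert (M1 := Rmin_l e 1). assert (M2 := Rmin_r e 1). assert (M3 : 0 < Rmin e 1) by (apply Rmin_pos; lra).
  assert (Hx : 0 < x < 1 /\ x < e) by (unfold x; lra).
  assert (A := He x lra ltac:(rewrite Rabs_pos_eq; lra)).
  assert (B := K _ (arc_in_nbhd c n (c (S n) x) N Hn (ex_intro _ x (conj (proj1 Hx) eq_refl)))).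
  assert (T3 := Cmod_tri3 (c (S n) 0) (c (S n) x) ze). rewrite (Cmod_sub_sym (c (S n) 0) (c (S n) x)) in T3. lra.
Qed.

End PrimeEnds.

(** [W] parametrizes a neighbourhood of the boundary point [W A 0], with the domain above the zero line. *)
Section Chart.
Context {D : C -> Prop} (Hop : copen D) (Hconn : forall z w, D z -> D w -> joined D z w).
Context {a b : C -> R} {W : R -> R -> C} {A d : R} (Hd : 0 < d <= 1).
Context (rca : forall z, rcont a z) (rcb : forall z, rcont b z).
Context (cW : forall x y eps, 0 < eps -> exists e, 0 < e /\ forall x' y', Rabs (x' - x) < e -> Rabs (y' - y) < e -> <|W x' y' - W x y|> < eps).
Context (aW : forall x y, a (W x y) = x) (bW : forall x y, b (W x y) = y) (Wab : forall z, W (a z) (b z) = z).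
Context (HD : forall x y, Rabs (x - A) < d -> 0 < y < d -> D (W x y)) (HN : forall x, Rabs (x - A) < d -> ~ D (W x 0)).

Definition rho (n : nat) : R := d / (2 * (INR n + 1)).
(** In the coordinates [(a, b)] the crosscut is the arc of the parabola [b + (a - A)^2 = rho n ^ 2]
    above the zero line. A parabola keeps the parametrization polynomial and the level function
    [lev] simple. *)
Definition bump (n : nat) (x : R) : C := W (A + rho n * (2 * x - 1)) (4 * (rho n * rho n) * (x * (1 - x))).
Definition lev (z : C) : R := b z + (a z - A) * (a z - A).
(** Positive exactly between the zero line and the parabola. Within [D] it vanishes only on the
    crosscut, so its sign is constant along paths in the cut domain; the minimum with [b] handles
    parts of [D] beyond the zero line, such as the other side of a slit. *)
Definition gap (n : nat) (z : C) : R := Rmin (b z) (rho n * rho n - lev z).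

Lemma rho_pos n : 0 < rho n <= d / 2 /\ rho n * rho n < d.
Proof.
  assert (P := pos_INR n). assert (0 < rho n) by (apply Rdiv_lt_0_compat; lra).
  assert (rho n <= d / 2).
  {  apply Rmult_le_compat_l; [lra|]. apply Rinv_le_contravar; lra. }
  split; [auto|]. nra.
Qed.

Lemma rho_decr n m : (n < m)%nat -> rho m < rho n.
Proof.
  intros L. apply lt_INR in L. assert (P := pos_INR n).  apply Rmult_lt_compat_l; [lra|]. apply Rinv_lt_contravar; nra.
Qed.

Lemma bump_coords n x : a (bump n x) = A + rho n * (2 * x - 1) /\ b (bump n x) = 4 * (rho n * rho n) * (x * (1 - x)) /\ lev (bump n x) = rho n * rho n.
Proof. unfold lev, bump. rewrite aW, bW. repeat split; auto. ring. Qed.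

Lemma bump_a n x : 0 <= x <= 1 -> Rabs (A + rho n * (2 * x - 1) - A) < d.
Proof. intros Hx. destruct (rho_pos n) as ((R0 & R1) & _). replace (A + rho n * (2 * x - 1) - A) with (rho n * (2 * x - 1)) by ring.
  assert (0 <= rho n * x) by nra. assert (0 <= rho n * (1 - x)) by nra. apply Rabs_def1; lra. Qed.

Lemma bump_arc n z : arc (bump n) z <-> 0 < b z /\ lev z = rho n * rho n.
Proof.
  destruct (rho_pos n) as ((R0 & _) & _). split.
  - intros (x & Hx & ->). destruct (bump_coords n x) as (_ & -> & ->). split; auto. apply Rmult_lt_0_compat; nra.
  - intros (B & L). unfold lev in L. set (u := (a z - A) / rho n).
    assert (U : a z - A = rho n * u) by (unfold u; field; lra).
    assert (U2 : b z = rho n * rho n * (1 - u * u)). { rewrite U in L. nra. }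
    assert (0 < 1 - u * u). { apply Rmult_lt_reg_l with (rho n * rho n); nra. }
    exists ((u + 1) / 2). split; [split; nra|]. rewrite <- (Wab z) at 1. unfold bump. f_equal; [lra|]. rewrite U2. field.
Qed.

Lemma D_b_neq z : D z -> Rabs (a z - A) < d -> b z <> 0.
Proof. intros Dz Ha E. apply (HN (a z) Ha). rewrite <- E, Wab. auto. Qed.

Lemma abs_sqr_lt (x e : R) : 0 < e -> x * x < e * e -> Rabs x < e.
Proof. intros He H. apply Rabs_def1; nra. Qed.

Lemma gap_zero n z : D z -> gap n z = 0 -> arc (bump n) z.
Proof.
  intros Dz G. destruct (rho_pos n) as ((R0 & R1) & _). apply bump_arc.
  assert (G1 := Rmin_l (b z) (rho n * rho n - lev z)). assert (G2 := Rmin_r (b z) (rho n * rho n - lev z)). fold (gap n z) in G1, G2. rewrite G in G1, G2.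
  assert (Na : Rabs (a z - A) < d). { apply abs_sqr_lt; [lra|]. unfold lev in G2. nra. }
  assert (Nb := D_b_neq z Dz Na). split; [lra|].
  unfold gap, Rmin in G. destruct Rle_dec in G; lra.
Qed.

Lemma rcont_lev z : rcont lev z.
Proof.
  apply rcont_plus; auto. assert (K : rcont (fun w => a w - A) z) by (apply rcont_plus; [auto|apply rcont_const]). apply rcont_mult; auto.
Qed.

Lemma rcont_gap n z : rcont (gap n) z.
Proof.
  intros e He. destruct (rcb z e He) as (d1 & D1 & K1). destruct (rcont_lev z e He) as (d2 & D2 & K2).
  exists (Rmin d1 d2). split; [apply Rmin_pos; auto|]. intros w Hw.
  specialize (K1 w (Rminl Hw)). specialize (K2 w (Rminr Hw)).
  apply Rabs_def2 in K1, K2. unfold gap, Rmin. repeat destruct Rle_dec; apply Rabs_def1; lra.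
Qed.

Lemma gap_joined n z w : joined (cut D (bump n)) z w -> 0 < gap n z * gap n w.
Proof.
  intros J. destruct (joined_elim _ _ _ J) as (p & P & HP & <- & <-).
  assert (NZ : forall x, 0 <= x <= 1 -> gap n (p x) <> 0).
  { intros x Hx E. destruct (HP x Hx) as (Dx & Nx). apply Nx, gap_zero; auto. }
  apply (sign_const (fun x => gap n (p 0) * gap n (p x)) 0 1); [| |lra| |lra].
  - apply (wcont_mult 0 1 (fun _ => gap n (p 0))); [apply wcont_cst|]. apply (wcont_C2 0 1); auto. intros; apply rcont_gap.
  - intros x Hx. apply Rmult_integral_contrapositive. split; apply NZ; auto; lra.
  - exists 0. split; [lra|]. apply (Rsqr_pos_lt (gap n (p 0))). apply NZ; lra.
Qed.

Lemma gap_pos n z : 0 < gap n z <-> 0 < b z /\ lev z < rho n * rho n.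
Proof.
  unfold gap. split; [|intros (H1 & H2); apply Rmin_pos; lra].
  intros H. assert (G1 := Rmin_l (b z) (rho n * rho n - lev z)). assert (G2 := Rmin_r (b z) (rho n * rho n - lev z)). lra.
Qed.

Lemma gap_neg n z : lev z > rho n * rho n -> gap n z < 0.
Proof. intros H. eapply Rle_lt_trans; [apply Rmin_r|lra]. Qed.

(** A point outside the [n]-th parabola reaches the initial crosscut without crossing the [n]-th
    one: straight up in the coordinate [b] if it lies under the initial parabola, otherwise along
    any path up to its first contact with that parabola. A point inside cannot, since [gap] would
    change sign. *)
Lemma gap_nbhd n z : (1 <= n)%nat -> D z -> chain_nbhd D bump n z <-> 0 < gap n z.
Proof.
  intros Hn Dz. assert (RD := rho_decr 0 n lia). destruct (rho_pos n) as ((R0 & _) & _). split.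
  - intros ((_ & Nz) & NJ). apply Rnot_le_lt. intros G.
    assert (GZ : gap n z <> 0) by (intros E; apply Nz, gap_zero; auto).
    destruct (Rle_lt_dec 0 (gap 0 z)) as [L|L].
    + assert (G1 := Rmin_l (b z) (rho 0 * rho 0 - lev z)). assert (G2 := Rmin_r (b z) (rho 0 * rho 0 - lev z)). fold (gap 0 z) in G1, G2.
      destruct (rho_pos 0) as ((R2 & R3) & R4).
      assert (Na : Rabs (a z - A) < d). { apply abs_sqr_lt; [lra|]. unfold lev in G2. nra. }
      assert (Nb := D_b_neq z Dz Na).
      assert (Lz : rho n * rho n < lev z). { apply Rnot_le_lt. intros K. assert (0 <= gap n z) by (unfold gap; apply Rmin_glb; lra). lra. }
      set (y1 := rho 0 * rho 0 - (a z - A) * (a z - A)). assert (Y : b z <= y1) by (unfold y1, lev in *; lra).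
      apply (NJ (W (a z) y1)).
      * apply bump_arc. unfold lev. rewrite aW, bW. split; [lra|]. unfold y1. ring.
      * rewrite <- (Wab z) at 1. apply (joined_intro _ (W (a z)) (b z) y1); auto.
        -- intros y e _ He. destruct (cW (a z) y e He) as (d1 & D1 & K). exists d1. split; auto. intros y' _ Hy'. apply K; auto.
           rewrite Rminus_diag, Rabs_R0. auto.
        -- intros y Hy. split; [apply HD; auto; assert (B0 : 0 < b z) by lra; assert (0 <= (a z - A) * (a z - A)) by apply Rle_0_sqr; unfold y1 in *; lra|]. intros Ay. apply bump_arc in Ay. unfold lev in *. rewrite aW, bW in Ay. lra.
    + assert (D0 : D (bump 0 (1/2))).
      { destruct (rho_pos 0) as ((R2 & R3) & R4). apply HD; [apply bump_a; lra|nra]. }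
      destruct (joined_elim _ _ _ (Hconn z _ Dz D0)) as (p & P & HP & P0 & P1).
      assert (A0 : forall x, 0 <= x <= 1 -> gap 0 (p x) <= 0 -> cut D (bump n) (p x)).
      { intros x Hx Gx. split; [apply HP; auto|]. intros Ax. apply bump_arc in Ax. assert (0 < gap 0 (p x)) by (apply gap_pos; split; [lra|nra]). lra. }
      destruct (first_hit (fun w => 0 <= gap 0 w) p P) as (tau & Ht & Kt & HB).
      * rewrite P0. lra.
      * rewrite P1. unfold gap. destruct (bump_coords 0 (1/2)) as (_ & -> & ->). apply Rmin_glb; [|lra]. destruct (rho_pos 0). nra.
      * intros x Hx Nx. destruct (rcont_gap 0 (p x) (- gap 0 (p x)) lra) as (r & R4 & K). exists r. split; auto.
        intros w Hw. specialize (K w Hw). apply Rabs_def2 in K. lra.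
      * assert (E : gap 0 (p tau) = 0).
        { destruct Kt as [Kt|Kt]; auto. exfalso. destruct (rcont_gap 0 (p tau) _ Kt) as (r & R4 & K).
          destruct (P tau r Ht R4) as (e & E0 & He).
          assert (TP : 0 < tau). { destruct (Req_dec tau 0) as [Q|Q]; [rewrite Q, P0 in Kt; lra|lra]. }
          set (x := Rmax 0 (tau - e / 2)). assert (X1 : 0 <= x) by apply Rmax_l. assert (X2 : tau - e / 2 <= x) by apply Rmax_r.
          assert (X3 : x < tau) by (apply Rmax_lub_lt; lra).
          specialize (K _ (He x lra ltac:(apply Rabs_def1; lra))). apply Rabs_def2 in K. apply (HB x); lra. }
        apply (NJ (p tau)); [apply gap_zero; auto|]. rewrite <- P0.
        apply joined_intro; [lra|apply (wcontC_sub 0 1); auto; lra|]. intros x Hx. apply A0; [lra|].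
        destruct (Rle_lt_or_eq_dec x tau lra) as [L2| ->]; [|lra]. apply Rlt_le, Rnot_le_lt, HB. lra.
  - intros G. apply gap_pos in G as G'. split.
    + split; auto. intros Az. apply bump_arc in Az. lra.
    + intros w Hw J. apply bump_arc in Hw. apply gap_joined in J. assert (N := gap_neg n w ltac:(nra)). nra.
Qed.

Lemma bump_small eps : 0 < eps -> exists N, (1 <= N)%nat /\ forall n, (N <= n)%nat -> forall z, 0 <= b z -> lev z <= rho n * rho n -> <|z - W A 0|> < eps.
Proof.
  intros He. destruct (cW A 0 eps He) as (e & E0 & K).
  destruct (inv_small e E0) as (N & HI). exists (S N). split; [lia|]. intros n Hn z Bz Lz.
  destruct (rho_pos n) as ((R0 & R1) & R2).
  assert (R3 : rho n < e).
  { eapply Rle_lt_trans; [|apply (HI n); lia]. unfold rho. assert (P := pos_INR n). unfold Rdiv. rewrite Rinv_mult.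
    assert (0 < / (INR n + 1)) by (apply Rinv_0_lt_compat; lra). nra. }
  unfold lev in Lz. rewrite <- (Wab z). apply K.
  - apply abs_sqr_lt; auto. nra.
  - assert (Q := Rle_0_sqr (a z - A)). unfold Rsqr in Q. rewrite Rminus_0_r, Rabs_pos_eq by lra.
    assert (rho n * rho n <= rho n * 1) by (apply Rmult_le_compat_l; lra). lra.
Qed.

Lemma bump_chain : null_chain D bump /\ prime_end_at D bump (W A 0).
Proof.
  assert (Bd : forall x, Rabs (x - A) < d -> boundary D (W x 0)).
  { intros x Hx e He. split.
    - destruct (cW x 0 e He) as (e1 & E1 & K). set (y := Rmin e1 d / 2). assert (M1 := Rmin_l e1 d). assert (M2 := Rmin_r e1 d).
      assert (M3 : 0 < Rmin e1 d) by (apply Rmin_pos; lra).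
      exists (W x y). split; [apply HD; auto; unfold y; lra|]. apply K; [rewrite Rminus_diag, Rabs_R0; auto|]. rewrite Rminus_0_r, Rabs_pos_eq; unfold y; lra.
    - exists (W x 0). split; [apply HN; auto|]. rewrite Cmod_sub_0. auto. }
  assert (CL : forall n z, closed_arc (bump n) z -> 0 <= b z /\ lev z = rho n * rho n).
  { intros n z (x & (X1 & X2) & ->). destruct (bump_coords n x) as (_ & -> & ->). split; auto. destruct (rho_pos n) as ((R0 & _) & _).
    assert (U := Rle_0_sqr (rho n)). unfold Rsqr in U. apply Rmult_le_pos; [lra|]. apply Rmult_le_pos; lra. }
  assert (AD : forall n z, arc (bump n) z -> D z).
  { intros n z (x & Hx & ->). destruct (rho_pos n) as ((R0 & R1) & R2). apply HD; [apply bump_a; lra|]. split; [apply Rmult_lt_0_compat; nra|].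
    assert (Q := Rle_0_sqr (x - / 2)). unfold Rsqr in Q. assert (0 < rho n * rho n) by nra.
    assert (rho n * rho n * (x * (1 - x)) <= rho n * rho n * / 4) by (apply Rmult_le_compat_l; lra). lra. }
  split; [split; [|split; [|split]]|].
  - intros n. destruct (rho_pos n) as ((R0 & R1) & R2). split; [|split; [|split; [|split]]].
    + apply wcontC_within. intros x e Hx He.
      destruct (cW (A + rho n * (2 * x - 1)) (4 * (rho n * rho n) * (x * (1 - x))) e He) as (e1 & E1 & K).
      exists e1. split; auto. intros y Hy Hd1. assert (U := Rabs_pos (y - x)).
      assert (M : forall k, Rabs k <= 1 -> Rabs (k * (y - x)) < e1) by (intros k Hk; rewrite Rabs_mult; nra).
      assert (R3 : 0 < rho n * rho n <= / 4) by nra. apply K.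
      * replace (A + rho n * (2 * y - 1) - (A + rho n * (2 * x - 1))) with (2 * rho n * (y - x)) by ring. apply M. rewrite Rabs_pos_eq; lra.
      * replace (4 * (rho n * rho n) * (y * (1 - y)) - 4 * (rho n * rho n) * (x * (1 - x))) with (4 * (rho n * rho n) * (1 - x - y) * (y - x)) by ring.
        apply M. rewrite Rabs_mult, Rabs_pos_eq by lra. assert (Rabs (1 - x - y) <= 1) by (apply Rabs_le; lra).
         nra.
    + intros x Hx. apply (AD n). exists x; auto.
    + intros x y _ _ E. apply (f_equal a) in E. rewrite !(proj1 (bump_coords n _)) in E. nra.
    + replace (bump n 0) with (W (A + rho n * (2 * 0 - 1)) 0) by (unfold bump; f_equal; ring). apply Bd, bump_a. lra.
    + replace (bump n 1) with (W (A + rho n * (2 * 1 - 1)) 0) by (unfold bump; f_equal; ring). apply Bd, bump_a. lra.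
  - intros n z (H1 & H2). apply CL in H1, H2. assert (R1 := rho_decr n (S n) lia). destruct (rho_pos (S n)). nra.
  - intros n Hn z w Hz Hw. assert (R1 := rho_decr n (S n) lia). assert (R2 := rho_decr 0 n lia).
    destruct (rho_pos (S n)) as ((R3 & _) & _).
    assert (Dz := AD _ _ Hz). assert (Dw := AD _ _ Hw). apply bump_arc in Hz, Hw.
    split; [|split]; [split; auto; intros K; apply bump_arc in K; nra|split; auto; intros K; apply bump_arc in K; nra|].
    intros J. apply gap_joined in J. assert (N := gap_neg n z ltac:(nra)). assert (P := proj2 (gap_pos n w) ltac:(split; [lra|nra])). nra.
  - intros e He. destruct (bump_small (e / 2) lra) as (N & _ & K). exists N. intros n Hn z w Hz Hw.
    apply bump_arc in Hz, Hw. assert (K1 := K n Hn z lra lra). assert (K2 := K n Hn w lra lra).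
    assert (T3 := Cmod_tri3 z (W A 0) w). rewrite (Cmod_sub_sym (W A 0) w) in T3. lra.
  - apply Cmod_filterlim; [intros P Q H; apply pe_mono; auto|]. intros e He.
    destruct (bump_small e He) as (N & N1 & K). exists N. split; auto. intros z Hz.
    assert (Dz := proj1 (proj1 Hz)). apply gap_nbhd in Hz; auto. apply gap_pos in Hz. apply (K N); auto; lra.
Qed.

(** The neighbourhoods of this chain contain full one-sided neighbourhoods of the boundary point, so
    a limit along the prime end becomes a limit in the ordinary sense. *)
Lemma bump_eventually (P : C -> Prop) : prime_end D bump P -> exists r, 0 < r /\ forall z, D z -> 0 < b z -> <|z - W A 0|> < r -> P z.
Proof.
  intros (n & Hn & K). destruct (rho_pos n) as ((R0 & _) & _).
  destruct (rcont_lev (W A 0) (rho n * rho n) ltac:(nra)) as (r & R1 & H). exists r. split; auto. intros z Dz Bz Hz.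
  apply K, gap_nbhd; auto. apply gap_pos. split; auto. specialize (H z Hz). unfold lev at 2 in H. rewrite aW, bW in H. apply Rabs_def2 in H. lra.
Qed.

End Chart.

(** * Passage between complex differentiability, [harmonic_on] and [harm] *)

Lemma copen_locally_2d D z (P : C -> Prop) : copen D -> D z -> (forall w, D w -> P w) -> locally_2d (fun x y => P (x, y)) (Re z) (Im z).
Proof.
  intros Hop Dz H. destruct (Hop z Dz) as (d & D0 & K).
  exists (mkposreal (d / 2) lra). simpl. intros x y Hx Hy. apply H, K.
  eapply Rle_lt_trans; [apply Cmod_le_sum|]. rewrite re_minus, im_minus.  simpl. lra.
Qed.

Lemma rcont_2d u z : rcont u z -> continuity_2d_pt (fun x y => u (x, y)) (Re z) (Im z).
Proof.
  intros H e. destruct (H e (cond_pos e)) as (d & D & K). exists (mkposreal (d / 2) lra). simpl. intros x y Hx Hy.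
  change (Rabs (u (x, y) - u (Re z, Im z)) < e). replace (Re z, Im z) with z by (destruct z; auto). apply K. eapply Rle_lt_trans; [apply Cmod_le_sum|].
  rewrite re_minus, im_minus.  simpl. lra.
Qed.

Section Harmonic.
Context {D : C -> Prop} (Hop : copen D).

Lemma holo_partials g c z l : cderiv g z l ->
  is_derive (fun x => Re (c * g (x, Im z))%C) (Re z) (Re (c * l)%C) /\ is_derive (fun y => Re (c * g (Re z, y))%C) (Im z) (Re (c * Ci * l)%C).
Proof.
  intros H. assert (K : cderiv (fun w => c * g w)%C z (c * l)%C).
  { apply (cderiv_eq _ _ (0 * g z + c * l)%C); [ring|]. apply cderiv_mult; auto. apply cderiv_const. }
  destruct z as (x, y). split; [apply (cderiv_re_x (fun w => c * g w)%C); auto|].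
  replace (Re (c * Ci * l)%C) with (- Im (c * l)%C) by (destruct c, l; unfold Re, Im; simpl; ring).
  apply (cderiv_re_y (fun w => c * g w)%C); auto.
Qed.

(** The factor [c] makes the induction cover both partial derivatives: the derivative in [x] keeps
    [c], the one in [y] replaces it by [c * Ci]. *)
Lemma holo_ex_diff n g c z : holo n D g -> D z -> ex_diff_n (fun x y => Re (c * g (x, y))%C) n (Re z) (Im z).
Proof.
  revert g c z. induction n as [|n IH]; intros g c z Hg Dz.
  - split; auto. apply (rcont_2d (fun w => Re (c * g w)%C)), (rcont_Re (fun w => c * g w)%C), ccont_mult; [apply ccont_const|apply Hg; auto].
  - assert (H0 := holo_cont _ _ _ _ Hg Dz). destruct Hg as (g' & H1 & H2). split; [|split; [|split; [|split]]].
    + apply (rcont_2d (fun w => Re (c * g w)%C)), (rcont_Re (fun w => c * g w)%C), ccont_mult; [apply ccont_const|auto].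
    + eexists. apply (holo_partials g c z _ (H1 z Dz)).
    + eexists. apply (holo_partials g c z _ (H1 z Dz)).
    + apply (ex_diff_n_ext_loc (fun x y => Re (c * g' (x, y))%C)); [|apply IH; auto].
      apply (copen_locally_2d D z (fun w => Re (c * g' w)%C = Derive (fun x => Re (c * g (x, Im w))%C) (Re w))); auto.
      intros w Dw. symmetry. apply is_derive_unique, (holo_partials g c w _ (H1 w Dw)).
    + apply (ex_diff_n_ext_loc (fun x y => Re (c * Ci * g' (x, y))%C)); [|apply IH; auto].
      apply (copen_locally_2d D z (fun w => Re (c * Ci * g' w)%C = Derive (fun y => Re (c * g (Re w, y))%C) (Im w))); auto.
      intros w Dw. symmetry. apply is_derive_unique, (holo_partials g c w _ (H1 w Dw)).
Qed.

Lemma copen_line_x z (P : C -> Prop) : D z -> (forall w, D w -> P w) -> locally (Re z) (fun x => P (x, Im z)).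
Proof.
  intros Dz H. destruct (copen_locally_2d D z P Hop Dz H) as (d & K). exists d. intros x Hx. apply K; [exact Hx|].
  rewrite Rminus_diag, Rabs_R0. apply cond_pos.
Qed.

Lemma copen_line_y z (P : C -> Prop) : D z -> (forall w, D w -> P w) -> locally (Im z) (fun y => P (Re z, y)).
Proof.
  intros Dz H. destruct (copen_locally_2d D z P Hop Dz H) as (d & K). exists d. intros y Hy. apply K; [|exact Hy].
  rewrite Rminus_diag, Rabs_R0. apply cond_pos.
Qed.

Lemma holo_harmonic g c : holo 2 D g -> harmonic_on D (fun z => Re (c * g z)%C).
Proof.
  intros Hg z Dz. split; [apply holo_ex_diff; auto|]. destruct Hg as (g1 & H1 & g2 & H2 & _).
   cbn [Derive_n].
  transitivity (Re (c * g2 z)%C + Re (c * Ci * Ci * g2 z)%C); [|destruct c, (g2 z); unfold Re, Im; simpl; ring].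
  apply (f_equal2 Rplus).
  - transitivity (Derive (fun x => Re (c * g1 (x, Im z))%C) (Re z)); [|apply is_derive_unique, (holo_partials g1 c z _ (H2 z Dz))].
    apply Derive_ext_loc.
    apply (copen_line_x z (fun w => Derive (fun x => Re (c * g (x, Im w))%C) (Re w) = Re (c * g1 w)%C)); auto.
    intros w Dw. apply is_derive_unique, (holo_partials g c w _ (H1 w Dw)).
  - transitivity (Derive (fun y => Re (c * Ci * g1 (Re z, y))%C) (Im z)); [|apply is_derive_unique, (holo_partials g1 (c * Ci)%C z _ (H2 z Dz))].
    apply Derive_ext_loc.
    apply (copen_line_y z (fun w => Derive (fun y => Re (c * g (Re w, y))%C) (Im w) = Re (c * Ci * g1 w)%C)); auto.
    intros w Dw. apply is_derive_unique, (holo_partials g c w _ (H1 w Dw)).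
Qed.

Lemma locally_R x (P : R -> Prop) : locally x P -> exists d, 0 < d /\ forall y, Rabs (y - x) < d -> P y.
Proof. intros (d & K). exists d. split; [apply cond_pos|exact K]. Qed.

Lemma harmonic_harm u : harmonic_on D u -> harm D u.
Proof.
  intros H z Dz. destruct (H z Dz) as (E & L). destruct E as (E0 & _ & _ & (_ & E1 & _) & (_ & _ & E2 & _)). split.
  - intros e He. destruct (E0 (mkposreal e He)) as (d & K). exists d. split; [apply cond_pos|]. intros w Hw.
    rewrite (surjective_pairing w), (surjective_pairing z). apply (K (fst w) (snd w)).
    + eapply Rle_lt_trans; [|exact Hw]. eapply Rle_trans; [|apply re_le_Cmod]. rewrite re_minus. right; reflexivity.
    + eapply Rle_lt_trans; [|exact Hw]. eapply Rle_trans; [|apply im_le_Cmod]. rewrite im_minus. right; reflexivity.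
  - set (A := Derive (Derive (fun x => u (x, Im z))) (Re z)). set (B := Derive (Derive (fun y => u (Re z, y))) (Im z)).
    change (A + B = 0) in L. exists A. split.
    + exists (Derive (fun x => u (x, Im z))). split; [|apply Derive_correct; exact E1].
      apply locally_R, (copen_line_x z (fun w => is_derive (fun x => u (x, Im w)) (Re w) (Derive (fun x => u (x, Im w)) (Re w)))); auto.
      intros w Dw. apply Derive_correct. apply (H w Dw).
    + exists (Derive (fun y => u (Re z, y))). split.
      * apply locally_R, (copen_line_y z (fun w => is_derive (fun y => u (Re w, y)) (Im w) (Derive (fun y => u (Re w, y)) (Im w)))); auto.
        intros w Dw. apply Derive_correct. apply (H w Dw).
      * replace (- A) with B by lra. apply Derive_correct; exact E2.
Qed.

End Harmonic.

(** * The argument in the upper half-plane *)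

Lemma im_sub_R z (x : R) : Im (z - RtoC x)%C = Im z.
Proof. rewrite im_minus. simpl. ring. Qed.

Lemma re_sub_R z (x : R) : Re (z - RtoC x)%C = Re z - x.
Proof. rewrite re_minus. simpl. ring. Qed.

Lemma argH_atan w : 0 < Im w -> argH w = PI / 2 - atan (Re w / Im w).
Proof.
  intros I. set (v := Re w / Im w). set (phi := PI / 2 - atan v). assert (B := atan_bound v).
  assert (S0 : 0 < sqrt (1 + v * v)) by (apply sqrt_lt_R0; nra).
  assert (E : w = (RtoC (Im w * sqrt (1 + v * v)) * (cos phi, sin phi))%C).
  { assert (C1 : cos phi = v / sqrt (1 + v * v)).
    { unfold phi. rewrite cos_shift, sin_atan.  auto. }
    assert (C2 : sin phi = 1 / sqrt (1 + v * v)).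
    { unfold phi. rewrite sin_shift, cos_atan.  auto. }
    rewrite C1, C2. set (r := sqrt (1 + v * v)) in *.  apply Ceq.
    - transitivity (Im w * r * (v / r) - 0 * (1 / r)); [unfold v; field; lra|reflexivity].
    - transitivity (Im w * r * (1 / r) + 0 * (v / r)); [field; lra|reflexivity]. }
  rewrite E at 1. rewrite argH_scal by (apply Rmult_lt_0_compat; auto). apply argH_polar. unfold phi. lra.
Qed.

Lemma argH_mono w (x y : R) : 0 < Im w -> x <= y -> argH (w - RtoC x)%C <= argH (w - RtoC y)%C.
Proof.
  intros I L. rewrite !argH_atan by (rewrite im_sub_R; auto). rewrite !im_sub_R, !re_sub_R.
  assert (Q : (Re w - y) / Im w <= (Re w - x) / Im w).
  { apply Rmult_le_compat_r; [apply Rlt_le, Rinv_0_lt_compat; auto|lra]. }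
  destruct Q as [Q|Q]; [apply atan_increasing in Q; lra|rewrite Q; lra].
Qed.

Lemma arg_shift_cont (l x : R) : l <> x -> forall e, 0 < e -> exists d, 0 < d /\ forall w, <|w - RtoC l|> < d ->
  Rabs (argH (w - RtoC x)%C - argH (RtoC (l - x))) < e.
Proof.
  intros N e He. destruct (rcont_argH (RtoC (l - x)) (slitH_real (l - x) lra) e He) as (d & D & K).
  exists d. split; auto. intros w Hw. apply K. rewrite RtoC_minus. replace (w - RtoC x - (RtoC l - RtoC x))%C with (w - RtoC l)%C by ring. auto.
Qed.

Lemma arg_right (l x : R) : x < l -> forall e, 0 < e -> exists d, 0 < d /\ forall w, <|w - RtoC l|> < d -> Rabs (argH (w - RtoC x)%C) < e.
Proof.
  intros L e He. destruct (arg_shift_cont l x lra e He) as (d & D & K). exists d. split; auto. intros w Hw. specialize (K w Hw).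
  rewrite argH_pos, Rminus_0_r in K by lra. auto.
Qed.

Lemma arg_left (l x : R) : l < x -> forall e, 0 < e -> exists d, 0 < d /\ forall w, <|w - RtoC l|> < d -> Rabs (argH (w - RtoC x)%C - PI) < e.
Proof.
  intros L e He. destruct (arg_shift_cont l x lra e He) as (d & D & K). exists d. split; auto. intros w Hw.
  rewrite argH_neg in K by lra. auto.
Qed.

Lemma harm_arg W g (x : R) : copen W -> holo 2 W g -> (forall z, W z -> 0 < Im (g z)) -> harm W (fun z => argH (g z - RtoC x)%C).
Proof.
  intros Ho Hg HI. apply (harm_ext W (fun z => Im (LogH (g z - RtoC x)%C))); [intros; apply LogH_im|].
  apply (harm_Im W (fun z => LogH (g z - RtoC x)%C)); auto.
  apply (holo_comp 2 W slitH (fun z => g z - RtoC x)%C LogH).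
  - intros z Hz. apply slitH_H. rewrite im_sub_R. auto.
  - apply (holo_plus 2 W g (fun _ => - RtoC x)%C); auto. apply holo_const.
  - apply holo_LogH.
Qed.

(** If [g y] is [i y] up to [O(1/y)], the argument of [g y - c] exceeds [PI / 2] by [c / y] to first
    order. This is how inequalities between arguments are turned into inequalities between real
    points. *)
Lemma arg_expand (g : R -> C) (K Y0 c : R) : 0 <= K ->
  (forall y, Y0 < y -> Rabs (Re (g y)) <= K / y /\ Rabs (Im (g y) - y) <= K / y) ->
  forall e, 0 < e -> exists Y1, forall y, Y1 < y -> Rabs (y * (argH (g y - RtoC c)%C - PI / 2) - c) < e.
Proof.
  intros HK H e He.
  set (C1 := 2 * (K + Rabs c * K)). assert (Rc := Rabs_pos c). assert (C1p : 0 <= C1) by (unfold C1; nra).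
  set (e1 := e / (2 * (Rabs c + C1 + 1))). assert (e10 : 0 < e1) by (apply Rdiv_lt_0_compat; lra).
  destruct (derivable_eps atan 0 1) with (eps := e1) as (d & D & Hd); auto.
  { replace 1 with (/ (1 + 0 ^ 2)) by field. apply derivable_pt_lim_atan. }
  exists (Rmax (Rmax Y0 1) (Rmax (2 * K) (Rmax ((Rabs c + C1 + 1) / d) (2 * C1 / e)))). intros y Hy.
  assert (y0 : Y0 < y) by (eapply Rle_lt_trans; [|exact Hy]; eapply Rle_trans; [apply Rmax_l|apply Rmax_l]).
  assert (y1 : 1 < y) by (eapply Rle_lt_trans; [|exact Hy]; eapply Rle_trans; [apply Rmax_r|apply Rmax_l]).
  assert (y2 : 2 * K < y) by (eapply Rle_lt_trans; [|exact Hy]; eapply Rle_trans; [apply Rmax_l|apply Rmax_r]).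
  assert (y3 : (Rabs c + C1 + 1) / d < y).
  { eapply Rle_lt_trans; [|exact Hy]. eapply Rle_trans; [|apply Rmax_r]. eapply Rle_trans; [|apply Rmax_r]. apply Rmax_l. }
  assert (y4 : 2 * C1 / e < y).
  { eapply Rle_lt_trans; [|exact Hy]. eapply Rle_trans; [|apply Rmax_r]. eapply Rle_trans; [|apply Rmax_r]. apply Rmax_r. }
  destruct (H y y0) as (H1 & H2).
  assert (Ky : K / y <= / 2). { apply Rmult_le_reg_r with y; [lra|]. unfold Rdiv. rewrite Rmult_assoc, Rinv_l; lra. }
  assert (I2 : y / 2 <= Im (g y)) by (apply Rabs_le_between in H2; lra).
  set (v := (Re (g y) - c) / Im (g y)).
  assert (E1 : (y * v + c) * Im (g y) = y * Re (g y) + c * (Im (g y) - y)) by (unfold v; field; lra).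
  assert (E2 : Rabs (y * v + c) <= C1 / y).
  { assert (A1 : Rabs ((y * v + c) * Im (g y)) <= K + Rabs c * (K / y)).
    { rewrite E1. eapply Rle_trans; [apply Rabs_triang|]. rewrite !Rabs_mult, (Rabs_pos_eq y) by lra.
      apply Rplus_le_compat; [|apply Rmult_le_compat_l; auto].
      apply Rle_trans with (y * (K / y)); [apply Rmult_le_compat_l; lra|right; field; lra]. }
    rewrite Rabs_mult, (Rabs_pos_eq (Im (g y))) in A1 by lra. assert (Q := Rabs_pos (y * v + c)).
    assert (A2 : Rabs (y * v + c) * (y / 2) <= K + Rabs c * K).
    { eapply Rle_trans; [apply Rmult_le_compat_l; [auto|exact I2]|]. eapply Rle_trans; [exact A1|]. apply Rplus_le_compat_l, Rmult_le_compat_l; auto.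
      apply Rmult_le_reg_r with y; [lra|]. unfold Rdiv. rewrite Rmult_assoc, Rinv_l; nra. }
    apply Rmult_le_reg_r with y; [lra|]. unfold Rdiv. rewrite (Rmult_assoc C1), Rinv_l by lra. unfold C1. lra. }
  assert (C1y : C1 / y <= C1) by (apply Rmult_le_reg_r with y; [lra|]; unfold Rdiv; rewrite Rmult_assoc, Rinv_l; nra).
  assert (E3 : Rabs (y * v) <= Rabs c + C1).
  { replace (y * v) with ((y * v + c) - c) by ring. eapply Rle_trans; [apply Rabs_triang|]. rewrite Rabs_Ropp. lra. }
  assert (E4 : Rabs v < d).
  { rewrite Rabs_mult, (Rabs_pos_eq y) in E3 by lra. apply Rmult_lt_reg_l with y; [lra|]. eapply Rle_lt_trans; [exact E3|].
    apply Rlt_trans with (Rabs c + C1 + 1); [lra|]. replace (Rabs c + C1 + 1) with ((Rabs c + C1 + 1) / d * d) by (field; lra). apply Rmult_lt_compat_r; auto. }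
  specialize (Hd v E4). rewrite Rplus_0_l, atan_0, Rminus_0_r, Rmult_1_l in Hd.
  rewrite argH_atan by (rewrite im_sub_R; lra). rewrite im_sub_R, re_sub_R. fold v.
  replace (y * (PI / 2 - atan v - PI / 2) - c) with (- (y * (atan v - v)) - (y * v + c)) by ring.
  eapply Rle_lt_trans; [apply Rabs_triang|]. rewrite !Rabs_Ropp, Rabs_mult, (Rabs_pos_eq y) by lra.
  assert (E5 : y * Rabs (atan v - v) <= e1 * (Rabs c + C1)).
  { apply Rle_trans with (y * (e1 * Rabs v)); [apply Rmult_le_compat_l; lra|]. rewrite Rabs_mult, (Rabs_pos_eq y) in E3 by lra.
    replace (y * (e1 * Rabs v)) with (e1 * (y * Rabs v)) by ring. apply Rmult_le_compat_l; lra. }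
  assert (E6 : e1 * (Rabs c + C1) < e / 2).
  { apply Rlt_le_trans with (e1 * (Rabs c + C1 + 1)); [apply Rmult_lt_compat_l; lra|]. right. unfold e1. field. lra. }
  assert (E7 : C1 / y < e / 2).
  { apply Rmult_lt_reg_r with y; [lra|]. unfold Rdiv at 1. rewrite Rmult_assoc, Rinv_l, Rmult_1_r by lra.
    replace C1 with (e / 2 * (2 * C1 / e)) by (field; lra). apply Rmult_lt_compat_l; lra. }
  lra.
Qed.

(** The two branches of the argument glue along the right half-plane with jump [PI]; this makes the
    barrier at the tip consistent across the continuation of the curve. *)
Lemma argH_opp z : 0 < Re z -> argH (- z)%C = argH z + PI.
Proof.
  intros P. unfold argH. rewrite Cmod_opp. assert (S := Cmod_sqr z). assert (G := Cmod_ge_0 z).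
  replace (Re (- z)%C) with (- Re z) by reflexivity. replace (Im (- z)%C) with (- Im z) by reflexivity.
  assert (B : - Cmod z < Im z < Cmod z) by (split; nra).
  set (v := Re z / (Cmod z + Im z)). assert (V : 0 < v) by (apply Rdiv_lt_0_compat; lra).
  replace (- Re z / (Cmod z + - Im z)) with (- / v).
  - rewrite atan_opp, atan_inv by auto. lra.
  - unfold v. apply Rmult_eq_reg_r with ((Cmod z - Im z) * Re z); [|apply Rmult_integral_contrapositive; lra].
    transitivity (- ((Cmod z + Im z) * (Cmod z - Im z))); [field; lra|].
    transitivity (- (Re z * Re z)); [lra|field; lra].
Qed.

Lemma argH_range z : - (PI / 2) < argH z < 3 * PI / 2.
Proof. unfold argH. assert (B := atan_bound (Re z / (Cmod z + Im z))). lra. Qed.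

Lemma atan_lip x y : x <= y -> 0 <= atan y - atan x <= y - x.
Proof.
  intros L. assert (D : forall z, is_derive atan z (/ (1 + z ^ 2))) by (intros; apply is_derive_Reals, derivable_pt_lim_atan).
  assert (B : forall z, 0 <= / (1 + z ^ 2) <= 1).
  { intros z. assert (Q := pow2_ge_0 z). split; [apply Rlt_le, Rinv_0_lt_compat; lra|]. rewrite <- Rinv_1. apply Rinv_le_contravar; lra. }
  assert (W : wcont x y atan).
  { apply wcont_of_continuity. intros z _. apply derivable_continuous_pt. eexists. apply derivable_pt_lim_atan. }
  split.
  - destruct L as [L| ->]; [apply atan_increasing in L|]; lra.
  - assert (M := mvt_le atan x y 1 L W). rewrite Rmult_1_l in M. apply M. intros z _. eexists. split; [apply D|apply B].
Qed.

Lemma atan_abs x : Rabs (atan x) <= Rabs x.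
Proof.
  destruct (Rle_lt_dec 0 x) as [L|L].
  - assert (H := atan_lip 0 x L). rewrite atan_0 in H. rewrite !Rabs_pos_eq; lra.
  - assert (H := atan_lip x 0 lra). rewrite atan_0 in H. rewrite !Rabs_left1; lra.
Qed.

(** The minimum of [cos (x / 4)] for [|x| <= 3 PI / 2]. It is positive, so the real part of a power
    of exponent [-1/4] is comparable to its modulus even on a slit neighbourhood. *)
Definition c0 : R := cos (3 * PI / 8).

Lemma c0_pos : 0 < c0.
Proof. assert (P := PI_RGT_0). apply cos_gt_0; lra. Qed.

Lemma cos_quarter x : - (3 * PI / 2) <= x <= 3 * PI / 2 -> c0 <= cos (x / 4) <= 1.
Proof.
  intros Hx.  split; [|apply COS_bound].
  destruct (Rle_lt_dec 0 x) as [L|L].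
  - apply cos_decr_1; lra.
  - rewrite <- (cos_neg (x / 4)). apply cos_decr_1; lra.
Qed.

Lemma slitH_intro w : Re w <> 0 \/ 0 < Im w -> slitH w.
Proof.
  intros H. unfold slitH. assert (S := Cmod_sqr w).  assert (A1 := im_le_Cmod w). apply Rabs_le_between in A1.
  destruct H as [H|H]; [|lra]. apply Rsqr_pos_lt in H. unfold Rsqr in H. destruct (Req_dec (Cmod w) (- Im w)) as [E|E]; [rewrite E in S; nra|lra].
Qed.

Lemma cexp_re w : Re (cexp w) = exp (Re w) * cos (Im w).
Proof. reflexivity. Qed.

Lemma atan_lower x y k : x <= y -> x * x <= k -> y * y <= k -> (y - x) / (1 + k) <= atan y - atan x.
Proof.
  intros L Hx Hy. assert (Q0 := Rle_0_sqr x).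
  assert (D : forall z, is_derive atan z (/ (1 + z ^ 2))) by (intros; apply is_derive_Reals, derivable_pt_lim_atan).
  assert (W : wcont x y atan).
  { apply wcont_of_continuity. intros z _. apply derivable_continuous_pt. eexists. apply derivable_pt_lim_atan. }
  enough (-1 * atan y - -1 * atan x <= - / (1 + k) * (y - x)) by (unfold Rdiv; lra).
  apply (mvt_le (fun z => -1 * atan z)); auto.
  - apply (wcont_mult x y (fun _ => -1)); [apply wcont_cst|auto].
  - intros z Hz. exists (-1 * / (1 + z ^ 2)). split; [apply (is_derive_scal atan z (-1)); auto|].
    assert (z ^ 2 <= k) by (simpl; destruct (Rle_lt_dec 0 z); nra).
    enough (/ (1 + k) <= / (1 + z ^ 2)) by lra. apply Rinv_le_contravar; [assert (Q := pow2_ge_0 z)|]; lra.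
Qed.

(** The hypotheses put [a / (a + b)] within [k] of [P], and [N], [M] agree with [b], [a] up to a
    factor [1 + k]. So [P N - (1 - P) M] is at most [2 k (a + b)] in modulus, while
    [M >= P (a + b) / 4]. *)
Lemma ratio_close (P k a b N M : R) : 0 < P < 1 -> 0 < k <= P / 2 -> 0 < a -> 0 < b -> a < (P + k) * (a + b) -> b < (1 - P + k) * (a + b) ->
  b / (1 + k) <= N <= b -> a / (1 + k) <= M <= a -> Rabs (N / M - (1 - P) / P) <= 8 * k / (P * P).
Proof.
  intros HP Hk Ha Hb Ba Bb HN HM. set (L := a + b) in *.
  assert (I1 : 1 - k <= / (1 + k)). { apply Rmult_le_reg_r with (1 + k); [lra|]. rewrite Rinv_l by lra. nra. }
  assert (a1 : a - k * a <= M) by (apply Rle_trans with (a / (1 + k)); [unfold Rdiv; nra|lra]).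
  assert (b1 : b - k * b <= N) by (apply Rle_trans with (b / (1 + k)); [unfold Rdiv; nra|lra]).
  assert (aL : (P - k) * L <= a) by (unfold L in *; lra).
  assert (ML : P / 4 * L <= M).
  { apply Rle_trans with ((1 - k) * a); [|lra]. apply Rle_trans with (/ 2 * (P / 2 * L)); [right; field|]. apply Rmult_le_compat; nra. }
  assert (M0 : 0 < M) by nra.
  assert (D1 : P * b - (1 - P) * a = P * L - a) by (unfold L; ring).
  assert (U : Rabs (P * N - (1 - P) * M) <= 2 * k * L).
  { apply Rabs_le. split.
    - assert (P * (b - k * b) <= P * N) by (apply Rmult_le_compat_l; lra). assert ((1 - P) * M <= (1 - P) * a) by (apply Rmult_le_compat_l; lra).
      assert (P * (k * b) <= 1 * (k * L)) by (apply Rmult_le_compat; nra). lra.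
    - assert (P * N <= P * b) by (apply Rmult_le_compat_l; lra). assert ((1 - P) * (a - k * a) <= (1 - P) * M) by (apply Rmult_le_compat_l; lra).
      assert ((1 - P) * (k * a) <= 1 * (k * L)) by (apply Rmult_le_compat; nra). lra. }
  replace (N / M - (1 - P) / P) with ((P * N - (1 - P) * M) / (P * M)) by (field; lra).
  assert (PM : 0 < P * M) by (apply Rmult_lt_0_compat; lra).
  unfold Rdiv at 1. rewrite Rabs_mult, Rabs_inv, (Rabs_pos_eq (P * M)) by lra. apply Rmult_le_reg_r with (P * M); auto.
  rewrite Rmult_assoc, Rinv_l, Rmult_1_r by lra. eapply Rle_trans; [exact U|].
  replace (8 * k / (P * P) * (P * M)) with (8 * k / P * M) by (field; lra).
  apply Rle_trans with (8 * k / P * (P / 4 * L)); [right; field; lra|]. apply Rmult_le_compat_l; auto. apply Rmult_le_pos; [lra|apply Rlt_le, Rinv_0_lt_compat; lra].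
Qed.

Lemma argH_i (x : R) : argH (Ci - RtoC x)%C = PI / 2 + atan x.
Proof.
  rewrite argH_atan by (rewrite im_sub_R; simpl; lra). rewrite im_sub_R, re_sub_R. simpl.
  replace ((0 - x) / 1) with (- x) by field. rewrite atan_opp. ring.
Qed.

(** * Coordinates along the ray of angle [th], and curves that are graphs over it *)

Definition ca (th : R) (z : C) : R := cos th * Re z + sin th * Im z.
Definition cb (th : R) (z : C) : R := - sin th * Re z + cos th * Im z.
Definition pt (th a b : R) : C := (cos th * a - sin th * b, sin th * a + cos th * b).

Lemma cs1 th : cos th * cos th + sin th * sin th = 1.
Proof. assert (T := sin2_cos2 th). unfold Rsqr in T. lra. Qed.

Lemma ca_pt th a b : ca th (pt th a b) = a.
Proof.
  unfold ca, pt, Re, Im. simpl. replace (cos th * (cos th * a - sin th * b) + sin th * (sin th * a + cos th * b))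
    with ((cos th * cos th + sin th * sin th) * a) by ring. rewrite cs1. ring.
Qed.
Lemma cb_pt th a b : cb th (pt th a b) = b.
Proof.
  unfold cb, pt, Re, Im. simpl. replace (- sin th * (cos th * a - sin th * b) + cos th * (sin th * a + cos th * b))
    with ((cos th * cos th + sin th * sin th) * b) by ring. rewrite cs1. ring.
Qed.
Lemma pt_c th z : pt th (ca th z) (cb th z) = z.
Proof.
  assert (E := cs1 th). apply Ceq; unfold pt, ca, cb, Re, Im; simpl.
  - replace (cos th * (cos th * fst z + sin th * snd z) - sin th * (- sin th * fst z + cos th * snd z))
      with ((cos th * cos th + sin th * sin th) * fst z) by ring. rewrite E. ring.
  - replace (sin th * (cos th * fst z + sin th * snd z) + cos th * (- sin th * fst z + cos th * snd z))
      with ((cos th * cos th + sin th * sin th) * snd z) by ring. rewrite E. ring.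
Qed.
Lemma Im_pt th a b : Im (pt th a b) = sin th * a + cos th * b.
Proof. reflexivity. Qed.

Lemma rot_sqr th z w : <|z - w|> * <|z - w|> =
  (ca th z - ca th w) * (ca th z - ca th w) + (cb th z - cb th w) * (cb th z - cb th w).
Proof.
  rewrite Cmod_sqr, re_minus, im_minus. unfold ca, cb. assert (E := cs1 th).
  set (x := Re z). set (y := Im z). set (x' := Re w). set (y' := Im w).
  replace ((cos th * x + sin th * y - (cos th * x' + sin th * y')) * (cos th * x + sin th * y - (cos th * x' + sin th * y')) +
    (- sin th * x + cos th * y - (- sin th * x' + cos th * y')) * (- sin th * x + cos th * y - (- sin th * x' + cos th * y')))
    with ((cos th * cos th + sin th * sin th) * ((x - x') * (x - x') + (y - y') * (y - y'))) by ring.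
  rewrite E. ring.
Qed.

Lemma abs_le_of_sqr x y : 0 <= y -> x * x <= y * y -> Rabs x <= y.
Proof. intros Hy H. apply Rabs_le. split; nra. Qed.

Lemma ca_lip th z w : Rabs (ca th z - ca th w) <= <|z - w|>.
Proof. apply abs_le_of_sqr; [apply Cmod_ge_0|]. rewrite (rot_sqr th).  assert (Y := Rle_0_sqr (cb th z - cb th w)). unfold Rsqr in *. lra. Qed.
Lemma cb_lip th z w : Rabs (cb th z - cb th w) <= <|z - w|>.
Proof. apply abs_le_of_sqr; [apply Cmod_ge_0|]. rewrite (rot_sqr th). assert (X := Rle_0_sqr (ca th z - ca th w)).  unfold Rsqr in *. lra. Qed.

Lemma rot_le th z w : <|z - w|> <= Rabs (ca th z - ca th w) + Rabs (cb th z - cb th w).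
Proof.
  assert (H := rot_sqr th z w).
  set (x := ca th z - ca th w) in *. set (y := cb th z - cb th w) in *.
  assert (H1 := Rabs_pos x). assert (H2 := Rabs_pos y).
  assert (Rabs x * Rabs x = x * x) by (rewrite <- Rabs_mult; apply Rabs_pos_eq; nra).
  assert (Rabs y * Rabs y = y * y) by (rewrite <- Rabs_mult; apply Rabs_pos_eq; nra). nra.
Qed.

(** The geometric form in which smoothness and tangency enter: the curve advances along the ray, and
    all its secants have slope at most [eps] against it. *)
Definition graphlike (th eps t0 : R) (gamma : R -> C) : Prop :=
  forall s t, 0 <= s -> s < t -> t <= t0 -> ca th (gamma s) < ca th (gamma t) /\
    Rabs (cb th (gamma t) - cb th (gamma s)) <= eps * (ca th (gamma t) - ca th (gamma s)).

(** The graph is continued over the whole line so that the height [ht] distinguishes two sides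
    everywhere. For [a < 0] the continuation runs along the ray backwards, below the real axis. *)
Definition graph_of (th eps t0 : R) (gamma : R -> C) (h : R -> R) : Prop :=
  (forall a a', Rabs (h a - h a') <= eps * Rabs (a - a')) /\
  (forall t, 0 <= t <= t0 -> h (ca th (gamma t)) = cb th (gamma t)) /\
  (forall a, a <= 0 -> h a = 0).

Section Graph.
Context {T : R} {lam : R -> R} {gamma : R -> C} {f : C -> R -> C} (CH : chain T lam gamma f).
Context {th eps t0 : R} (Hth : 0 < th < PI) (Heps : 0 <= eps <= /4) (Ht0 : 0 < t0 <= T) (GL : graphlike th eps t0 gamma).

Lemma sin_th : 0 < sin th.
Proof. apply sin_gt_0; lra. Qed.

Lemma ca_g0 : ca th (gamma 0) = 0.
Proof. rewrite (ch_g0 CH). unfold ca, Re, Im. simpl. ring. Qed.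
Lemma cb_g0 : cb th (gamma 0) = 0.
Proof. rewrite (ch_g0 CH). unfold cb, Re, Im. simpl. ring. Qed.

Lemma ca_mono s t : 0 <= s -> s <= t -> t <= t0 -> ca th (gamma s) <= ca th (gamma t).
Proof. intros H1 H2 H3. destruct H2 as [H2| ->]; [|lra]. left. apply GL; auto. Qed.

Lemma ca_onto t a : 0 <= t <= t0 -> 0 <= a <= ca th (gamma t) -> exists s, 0 <= s <= t /\ ca th (gamma s) = a.
Proof.
  intros Ht Ha. destruct (Req_dec t 0) as [->|N].
  { exists 0. rewrite ca_g0 in *. split; lra. }
  assert (W : wcont 0 t (fun x => ca th (gamma x))).
  { apply (wcont_C2 0 t (ca th)).
    - intros x _.  apply rcont_plus; apply rcont_mult; try apply rcont_const; [apply rcont_Re_id|apply rcont_Im_id].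
    - apply (wcontC_sub 0 T); try lra. apply (ch_gam CH). }
  destruct (IVT_gen_consistent (fun x => ca th (gamma (clamp 0 t x))) 0 t a) as (x & Hx & E).
  - intros x. apply continuous_continuity_pt, (wcont_clamp 0 t (fun x => ca th (gamma x))); auto; lra.
  - rewrite !clamp_id, ca_g0 by lra. rewrite Rmin_left, Rmax_right by lra. auto.
  - rewrite Rmin_left, Rmax_right in Hx by lra. rewrite clamp_id in E by lra. exists x. auto.
Qed.

Lemma exists_graph : exists h, graph_of th eps t0 gamma h.
Proof.
  assert (A0 := ca_mono 0 t0 lra lra lra). rewrite ca_g0 in A0.
  assert (X : forall a, exists s, 0 <= s <= t0 /\ ca th (gamma s) = clamp 0 (ca th (gamma t0)) a).
  { intros a. apply ca_onto; [lra|]. apply clamp_in; auto. }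
  destruct (ClassicalEpsilon.choice _ X) as (S & HS).
  exists (fun a => cb th (gamma (S a))). split; [|split].
  - intros a a'. destruct (HS a) as (H1 & H2), (HS a') as (H3 & H4).
    assert (L := clamp_lip 0 (ca th (gamma t0)) a' a). rewrite <- H2, <- H4 in L.
    apply Rle_trans with (eps * Rabs (ca th (gamma (S a)) - ca th (gamma (S a')))); [|apply Rmult_le_compat_l; [lra|auto]].
    destruct (Rtotal_order (S a) (S a')) as [Q|[Q|Q]].
    + destruct (GL (S a) (S a')) as (G1 & G2); try lra.
      rewrite (Rabs_minus_sym (cb th (gamma (S a)))), (Rabs_minus_sym (ca th (gamma (S a)))). rewrite (Rabs_pos_eq (ca th (gamma (S a')) - _)) by lra. auto.
    + rewrite Q, !Rminus_diag, Rabs_R0. lra.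
    + destruct (GL (S a') (S a)) as (G1 & G2); try lra. rewrite (Rabs_pos_eq (ca th (gamma (S a)) - _)) by lra. auto.
  - intros t Ht. destruct (HS (ca th (gamma t))) as (H1 & H2).
    rewrite clamp_id in H2.
    + do 2 f_equal. destruct (Rtotal_order (S (ca th (gamma t))) t) as [Q|[Q|Q]]; auto.
      * destruct (GL (S (ca th (gamma t))) t); lra.
      * destruct (GL t (S (ca th (gamma t)))); lra.
    + split; [rewrite <- ca_g0; apply ca_mono; lra|apply ca_mono; lra].
  - intros a Ha. destruct (HS a) as (H1 & H2). rewrite <- cb_g0. do 2 f_equal.
    assert (E : clamp 0 (ca th (gamma t0)) a = 0) by (unfold clamp, Rmax, Rmin; repeat destruct Rle_dec; lra).
    rewrite E in H2. destruct (Rtotal_order (S a) 0) as [Q|[Q|Q]]; auto; [lra|].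
    destruct (GL 0 (S a)) as (G1 & _); try lra. rewrite ca_g0 in G1. lra.
Qed.

Context {h : R -> R} (Hh : graph_of th eps t0 gamma h).
Local Notation F := (@F gamma f).

Lemma h_lip a a' : Rabs (h a - h a') <= eps * Rabs (a - a').
Proof. apply Hh. Qed.
Lemma h_lip4 a a' : Rabs (h a - h a') <= / 4 * Rabs (a - a').
Proof. eapply Rle_trans; [apply h_lip|]. apply Rmult_le_compat_r; [apply Rabs_pos|lra]. Qed.
Lemma h_gamma t : 0 <= t <= t0 -> h (ca th (gamma t)) = cb th (gamma t).
Proof. apply Hh. Qed.
Lemma h_neg a : a <= 0 -> h a = 0.
Proof. apply Hh. Qed.
Definition G (a : R) : C := pt th a (h a).
Definition ht (z : C) : R := cb th z - h (ca th z).

Lemma G_gamma t : 0 <= t <= t0 -> G (ca th (gamma t)) = gamma t.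
Proof. intros Ht. unfold G. rewrite h_gamma by auto. apply pt_c. Qed.

Lemma trace_iff t z : 0 <= t <= t0 -> (trace gamma t z <-> 0 <= ca th z <= ca th (gamma t) /\ ht z = 0).
Proof.
  intros Ht. split.
  - intros (s & Hs & ->). unfold Icc in Hs. split.
    + split; [rewrite <- ca_g0; apply ca_mono; lra|apply ca_mono; lra].
    + unfold ht. rewrite h_gamma by lra. ring.
  - intros (H1 & H2). destruct (ca_onto t _ Ht H1) as (s & Hs & E). exists s. split; [exact Hs|].
    rewrite <- (G_gamma s) by lra. rewrite E. unfold G. replace (h (ca th z)) with (cb th z) by (unfold ht in H2; lra).
    symmetry; apply pt_c.
Qed.

Lemma slit_of_ht t z : 0 <= t <= t0 -> 0 < Im z -> ht z <> 0 -> slit gamma t z.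
Proof. intros Ht H N. split; auto. rewrite trace_iff by auto. tauto. Qed.

Lemma ht_lip z w : Rabs (ht z - ht w) <= 2 * <|z - w|>.
Proof.
  unfold ht. assert (A := ca_lip th z w). assert (B := cb_lip th z w). assert (L := h_lip4 (ca th z) (ca th w)).
  replace (cb th z - h (ca th z) - (cb th w - h (ca th w))) with ((cb th z - cb th w) + - (h (ca th z) - h (ca th w))) by ring.
  eapply Rle_trans; [apply Rabs_triang|]. rewrite Rabs_Ropp. assert (Q := Cmod_ge_0 (z - w)%C). lra.
Qed.

Lemma ht_G a : ht (G a) = 0.
Proof. unfold ht, G. rewrite ca_pt, cb_pt. ring. Qed.
Lemma ca_G a : ca th (G a) = a.
Proof. apply ca_pt. Qed.

Lemma G_eq z : ht z = 0 -> z = G (ca th z).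
Proof. intros H. unfold G. replace (h (ca th z)) with (cb th z) by (unfold ht in H; lra). symmetry; apply pt_c. Qed.

Lemma G_lip a a' : <|G a - G a'|> <= 2 * Rabs (a - a').
Proof.
  eapply Rle_trans; [apply (rot_le th)|]. unfold G. rewrite !ca_pt, !cb_pt.
  assert (L := h_lip4 a a'). assert (P := Rabs_pos (a - a')). lra.
Qed.

(** Chart of the side [sg] (1 or -1) of the graph: position along the ray and height off the graph.
    It is Lipschitz in both directions and is fed to the charts of the prime end part. *)
Definition V (sg a be : R) : C := pt th a (h a + sg * be).

Lemma ht_V sg a be : ht (V sg a be) = sg * be.
Proof. unfold ht, V. rewrite ca_pt, cb_pt. ring. Qed.
Lemma ca_V sg a be : ca th (V sg a be) = a.
Proof. apply ca_pt. Qed.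

Lemma V_of z sg : sg * sg = 1 -> z = V sg (ca th z) (sg * ht z).
Proof.
  intros S. unfold V, ht. replace (h (ca th z) + sg * (sg * (cb th z - h (ca th z)))) with (cb th z).
  - symmetry. apply pt_c.
  - replace (sg * (sg * (cb th z - h (ca th z)))) with ((sg * sg) * (cb th z - h (ca th z))) by ring. rewrite S. ring.
Qed.

Lemma V_dist sg a be a' be' : sg * sg = 1 -> <|V sg a be - V sg a' be'|> <= 2 * Rabs (a - a') + Rabs (be - be').
Proof.
  intros S. eapply Rle_trans; [apply (rot_le th)|]. unfold V. rewrite !ca_pt, !cb_pt.
  replace (h a + sg * be - (h a' + sg * be')) with ((h a - h a') + sg * (be - be')) by ring.
  assert (T1 := Rabs_triang (h a - h a') (sg * (be - be'))). rewrite Rabs_mult in T1.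
  assert (Rabs sg = 1). { assert (Q := Rabs_pos sg). assert (Rabs sg * Rabs sg = 1) by (rewrite <- Rabs_mult, S; apply Rabs_R1). nra. }
  assert (L := h_lip4 a a'). assert (P := Rabs_pos (a - a')). rewrite H in T1. lra.
Qed.

(** * Behaviour of [f] at the curve and at its tip *)

Lemma cb_kappa (sg : R) (z z0 : C) :
  (- Ci * RtoC sg * (cos th, (- sin th)%R) * (z - z0))%C = ((sg * (cb th z - cb th z0))%R, (- (sg * (ca th z - ca th z0)))%R).
Proof. apply Ceq; unfold ca, cb, Re, Im; simpl; ring. Qed.

(** Schwarz's lemma through the maximum principle: the logarithm of [|f - w0| / |f - conj w0|] minus
    that of [|z - z0| / r] is at most 0 on the punctured disc. The centre is an exceptional point,
    where differentiability of [f] bounds the function from above. The constant 4 uses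
    [|z - z0| <= r / 2]. *)
Lemma schwarz_pick t z0 r : 0 <= t <= T -> 0 < r -> (forall z, <|z - z0|> < r -> slit gamma t z) ->
  forall z, <|z - z0|> <= r / 2 ->
  <|f z t - f z0 t|> <= 4 * (<|z - z0|> / r) * Im (f z0 t).
Proof.
  intros Ht Hr HB z Hz.
  assert (S0 : slit gamma t z0) by (apply HB; rewrite Cmod_sub_0; auto).
  assert (I0 := ch_map CH t z0 Ht S0).
  destruct (Ceq_dec z z0) as [->|Nz].
  { rewrite !Cmod_sub_0. unfold Rdiv. rewrite Rmult_0_l, Rmult_0_r, Rmult_0_l. lra. }
  set (w0 := f z0 t) in *.
  set (W := fun y => y <> z0 /\ <|y - z0|> < r).
  assert (OW : copen W).
  { intros y (Y1 & Y2). assert (P : 0 < <|y - z0|>) by (apply Cmod_gt_0; intros K; apply Y1, Csub0; auto).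
    exists (Rmin (<|y - z0|>) (r - <|y - z0|>)). split; [apply Rmin_pos; lra|].
    intros v Hv. destruct (Rmin2 _ _ _ Hv) as (V1 & V2). split.
    - intros ->. rewrite Cmod_sub_sym in V1. lra.
    - eapply Rle_lt_trans; [apply (Cmod_tri3 v y z0)|]. lra. }
  assert (SW : forall y, W y -> slit gamma t y) by (intros y (_ & Y); auto).
  assert (Nf : forall y, W y -> (f y t - w0)%C <> 0%C).
  { intros y Hy K. apply (proj1 Hy). apply (ch_inj CH t); auto. apply Csub0; auto. }
  assert (Dist : forall y, W y -> <|f y t - w0|> <= <|f y t - Cconj w0|> /\ 0 < <|f y t - Cconj w0|>).
  { intros y Hy. assert (I := ch_map CH t y Ht (SW y Hy)).
    assert (E1 := Cmod_sqr (f y t - w0)%C). assert (E2 := Cmod_sqr (f y t - Cconj w0)%C).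
    rewrite !re_minus, !im_minus in E1, E2. rewrite re_conj, im_conj in E2.
     assert (P2 := Cmod_ge_0 (f y t - Cconj w0)%C).
    split; nra. }
  set (u := fun y => ln (<|f y t - w0|>) - ln (<|f y t - Cconj w0|>) - ln (<|y - z0|>) + ln r).
  assert (Hol : forall c, holo 2 W (fun y => f y t - c)%C).
  { intros c. apply holo_plus; [|apply holo_const]. apply (holo_sub 2 W (slit gamma t)); auto. apply (f_holo CH); auto. }
  assert (Pd : forall y, W y -> 0 < <|y - z0|>).
  { intros y (Y & _). apply Cmod_gt_0. intros K; apply Y, Csub0; auto. }
  assert (U1 : forall y, W y -> u y <= ln r - ln (<|y - z0|>)).
  { intros y Hy. destruct (Dist y Hy) as (D1 & D2). unfold u.
    assert (ln (<|f y t - w0|>) <= ln (<|f y t - Cconj w0|>)).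
    { apply ln_le; auto. apply Cmod_gt_0; auto. } lra. }
  destruct (f_holo CH t Ht) as (f' & F1 & _).
  destruct (cderiv_eps_inv _ _ _ (F1 z0 S0) 1 lra) as (d & D0 & HD). fold w0 in HD.
  set (K := Cmod (f' z0) + 1). assert (K0 : 0 < K) by (unfold K; assert (P := Cmod_ge_0 (f' z0)); lra).
  assert (B : forall y, W y -> u y <= 0).
  { apply (max_principle W u (Rmax (ln r - ln d) (ln K - ln (Im w0) + ln r)) (z0 :: nil)); auto.
    - intros y Hy. apply (@slit_H gamma t); auto.
    - intros e [<-|[]] (K1 & _). auto.
    -  apply harm_plus; [|apply harm_const]. apply harm_minus; [apply harm_minus|]; apply harm_lnCmod; auto.
      + intros y Hy E. destruct (Dist y Hy) as (_ & D2). rewrite E, Cmod_0 in D2. lra.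
      + intros y Hy E. specialize (Pd y Hy). rewrite E, Cmod_0 in Pd. lra.
      + apply holo_plus; [apply holo_id|apply holo_const].
    - intros y Hy. destruct (Rle_lt_dec d (<|y - z0|>)) as [L|L].
      + eapply Rle_trans; [apply U1; auto|]. eapply Rle_trans; [|apply Rmax_l].
        assert (ln d <= ln (<|y - z0|>)) by (apply ln_le; auto). lra.
      + eapply Rle_trans; [|apply Rmax_r]. specialize (HD y L).
        assert (X : <|f y t - w0|> <= K * <|y - z0|>).
        { replace (f y t - w0)%C with ((f y t - w0 - f' z0 * (y - z0)) + f' z0 * (y - z0))%C by ring.
          eapply Rle_trans; [apply Cmod_triangle|]. rewrite Cmod_mult. unfold K. lra. }
         assert (X1 := proj1 (Cmod_gt_0 _) (Nf y Hy)).
        assert (X2 : ln (<|f y t - w0|>) <= ln K + ln (<|y - z0|>)).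
        { rewrite <- ln_mult by auto. apply ln_le; auto. }
        assert (X3 : ln (Im w0) <= ln (<|f y t - Cconj w0|>)).
        { apply ln_le; auto. assert (Q := im_le_Cmod (f y t - Cconj w0)%C). rewrite im_minus, im_conj in Q.
          assert (Q2 := Rle_abs (Im (f y t) - - Im w0)). assert (Q3 := ch_map CH t y Ht (SW y Hy)). lra. }
        unfold u. lra.
    - intros ze e Nze NE _ He.
      assert (L : r <= <|ze - z0|>).
      { apply Rnot_lt_le. intros L. apply Nze. split; auto. intros ->. apply NE. left; auto. }
      assert (Ee : exp (- e) < 1) by (rewrite <- exp_0; apply exp_increasing; lra). assert (Pe := exp_pos (- e)).
      exists (r * (1 - exp (- e))). split; [apply Rmult_lt_0_compat; lra|]. intros y Hy Hd.
      eapply Rle_trans; [apply U1; auto|].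
      assert (T1 := Cmod_tri3 ze y z0). rewrite (Cmod_sub_sym ze y) in T1.
      assert (r * exp (- e) <= <|y - z0|>) by lra.
      assert (ln (r * exp (- e)) <= ln (<|y - z0|>)) by (apply ln_le; auto; apply Rmult_lt_0_compat; auto).
      rewrite ln_mult, ln_exp in H0 by auto. lra. }
  assert (Wz : W z) by (split; auto; lra).
  specialize (B z Wz). destruct (Dist z Wz) as (D1 & D2). specialize (Pd z Wz).
  assert (X1 := proj1 (Cmod_gt_0 _) (Nf z Wz)).
  assert (Y : <|f z t - w0|> * r <= <|f z t - Cconj w0|> * <|z - z0|>).
  { apply Rnot_lt_le. intros L. apply ln_increasing in L; [|nra]. rewrite !ln_mult in L by auto. unfold u in B. lra. }
  assert (Y2 : <|f z t - Cconj w0|> <= <|f z t - w0|> + 2 * Im w0).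
  { replace (f z t - Cconj w0)%C with ((f z t - w0) + (w0 - Cconj w0))%C by ring.
    eapply Rle_trans; [apply Cmod_triangle|]. apply Rplus_le_compat_l.
    replace (w0 - Cconj w0)%C with (Ci * RtoC (2 * Im w0))%C by (apply Ceq; unfold Re, Im; simpl; ring).
    rewrite Cmod_mult, Cmod_Ci, Cmod_R, Rabs_pos_eq; lra. }
  set (k := <|z - z0|> / r). assert (Ek : <|z - z0|> = k * r) by (unfold k; field; lra).
  rewrite Ek in Y, Hz, Pd. set (m := <|f z t - w0|>) in *.
   nra.
Qed.

(** The fourth root of a positive [x]. *)
Definition b4 (x : R) : R := exp (/ 4 * ln x).
Lemma b4_pos x : 0 < b4 x.
Proof. apply exp_pos. Qed.
Lemma b4_le x y : 0 < x -> x <= y -> b4 x <= b4 y.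
Proof.
  intros H1 [H2| ->]; [|lra]. left. apply exp_increasing. assert (ln x < ln y) by (apply ln_increasing; auto). lra.
Qed.
Lemma b4_mult x y : 0 < x -> 0 < y -> b4 (x * y) = b4 x * b4 y.
Proof. intros. unfold b4. rewrite ln_mult, Rmult_plus_distr_l, exp_plus by auto. reflexivity. Qed.
Lemma b4_small e : 0 < e -> exists d, 0 < d /\ forall x, 0 < x < d -> b4 x < e.
Proof.
  intros He. exists (exp (4 * ln e)). split; [apply exp_pos|]. intros x Hx.
   rewrite <- (exp_ln e) by auto. apply exp_increasing.
  assert (ln x < 4 * ln e) by (rewrite <- (ln_exp (4 * ln e)); apply ln_increasing; lra). lra.
Qed.

Lemma ball_slit t sg a rho z : 0 <= t <= t0 -> sg * sg = 1 -> (forall y, <|y - G a|> < rho -> 0 < Im y) ->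
  0 < sg * ht z -> <|z - G a|> < rho -> slit gamma t z.
Proof. intros Ht S HI Hz Hd. apply slit_of_ht; auto. intros E. rewrite E in Hz. lra. Qed.

(** Comparison with [Re (zeta^(1/4))] and the maximum principle. *)
Lemma Im_decay t sg a rho : 0 <= t <= t0 -> sg * sg = 1 -> 0 < rho -> 0 < a - rho -> a + rho < ca th (gamma t) ->
  (forall y, <|y - G a|> < rho -> 0 < Im y) ->
  forall z, 0 < sg * ht z -> <|z - G a|> < rho ->
  Im (f z t) <= (Im (G a) + rho) / (cos (PI / 4) * b4 (rho / 2)) * b4 (<|z - G a|>).
Proof.
  intros Ht S Hr Ha1 Ha2 HI z Hz Hd.
  assert (C4 : 0 < cos (PI / 4)) by (apply cos_gt_0; assert (P := PI_RGT_0); lra).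
  assert (B4 := b4_pos (rho / 2)).
  assert (IG : 0 < Im (G a)) by (apply HI; rewrite Cmod_sub_0; auto).
  (* With this [K] the comparison function dominates the bound [Im (G a) + rho] for [Im f] wherever
     [|y - G a| >= rho / 2]. *)
  set (K := (Im (G a) + rho) / (cos (PI / 4) * b4 (rho / 2))).
  assert (K0 : 0 < K) by (unfold K; apply Rdiv_lt_0_compat; [lra|nra]).
  assert (HtT : 0 <= t <= T) by lra.
  set (W := fun y => 0 < sg * ht y /\ <|y - G a|> < rho).
  assert (SW : forall y, W y -> slit gamma t y) by (intros y (Y1 & Y2); apply (ball_slit t sg a rho); auto).
  assert (OW : copen W).
  { intros y (Y1 & Y2). exists (Rmin (sg * ht y / 2) (rho - <|y - G a|>)). split; [apply Rmin_pos; lra|].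
    intros v Hv. destruct (Rmin2 _ _ _ Hv) as (V1 & V2). split.
    - assert (L := ht_lip v y). assert (Rabs (sg * (ht v - ht y)) <= 2 * <|v - y|>).
      { rewrite Rabs_mult. assert (Rabs sg = 1). { assert (Q := Rabs_pos sg). assert (Rabs sg * Rabs sg = 1) by (rewrite <- Rabs_mult, S; apply Rabs_R1). nra. } rewrite H. lra. }
      apply Rabs_le_between in H. lra.
    - eapply Rle_lt_trans; [apply (Cmod_tri3 v y (G a))|]. lra. }
  (* [kz] sends [G a] to 0 and the normal pointing to the side [sg] to the positive real axis. The
     slope bound [/ 4] keeps this side of the graph off the negative axis, so the fourth root is
     defined on it. *)
  set (kz := fun y => (- Ci * RtoC sg * (cos th, (- sin th)%R) * (y - G a))%C).
  assert (Ek : forall y, kz y = (sg * (cb th y - h a), - (sg * (ca th y - a)))).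
  { intros y. unfold kz. rewrite cb_kappa. unfold G. rewrite ca_pt, cb_pt. reflexivity. }
  assert (Sk1 : forall y, Cmod (kz y) = <|y - G a|>).
  { intros y. assert (E1 := Cmod_sqr (kz y)). rewrite Ek in E1 at 3 4 5 6.  simpl in E1.
    assert (E2 := rot_sqr th y (G a)). unfold G in E2 at 3 4 5 6. rewrite ca_pt, cb_pt in E2.
    assert (P1 := Cmod_ge_0 (kz y)). assert (P2 := Cmod_ge_0 (y - G a)%C).
    assert (Cmod (kz y) * Cmod (kz y) = <|y - G a|> * <|y - G a|>).
    { rewrite E1, E2. replace (sg * (cb th y - h a) * (sg * (cb th y - h a)) + - (sg * (ca th y - a)) * - (sg * (ca th y - a)))
        with (sg * sg * ((cb th y - h a) * (cb th y - h a) + (ca th y - a) * (ca th y - a))) by ring. rewrite S. ring. }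
    nra. }
  assert (Sp : forall y, W y -> slitp (kz y)).
  { intros y (Y1 & Y2). unfold slitp. rewrite Ek.  simpl. rewrite <- Ek.
    assert (Q : sg * (cb th y - h a) = sg * ht y + sg * (h (ca th y) - h a)) by (unfold ht; ring).
    assert (L := h_lip4 (ca th y) a).
    assert (L2 : - (/ 4 * Rabs (ca th y - a)) <= sg * (h (ca th y) - h a)).
    { assert (Rabs (sg * (h (ca th y) - h a)) <= / 4 * Rabs (ca th y - a)).
      { rewrite Rabs_mult. assert (Rabs sg = 1). { assert (Q1 := Rabs_pos sg). assert (Rabs sg * Rabs sg = 1) by (rewrite <- Rabs_mult, S; apply Rabs_R1). nra. } rewrite H. lra. }
      apply Rabs_le_between in H. lra. }
    assert (L3 : Rabs (ca th y - a) <= Cmod (kz y)).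
    { rewrite Sk1. assert (L4 := ca_lip th y (G a)). rewrite ca_G in L4. auto. }
    assert (P := Rabs_pos (ca th y - a)). lra. }
  set (u := fun y => Im (f y t) - K * Re (pw (/ 4) (kz y))).
  assert (Lo : forall y, W y -> b4 (<|y - G a|>) * cos (PI / 4) <= Re (pw (/ 4) (kz y)) <= b4 (<|y - G a|>)).
  { intros y Hy. rewrite pw_re, Sk1. fold (b4 (<|y - G a|>)). assert (P := b4_pos (<|y - G a|>)).
    assert (A := Arg_bound (kz y)).
    assert (cos (PI / 4) <= cos (/ 4 * Arg (kz y))).
    { destruct (Rle_lt_dec 0 (Arg (kz y))).
      - apply cos_decr_1; lra.
      - rewrite <- (cos_neg (/ 4 * Arg (kz y))). apply cos_decr_1; lra. }
    assert (C1 := COS_bound (/ 4 * Arg (kz y))). split; nra. }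
  assert (Bd : forall y, W y -> Im (f y t) <= Im (G a) + rho).
  { intros y Hy. assert (A := Imf_le CH t y HtT (SW y Hy)). assert (A2 := im_le_Cmod (y - G a)%C). rewrite im_minus in A2.
    apply Rabs_le_between in A2. destruct Hy. lra. }
  assert (UB : forall y, W y -> u y <= 0).
  { apply (max_principle W u (Im (G a) + rho) nil); auto.
    - intros y Hy. apply (@slit_H gamma t); auto.
    -  apply harm_minus.
      + apply (harm_Im W (fun y => f y t)); auto. apply (holo_sub 2 W (slit gamma t)); auto. apply (f_holo CH); auto.
      + apply harm_scal. apply (harm_Re W (fun y => pw (/ 4) (kz y))); auto.
        apply (holo_comp 2 W slitp kz (pw (/ 4))); auto; [|apply holo_pw].
        apply (holo_mult 2 W (fun _ => (- Ci * RtoC sg * (cos th, (- sin th)%R))%C)); [apply holo_const|].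
        apply holo_plus; [apply holo_id|apply holo_const].
    - intros y Hy. unfold u. destruct (Lo y Hy) as (L1 & _). specialize (Bd y Hy). assert (P := b4_pos (<|y - G a|>)).
      assert (0 <= K * Re (pw (/ 4) (kz y))) by (apply Rmult_le_pos; nra). lra.
    - intros ze e Nze _ _ He.
      destruct (Rle_lt_dec rho (<|ze - G a|>)) as [L|L].
      + exists (rho / 2). split; [lra|]. intros y Hy Hdy.
        assert (T1 := Cmod_tri3 ze y (G a)). rewrite (Cmod_sub_sym ze y) in T1.
        destruct (Lo y Hy) as (L1 & _). specialize (Bd y Hy).
        assert (B1 : b4 (rho / 2) <= b4 (<|y - G a|>)) by (apply b4_le; lra).
        assert (E : K * (b4 (rho / 2) * cos (PI / 4)) = Im (G a) + rho) by (unfold K; field; split; lra).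
        assert (K * (b4 (rho / 2) * cos (PI / 4)) <= K * Re (pw (/ 4) (kz y))).
        { apply Rmult_le_compat_l; [lra|]. nra. }
        unfold u. lra.
      + assert (Hs : ~ slit gamma t ze \/ sg * ht ze < 0).
        { destruct (Rlt_le_dec (sg * ht ze) 0) as [|Q]; auto. left. intros (Q1 & Q2). apply Q2.
          apply trace_iff; auto. assert (A := ca_lip th ze (G a)). rewrite ca_G in A. apply Rabs_le_between in A.
          split; [lra|]. destruct Q as [Q|Q].
          - exfalso. apply Nze. split; auto.
          - replace (ht ze) with (sg * sg * ht ze) by (rewrite S; ring). rewrite Rmult_assoc, <- Q. ring. }
        destruct Hs as [Hs|Hs].
        * destruct (f_proper CH t ze e HtT Hs He) as (d & D & KK). exists d. split; auto. intros y Hy Hdy.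
          specialize (KK y (conj (SW y Hy) Hdy)). destruct (Lo y Hy) as (L1 & _). assert (P := b4_pos (<|y - G a|>)).
          assert (0 <= K * Re (pw (/ 4) (kz y))) by (apply Rmult_le_pos; nra). unfold u. lra.
        * exists (- (sg * ht ze) / 2). split; [lra|]. intros y (Y1 & Y2) Hdy. exfalso.
          assert (L2 := ht_lip y ze). assert (Rabs (sg * (ht y - ht ze)) <= 2 * <|y - ze|>).
          { rewrite Rabs_mult. assert (Rabs sg = 1). { assert (Q := Rabs_pos sg). assert (Rabs sg * Rabs sg = 1) by (rewrite <- Rabs_mult, S; apply Rabs_R1). nra. } rewrite H. lra. }
          apply Rabs_le_between in H. lra. }
  assert (Wz : W z) by (split; auto). specialize (UB z Wz). destruct (Lo z Wz) as (_ & L2). unfold u in UB.  nra.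
Qed.

Lemma sg_abs (sg : R) : sg * sg = 1 -> Rabs sg = 1.
Proof. intros S. assert (Q := Rabs_pos sg). assert (Rabs sg * Rabs sg = 1) by (rewrite <- Rabs_mult, S; apply Rabs_R1). nra. Qed.

Lemma sg_ht_lip (sg : R) z w : sg * sg = 1 -> sg * ht z - 2 * <|z - w|> <= sg * ht w <= sg * ht z + 2 * <|z - w|>.
Proof.
  intros S. assert (L := ht_lip z w).
  assert (Rabs (sg * (ht z - ht w)) <= 2 * <|z - w|>) by (rewrite Rabs_mult, (sg_abs sg S); lra).
  apply Rabs_le_between in H. lra.
Qed.

Lemma V_0 sg a : V sg a 0 = G a.
Proof. unfold V, G. f_equal. ring. Qed.

Lemma VG_dist sg a be : sg * sg = 1 -> 0 <= be -> <|V sg a be - G a|> <= be.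
Proof.
  intros S Hb. rewrite <- (V_0 sg a). eapply Rle_trans; [apply V_dist; auto|].
  rewrite Rminus_diag, Rabs_R0, Rminus_0_r, Rabs_pos_eq by auto. lra.
Qed.

(** A stretch of the curve away from the origin and the tip, with room [rho] around each of its
    points inside the half-plane. *)
Definition good_strip (t a1 a2 rho : R) : Prop :=
  0 <= t <= t0 /\ 0 < rho /\ a1 < a2 /\ 0 < a1 - rho /\ a2 + rho < ca th (gamma t) /\
  forall a y, a1 <= a <= a2 -> <|y - G a|> < rho -> 0 < Im y.

(** Descend towards the curve through heights with ratio [7/8]. By Schwarz's lemma each step moves
    [f] by at most a multiple of [Im f], which decays like the fourth root of the height, so the
    moves form a geometric series. *)
Lemma osc t a1 a2 rho sg : good_strip t a1 a2 rho -> sg * sg = 1 ->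
  exists K, 0 < K /\ forall a a' be be', a1 <= a <= a2 -> a1 <= a' <= a2 -> 0 < be' <= be -> be < rho / 4 ->
    Rabs (a' - a) <= be / 16 -> <|f (V sg a' be') t - f (V sg a be) t|> <= K * b4 be.
Proof.
  intros (Ht & Hr & Ha & Ha1 & Ha2 & HI) S.
  assert (HtT : 0 <= t <= T) by lra.
  assert (C4 : 0 < cos (PI / 4)) by (apply cos_gt_0; assert (P := PI_RGT_0); lra).
  assert (B4 := b4_pos (rho / 2)).
  set (M := Cmod (G a1) + 2 * (a2 - a1)).
  assert (HM : forall a, a1 <= a <= a2 -> Im (G a) <= M).
  { intros a Hax. assert (A := im_le_Cmod (G a)). assert (A2 := Rle_abs (Im (G a))).
    assert (A3 := Cmod_rev (G a) (G a1)). assert (A4 := G_lip a a1). rewrite Rabs_pos_eq in A4 by lra. unfold M. lra. }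
  assert (M0 : 0 < M) by (unfold M; assert (P := Cmod_ge_0 (G a1)); lra).
  set (K := (M + rho) / (cos (PI / 4) * b4 (rho / 2))).
  assert (K0 : 0 < K) by (unfold K; apply Rdiv_lt_0_compat; [lra|nra]).
  assert (Dec : forall a be, a1 <= a <= a2 -> 0 < be < rho -> Im (f (V sg a be) t) <= K * b4 be).
  { intros a be Hax Hbe. assert (D := VG_dist sg a be S lra).
    assert (X := Im_decay t sg a rho Ht S Hr lra lra (fun y => HI a y Hax) (V sg a be)).
    rewrite ht_V in X. replace (sg * (sg * be)) with (sg * sg * be) in X by ring. rewrite S in X.
    specialize (X lra lra). eapply Rle_trans; [exact X|].
    assert (P : 0 < <|V sg a be - G a|>).
    { apply Cmod_gt_0. intros E. apply Csub0 in E. assert (E2 := ht_V sg a be). rewrite E, ht_G in E2.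
      apply (f_equal (Rmult sg)) in E2. replace (sg * (sg * be)) with (sg * sg * be) in E2 by ring. rewrite S in E2. lra. }
    apply Rmult_le_compat; auto.
    - apply Rlt_le, Rdiv_lt_0_compat; [|nra]. assert (0 < Im (G a)) by (apply (HI a); auto; rewrite Cmod_sub_0; auto). lra.
    - left; apply b4_pos.
    -  apply Rmult_le_compat_r; [apply Rlt_le, Rinv_0_lt_compat; nra|]. specialize (HM a Hax). lra.
    - apply b4_le; auto. }
  assert (Step : forall a be a' be', a1 <= a <= a2 -> 0 < be < rho / 4 -> <|V sg a' be' - V sg a be|> <= be / 8 ->
    <|f (V sg a' be') t - f (V sg a be) t|> <= 2 * K * b4 be).
  { intros a be a' be' Hax Hbe Hd.
    assert (X := schwarz_pick t (V sg a be) (be / 4) HtT lra).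
    assert (Y : forall z, <|z - V sg a be|> < be / 4 -> slit gamma t z).
    { intros z Hz. apply (ball_slit t sg a rho z Ht S (fun y => HI a y Hax)).
      - assert (L := sg_ht_lip sg (V sg a be) z S). rewrite ht_V, (Cmod_sub_sym (V sg a be)) in L.
        replace (sg * (sg * be)) with (sg * sg * be) in L by ring. rewrite S in L. lra.
      - assert (D := VG_dist sg a be S lra). assert (D2 := Cmod_tri3 z (V sg a be) (G a)). lra. }
    specialize (X Y (V sg a' be') lra). eapply Rle_trans; [exact X|].
    assert (D := Dec a be Hax lra).
    assert (I := ch_map CH t _ HtT (Y (V sg a be) ltac:(rewrite Cmod_sub_0; lra))).
    assert (Q : <|V sg a' be' - V sg a be|> / (be / 4) <= / 2).
    { apply Rmult_le_reg_r with (be / 4); [lra|]. unfold Rdiv at 1. rewrite Rmult_assoc, Rinv_l by lra. lra. }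
    set (k := <|V sg a' be' - V sg a be|> / (be / 4)) in *.
    nra. }
  (* One descent by [7/8] multiplies the bound by [Q < 1]; [K1] is the sum of the resulting
     series. *)
  set (Q := b4 (7 / 8)).
  assert (Q1 : Q < 1).
  {  rewrite <- exp_0. apply exp_increasing. assert (ln (7/8) < ln 1) by (apply ln_increasing; lra). rewrite ln_1 in H. lra. }
  assert (Q0 : 0 < Q) by apply b4_pos.
  set (K1 := 2 * K / (1 - Q)).
  assert (EK1 : K1 * (1 - Q) = 2 * K) by (unfold K1; field; lra).
  assert (KK : 2 * K <= K1) by nra.
  assert (VD : forall a be be', <|V sg a be - V sg a be'|> <= Rabs (be - be')).
  { intros a be be'. eapply Rle_trans; [apply V_dist; auto|]. rewrite Rminus_diag, Rabs_R0. lra. }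
  assert (Chain : forall k a be be', a1 <= a <= a2 -> 0 < be < rho / 4 -> be * (7/8) ^ k < be' <= be ->
    <|f (V sg a be') t - f (V sg a be) t|> <= K1 * b4 be).
  { induction k as [|k IH]; intros a be be' Hax Hbe Hb'.
    - rewrite pow_O in Hb'. lra.
    - assert (Bp := b4_pos be).
      destruct (Rle_lt_dec (7/8 * be) be') as [L|L].
      + eapply Rle_trans; [apply Step; auto|apply Rmult_le_compat_r; lra]. eapply Rle_trans; [apply VD|]. rewrite Rabs_left1 by lra. lra.
      + simpl in Hb'.
        assert (S1 := Step a be a (7/8 * be) Hax Hbe).
        specialize (S1 ltac:(eapply Rle_trans; [apply VD|]; rewrite Rabs_left1; lra)).
        assert (S2 := IH a (7/8 * be) be' Hax lra lra).
        rewrite b4_mult in S2 by lra. fold Q in S2.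
        assert (T3 := Cmod_tri3 (f (V sg a be') t) (f (V sg a (7/8*be)) t) (f (V sg a be) t)). nra. }
  exists (K1 + 2 * K). split; [lra|]. intros a a' be be' Hax Hax' Hb' Hbe Hd.
  assert (P78 : exists k, be * (7/8) ^ k < be').
  { destruct (pow_lt_1_zero (7/8) ltac:(rewrite Rabs_pos_eq; lra) (be' / be)) as (k & Hk); [apply Rdiv_lt_0_compat; lra|].
    exists k. specialize (Hk k lia). rewrite Rabs_pos_eq in Hk by (apply pow_le; lra).
    apply (Rmult_lt_compat_l be) in Hk; [|lra]. unfold Rdiv in Hk. replace (be * (be' * / be)) with be' in Hk by (field; lra). exact Hk. }
  destruct P78 as (k & Hk).
  assert (S2 := Chain k a' be be' Hax' lra lra).
  assert (S1 := Step a be a' be Hax lra).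
  specialize (S1 ltac:(eapply Rle_trans; [apply V_dist; auto|]; rewrite (Rminus_diag be), Rabs_R0; lra)).
  assert (T3 := Cmod_tri3 (f (V sg a' be') t) (f (V sg a' be) t) (f (V sg a be) t)). lra.
Qed.

(** Two-constants argument: [log |f - l|] would be [-oo] on an arc of the boundary. *)
Lemma no_collapse t a1 a2 rho sg (l K : R) : good_strip t a1 a2 rho -> sg * sg = 1 -> 0 < K ->
  (forall a be, a1 <= a <= a2 -> 0 < be < rho / 4 -> <|f (V sg a be) t - RtoC l|> <= K * b4 be) -> False.
Proof.
  intros (Ht & Hr & Ha & Ha1 & Ha2 & HI) S HK HV.
  assert (HtT : 0 <= t <= T) by lra.
  set (am := (a1 + a2) / 2). set (ka := Rmin ((a2 - a1) / 8) (rho / 40)).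
  assert (ka0 : 0 < ka) by (apply Rmin_pos; lra).
  assert (ka1 : ka <= (a2 - a1) / 8) by apply Rmin_l. assert (ka2 : ka <= rho / 40) by apply Rmin_r.
  (* The centre lies at depth [ka] on the other side of the curve, so the disc of radius [2 ka] cuts
     a cap out of the side [sg], bounded by the curve and a circular arc. *)
  set (z1 := V sg am (- ka)).
  assert (H1 : sg * ht z1 = - ka). { unfold z1. rewrite ht_V. replace (sg * (sg * - ka)) with (sg * sg * - ka) by ring. rewrite S. ring. }
  set (W := fun y => 0 < sg * ht y /\ <|y - z1|> < 2 * ka).
  assert (WV : forall y, W y -> a1 <= ca th y <= a2 /\ 0 < sg * ht y < rho / 4 /\ y = V sg (ca th y) (sg * ht y)).
  { intros y (Y1 & Y2). assert (A := ca_lip th y z1). unfold z1 in A. rewrite ca_V in A. fold z1 in A. apply Rabs_le_between in A.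
    assert (L := sg_ht_lip sg z1 y S). rewrite (Cmod_sub_sym z1) in L. rewrite H1 in L.
    split; [unfold am in A; lra|]. split; [lra|]. apply V_of; auto. }
  assert (SW : forall y, W y -> slit gamma t y).
  { intros y Hy. destruct (WV y Hy) as (A & B & E). apply (ball_slit t sg (ca th y) rho y Ht S (fun v => HI (ca th y) v A)); [lra|].
    rewrite E at 1. eapply Rle_lt_trans; [apply VG_dist; auto; lra|]. lra. }
  assert (OW : copen W).
  { intros y (Y1 & Y2). exists (Rmin (sg * ht y / 2) (2 * ka - <|y - z1|>)). split; [apply Rmin_pos; lra|].
    intros v Hv. destruct (Rmin2 _ _ _ Hv) as (V1 & V2). split.
    - assert (L := sg_ht_lip sg y v S). rewrite (Cmod_sub_sym y) in L. lra.
    - eapply Rle_lt_trans; [apply (Cmod_tri3 v y z1)|]. lra. }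
  assert (FW : forall y, W y -> <|f y t - RtoC l|> <= K * b4 (sg * ht y) /\ 0 < <|f y t - RtoC l|>).
  { intros y Hy. destruct (WV y Hy) as (A & B & E). split.
    - rewrite E at 1. apply HV; auto.
    - assert (I := ch_map CH t y HtT (SW y Hy)). assert (I2 := Im_le_dist (f y t) l I). lra. }
  set (C1 := ln (K * b4 (rho / 4))).
  assert (LnC : forall y, W y -> ln (<|f y t - RtoC l|>) <= C1).
  { intros y Hy. destruct (FW y Hy) as (F1 & F2). destruct (WV y Hy) as (A & B & E). apply ln_le; auto.
    eapply Rle_trans; [exact F1|]. apply Rmult_le_compat_l; [lra|]. apply b4_le; lra. }
  assert (Low : forall y, W y -> ka / 2 <= <|y - z1|>).
  { intros y (Y1 & Y2). assert (L := sg_ht_lip sg z1 y S). rewrite (Cmod_sub_sym z1) in L. rewrite H1 in L. lra. }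
  set (zs := V sg am (ka / 2)).
  assert (Ws : W zs).
  { split; unfold zs.
    - rewrite ht_V. replace (sg * (sg * (ka / 2))) with (sg * sg * (ka/2)) by ring. rewrite S. lra.
    -  eapply Rle_lt_trans; [apply V_dist; auto|]. rewrite Rminus_diag, Rabs_R0, Rabs_pos_eq by lra. lra. }
  assert (L43 : 0 < ln (4 / 3)) by (rewrite <- ln_1; apply ln_increasing; lra).
  (* On the circular arc the term with [M] vanishes; on the curve [ln |f - l|] tends to minus
     infinity and beats it for every [M]. At [zs], well inside the circle, the term is at least
     [M * ln (4 / 3)], so a large [M] gives a contradiction. *)
  assert (Main : forall M, 0 < M -> ln (<|f zs t - RtoC l|>) + M * (ln (2 * ka) - ln (<|zs - z1|>)) - C1 <= 0).
  { intros M HM.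
    apply (max_principle W (fun y => ln (<|f y t - RtoC l|>) + M * (ln (2 * ka) - ln (<|y - z1|>)) - C1)
      (M * (ln (2 * ka) - ln (ka / 2))) nil); auto.
    - intros y Hy. apply (@slit_H gamma t); auto.
    - apply (harm_minus W (fun y => ln (<|f y t - RtoC l|>) + M * (ln (2 * ka) - ln (<|y - z1|>))) (fun _ => C1)); [|apply harm_const].
      apply harm_plus.
      + apply harm_lnCmod; auto.
        * intros y Hy E. destruct (FW y Hy) as (_ & F2). rewrite E, Cmod_0 in F2. lra.
        * apply holo_plus; [|apply holo_const]. apply (holo_sub 2 W (slit gamma t)); auto. apply (f_holo CH); auto.
      + apply (harm_scal W (fun y => ln (2 * ka) - ln (<|y - z1|>))). apply (harm_minus W (fun _ => ln (2 * ka))); [apply harm_const|].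
        apply harm_lnCmod; auto.
        * intros y Hy E. specialize (Low y Hy). rewrite E, Cmod_0 in Low. lra.
        * apply holo_plus; [apply holo_id|apply holo_const].
    - intros y Hy. specialize (LnC y Hy). specialize (Low y Hy).
      assert (ln (ka / 2) <= ln (<|y - z1|>)) by (apply ln_le; lra). nra.
    - intros ze e Nze _ _ He.
      destruct (Rle_lt_dec (2 * ka) (<|ze - z1|>)) as [L|L].
      + assert (Ee : exp (- (e / M)) < 1) by (rewrite <- exp_0; apply exp_increasing; assert (0 < e / M) by (apply Rdiv_lt_0_compat; auto); lra).
        assert (Pe := exp_pos (- (e / M))).
        exists (2 * ka * (1 - exp (- (e / M)))). split; [apply Rmult_lt_0_compat; lra|]. intros y Hy Hd.
        assert (T1 := Cmod_tri3 ze y z1). rewrite (Cmod_sub_sym ze y) in T1.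
        assert (X : ln (2 * ka * exp (- (e / M))) <= ln (<|y - z1|>)) by (apply ln_le; [apply Rmult_lt_0_compat; lra|lra]).
        rewrite ln_mult, ln_exp in X by lra. specialize (LnC y Hy).
        assert (M * (e / M) = e) by (field; lra). nra.
      + assert (Hs : sg * ht ze <= 0) by (apply Rnot_lt_le; intros Q; apply Nze; split; auto).
        set (E0 := exp (C1 - M * (ln (2 * ka) - ln (ka / 2))) / K).
        assert (E00 : 0 < E0) by (apply Rdiv_lt_0_compat; [apply exp_pos|auto]).
        destruct (b4_small E0 E00) as (d & D & HD). exists (d / 2). split; [lra|]. intros y Hy Hdy.
        destruct (WV y Hy) as (A & B & E). destruct (FW y Hy) as (F1 & F2).
        assert (L2 := sg_ht_lip sg ze y S). rewrite (Cmod_sub_sym ze) in L2.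
        specialize (HD (sg * ht y) lra). specialize (Low y Hy).
        assert (X1 : ln (ka / 2) <= ln (<|y - z1|>)) by (apply ln_le; lra).
        assert (X2 : ln (<|f y t - RtoC l|>) <= C1 - M * (ln (2 * ka) - ln (ka / 2))).
        { rewrite <- (ln_exp (C1 - _)). apply ln_le; auto. eapply Rle_trans; [exact F1|].
          apply Rlt_le, Rlt_le_trans with (K * E0); [apply Rmult_lt_compat_l; auto|]. unfold E0. right. field. lra. }
        nra. }
  assert (D32 : <|zs - z1|> <= 3 / 2 * ka).
  {  eapply Rle_trans; [apply V_dist; auto|]. rewrite Rminus_diag, Rabs_R0, Rabs_pos_eq by lra. lra. }
  assert (Lz : ln (<|zs - z1|>) <= ln (2 * ka) - ln (4 / 3)).
  { replace (ln (2 * ka)) with (ln (4 / 3) + ln (3 / 2 * ka)) by (rewrite <- ln_mult by lra; f_equal; field).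
    assert (ln (<|zs - z1|>) <= ln (3 / 2 * ka)) by (apply ln_le; auto; specialize (Low zs Ws); lra). lra. }
  set (A := C1 - ln (<|f zs t - RtoC l|>)).
  assert (A0 : 0 <= A) by (unfold A; specialize (LnC zs Ws); lra).
  specialize (Main ((A + 1) / ln (4 / 3)) ltac:(apply Rdiv_lt_0_compat; lra)).
  assert (X : (A + 1) / ln (4 / 3) * ln (4 / 3) = A + 1) by (field; lra).
  assert (0 < (A + 1) / ln (4 / 3)) by (apply Rdiv_lt_0_compat; lra).
  assert ((A + 1) / ln (4 / 3) * ln (4 / 3) <= (A + 1) / ln (4 / 3) * (ln (2 * ka) - ln (<|zs - z1|>))) by (apply Rmult_le_compat_l; lra).
  unfold A in *. lra.
Qed.

(** Slopes at most [/ 4] make consecutive increments nearly parallel. Hence each circle around the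
    tip meets the curve at most once, which [tip_only] uses to locate cluster points. *)
Lemma tip_dist_mono s s' t : 0 <= s -> s < s' -> s' < t -> t <= t0 ->
  <|gamma s' - gamma t|> < <|gamma s - gamma t|>.
Proof.
  intros H0 H1 H2 H3.
  destruct (GL s s' lra lra lra) as (A1 & A2).
  destruct (GL s' t lra lra lra) as (B1 & B2).
  assert (E1 := rot_sqr th (gamma s') (gamma t)). assert (E2 := rot_sqr th (gamma s) (gamma t)).
  set (x := ca th (gamma t) - ca th (gamma s')) in *. set (y := ca th (gamma s') - ca th (gamma s)) in *.
  set (p := cb th (gamma t) - cb th (gamma s')) in *. set (q := cb th (gamma s') - cb th (gamma s)) in *.
  replace (ca th (gamma s') - ca th (gamma t)) with (- x) in E1 by (unfold x; ring).
  replace (cb th (gamma s') - cb th (gamma t)) with (- p) in E1 by (unfold p; ring).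
  replace (ca th (gamma s) - ca th (gamma t)) with (- (x + y)) in E2 by (unfold x, y; ring).
  replace (cb th (gamma s) - cb th (gamma t)) with (- (p + q)) in E2 by (unfold p, q; ring).
   assert (P2 := Cmod_ge_0 (gamma s - gamma t)%C).
  assert (X0 : 0 < x) by (unfold x; lra). assert (Y0 : 0 < y) by (unfold y; lra).
  assert (A2' : Rabs q <= / 4 * y) by (eapply Rle_trans; [exact A2|apply Rmult_le_compat_r; lra]).
  assert (B2' : Rabs p <= / 4 * x) by (eapply Rle_trans; [exact B2|apply Rmult_le_compat_r; lra]).
  apply Rabs_le_between in A2'. apply Rabs_le_between in B2'.
  assert (PQ : - (/ 16 * (x * y)) <= p * q).
  { assert (Q := Rabs_mult p q). assert (Rabs p * Rabs q <= (/ 4 * x) * (/ 4 * y)).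
    { apply Rmult_le_compat; try apply Rabs_pos; apply Rabs_le; lra. }
    rewrite <- Q in H. apply Rabs_le_between in H. lra. }
  assert (0 < x * y) by (apply Rmult_lt_0_compat; auto).
  assert (<|gamma s' - gamma t|> * <|gamma s' - gamma t|> < <|gamma s - gamma t|> * <|gamma s - gamma t|>).
  { rewrite E1, E2. assert (0 < y * y) by (apply Rmult_lt_0_compat; auto). assert (0 <= q * q) by nra. lra. }
  nra.
Qed.

Lemma tip_dist_inj s s' t : 0 <= s <= t -> 0 <= s' <= t -> t <= t0 ->
  <|gamma s' - gamma t|> = <|gamma s - gamma t|> -> s = s'.
Proof.
  intros Hs Hs' Ht E.
  assert (P : forall r, 0 <= r < t -> 0 < <|gamma r - gamma t|>).
  { intros r Hr. apply Cmod_gt_0. intros K. apply Csub0 in K. apply (ch_simple CH) in K; lra. }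
  destruct (Req_dec s t) as [->|N1].
  - destruct (Req_dec s' t) as [->|N2]; auto. specialize (P s' lra). rewrite E, Cmod_sub_0 in P. lra.
  - destruct (Req_dec s' t) as [->|N2]. { specialize (P s lra). rewrite <- E, Cmod_sub_0 in P. lra. }
    destruct (Rtotal_order s s') as [Q|[Q|Q]]; auto.
    + assert (X := tip_dist_mono s s' t). lra.
    + assert (X := tip_dist_mono s' s t). lra.
Qed.

Lemma pull_segment t w0 w1 (p : C) (d : R) : 0 <= t <= T -> 0 < Im w0 -> 0 < Im w1 ->
  <|F t w0 - p|> <= d <= <|F t w1 - p|> ->
  exists x, 0 <= x <= 1 /\ <|F t (w0 + RtoC x * (w1 - w0))%C - p|> = d.
Proof.
  intros Ht H0 H1 Hd.
  assert (Pos : forall x, 0 <= x <= 1 -> 0 < Im (w0 + RtoC x * (w1 - w0))%C).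
  { intros x Hx. rewrite im_plus, im_scal_l, im_minus. destruct (Req_dec x 0) as [->|]; nra. }
  assert (W : wcont 0 1 (fun x => <|F t (w0 + RtoC x * (w1 - w0))%C - p|>)).
  { apply (wcont_C2 0 1 (fun w => <|F t w - p|>) (fun x => w0 + RtoC x * (w1 - w0))%C).
    - intros x Hx. apply (rcont_Cmod (fun w => F t w - p)%C).
      apply ccont_plus; [|apply ccont_const]. apply (F_cont CH); auto.
    - apply wcontC_plus; [apply wcontC_cst|]. apply wcontC_mult; [|apply wcontC_cst].
      apply wcontC_of; simpl; [|apply wcont_cst]. apply wcont_of_continuity. intros; apply derivable_continuous_pt, derivable_pt_id. }
  destruct (IVT_gen_consistent (fun y => <|F t (w0 + RtoC (clamp 0 1 y) * (w1 - w0))%C - p|>) 0 1 d) as (x & Hx & E).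
  - intros x. apply continuous_continuity_pt, (wcont_clamp 0 1 _ x lra W).
  - rewrite !clamp_id by lra. replace (w0 + 0 * (w1 - w0))%C with w0 by ring. replace (w0 + 1 * (w1 - w0))%C with w1 by ring.
    rewrite Rmin_left, Rmax_right by lra. lra.
  - rewrite Rmin_left, Rmax_right in Hx by lra. rewrite clamp_id in E by lra. exists x. split; auto.
Qed.

Lemma lam_0 : lam 0 = 0.
Proof.
  apply NNPP. intros N. assert (P : 0 < Rabs (lam 0)) by (apply Rabs_pos_lt; auto).
  destruct (ch_tip CH 0 (Rabs (lam 0) / 2) lra lra) as (d & D & K).
  set (y := Rmin d (Rabs (lam 0) / 2) / 2). assert (M0 : 0 < Rmin d (Rabs (lam 0) / 2)) by (apply Rmin_pos; lra).
  assert (M1 := Rmin_l d (Rabs (lam 0) / 2)). assert (M2 := Rmin_r d (Rabs (lam 0) / 2)).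
  set (zz := (Ci * RtoC y)%C).
  assert (Iz : Im zz = y) by (unfold zz, Im; simpl; ring).
  assert (Cz : Cmod zz = y) by (unfold zz; rewrite Cmod_mult, Cmod_Ci, Cmod_R, Rabs_pos_eq; unfold y; lra).
  assert (Sz : slit gamma 0 zz).
  { split; [unfold Hplane; rewrite Iz; unfold y; lra|]. intros (s & Hs & E). unfold Icc in Hs. replace s with 0 in E by lra.
    rewrite (ch_g0 CH) in E. rewrite E, Cmod_0 in Cz. unfold y in Cz. lra. }
  specialize (K zz Sz). rewrite (ch_g0 CH), (ch_0 CH) in K by (rewrite Iz; unfold y; lra).
  replace (zz - 0)%C with zz in K by ring.
  assert (X := Cmod_rev (RtoC (lam 0)) zz). rewrite Cmod_R, Cmod_sub_sym in X. unfold y in Cz. lra.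
Qed.

(** Otherwise points far from the tip have images near [lam t]. Joining such an image to the image
    of a point near the tip by a short segment and pulling back shows that [lam t] is a cluster
    value of [f] at every curve point near the tip. By [osc], [f] would have the constant boundary
    value [lam t] on one side of an arc, against [no_collapse]. *)
Theorem tip_only t e : 0 <= t < t0 -> 0 < e -> exists r, 0 < r /\ forall z, slit gamma t z ->
  <|f z t - RtoC (lam t)|> < r -> <|z - gamma t|> < e.
Proof.
  intros Ht He. assert (HtT : 0 <= t <= T) by lra.
  destruct (Req_dec t 0) as [->|Nt].
  { exists e. split; auto. intros z Hz. rewrite (ch_0 CH z (@slit_H gamma 0 z Hz)), lam_0, (ch_g0 CH). auto. }
  apply NNPP. intros N.
  assert (XS : forall r, 0 < r -> exists z, slit gamma t z /\ <|f z t - RtoC (lam t)|> < r /\ e <= <|z - gamma t|>).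
  { intros r Hr. apply NNPP. intros K. apply N. exists r. split; auto. intros z H1 H2. apply Rnot_le_lt. intros H3. apply K. exists z. auto. }
  set (P := gamma t) in *. assert (IP : 0 < Im P) by (apply (ch_gH CH); lra).
  set (e1 := Rmin e (Im P)). assert (E1 : 0 < e1) by (apply Rmin_pos; auto).
  (* lam t is a cluster value of f at every point of the curve close to the tip *)
  assert (Cl : forall s, 0 <= s < t -> <|gamma s - P|> < e1 -> forall r, 0 < r -> exists z, slit gamma t z /\
    <|z - gamma s|> < r /\ <|f z t - RtoC (lam t)|> < r).
  { intros s Hs Hd. set (d := <|gamma s - P|>) in *.
    assert (D0 : 0 < d). { apply Cmod_gt_0. intros K. apply Csub0 in K. apply (ch_simple CH) in K; lra. }
    assert (De : d < e) by (eapply Rlt_le_trans; [exact Hd|apply Rmin_l]).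
    assert (DI : d < Im P) by (eapply Rlt_le_trans; [exact Hd|apply Rmin_r]).
    (* Both ends of the segment are close to [lam t], hence so is all of it; its preimage runs from
       near the tip to distance at least [e] and crosses the circle of radius [d]. *)
    assert (Y : forall n : nat, exists z, slit gamma t z /\ <|f z t - RtoC (lam t)|> < / (INR n + 1) /\ <|z - P|> = d).
    { intros n. set (r := / (INR n + 1)). assert (R0 : 0 < r) by (apply Rinv_0_lt_compat; assert (Q := pos_INR n); lra).
      destruct (XS r R0) as (z1 & Z1 & Z2 & Z3).
      destruct (ch_tip CH t r HtT R0) as (dl & Dl & HT).
      assert (HP : exists y, slit gamma t y /\ <|y - P|> < Rmin dl d).
      { assert (M0 : 0 < Rmin dl d) by (apply Rmin_pos; auto).
        set (k := Rmin (Rmin dl d / 2) (Im P / 2)). assert (k0 : 0 < k) by (apply Rmin_pos; lra).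
        assert (k1 : k <= Rmin dl d / 2) by apply Rmin_l. assert (k2 : k <= Im P / 2) by apply Rmin_r.
        set (y := V 1 (ca th P) k).
        assert (Gy : G (ca th P) = P) by (apply G_gamma; lra).
        assert (Dy : <|y - P|> <= k). { rewrite <- Gy.  apply VG_dist; lra. }
        exists y. split; [|lra]. apply slit_of_ht; [lra| |unfold y; rewrite ht_V; lra].
        assert (A := im_le_Cmod (y - P)%C). rewrite im_minus in A. apply Rabs_le_between in A. lra. }
      destruct HP as (y & Y1 & Y2).
      destruct (Rmin2 _ _ _ Y2) as (Y3 & Y4).
      specialize (HT y Y1 Y3).
      assert (I0 := ch_map CH t y HtT Y1). assert (I1 := ch_map CH t z1 HtT Z1).
      destruct (pull_segment t (f y t) (f z1 t) P d HtT I0 I1) as (x & Hx & E).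
      { rewrite !(F_f CH) by auto. lra. }
      set (w := (f y t + RtoC x * (f z1 t - f y t))%C) in *.
      assert (Iw : 0 < Im w).
      { unfold w. rewrite im_plus, im_scal_l, im_minus. destruct (Req_dec x 0) as [->|]; nra. }
      destruct (F_spec CH t w HtT Iw) as (W1 & W2). exists (F t w). split; auto. split; auto.
      rewrite W2. unfold w.
      replace (f y t + RtoC x * (f z1 t - f y t) - RtoC (lam t))%C
        with (RtoC (1 - x) * (f y t - RtoC (lam t)) + RtoC x * (f z1 t - RtoC (lam t)))%C by (apply Ceq; unfold Re, Im; simpl; ring).
      eapply Rle_lt_trans; [apply Cmod_triangle|]. rewrite !Cmod_mult, !Cmod_R, !Rabs_pos_eq by lra.
      destruct (Req_dec x 0) as [->|]; nra. }
    destruct (ClassicalEpsilon.choice _ Y) as (zn & Hz).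
    destruct (cluster_point zn (Cmod P + d)) as (ze & Hze).
    { intros n. destruct (Hz n) as (_ & _ & E). assert (X := Cmod_rev (zn n) P). lra. }
    assert (Dz : <|ze - P|> = d).
    { apply Rle_antisym; apply Rnot_lt_le; intros L.
      - destruct (Hze (<|ze - P|> - d) 0%nat lra) as (n & _ & Hn). destruct (Hz n) as (_ & _ & E).
        assert (X := Cmod_tri3 ze (zn n) P). rewrite (Cmod_sub_sym ze (zn n)) in X. lra.
      - destruct (Hze (d - <|ze - P|>) 0%nat lra) as (n & _ & Hn). destruct (Hz n) as (_ & _ & E).
        assert (X := Cmod_tri3 (zn n) ze P). lra. }
    assert (Iz : 0 < Im ze).
    { assert (A := im_le_Cmod (ze - P)%C). rewrite im_minus in A. apply Rabs_le_between in A. lra. }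
    assert (Ns : ~ slit gamma t ze).
    { intros Sz. assert (I := ch_map CH t ze HtT Sz).
      destruct (ch_cont CH t ze HtT Sz (Im (f ze t) / 2) lra) as (dl & Dl & K).
      destruct (inv_small (Im (f ze t) / 2) lra) as (N1 & HN1).
      destruct (Hze dl N1 Dl) as (n & Hn & Hd2). specialize (K _ Hd2). specialize (HN1 n Hn).
      destruct (Hz n) as (_ & E & _).
      assert (A := im_le_Cmod (f (zn n) t - f ze t)%C). rewrite im_minus in A. apply Rabs_le_between in A.
      assert (A2 := im_le_Cmod (f (zn n) t - RtoC (lam t))%C). rewrite im_minus in A2. simpl in A2. apply Rabs_le_between in A2. lra. }
    assert (Tz : trace gamma t ze) by (apply NNPP; intros K; apply Ns; split; auto).
    destruct Tz as (s' & Hs' & ->). unfold Icc in Hs'.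
    (* The cluster point is on the curve at distance [d] from the tip, and there is only one such
       point. *)
    assert (s = s') by (apply (tip_dist_inj s s' t); try lra; exact Dz). subst s'.
    intros r Hr. destruct (inv_small r Hr) as (N1 & HN1). destruct (Hze r N1 Hr) as (n & Hn & Hd2).
    exists (zn n). destruct (Hz n) as (Z1 & Z2 & _). specialize (HN1 n Hn). split; [|split]; auto; lra. }
  set (A := ca th P) in *. assert (EA : ca th (gamma t) = A) by reflexivity.
  assert (A0 : 0 < A). {  rewrite <- ca_g0. apply GL; lra. }
  set (alo := Rmax (A / 2) (A - e1 / 4)).
  assert (Hlo : alo < A) by (unfold alo; apply Rmax_lub_lt; lra).
  assert (Hlo2 : A / 2 <= alo) by apply Rmax_l. assert (Hlo3 : A - e1 / 4 <= alo) by apply Rmax_r.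
  assert (GP : G A = P) by (apply G_gamma; lra).
  set (Sd := fun sg a => forall r, 0 < r -> exists z, slit gamma t z /\ 0 < sg * ht z /\ <|z - G a|> < r /\ <|f z t - RtoC (lam t)|> < r).
  assert (Cl2 : forall a, alo < a < A -> forall r, 0 < r -> exists z, slit gamma t z /\ <|z - G a|> < r /\ <|f z t - RtoC (lam t)|> < r).
  { intros a Hax. destruct (ca_onto t a lra ltac:(rewrite EA; lra)) as (s & Hs & E).
    assert (Gs : G a = gamma s) by (rewrite <- E; apply G_gamma; lra).
    rewrite Gs. apply Cl.
    - split; [lra|]. destruct Hs as (_ & [Hs| ->]); auto. exfalso. rewrite EA in E. lra.
    - rewrite <- Gs, <- GP. eapply Rle_lt_trans; [apply G_lip|]. rewrite Rabs_left1 by lra. lra. }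
  assert (Or : forall a, alo < a < A -> Sd 1 a \/ Sd (-1) a).
  { intros a Hax. apply NNPP. intros K. apply not_or_and in K. destruct K as (K1 & K2).
    apply not_all_ex_not in K1. destruct K1 as (r1 & K1). apply imply_to_and in K1. destruct K1 as (R1 & K1).
    apply not_all_ex_not in K2. destruct K2 as (r2 & K2). apply imply_to_and in K2. destruct K2 as (R2 & K2).
    set (r := Rmin (Rmin r1 r2) (Rmin (a - alo) (A - a))).
    assert (r0 : 0 < r) by (repeat apply Rmin_pos; lra).
    assert (M1 : r <= r1) by (eapply Rle_trans; [apply Rmin_l|apply Rmin_l]).
    assert (M2 : r <= r2) by (eapply Rle_trans; [apply Rmin_l|apply Rmin_r]).
    assert (M4 : r <= A - a) by (eapply Rle_trans; [apply Rmin_r|apply Rmin_r]).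
    destruct (Cl2 a Hax r r0) as (z & Z1 & Z2 & Z3).
    assert (Cz := ca_lip th z (G a)). rewrite ca_G in Cz. apply Rabs_le_between in Cz.
    destruct (Rtotal_order (ht z) 0) as [Q|[Q|Q]].
    - apply K2. exists z. split; [|split; [|split]]; auto; lra.
    - apply (proj2 Z1). apply trace_iff; [lra|]. split; auto. rewrite EA. lra.
    - apply K1. exists z. split; [|split; [|split]]; auto; lra. }
  assert (Open : forall sg a, ~ Sd sg a -> exists d, 0 < d /\ forall a', Rabs (a' - a) < d -> ~ Sd sg a').
  { intros sg a K. apply not_all_ex_not in K. destruct K as (r & K). apply imply_to_and in K. destruct K as (R0 & K).
    exists (r / 4). split; [lra|]. intros a' Ha' K'. destruct (K' (r / 2) lra) as (z & Z1 & Z2 & Z3 & Z4).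
    apply K. exists z. split; [|split; [|split]]; auto; [|lra].
    assert (X := Cmod_tri3 z (G a') (G a)). assert (L := G_lip a' a). lra. }
  (* Approach from side 1 fails on an open set of positions. Either it never fails, or near a
     failure side -1 works throughout, so one side works on a whole interval. *)
  assert (Int : exists sg b1 b2, sg * sg = 1 /\ alo < b1 < b2 /\ b2 < A /\ forall a, b1 <= a <= b2 -> Sd sg a).
  { destruct (classic (forall a, alo < a < A -> Sd 1 a)) as [K|K].
    - exists 1, (alo + (A - alo) / 4), (alo + (A - alo) / 2). split; [lra|]. split; [lra|]. split; [lra|]. intros a Hax. apply K. lra.
    - apply not_all_ex_not in K. destruct K as (a & K). apply imply_to_and in K. destruct K as (Hax & K).
      destruct (Open 1 a K) as (d & D & HD).
      set (d1 := Rmin d (A - a) / 2). assert (M0 : 0 < Rmin d (A - a)) by (apply Rmin_pos; lra).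
      assert (M1 := Rmin_l d (A - a)). assert (M2 := Rmin_r d (A - a)).
      exists (-1), (a + d1 / 2), (a + d1). unfold d1. split; [lra|]. split; [lra|]. split; [lra|]. intros a' Ha'.
      destruct (Or a' lra) as [Q|Q]; auto. exfalso. apply (HD a'); auto. rewrite Rabs_pos_eq; lra. }
  destruct Int as (sg & b1 & b2 & S & Hb & Hb2 & HS).
  set (rho := Rmin (Rmin (b1 / 2) ((A - b2) / 2)) (e1 / 4)).
  assert (r0 : 0 < rho) by (repeat apply Rmin_pos; lra).
  assert (r2 : rho <= (A - b2) / 2) by (eapply Rle_trans; [apply Rmin_l|apply Rmin_r]).
  assert (GS : good_strip t b1 b2 rho).
  { split; [lra|]. split; [lra|]. split; [lra|]. split; [lra|]. split; [rewrite EA; lra|]. intros a y Hax Hy.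
    assert (L := G_lip a A). rewrite GP, Rabs_left1 in L by lra.
    assert (X := Cmod_tri3 y (G a) P). assert (Y := im_le_Cmod (y - P)%C). rewrite im_minus in Y. apply Rabs_le_between in Y.
    assert (e1 <= Im P) by apply Rmin_r. lra. }
  destruct (osc t b1 b2 rho sg GS S) as (K & K0 & HK).
  set (c1 := b1 + (b2 - b1) / 4). set (c2 := b1 + (b2 - b1) / 2).
  assert (GS2 : good_strip t c1 c2 rho).
  { destruct GS as (g1 & g2 & g3 & g4 & g5 & g6). unfold good_strip, c1, c2. split; [auto|]. split; [auto|]. split; [lra|]. split; [lra|].
    split; [lra|]. intros a y Hax. apply g6. lra. }
  apply (no_collapse t c1 c2 rho sg (lam t) K GS2 S K0).
  intros a be Hax Hbe. apply Rnot_lt_le. intros L.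
  set (g := <|f (V sg a be) t - RtoC (lam t)|> - K * b4 be).
  set (r := Rmin (Rmin (be / 16) g) (Rmin ((b2 - b1) / 8) (be / 4))).
  assert (g0 : 0 < g) by (unfold g; lra).
  assert (r00 : 0 < r) by (repeat apply Rmin_pos; unfold c1, c2 in *; lra).
  assert (q1 : r <= be / 16) by (eapply Rle_trans; [apply Rmin_l|apply Rmin_l]).
  assert (q2 : r <= g) by (eapply Rle_trans; [apply Rmin_l|apply Rmin_r]).
  assert (q3 : r <= (b2 - b1) / 8) by (eapply Rle_trans; [apply Rmin_r|apply Rmin_l]).
  destruct (HS a ltac:(unfold c1, c2 in *; lra) r r00) as (z & Z1 & Z2 & Z3 & Z4).
  assert (Cz := ca_lip th z (G a)). rewrite ca_G in Cz.
  assert (Cz2 := Cz). apply Rabs_le_between in Cz2.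
  assert (Hz := sg_ht_lip sg (G a) z S). rewrite ht_G, (Cmod_sub_sym (G a)), Rmult_0_r in Hz.
  assert (X := HK a (ca th z) be (sg * ht z)).
  rewrite <- (V_of z sg S) in X.
  specialize (X ltac:(unfold c1, c2 in *; lra) ltac:(unfold c1, c2 in *; lra) lra lra lra).
  assert (Y := Cmod_tri3 (f (V sg a be) t) (f z t) (RtoC (lam t))). rewrite (Cmod_sub_sym (f (V sg a be) t) (f z t)) in Y.
  unfold g in q2. lra.
Qed.

Lemma lam_wcont s t : 0 <= s -> t <= T -> wcont s t lam.
Proof. intros. apply (wcont_sub 0 T); auto. apply (ch_lam CH). Qed.

Lemma gam_away s t ze : 0 <= s <= t -> t <= T -> (forall r, s <= r <= t -> gamma r <> ze) ->
  exists c, 0 < c /\ forall r, s <= r <= t -> c <= <|gamma r - ze|>.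
Proof.
  intros Hs Ht N. apply (wcont_min s t (fun r => <|gamma r - ze|>)); [lra| |].
  - apply (wcont_C2 s t (fun w => <|w - ze|>)).
    + intros x _. apply (rcont_Cmod (fun w => w - ze)%C), ccont_plus; [apply ccont_id|apply ccont_const].
    + apply (wcontC_sub 0 T); try lra. apply (ch_gam CH).
  - intros r Hr. apply Cmod_gt_0. intros K. apply (N r Hr), Csub0; auto.
Qed.

Lemma f_sub_sol s t z r : 0 <= s -> t <= r -> r <= T -> slit gamma r z -> s <= t -> sol lam s t (f z).
Proof. intros. apply (sol_sub lam 0 r); try lra. apply (ch_sol CH); auto; lra. Qed.

(** Compactness in time. If trajectories from points tending to [ze] came arbitrarily close to the
    driving function at times accumulating at [r], then by [short_time] they would also be close to
    it at time [r], and by [tip_only] the points would be near [gamma r], which differs from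
    [ze]. *)
Lemma away s t ze : 0 <= s <= t -> t < t0 -> (forall r, s <= r <= t -> gamma r <> ze) ->
  exists c, 0 < c /\ forall z, slit gamma t z -> <|z - ze|> < c -> forall r, s <= r <= t -> c <= <|f z r - RtoC (lam r)|>.
Proof.
  intros Hs Ht N. apply NNPP. intros K.
  assert (X : forall n : nat, exists p : C * R, slit gamma t (fst p) /\ <|fst p - ze|> < / (INR n + 1) /\ s <= snd p <= t /\
    <|f (fst p) (snd p) - RtoC (lam (snd p))|> < / (INR n + 1)).
  { intros n. apply NNPP. intros K2. apply K. exists (/ (INR n + 1)). split; [apply Rinv_0_lt_compat; assert (Q := pos_INR n); lra|].
    intros z Hz Hd r Hr. apply Rnot_lt_le. intros L. apply K2. exists (z, r). auto. }
  destruct (ClassicalEpsilon.choice _ X) as (pn & Hp).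
  destruct (cluster_point (fun n => RtoC (snd (pn n))) t) as (rs & Hrs).
  { intros n. rewrite Cmod_R, Rabs_pos_eq; destruct (Hp n) as (_ & _ & A & _); lra. }
  set (r := Re rs).
  assert (Hr' : forall d N0, 0 < d -> exists n, (N0 <= n)%nat /\ Rabs (snd (pn n) - r) < d).
  { intros d N0 D. destruct (Hrs d N0 D) as (n & Hn & Hd). exists n. split; auto.
    eapply Rle_lt_trans; [|exact Hd]. eapply Rle_trans; [|apply re_le_Cmod]. rewrite re_minus.  right. reflexivity. }
  assert (Hr : s <= r <= t).
  { split; apply Rnot_lt_le; intros L.
    - destruct (Hr' (s - r) 0%nat lra) as (n & _ & Hn). destruct (Hp n) as (_ & _ & A & _). apply Rabs_def2 in Hn. lra.
    - destruct (Hr' (r - t) 0%nat lra) as (n & _ & Hn). destruct (Hp n) as (_ & _ & A & _). apply Rabs_def2 in Hn. lra. }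
  set (e := <|gamma r - ze|>).
  assert (E0 : 0 < e) by (apply Cmod_gt_0; intros Q; apply (N r Hr), Csub0; auto).
  destruct (tip_only r (e / 2) lra lra) as (rho & R0 & HT).
  (* The squared distance at time [r] will be at most [4 dl^2 + 8 dl^2], which is less than
     [rho^2 = 25 dl^2]. *)
  set (dl := rho / 5). assert (dl0 : 0 < dl) by (unfold dl; lra).
  destruct (lam_wcont 0 T lra lra r dl lra dl0) as (eta & Et & HL).
  destruct (inv_small (Rmin dl (e / 2))) as (N1 & HN1); [apply Rmin_pos; lra|].
  destruct (Hr' (Rmin eta (dl * dl)) N1 ltac:(apply Rmin_pos; nra)) as (n & Hn & Hd).
  destruct (Hp n) as (Z1 & Z2 & Z3 & Z4). specialize (HN1 n Hn).
  destruct (Rmin2 _ _ _ HN1) as (A1 & A2).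
  destruct (Rmin2 _ _ _ Hd) as (B1 & B2).
  set (z := fst (pn n)) in *. set (q := snd (pn n)) in *.
  assert (Fq : <|f z q - RtoC (lam r)|> <= 2 * dl).
  { assert (T3 := Cmod_tri3 (f z q) (RtoC (lam q)) (RtoC (lam r))). rewrite Cmod_RR in T3. specialize (HL q lra B1). lra. }
  assert (Fr : <|f z r - RtoC (lam r)|> * <|f z r - RtoC (lam r)|> <= 4 * dl * dl + 8 * (dl * dl)).
  { assert (P0 := Cmod_ge_0 (f z q - RtoC (lam r))%C).
    assert (MX : Rmax (<|f z q - RtoC (lam r)|> * <|f z q - RtoC (lam r)|>) (4 * dl * dl) <= 4 * dl * dl) by (apply Rmax_lub; nra).
    destruct (Rle_lt_dec q r) as [L|L].
    - destruct (short_time lam q r (f z) (lam r) dl L (f_sub_sol q r z t lra lra lra Z1 L) lra) as (S1 & _).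
      + intros x Hx. apply Rlt_le, HL; [lra|]. rewrite Rabs_left1 in * by lra. lra.
      + rewrite Rabs_left1 in B2 by lra. lra.
    - destruct (short_time lam r q (f z) (lam r) dl lra (f_sub_sol r q z t lra lra lra Z1 lra) lra) as (_ & S1).
      + intros x Hx. apply Rlt_le, HL; [lra|]. rewrite Rabs_pos_eq in * by lra. lra.
      + rewrite Rabs_pos_eq in B2 by lra. lra. }
  assert (Fr2 : <|f z r - RtoC (lam r)|> < rho).
  {  unfold dl in Fr. nra. }
  specialize (HT z (slit_mono r t z lra Z1) Fr2).
  assert (T3 := Cmod_tri3 (gamma r) z ze). rewrite (Cmod_sub_sym (gamma r) z) in T3. fold e in T3. lra.
Qed.

(** * Boundary values of [f] on the real line and on the two sides of the curve *)

Definition lim_at (t : R) (N : C -> Prop) (ze : C) (l : R) : Prop :=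
  forall e, 0 < e -> exists d, 0 < d /\ forall z, slit gamma t z -> N z -> <|z - ze|> < d -> <|f z t - RtoC l|> < e.

Definition approachable (t : R) (N : C -> Prop) (ze : C) : Prop :=
  forall d, 0 < d -> exists z, slit gamma t z /\ N z /\ <|z - ze|> < d.

(** A cluster value exists since images of bounded sets are bounded; the Cauchy condition makes it a
    limit, and [f_proper] makes it real. *)
Lemma cauchy_limit t N ze : 0 <= t <= T -> ~ slit gamma t ze -> approachable t N ze ->
  (forall e, 0 < e -> exists d, 0 < d /\ forall z y, slit gamma t z -> slit gamma t y -> N z -> N y ->
     <|z - ze|> < d -> <|y - ze|> < d -> <|f z t - f y t|> < e) -> exists l, lim_at t N ze l.
Proof.
  intros Ht NS Ap Cau.
  assert (X : forall n : nat, exists z, slit gamma t z /\ N z /\ <|z - ze|> < / (INR n + 1)).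
  { intros n. apply Ap. apply Rinv_0_lt_compat. assert (Q := pos_INR n). lra. }
  destruct (ClassicalEpsilon.choice _ X) as (zn & Hz).
  destruct (f_growth CH) as (B & B0 & HB).
  destruct (cluster_point (fun n => f (zn n) t) (Cmod ze + 1 + B)) as (L & HL).
  { intros n. destruct (Hz n) as (S1 & _ & S2). destruct (HB t (zn n) Ht S1) as (Gr & _).
    assert (X1 := Cmod_rev (zn n) ze).
    assert (/ (INR n + 1) <= 1). { rewrite <- Rinv_1 at 2. apply Rinv_le_contravar; [lra|]. assert (P := pos_INR n). lra. } lra. }
  assert (LL : forall e, 0 < e -> exists d, 0 < d /\ forall z, slit gamma t z -> N z -> <|z - ze|> < d -> <|f z t - L|> < e).
  { intros e He. destruct (Cau (e/2) lra) as (d & D & K). exists d. split; auto. intros z Z1 Z2 Z3.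
    destruct (inv_small d D) as (N1 & HN1). destruct (HL (e/2) N1 lra) as (n & Hn & Hd). specialize (HN1 n Hn).
    destruct (Hz n) as (Y1 & Y2 & Y3). specialize (K z (zn n) Z1 Y1 Z2 Y2 Z3 lra).
    assert (T3 := Cmod_tri3 (f z t) (f (zn n) t) L). lra. }
  exists (Re L). unfold lim_at. replace (RtoC (Re L)) with L; [exact LL|].
  assert (Im L = 0).
  { apply NNPP. intros NI. assert (P : 0 < Rabs (Im L)) by (apply Rabs_pos_lt; auto).
    destruct (LL (Rabs (Im L) / 2) lra) as (d & D & K).
    destruct (f_proper CH t ze (Rabs (Im L) / 2) Ht NS lra) as (d2 & D2 & K2).
    destruct (Ap (Rmin d d2) ltac:(apply Rmin_pos; auto)) as (z & Z1 & Z2 & Z3).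
    specialize (K z Z1 Z2 (Rminl Z3)). specialize (K2 z (conj Z1 (Rminr Z3))).
    assert (A := im_le_Cmod (f z t - L)%C). rewrite im_minus in A. assert (I := ch_map CH t z Ht Z1).
    assert (T3 := Rabs_triang_inv (Im L) (Im (f z t))). rewrite Rabs_minus_sym in A. rewrite (Rabs_pos_eq (Im (f z t))) in T3 by lra. lra. }
  apply Ceq; simpl; auto.
Qed.

Lemma lim_at_unique t N ze l m : approachable t N ze -> lim_at t N ze l -> lim_at t N ze m -> l = m.
Proof.
  intros Ap H1 H2. apply NNPP. intros NE. assert (P : 0 < Rabs (l - m)) by (apply Rabs_pos_lt; lra).
  destruct (H1 (Rabs (l - m) / 2) lra) as (d & D & K). destruct (H2 (Rabs (l - m) / 2) lra) as (d2 & D2 & K2).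
  destruct (Ap (Rmin d d2) ltac:(apply Rmin_pos; auto)) as (z & Z1 & Z2 & Z3).
  specialize (K z Z1 Z2 (Rminl Z3)). specialize (K2 z Z1 Z2 (Rminr Z3)).
  assert (T3 := Cmod_tri3 (RtoC l) (f z t) (RtoC m)). rewrite Cmod_RR, (Cmod_sub_sym (RtoC l)) in T3. lra.
Qed.

Lemma real_not_gamma t x : x <> 0 -> 0 <= t <= T -> forall r, 0 <= r <= t -> gamma r <> RtoC x.
Proof.
  intros N Ht r Hr E. destruct (Req_dec r 0) as [->|Nr].
  - rewrite (ch_g0 CH) in E. apply N. apply (f_equal Re) in E. symmetry. exact E.
  - assert (I := ch_gH CH r lra). rewrite E in I. simpl in I. lra.
Qed.

Lemma real_approach t x : x <> 0 -> 0 <= t <= T -> approachable t (fun _ => True) (RtoC x).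
Proof.
  intros N Ht d D. destruct (gam_away 0 t (RtoC x) lra lra (real_not_gamma t x N Ht)) as (c & C0 & HC).
  set (y := Rmin d c / 2). assert (M0 : 0 < Rmin d c) by (apply Rmin_pos; auto).
  assert (M1 := Rmin_l d c). assert (M2 := Rmin_r d c).
  set (z := (RtoC x + Ci * RtoC y)%C).
  assert (Dz : <|z - RtoC x|> = y).
  { unfold z. replace (RtoC x + Ci * RtoC y - RtoC x)%C with (Ci * RtoC y)%C by ring. rewrite Cmod_mult, Cmod_Ci, Cmod_R, Rabs_pos_eq; unfold y; lra. }
  exists z. split; [|split; auto; rewrite Dz; unfold y; lra]. split.
  - unfold Hplane, z, Im; simpl. unfold y. lra.
  - intros (r & Hr & E). specialize (HC r Hr). rewrite <- E, Dz in HC. unfold y in HC. lra.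
Qed.

Lemma pair_lip s t z y c : 0 <= s <= t -> t <= T -> slit gamma t z -> slit gamma t y -> 0 < c ->
  (forall r, s <= r <= t -> c <= <|f z r - RtoC (lam r)|>) -> (forall r, s <= r <= t -> c <= <|f y r - RtoC (lam r)|>) ->
  forall r, s <= r <= t -> <|f z r - f y r|> <= <|f z s - f y s|> * exp (2 * / (c * c) * (t - s)).
Proof.
  intros Hs Ht Hz Hy Hc H1 H2 r Hr.
  assert (K0 : 0 < / (c * c)) by (apply Rinv_0_lt_compat; nra).
  destruct (pair_gronwall lam s r (f z) (f y) (/ (c * c)) lra lra) as (A & _).
  - apply (f_sub_sol s r z t); auto; lra.
  - apply (f_sub_sol s r y t); auto; lra.
  - intros x Hx. specialize (H1 x lra). specialize (H2 x lra).
    apply Rmult_le_reg_l with (c * c); [nra|]. rewrite <- Rmult_assoc, Rinv_r by nra. rewrite Rmult_1_r, Rmult_1_l.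
    apply Rmult_le_compat; lra.
  - eapply Rle_trans; [exact A|]. apply Rmult_le_compat_l; [apply Cmod_ge_0|].
    assert (Q : 2 * / (c * c) * (r - s) <= 2 * / (c * c) * (t - s)) by (apply Rmult_le_compat_l; lra).
    destruct Q as [Q| ->]; [left; apply exp_increasing; auto|lra].
Qed.

Lemma real_slit t x : ~ slit gamma t (RtoC x).
Proof. intros (H & _). unfold Hplane in H. simpl in H. lra. Qed.

Lemma real_limit t x : x <> 0 -> 0 <= t < t0 -> exists l, lim_at t (fun _ => True) (RtoC x) l.
Proof.
  intros N Ht. apply cauchy_limit; [lra|apply real_slit|apply real_approach; auto; lra|]. intros e He.
  destruct (away 0 t (RtoC x) lra lra (real_not_gamma t x N lra)) as (c & C0 & HC).
  set (E := exp (2 * / (c * c) * (t - 0))). assert (E0 : 0 < E) by apply exp_pos.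
  exists (Rmin c (e / (2 * E))). split; [apply Rmin_pos; auto; apply Rdiv_lt_0_compat; lra|].
  intros z y Z1 Y1 _ _ Z2 Y2.
  destruct (Rmin2 _ _ _ Z2) as (Z3 & Z4).
  destruct (Rmin2 _ _ _ Y2) as (Y3 & Y4).
  assert (L := pair_lip 0 t z y c lra lra Z1 Y1 C0 (HC z Z1 Z3) (HC y Y1 Y3) t lra).
  rewrite !(ch_0 CH) in L by (eapply slit_H; eauto).
  assert (T3 := Cmod_tri3 z (RtoC x) y). rewrite (Cmod_sub_sym (RtoC x)) in T3.
  eapply Rle_lt_trans; [exact L|]. apply Rlt_le_trans with (e / E * E); [|right; field; lra].
  apply Rmult_lt_compat_r; auto. replace (e / E) with (e / (2 * E) + e / (2 * E)) by (field; lra). lra.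
Qed.

(** The boundary value of [f _ t] at the real point [x]; for [x <> 0] and [0 <= t < t0] it exists by
    [real_limit]. *)
Definition X (x t : R) : R := epsilon (inhabits 0) (fun l => lim_at t (fun _ => True) (RtoC x) l).

Lemma X_lim t x : x <> 0 -> 0 <= t < t0 -> lim_at t (fun _ => True) (RtoC x) (X x t).
Proof. intros N Ht. unfold X. apply epsilon_spec. apply real_limit; auto. Qed.

Lemma X_away s t x c : x <> 0 -> 0 <= s <= t -> t < t0 ->
  (exists d, 0 < d /\ forall z, slit gamma t z -> <|z - RtoC x|> < d -> forall r, s <= r <= t -> c <= <|f z r - RtoC (lam r)|>) ->
  forall r, s <= r <= t -> c <= Rabs (X x r - lam r).
Proof.
  intros N Hs Ht (d & D & K) r Hr. apply Rnot_lt_le. intros L.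
  destruct (X_lim r x N lra (c - Rabs (X x r - lam r)) lra) as (d2 & D2 & K2).
  destruct (real_approach t x N lra (Rmin d d2) ltac:(apply Rmin_pos; auto)) as (z & Z1 & _ & Z2).
  specialize (K z Z1 (Rminl Z2) r Hr).
  specialize (K2 z (slit_mono r t z lra Z1) I (Rminr Z2)).
  assert (T3 := Cmod_tri3 (f z r) (RtoC (X x r)) (RtoC (lam r))). rewrite Cmod_RR in T3. lra.
Qed.

Lemma X_unif t x : x <> 0 -> 0 <= t < t0 -> exists c E, 0 < c /\ 0 < E /\ (forall r, 0 <= r <= t -> c <= Rabs (X x r - lam r)) /\
  forall z, slit gamma t z -> <|z - RtoC x|> < c -> forall r, 0 <= r <= t -> <|f z r - RtoC (X x r)|> <= E * <|z - RtoC x|>.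
Proof.
  intros N Ht. destruct (away 0 t (RtoC x) lra lra (real_not_gamma t x N lra)) as (c & C0 & HC).
  set (E := exp (2 * / (c * c) * (t - 0))). assert (E0 : 0 < E) by apply exp_pos.
  exists c, E. split; auto. split; auto. split.
  - apply (X_away 0 t x c); auto; [lra|lra|]. exists c. auto.
  - intros z Z1 Z2 r Hr. apply Rnot_lt_le. intros L.
    set (g := <|f z r - RtoC (X x r)|> - E * <|z - RtoC x|>) in *.
    assert (g0 : 0 < g) by (unfold g; lra).
    destruct (X_lim r x N lra (g / 2) lra) as (d2 & D2 & K2).
    assert (M0 : 0 < Rmin (Rmin c d2) (g / (2 * E))) by (repeat apply Rmin_pos; auto; apply Rdiv_lt_0_compat; lra).
    destruct (real_approach t x N lra _ M0) as (y & Y1 & _ & Y2).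
    assert (Y3 := Rminl (Rminl Y2)).
    assert (Y4 := Rminr (Rminl Y2)).
    assert (Y5 := Rminr Y2).
    specialize (K2 y (slit_mono r t y lra Y1) I Y4).
    assert (LL := pair_lip 0 t z y c lra lra Z1 Y1 C0 (HC z Z1 Z2) (HC y Y1 Y3) r Hr). fold E in LL.
    rewrite !(ch_0 CH) in LL by (eapply slit_H; eauto).
    assert (T3 := Cmod_tri3 z (RtoC x) y). rewrite (Cmod_sub_sym (RtoC x)) in T3.
    assert (T4 := Cmod_tri3 (f z r) (f y r) (RtoC (X x r))).
    assert (Q : <|y - RtoC x|> * E < g / 2).
    { apply Rlt_le_trans with (g / (2 * E) * E); [apply Rmult_lt_compat_r; auto|right; field; lra]. }
    assert (<|z - y|> * E <= (<|z - RtoC x|> + <|y - RtoC x|>) * E) by (apply Rmult_le_compat_r; lra).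
    unfold g in *. lra.
Qed.

Lemma X_rsol t x : x <> 0 -> 0 <= t < t0 -> rsol lam 0 t (X x).
Proof.
  intros N Ht. destruct (X_unif t x N Ht) as (c & E & C0 & E0 & HC & HU).
  apply (sol_limit lam 0 t (X x) c); auto; [lra|apply lam_wcont; lra|]. intros eta He.
  assert (M0 : 0 < Rmin c (eta / E)) by (apply Rmin_pos; auto; apply Rdiv_lt_0_compat; auto).
  destruct (real_approach t x N lra _ M0) as (z & Z1 & _ & Z2).
  destruct (Rmin2 _ _ _ Z2) as (Z3 & Z4).
  exists (f z). split; [apply (ch_sol CH); auto; lra|]. intros r Hr.
  eapply Rle_trans; [apply HU; auto|]. apply Rle_trans with (E * (eta / E)); [apply Rmult_le_compat_l; lra|right; field; lra].
Qed.

Lemma X_0 x : x <> 0 -> X x 0 = x.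
Proof.
  intros N. apply (lim_at_unique 0 (fun _ => True) (RtoC x)); [apply real_approach; auto; lra|apply X_lim; auto; lra|].
  intros e He. exists e. split; auto. intros z Z1 _ Z2. rewrite (ch_0 CH); auto. eapply slit_H; eauto.
Qed.

(** [Y sx u t = sx * X (sx * u) t] treats both half-axes ([sx = 1] and [sx = -1]) at once. *)
Definition Y (sx u t : R) : R := sx * X (sx * u) t.

Lemma rsol_scale s t phi sx : sx * sx = 1 -> rsol lam s t phi -> rsol (fun r => sx * lam r) s t (fun r => sx * phi r).
Proof.
  intros S H. destruct (rsol_elim _ _ _ _ H) as (W & D & N).
  assert (Sn : sx <> 0) by (intros E; rewrite E in S; lra).
  apply rsol_intro.
  - apply (wcont_mult s t (fun _ => sx)); auto. apply wcont_cst.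
  - intros r Hr. assert (N' := N r lra).
    replace (2 / (sx * phi r - sx * lam r)) with (sx * (2 / (phi r - lam r))).
    + apply (is_derive_scal phi r sx). apply D; auto.
    + replace (sx * phi r - sx * lam r) with (sx * (phi r - lam r)) by ring.
      replace (2 / (sx * (phi r - lam r))) with (sx * sx * 2 / (sx * (phi r - lam r))) by (rewrite S; field; lra). field. lra.
  - intros r Hr E. apply (N r Hr). apply Rmult_eq_reg_l with sx; auto.
Qed.

Section OneSide.
Context (sx : R) (Sx : sx * sx = 1).

Lemma sx_neq : sx <> 0.
Proof. intros E. rewrite E in Sx. lra. Qed.

Lemma slam_wcont s t : 0 <= s -> t <= T -> wcont s t (fun r => sx * lam r).
Proof. intros. apply (wcont_mult s t (fun _ => sx)); [apply wcont_cst|apply lam_wcont; auto]. Qed.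

Lemma Y_rsol u t : 0 < u -> 0 <= t < t0 -> rsol (fun r => sx * lam r) 0 t (Y sx u).
Proof.
  intros Hu Ht. apply rsol_scale; auto. apply X_rsol; auto.  nra.
Qed.

Lemma Y_0 u : 0 < u -> Y sx u 0 = u.
Proof. intros Hu. unfold Y. rewrite X_0 by (assert (A := sx_neq); nra). nra. Qed.

Lemma Y_gt u t : 0 < u -> 0 <= t < t0 -> sx * lam t < Y sx u t.
Proof.
  intros Hu Ht. apply (rsol_sign (fun r => sx * lam r) 0 t (Y sx u)); [lra|apply slam_wcont; lra|apply Y_rsol; auto| |lra].
  exists 0. split; [lra|]. rewrite lam_0, Y_0 by auto. lra.
Qed.

Lemma Y_mono_u u v t : 0 < u < v -> 0 <= t < t0 -> Y sx u t < Y sx v t /\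
  forall s, 0 <= s <= t -> Y sx v t - Y sx u t <= Y sx v s - Y sx u s.
Proof.
  intros Hu Ht.
  assert (A : forall s, 0 <= s <= t -> Y sx u s < Y sx v s).
  { intros s Hs. apply (rsol_pair (fun r => sx * lam r) 0 s (Y sx u) (Y sx v)); [lra|apply slam_wcont; lra|apply Y_rsol; lra|apply Y_rsol; lra| | |].
    - intros r Hr. apply Y_gt; lra.
    - intros r Hr. apply Y_gt; lra.
    - rewrite !Y_0; lra. }
  split; [apply A; lra|]. intros s Hs.
  apply (rsol_pair (fun r => sx * lam r) s t (Y sx u) (Y sx v)); [lra|apply slam_wcont; lra| | | | |apply A; lra].
  - apply (rsol_sub _ 0 t); try lra. apply Y_rsol; lra.
  - apply (rsol_sub _ 0 t); try lra. apply Y_rsol; lra.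
  - intros r Hr. apply Y_gt; lra.
  - intros r Hr. apply Y_gt; lra.
Qed.

Lemma Y_mono_t u s t : 0 < u -> 0 <= s <= t -> t < t0 -> Y sx u s <= Y sx u t.
Proof.
  intros Hu Hs Ht. apply (rsol_mono (fun r => sx * lam r)); [lra| |].
  - apply (rsol_sub _ 0 t); try lra. apply Y_rsol; lra.
  - intros r Hr. apply Y_gt; lra.
Qed.

Lemma ye_exists t : 0 <= t < t0 -> exists y, (forall u, 0 < u -> y <= Y sx u t) /\ forall e, 0 < e -> exists u, 0 < u /\ Y sx u t < y + e.
Proof.
  intros Ht. destruct (completeness (fun x => exists u, 0 < u /\ x = - Y sx u t)) as (m & M1 & M2).
  - exists (- (sx * lam t)). intros x (u & Hu & ->). assert (A := Y_gt u t Hu Ht). lra.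
  - exists (- Y sx 1 t), 1. split; [lra|auto].
  - exists (- m). split.
    + intros u Hu. assert (- Y sx u t <= m) by (apply M1; exists u; auto). lra.
    + intros e He. apply NNPP. intros K. assert (m <= m - e); [|lra]. apply M2. intros x (u & Hu & ->).
      apply Rnot_lt_le. intros L. apply K. exists u. split; auto. lra.
Qed.

(** The image of the origin on the side [sx], multiplied by [sx]: the infimum of [Y sx u t] over
    [u > 0], which by monotonicity is the limit as [u -> 0]. *)
Definition ye (t : R) : R := epsilon (inhabits 0) (fun y =>
  (forall u, 0 < u -> y <= Y sx u t) /\ forall e, 0 < e -> exists u, 0 < u /\ Y sx u t < y + e).

Lemma ye_spec t : 0 <= t < t0 -> (forall u, 0 < u -> ye t < Y sx u t) /\
  forall e, 0 < e -> exists u0, 0 < u0 /\ forall u, 0 < u < u0 -> Y sx u t < ye t + e.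
Proof.
  intros Ht. assert (H := epsilon_spec (inhabits 0) (fun y =>
    (forall u, 0 < u -> y <= Y sx u t) /\ forall e, 0 < e -> exists u, 0 < u /\ Y sx u t < y + e) (ye_exists t Ht)).
  fold (ye t) in H. destruct H as (H1 & H2). split.
  - intros u Hu. assert (A := H1 (u/2) lra). destruct (Y_mono_u (u/2) u t lra Ht) as (B & _). lra.
  - intros e He. destruct (H2 e He) as (u & Hu & L). exists u. split; auto. intros v Hv.
    destruct (Y_mono_u v u t lra Ht) as (B & _). lra.
Qed.

Lemma Y_gap s t : 0 < s <= t -> t < t0 -> exists c, 0 < c /\ (forall u r, 0 < u -> s <= r <= t -> sx * lam r + c <= Y sx u r) /\
  forall z, slit gamma t z -> Cmod z < c -> forall r, s <= r <= t -> c <= <|f z r - RtoC (lam r)|>.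
Proof.
  intros Hs Ht. destruct (away s t 0%C lra Ht) as (c & C0 & HC).
  { intros r Hr E. assert (I := ch_gH CH r lra). rewrite E in I. simpl in I. lra. }
  assert (HC' : forall z, slit gamma t z -> Cmod z < c -> forall r, s <= r <= t -> c <= <|f z r - RtoC (lam r)|>).
  { intros z Z1 Z2. apply HC; auto. replace (z - 0)%C with z by ring. auto. }
  exists c. split; auto. split; auto.
  assert (A : forall u r, 0 < u < c / 2 -> s <= r <= t -> sx * lam r + c <= Y sx u r).
  { intros u r Hu Hr.  assert (Gt := Y_gt u r lra lra).
    assert (Ab : Rabs sx = 1). { assert (Q := Rabs_pos sx). assert (Rabs sx * Rabs sx = 1) by (rewrite <- Rabs_mult, Sx; apply Rabs_R1). nra. }
    assert (B : c <= Rabs (X (sx * u) r - lam r)).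
    { apply (X_away s t (sx * u) c); auto; [nra|lra|]. exists (c / 2). split; [lra|]. intros z Z1 Z2 r' Hr'. apply HC'; auto.
      assert (Q := Cmod_rev z (RtoC (sx * u))). rewrite Cmod_R, Rabs_mult, Ab, (Rabs_pos_eq u) in Q by lra. lra. }
    replace (X (sx * u) r - lam r) with (sx * (Y sx u r - sx * lam r)) in B.
    - rewrite Rabs_mult, Ab, Rabs_pos_eq in B by lra. lra.
    - unfold Y. replace (sx * (sx * X (sx * u) r - sx * lam r)) with (sx * sx * (X (sx * u) r - lam r)) by ring. rewrite Sx. ring. }
  intros u r Hu Hr. destruct (Rlt_le_dec u (c / 2)) as [L|L]; [apply A; lra|].
  eapply Rle_trans; [apply (A (c / 4) r); lra|]. left. apply Y_mono_u; lra.
Qed.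

Lemma ye_gt t : 0 < t < t0 -> sx * lam t < ye t.
Proof.
  intros Ht. destruct (Y_gap t t lra lra) as (c & C0 & HC & _).
  destruct (ye_spec t lra) as (_ & H). apply Rnot_le_lt. intros L.
  destruct (H (c / 2) lra) as (u0 & U0 & HU). specialize (HU (u0 / 2) lra). specialize (HC (u0/2) t lra lra). lra.
Qed.

End OneSide.

Definition side (sg : R) (z : C) : Prop := 0 < sg * ht z.

Lemma gamma_ca s : 0 < s <= t0 -> 0 < ca th (gamma s).
Proof. intros Hs. rewrite <- ca_g0. apply GL; lra. Qed.

Lemma side_box t s : 0 < s < t -> t <= t0 -> exists d, 0 < d /\ forall sg a be, sg * sg = 1 -> Rabs (a - ca th (gamma s)) < d -> 0 < be < d ->
  slit gamma t (V sg a be) /\ 0 < a < ca th (gamma t).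
Proof.
  intros Hs Ht. set (A := ca th (gamma s)).
  assert (I := ch_gH CH s lra). assert (A0 := gamma_ca s lra). fold A in A0.
  assert (A1 : A < ca th (gamma t)) by (apply GL; lra).
  assert (GA : G A = gamma s) by (apply G_gamma; lra).
  exists (Rmin (Im (gamma s) / 4) (Rmin A (ca th (gamma t) - A))). split; [repeat apply Rmin_pos; lra|].
  intros sg a be S Ha Hb.
  assert (M1 := Rmin_l (Im (gamma s) / 4) (Rmin A (ca th (gamma t) - A))). assert (M2 := Rmin_r (Im (gamma s) / 4) (Rmin A (ca th (gamma t) - A))).
  assert (M3 := Rmin_l A (ca th (gamma t) - A)). assert (M4 := Rmin_r A (ca th (gamma t) - A)).
  assert (Ha' := Ha). apply Rabs_def2 in Ha'.
  split; [|lra]. apply slit_of_ht; [lra| |].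
  - assert (D1 := VG_dist sg a be S lra). assert (D2 := G_lip a A). rewrite GA in D2.
    assert (T3 := Cmod_tri3 (V sg a be) (G a) (gamma s)). assert (Q := im_le_Cmod (V sg a be - gamma s)%C). rewrite im_minus in Q.
    apply Rabs_le_between in Q. lra.
  - rewrite ht_V. intros E. assert (sg * (sg * be) = 0) by (rewrite E; ring). replace (sg * (sg * be)) with (sg * sg * be) in H by ring.
    rewrite S in H. lra.
Qed.

Lemma side_approach t s sg : sg * sg = 1 -> 0 < s < t -> t <= t0 -> approachable t (side sg) (gamma s).
Proof.
  intros S Hs Ht d D. destruct (side_box t s Hs Ht) as (d1 & D1 & HB).
  set (be := Rmin d d1 / 2). assert (M0 : 0 < Rmin d d1) by (apply Rmin_pos; auto).
  assert (M1 := Rmin_l d d1). assert (M2 := Rmin_r d d1).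
  exists (V sg (ca th (gamma s)) be). split; [|split].
  - apply HB; auto; [rewrite Rminus_diag, Rabs_R0; auto|unfold be; lra].
  - unfold side. rewrite ht_V. replace (sg * (sg * be)) with (sg * sg * be) by ring. rewrite S. unfold be; lra.
  - assert (Dv := VG_dist sg (ca th (gamma s)) be S ltac:(unfold be; lra)). rewrite G_gamma in Dv by lra. unfold be in *; lra.
Qed.

Lemma gamma_not_slit t s : 0 <= s <= t -> ~ slit gamma t (gamma s).
Proof. intros Hs (_ & K). apply K. exists s. split; auto. Qed.

(** At time [s] the image of a point near [gamma s] is close to [lam s], and it still is at a
    slightly later [r0]. After [r0] the tip has left [gamma s], so the distance to the driving
    function is at least [c]; [f_proper] at time [r0] makes the imaginary part small against [c],
    hence the real part stays off the driving function. *)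
Lemma near_curve s t eta : 0 < s < t -> t < t0 -> 0 < eta -> exists r0 c d, s < r0 < t /\ 0 < c /\ 0 < d /\
  forall z, slit gamma t z -> <|z - gamma s|> < d ->
    <|f z r0 - RtoC (lam s)|> < eta /\
    forall r, r0 <= r <= t -> Im (f z r) < c / 4 /\ c / 2 <= Rabs (Re (f z r) - lam r) /\ c <= <|f z r - RtoC (lam r)|>.
Proof.
  intros Hs Ht He.
  set (dl := eta / 8). assert (dl0 : 0 < dl) by (unfold dl; lra).
  destruct (lam_wcont 0 T lra lra s dl lra dl0) as (k & K0 & HL).
  set (w := Rmin (Rmin (k / 2) (dl * dl)) ((t - s) / 2)).
  assert (w0 : 0 < w) by (repeat apply Rmin_pos; nra).
  assert (w1 : w <= k / 2) by (eapply Rle_trans; [apply Rmin_l|apply Rmin_l]).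
  assert (w2 : w <= dl * dl) by (eapply Rle_trans; [apply Rmin_l|apply Rmin_r]).
  assert (w3 : w <= (t - s) / 2) by apply Rmin_r.
  set (r0 := s + w).
  destruct (away r0 t (gamma s) ltac:(unfold r0; lra) Ht) as (c & C0 & HC).
  { intros r Hr E. apply (ch_simple CH) in E; unfold r0 in *; lra. }
  destruct (ch_tip CH s dl lra dl0) as (d1 & D1 & HT).
  destruct (f_proper CH r0 (gamma s) (c / 4) ltac:(unfold r0; lra) (gamma_not_slit r0 s ltac:(unfold r0; lra)) lra) as (d2 & D2 & HP).
  exists r0, c, (Rmin c (Rmin d1 d2)). split; [unfold r0; lra|]. split; auto. split; [repeat apply Rmin_pos; auto|].
  intros z Hz Hd.
  destruct (Rmin3 _ _ _ _ Hd) as (Z1 & Z2 & Z3). split.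
  - assert (Fs := HT z (slit_mono s t z lra Hz) Z2).
    destruct (short_time lam s r0 (f z) (lam s) dl ltac:(unfold r0; lra)) as (S1 & _).
    + apply (f_sub_sol s r0 z t); auto; unfold r0; lra.
    + lra.
    + intros x Hx. apply Rlt_le, HL; [unfold r0 in *; lra|]. rewrite Rabs_pos_eq; unfold r0 in *; lra.
    + assert (P := Cmod_ge_0 (f z s - RtoC (lam s))%C).
      assert (MX : Rmax (<|f z s - RtoC (lam s)|> * <|f z s - RtoC (lam s)|>) (4 * dl * dl) <= 4 * dl * dl) by (apply Rmax_lub; nra).
       unfold r0 in S1 at 3. unfold dl in *. nra.
  - intros r Hr. specialize (HC z Hz Z1 r Hr). specialize (HP z (conj (slit_mono r0 t z ltac:(unfold r0; lra) Hz) Z3)).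
    assert (I1 := Imf_decr CH r z r0 ltac:(unfold r0 in *; lra) lra (slit_mono r t z ltac:(unfold r0 in *; lra) Hz)).
    assert (I2 := ch_map CH r z ltac:(unfold r0 in *; lra) (slit_mono r t z ltac:(unfold r0 in *; lra) Hz)).
    assert (CS := Cmod_le_sum (f z r - RtoC (lam r))%C). rewrite re_minus, im_minus in CS. simpl in CS. rewrite Rminus_0_r, (Rabs_pos_eq (Im (f z r))) in CS by lra.
    split; [lra|]. split; [lra|auto].
Qed.

Lemma Re_sign_const t z r0 c (sx : R) : 0 <= r0 <= t -> t <= T -> slit gamma t z -> 0 < c ->
  (forall r, r0 <= r <= t -> c <= Rabs (Re (f z r) - lam r)) ->
  (exists r, r0 <= r <= t /\ 0 < sx * (Re (f z r) - lam r)) -> forall r, r0 <= r <= t -> 0 < sx * (Re (f z r) - lam r).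
Proof.
  intros Hr Ht Hz Hc HC (q & Hq & Pq). assert (Sn : sx <> 0) by (intros ->; lra).
  apply (sign_const (fun r => sx * (Re (f z r) - lam r)) r0 t); [| |lra|exists q; auto].
  - apply (wcont_mult r0 t (fun _ => sx)); [apply wcont_cst|]. apply wcont_minus; [|apply lam_wcont; lra].
    apply wcont_re. apply (f_sub_sol r0 t z t); auto; lra.
  - intros x Hx E. specialize (HC x Hx). apply Rmult_integral in E. destruct E as [E|E]; [lra|]. rewrite E, Rabs_R0 in HC. lra.
Qed.

Lemma box_joined (P : C -> Prop) sg A d z y : sg * sg = 1 -> (forall a be, Rabs (a - A) < d -> 0 < be < d -> P (V sg a be)) ->
  Rabs (ca th z - A) < d -> 0 < sg * ht z < d -> Rabs (ca th y - A) < d -> 0 < sg * ht y < d -> joined P z y.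
Proof.
  intros S HP P1 P2 Q1 Q2.
  set (path := fun x => V sg (ca th z + x * (ca th y - ca th z)) (sg * ht z + x * (sg * ht y - sg * ht z))).
  replace z with (path 0); [replace y with (path 1)|].
  - apply joined_01.
    + intros x e Hx He.
      set (M := 2 * Rabs (ca th y - ca th z) + Rabs (sg * ht y - sg * ht z) + 1).
      assert (M0 : 0 < M). { unfold M. assert (U1 := Rabs_pos (ca th y - ca th z)). assert (U2 := Rabs_pos (sg * ht y - sg * ht z)). lra. }
      exists (e / M). split; [apply Rdiv_lt_0_compat; auto|]. intros x' Hx' Hd.
      eapply Rle_lt_trans; [apply V_dist; auto|].
      replace (ca th z + x' * (ca th y - ca th z) - (ca th z + x * (ca th y - ca th z))) with ((x' - x) * (ca th y - ca th z)) by ring.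
      replace (sg * ht z + x' * (sg * ht y - sg * ht z) - (sg * ht z + x * (sg * ht y - sg * ht z))) with ((x' - x) * (sg * ht y - sg * ht z)) by ring.
      rewrite !Rabs_mult. assert (U := Rabs_pos (x' - x)).
      apply Rle_lt_trans with (Rabs (x' - x) * M); [unfold M; nra|].
      apply Rlt_le_trans with (e / M * M); [apply Rmult_lt_compat_r; auto|right; field; lra].
    + intros x Hx. apply Rabs_def2 in P1. apply Rabs_def2 in Q1. apply HP; [apply Rabs_def1|split]; destruct (Req_dec x 0) as [->|]; nra.
  - transitivity (V sg (ca th y) (sg * ht y)); [unfold path; f_equal; ring|symmetry; apply V_of; auto].
  - transitivity (V sg (ca th z) (sg * ht z)); [unfold path; f_equal; ring|symmetry; apply V_of; auto].
Qed.

Lemma same_side_sign t s sg d : sg * sg = 1 -> 0 < s < t -> t < t0 -> 0 < d ->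
  (forall z, slit gamma t z -> <|z - gamma s|> < d -> Re (f z t) <> lam t) ->
  exists d', 0 < d' /\ forall z y, slit gamma t z -> slit gamma t y -> side sg z -> side sg y ->
    <|z - gamma s|> < d' -> <|y - gamma s|> < d' -> 0 < (Re (f z t) - lam t) * (Re (f y t) - lam t).
Proof.
  intros S Hs Ht D HN. destruct (side_box t s Hs lra) as (d1 & D1 & HB).
  set (A := ca th (gamma s)) in *. assert (GA : G A = gamma s) by (apply G_gamma; lra).
  set (d2 := Rmin (d1 / 2) (d / 6)). assert (d20 : 0 < d2) by (apply Rmin_pos; lra).
  assert (m1 : d2 <= d1 / 2) by apply Rmin_l. assert (m2 : d2 <= d / 6) by apply Rmin_r.
  exists (d2 / 2). split; [lra|].
  assert (Par : forall z, side sg z -> <|z - gamma s|> < d2 / 2 -> Rabs (ca th z - A) < d2 /\ 0 < sg * ht z < d2).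
  { intros z Z1 Z2. assert (C1 := ca_lip th z (gamma s)). fold A in C1. assert (L := sg_ht_lip sg (gamma s) z S).
    rewrite <- GA, ht_G, GA, (Cmod_sub_sym (gamma s)), Rmult_0_r in L. unfold side in Z1. lra. }
  intros z y Z1 Y1 Z2 Y2 Z3 Y3.
  destruct (Par z Z2 Z3) as (P1 & P2). destruct (Par y Y2 Y3) as (Q1 & Q2).
  destruct (joined_elim (fun w => slit gamma t w /\ <|w - gamma s|> < d) z y) as (path & Pc & Psl & <- & <-).
  { apply (box_joined _ sg A d2); auto. intros a be B1 B2. split; [apply HB; auto; lra|].
    rewrite <- GA, <- (V_0 sg A). eapply Rle_lt_trans; [apply V_dist; auto|]. rewrite Rminus_0_r, (Rabs_pos_eq be) by lra. lra. }
  apply (sign_const (fun x => (Re (f (path 0) t) - lam t) * (Re (f (path x) t) - lam t)) 0 1); [| |lra| |lra].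
  - apply (wcont_mult 0 1 (fun _ => Re (f (path 0) t) - lam t)); [apply wcont_cst|]. apply wcont_minus; [|apply wcont_cst].
    apply (wcont_C2 0 1 (fun w => Re (f w t)) path); auto.
    intros x Hx. apply (rcont_Re (fun w => f w t)). apply (ch_cont CH); [lra|apply Psl; auto].
  - intros x Hx E. destruct (Psl x Hx) as (B1 & B2). destruct (Psl 0 lra) as (B3 & B4). apply Rmult_integral in E.
    destruct E as [E|E]; [apply (HN _ B3 B4); lra|apply (HN _ B1 B2); lra].
  - exists 0. split; [lra|]. destruct (Psl 0 lra) as (B3 & B4). assert (N := HN _ B3 B4).
    apply (Rsqr_pos_lt (Re (f (path 0) t) - lam t)). lra.
Qed.

(** Two nearly real numbers of the same sign have a product with positive real part: this is the
    condition under which two trajectories approach each other. *)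
Lemma contract_sign (a b : C) (c : R) : 0 < c -> 0 <= Im a < c / 4 -> 0 <= Im b < c / 4 -> c / 2 <= Rabs (Re a) -> c / 2 <= Rabs (Re b) ->
  0 < Re a * Re b -> 0 <= Re (/ (a * b))%C.
Proof.
  intros Hc Ia Ib Ra Rb P.
  assert (Q : c / 2 * (c / 2) <= Re a * Re b).
  { rewrite <- (Rabs_pos_eq (Re a * Re b)) by lra. rewrite Rabs_mult. apply Rmult_le_compat; lra. }
  assert (Q3 : 0 <= Re (a * b)%C) by (rewrite re_mult; nra).
  set (w := (a * b)%C) in *.  cbn [fst]. apply Rmult_le_pos; auto.
  match goal with |- 0 <= / ?d => destruct (Req_dec d 0) as [E|E]; [rewrite E, Rinv_0; lra|] end.
  apply Rlt_le, Rinv_0_lt_compat. assert (U1 := pow2_ge_0 (fst w)). assert (U2 := pow2_ge_0 (snd w)).  lra.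
Qed.

(** At [r0] two trajectories from near [gamma s] are both close to [lam s], hence to each other.
    Points on one side of the curve keep to the same side of the driving function afterwards, so
    their distance only decreases up to time [t]; this is the Cauchy condition. *)
Lemma side_limit s t sg : sg * sg = 1 -> 0 < s < t -> t < t0 -> exists l, lim_at t (side sg) (gamma s) l.
Proof.
  intros S Hs Ht. apply cauchy_limit; [lra|apply gamma_not_slit; lra|apply side_approach; auto; lra|]. intros e He.
  destruct (near_curve s t (e / 4) Hs Ht lra) as (r0 & c & d & Hr0 & C0 & D & HN).
  destruct (same_side_sign t s sg d S Hs Ht D) as (d' & D' & HS).
  { intros z Hz Hd E. destruct (HN z Hz Hd) as (_ & K). destruct (K t lra) as (_ & K2 & _). rewrite E, Rminus_diag, Rabs_R0 in K2. lra. }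
  exists (Rmin d d'). split; [apply Rmin_pos; auto|]. intros z y Z1 Y1 Z2 Y2 Z3 Y3.
  specialize (HS z y Z1 Y1 Z2 Y2 (Rminr Z3) (Rminr Y3)).
  destruct (HN z Z1 (Rminl Z3)) as (A1 & A2).
  destruct (HN y Y1 (Rminl Y3)) as (B1 & B2).
  assert (CT : <|f z t - f y t|> <= <|f z r0 - f y r0|>).
  { apply (pair_contract lam r0 t (f z) (f y)); [lra|apply (f_sub_sol r0 t z t); auto; lra|apply (f_sub_sol r0 t y t); auto; lra|].
    intros r Hr.
    destruct (A2 r lra) as (A3 & A4 & _). destruct (B2 r lra) as (B3 & B4 & _).
    assert (I1 := ch_map CH r z lra (slit_mono r t z lra Z1)).
    assert (I2 := ch_map CH r y lra (slit_mono r t y lra Y1)).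
    set (q := Re (f z t) - lam t) in *.
    apply (contract_sign _ _ c); auto; rewrite ?re_minus, ?im_minus; simpl; try rewrite Rminus_0_r; try lra.
    assert (P1 := Re_sign_const t z r0 (c/2) q lra lra Z1 lra (fun r Hr => proj1 (proj2 (A2 r Hr)))).
    assert (P2 := Re_sign_const t y r0 (c/2) q lra lra Y1 lra (fun r Hr => proj1 (proj2 (B2 r Hr)))).
    specialize (P2 ltac:(exists t; split; [lra|auto]) r lra).
    assert (Q0 := Rsqr_pos_lt q ltac:(intros Q0; rewrite Q0 in HS; lra)). unfold Rsqr in Q0.
    specialize (P1 ltac:(exists t; split; [lra|exact Q0]) r lra).
     nra. }
  assert (T3 := Cmod_tri3 (f z r0) (RtoC (lam s)) (f y r0)). rewrite (Cmod_sub_sym (RtoC (lam s))) in T3. lra.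
Qed.

Lemma side_limit_neq s t sg l : sg * sg = 1 -> 0 < s < t -> t < t0 -> lim_at t (side sg) (gamma s) l -> l <> lam t.
Proof.
  intros S Hs Ht HL ->. destruct (near_curve s t 1 Hs Ht lra) as (r0 & c & d & Hr0 & C0 & D & HN).
  destruct (HL c C0) as (d2 & D2 & K).
  destruct (side_approach t s sg S Hs lra (Rmin d d2) ltac:(apply Rmin_pos; auto)) as (z & Z1 & Z2 & Z3).
  specialize (K z Z1 Z2 (Rminr Z3)). destruct (HN z Z1 (Rminl Z3)) as (_ & A).
  destruct (A t lra) as (_ & _ & B). lra.
Qed.

Lemma side_away s t t' : 0 < s < t -> t <= t' -> t' < t0 -> exists c d, 0 < c /\ 0 < d /\
  forall z, slit gamma t' z -> <|z - gamma s|> < d -> forall r, t <= r <= t' -> c <= Rabs (Re (f z r) - lam r).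
Proof.
  intros Hs Htt Ht.
  destruct (away t t' (gamma s) lra Ht) as (c & C0 & HC).
  { intros r Hr E. apply (ch_simple CH) in E; lra. }
  destruct (f_proper CH t (gamma s) (c / 2) lra (gamma_not_slit t s lra) lra) as (d2 & D2 & HP).
  exists (c / 2), (Rmin c d2). split; [lra|]. split; [apply Rmin_pos; auto|]. intros z Z1 Z3 r Hr.
  specialize (HP z (conj (slit_mono t t' z lra Z1) (Rminr Z3))). specialize (HC z Z1 (Rminl Z3) r Hr).
  assert (I1 := Imf_decr CH r z t lra lra (slit_mono r t' z lra Z1)).
  assert (I2 := ch_map CH r z lra (slit_mono r t' z lra Z1)).
  assert (CS := Cmod_le_sum (f z r - RtoC (lam r))%C). rewrite re_minus, im_minus in CS. simpl in CS. rewrite Rminus_0_r, (Rabs_pos_eq (Im (f z r))) in CS by lra. lra.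
Qed.

Lemma Re_vel_sign sx phi r : 0 <= sx * (Re (phi r) - lam r) -> 0 <= sx * Re (vel lam phi r).
Proof.
  intros H. unfold vel. set (w := (phi r - RtoC (lam r))%C). assert (E : Re w = Re (phi r) - lam r) by (unfold w; rewrite re_minus; auto). rewrite <- E in H.
  replace (sx * Re (2 / w)%C) with (2 * (sx * Re w) / (Re w ^ 2 + Im w ^ 2)) by (unfold Re, Im; simpl; unfold Rdiv; ring).
  unfold Rdiv. destruct (Req_dec (Re w ^ 2 + Im w ^ 2) 0) as [-> |N]; [rewrite Rinv_0; lra|].
  assert (U1 := pow2_ge_0 (Re w)). assert (U2 := pow2_ge_0 (Im w)). apply Rmult_le_pos; [lra|]. apply Rlt_le, Rinv_0_lt_compat. lra.
Qed.

(** A boundary image on one side of the driving function stays on that side and moves outwards,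
    since its velocity points away from the driving function. *)
Lemma side_limit_time s t t' sg sx l l' : sg * sg = 1 -> sx * sx = 1 -> 0 < s < t -> t <= t' -> t' < t0 ->
  lim_at t (side sg) (gamma s) l -> lim_at t' (side sg) (gamma s) l' -> 0 < sx * (l - lam t) -> sx * l <= sx * l' /\ 0 < sx * (l' - lam t').
Proof.
  intros S Sx Hs Htt Ht HL HL' P. destruct (side_away s t t' Hs Htt Ht) as (c & d & C0 & D & HA).
  assert (Ab := sg_abs sx Sx).
  assert (Main : forall e, 0 < e -> e <= sx * (l - lam t) / 2 -> e <= c / 2 -> sx * l <= sx * l' + 2 * e /\ c / 2 <= sx * (l' - lam t')).
  { intros e He E1 E2. destruct (HL e He) as (d3 & D3 & K3). destruct (HL' e He) as (d4 & D4 & K4).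
    destruct (side_approach t' s sg S lra lra (Rmin d (Rmin d3 d4)) ltac:(repeat apply Rmin_pos; auto)) as (z & Z1 & Z2 & Z3).
    destruct (Rmin3 _ _ _ _ Z3) as (M1 & M2 & M3).
    assert (Zt := slit_mono t t' z lra Z1). specialize (K3 z Zt Z2 M2). specialize (K4 z Z1 Z2 M3). specialize (HA z Z1 M1).
    assert (B1 := re_le_Cmod (f z t - RtoC l)%C). assert (B2 := re_le_Cmod (f z t' - RtoC l')%C). rewrite re_minus in B1, B2. simpl in B1, B2.
    assert (B3 : Rabs (sx * (Re (f z t) - l)) < e) by (rewrite Rabs_mult, Ab; lra). assert (B4 : Rabs (sx * (Re (f z t') - l')) < e) by (rewrite Rabs_mult, Ab; lra).
    apply Rabs_def2 in B3, B4.
    assert (Pos := Re_sign_const t' z t c sx lra lra Z1 C0 HA ltac:(exists t; split; lra)).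
    assert (G : sx * Re (f z t) <= sx * Re (f z t')).
    { destruct (f_sub_sol t t' z t' lra lra lra Z1 Htt) as (W & Dr & _).
      enough (- sx * Re (f z t') - - sx * Re (f z t) <= 0 * (t' - t)) by lra.
      apply (mvt_le (fun r => - sx * Re (f z r))); auto.
      - apply (wcont_mult t t' (fun _ => - sx)); [apply wcont_cst|apply wcont_re; auto].
      - intros r Hr. exists (- sx * Re (vel lam (f z) r)). split; [apply (is_derive_scal (fun r => Re (f z r)) r (- sx)); apply (Dr r Hr)|].
        assert (Q := Re_vel_sign sx (f z) r ltac:(apply Rlt_le, Pos; lra)). lra. }
    split; [lra|]. specialize (Pos t' lra). specialize (HA t' lra).
    assert (Q : c <= sx * (Re (f z t') - lam t')). { rewrite <- (Rabs_pos_eq (sx * (Re (f z t') - lam t'))) by lra. rewrite Rabs_mult, Ab. lra. }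
    lra. }
  assert (M0 : 0 < Rmin (sx * (l - lam t) / 2) (c / 2)) by (apply Rmin_pos; lra).
  assert (N1 := Rmin_l (sx * (l - lam t) / 2) (c / 2)). assert (N2 := Rmin_r (sx * (l - lam t) / 2) (c / 2)).
  split; [|destruct (Main _ M0 N1 N2); lra]. apply le_epsilon. intros e He.
  set (e' := Rmin (e / 2) (Rmin (sx * (l - lam t) / 2) (c / 2))). assert (E1 := Rmin_l (e / 2) (Rmin (sx * (l - lam t) / 2) (c / 2))). assert (E2 := Rmin_r (e / 2) (Rmin (sx * (l - lam t) / 2) (c / 2))).
  fold e' in E1, E2. destruct (Main e' ltac:(apply Rmin_pos; lra) lra lra). lra.
Qed.

(** Just after time [s] the image of a point near [gamma s] is within [g / 2] of [lam s], while the
    images of real points on the side [sx] are at least [g] beyond it. By Gronwall a gap survives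
    until [t], with a bound independent of the real point, so strictness passes to the infimum. *)
Lemma side_lt_ye sx s t sg l : sx * sx = 1 -> sg * sg = 1 -> 0 < s < t -> t < t0 -> lim_at t (side sg) (gamma s) l -> sx * l < ye sx t.
Proof.
  intros Sx S Hs Ht HL.
  destruct (Y_gap sx Sx s t lra Ht) as (g & G0 & HG & _).
  destruct (near_curve s t (g / 2) Hs Ht lra) as (r0 & c & d & Hr0 & C0 & D & HN).
  (* The two trajectories keep the distances [c] and [g] from the driving function, which gives this
     Gronwall constant; [ka] is what is left of the gap [g / 2]. *)
  set (K := / (c * g)). assert (K0 : 0 < K) by (apply Rinv_0_lt_compat, Rmult_lt_0_compat; auto).
  set (ka := g / 2 * exp (- (2 * K * t))). assert (ka0 : 0 < ka) by (apply Rmult_lt_0_compat; [lra|apply exp_pos]).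
  assert (Ab : Rabs sx = 1) by (apply sg_abs; auto).
  assert (Sn : sx <> 0) by (intros E; rewrite E in Sx; lra).
  enough (Main : forall u, 0 < u -> ka / 4 <= Y sx u t - sx * l).
  { destruct (ye_spec sx Sx t lra) as (_ & H). destruct (H (ka / 8) lra) as (u0 & U0 & HU).
    specialize (HU (u0 / 2) lra). specialize (Main (u0 / 2) lra). lra. }
  intros u Hu.
  destruct (HL (ka / 4) lra) as (d2 & D2 & K2).
  destruct (f_proper CH r0 (gamma s) (ka / 4) lra (gamma_not_slit r0 s lra) lra) as (d3 & D3 & HP).
  destruct (side_approach t s sg S Hs lra (Rmin d (Rmin d2 d3)) ltac:(repeat apply Rmin_pos; auto)) as (z & Z1 & Z2 & Z3).
  destruct (Rmin3 _ _ _ _ Z3) as (M1 & M2 & M3).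
  specialize (K2 z Z1 Z2 M2). destruct (HN z Z1 M1) as (A1 & A2). specialize (HP z (conj (slit_mono r0 t z lra Z1) M3)).
  assert (Ym := Y_mono_t sx Sx u s r0 Hu lra lra). assert (Yg := HG u s Hu lra).
  assert (XY : forall r, sx * X (sx * u) r = Y sx u r) by reflexivity.
  assert (Nx : sx * u <> 0) by nra.
  assert (Dist : forall r, r0 <= r <= t -> ka <= <|RtoC (X (sx * u) r) - f z r|>).
  { intros r Hr.
    destruct (pair_gronwall lam r0 r (fun r => RtoC (X (sx * u) r)) (f z) K lra lra) as (_ & GR).
    - apply (rsol_sub lam 0 t); try lra. apply X_rsol; auto; lra.
    - apply (f_sub_sol r0 r z t); auto; lra.
    - intros q Hq. rewrite Cmod_RR. destruct (A2 q lra) as (_ & _ & A3). specialize (HG u q Hu lra).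
      assert (g <= Rabs (X (sx * u) q - lam q)).
      { rewrite <- (Rmult_1_l (Rabs _)), <- Ab, <- Rabs_mult, Rmult_minus_distr_l, XY. rewrite Rabs_pos_eq; lra. }
      apply Rmult_le_reg_l with (c * g); [apply Rmult_lt_0_compat; auto|].  rewrite <- Rmult_assoc, Rinv_r by (apply Rgt_not_eq, Rmult_lt_0_compat; auto).
      rewrite Rmult_1_l, Rmult_1_r, (Rmult_comm c). apply Rmult_le_compat; lra.
    - assert (LB : g / 2 <= <|RtoC (X (sx * u) r0) - f z r0|>).
      { assert (T3 := Cmod_tri3 (RtoC (X (sx * u) r0)) (f z r0) (RtoC (lam s))). rewrite Cmod_RR in T3.
        assert (g <= Rabs (X (sx * u) r0 - lam s)).
        { rewrite <- (Rmult_1_l (Rabs _)), <- Ab, <- Rabs_mult, Rmult_minus_distr_l, XY. rewrite Rabs_pos_eq; lra. }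
        lra. }
      assert (E1 : exp (2 * K * (r - r0)) <= exp (2 * K * t)).
      { assert (Q : 2 * K * (r - r0) < 2 * K * t) by (apply Rmult_lt_compat_l; lra). left. apply exp_increasing; auto. }
      assert (EE : exp (- (2 * K * t)) * exp (2 * K * t) = 1) by (rewrite <- exp_plus; replace (- (2 * K * t) + 2 * K * t) with 0 by ring; apply exp_0).
       assert (P2 := exp_pos (2 * K * t)). assert (P3 := Cmod_ge_0 (RtoC (X (sx * u) r) - f z r)%C).
      apply Rmult_le_reg_r with (exp (2 * K * t)); auto. unfold ka. rewrite Rmult_assoc, EE, Rmult_1_r.
      eapply Rle_trans; [exact LB|]. eapply Rle_trans; [exact GR|]. apply Rmult_le_compat_l; auto. }
  assert (ReD : forall r, r0 <= r <= t -> ka / 2 < Rabs (X (sx * u) r - Re (f z r))).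
  { intros r Hr. specialize (Dist r Hr). assert (CS := Cmod_le_sum (RtoC (X (sx * u) r) - f z r)%C). rewrite re_minus, im_minus in CS. simpl in CS.
    assert (I1 := Imf_decr CH r z r0 lra lra (slit_mono r t z lra Z1)).
    assert (I2 := ch_map CH r z lra (slit_mono r t z lra Z1)).
    rewrite Rminus_0_l, Rabs_Ropp, (Rabs_pos_eq (Im _)) in CS by lra. lra. }
  assert (Pos : forall r, r0 <= r <= t -> 0 < sx * (X (sx * u) r - Re (f z r))).
  { apply (sign_const (fun r => sx * (X (sx * u) r - Re (f z r))) r0 t); [| |lra|].
    - apply (wcont_mult r0 t (fun _ => sx)); [apply wcont_cst|]. apply wcont_minus.
      + apply (wcont_sub 0 t); try lra. apply (rsol_elim lam 0 t). apply X_rsol; auto; lra.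
      + apply wcont_re. apply (f_sub_sol r0 t z t); auto; lra.
    - intros r Hr E. specialize (ReD r Hr). apply Rmult_integral in E. destruct E as [E|E]; [lra|]. rewrite E, Rabs_R0 in ReD. lra.
    - exists r0. split; [lra|]. rewrite Rmult_minus_distr_l, XY.
      assert (B := re_le_Cmod (f z r0 - RtoC (lam s))%C). rewrite re_minus in B. simpl in B.
      assert (B2 : Rabs (sx * (Re (f z r0) - lam s)) < g / 2) by (rewrite Rabs_mult, Ab; lra). apply Rabs_def2 in B2. lra. }
  specialize (Pos t lra). specialize (ReD t lra).
  assert (B := re_le_Cmod (f z t - RtoC l)%C). rewrite re_minus in B. simpl in B.
  assert (B2 : Rabs (sx * (Re (f z t) - l)) < ka / 4) by (rewrite Rabs_mult, Ab; lra). apply Rabs_def2 in B2.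
  assert (Q : ka / 2 < Rabs (sx * (X (sx * u) t - Re (f z t)))) by (rewrite Rabs_mult, Ab; lra).
  rewrite Rabs_pos_eq in Q by lra. rewrite Rmult_minus_distr_l, XY in Q.
  lra.
Qed.

Definition x1 (t : R) : R := ye 1 t.
Definition x2 (t : R) : R := - ye (-1) t.

Lemma x1_gt t : 0 < t < t0 -> lam t < x1 t.
Proof. intros Ht. assert (H := ye_gt 1 lra t Ht). unfold x1. lra. Qed.

Lemma x2_lt t : 0 < t < t0 -> x2 t < lam t.
Proof. intros Ht. assert (H := ye_gt (-1) lra t Ht). unfold x2. lra. Qed.

Lemma X_right t x : 0 < x -> 0 <= t < t0 -> x1 t < X x t.
Proof. intros Hx Ht. assert (H := proj1 (ye_spec 1 lra t Ht) x Hx). unfold Y in H. rewrite !Rmult_1_l in H. exact H. Qed.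

Lemma X_left t x : x < 0 -> 0 <= t < t0 -> X x t < x2 t.
Proof.
  intros Hx Ht. assert (H := proj1 (ye_spec (-1) lra t Ht) (- x) lra). unfold Y in H.
  replace (-1 * - x) with x in H by ring. unfold x2. lra.
Qed.

(** * Prime ends of the slit half-plane and identification of the harmonic measures *)

Lemma D_conn t z w : 0 <= t <= T -> slit gamma t z -> slit gamma t w -> joined (slit gamma t) z w.
Proof.
  intros Ht Hz Hw. assert (Iz := ch_map CH t z Ht Hz). assert (Iw := ch_map CH t w Ht Hw).
  set (p := fun x : R => (f z t + RtoC x * (f w t - f z t))%C).
  assert (Ip : forall x, 0 <= x <= 1 -> 0 < Im (p x)).
  { intros x Hx. unfold p. replace (Im (f z t + RtoC x * (f w t - f z t))%C) with ((1 - x) * Im (f z t) + x * Im (f w t))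
      by (unfold Im, Re; simpl; ring). destruct (Req_dec x 0) as [->|]; [lra|]. assert (0 < x * Im (f w t)) by (apply Rmult_lt_0_compat; lra).
    assert (0 <= (1 - x) * Im (f z t)) by (apply Rmult_le_pos; lra). lra. }
  replace z with (F t (p 0)); [replace w with (F t (p 1))|].
  - apply (joined_01 (slit gamma t) (fun x => F t (p x))).
    + apply (wcontC_C2 0 1 (F t)); [intros x Hx; apply (F_cont CH); auto|].  apply wcontC_plus; [apply wcontC_cst|].
      apply (wcontC_mult 0 1 (fun x => RtoC x)); [|apply wcontC_cst].
      intros x e Hx He. exists e. split; auto. intros y _ Hy. rewrite Cmod_RR. auto.
    + intros x Hx. apply (F_spec CH); auto.
  - unfold p. replace (f z t + 1 * (f w t - f z t))%C with (f w t) by ring. apply (F_f CH); auto.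
  - unfold p. replace (f z t + 0 * (f w t - f z t))%C with (f z t) by ring. apply (F_f CH); auto.
Qed.

Lemma boundary_cases t ze : 0 <= t <= T -> ~ slit gamma t ze -> 0 <= Im ze -> ~ slit_ends gamma t ze ->
  (exists x, x <> 0 /\ ze = RtoC x) \/ (exists s, 0 < s < t /\ ze = gamma s).
Proof.
  intros Ht ND I0 NE. destruct (Req_dec (Im ze) 0) as [E|E].
  - left. exists (Re ze). assert (Q : ze = RtoC (Re ze)) by (apply Ceq; auto). split; auto.
    intros R0. apply NE. left. rewrite (ch_g0 CH), Q, R0. auto.
  - right. assert (TR : trace gamma t ze). { apply NNPP. intros K. apply ND. split; auto. unfold Hplane. lra. }
    destruct TR as (s & (S0 & S1) & ->). exists s. split; auto. split.
    + destruct S0 as [S0|S0]; auto. exfalso. apply NE. left. subst s. auto.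
    + destruct S1 as [S1|S1]; auto. exfalso. apply NE. right. subst s. auto.
Qed.

(** Turns conditions on prime ends into the boundary conditions of the maximum principle. One
    explicit chain suffices at a real point; at a point of the curve one chain per side is used, and
    nearby points of height 0 belong to the curve. *)
Lemma chains_fill t ze (P : C -> Prop) : 0 < t < t0 -> ~ slit gamma t ze -> 0 <= Im ze -> ~ slit_ends gamma t ze ->
  (forall c, null_chain (slit gamma t) c -> prime_end_at (slit gamma t) c ze -> prime_end (slit gamma t) c P) ->
  exists r, 0 < r /\ forall z, slit gamma t z -> <|z - ze|> < r -> P z.
Proof.
  intros Ht ND I0 NE HP. assert (Hc := fun z w => D_conn t z w lra).
  destruct (boundary_cases t ze lra ND I0 NE) as [(x & Nx & ->)|(s & Hs & ->)].
  - destruct (gam_away 0 t (RtoC x) lra lra (real_not_gamma t x Nx lra)) as (c & C0 & HC).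
    set (d := Rmin 1 (c / 2)). assert (d0 : 0 < d) by (apply Rmin_pos; lra).
    assert (d1 : d <= 1) by apply Rmin_l. assert (d2 : d <= c / 2) by apply Rmin_r.
    assert (cW : forall u v eps, 0 < eps -> exists e, 0 < e /\ forall u' v', Rabs (u' - u) < e -> Rabs (v' - v) < e -> <|(u', v') - (u, v)|> < eps).
    { intros u v e He. exists (e / 2). split; [lra|]. intros u' v' Hu Hv. eapply Rle_lt_trans; [apply Cmod_le_sum|].
      rewrite re_minus, im_minus.  simpl. lra. }
    assert (HD : forall u v, Rabs (u - x) < d -> 0 < v < d -> slit gamma t (u, v)).
    { intros u v Hu Hv. split; [unfold Hplane, Im; simpl; lra|]. intros (r & Hr & E). specialize (HC r Hr). rewrite <- E in HC.
      assert (B := Cmod_le_sum ((u, v) - RtoC x)%C). rewrite re_minus, im_minus in B.  simpl in B.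
      rewrite Rminus_0_r, (Rabs_pos_eq v) in B; lra. }
    assert (HN : forall u, Rabs (u - x) < d -> ~ slit gamma t (u, 0)) by (intros u _; apply (real_slit t u)).
    assert (dd : 0 < d <= 1) by lra.
    assert (aW : forall u v : R, Re (u, v) = u) by reflexivity. assert (bW : forall u v : R, Im (u, v) = v) by reflexivity.
    assert (Wab : forall z : C, (Re z, Im z) = z) by (intros (u, v); auto).
    destruct (bump_chain Hc dd rcont_Re_id rcont_Im_id cW aW bW Wab HD HN) as (N & PE).
    destruct (bump_eventually Hc dd rcont_Re_id rcont_Im_id cW aW bW Wab HD HN P (HP _ N PE)) as (r & R0 & K).
    exists r. split; auto. intros z Hz. apply K; auto. apply (@slit_H gamma t). auto.
  - destruct (side_box t s Hs lra) as (d' & D' & HB). set (A := ca th (gamma s)) in *.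
    set (d := Rmin 1 d'). assert (d0 : 0 < d) by (apply Rmin_pos; lra).
    assert (d1 : d <= 1) by apply Rmin_l. assert (d2 : d <= d') by apply Rmin_r. clearbody d.
    assert (GA : G A = gamma s) by (apply G_gamma; lra).
    assert (HN : forall sg u, Rabs (u - A) < d -> ~ slit gamma t (V sg u 0)).
    { intros sg u Hu (_ & K). apply K. apply trace_iff; [lra|]. rewrite V_0, ca_G, ht_G. split; auto.
      destruct (HB 1 u (d / 2) lra lra lra) as (_ & B). lra. }
    assert (Ch : forall sg, sg * sg = 1 -> exists r, 0 < r /\ forall z, slit gamma t z -> 0 < sg * ht z -> <|z - gamma s|> < r -> P z).
    { intros sg S. assert (dd : 0 < d <= 1) by lra.
      assert (rca : forall z, rcont (ca th) z).
      { intros z e He. exists e. split; auto. intros w Hw. eapply Rle_lt_trans; [apply ca_lip|]. auto. }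
      assert (rcb : forall z, rcont (fun w => sg * ht w) z).
      { intros z e He. exists (e / 2). split; [lra|]. intros w Hw.
        rewrite <- Rmult_minus_distr_l, Rabs_mult, (sg_abs sg S), Rmult_1_l. eapply Rle_lt_trans; [apply ht_lip|]. lra. }
      assert (cW : forall u v eps, 0 < eps -> exists e, 0 < e /\ forall u' v', Rabs (u' - u) < e -> Rabs (v' - v) < e -> <|V sg u' v' - V sg u v|> < eps).
      { intros u v e He. exists (e / 3). split; [lra|]. intros u' v' Hu Hv. eapply Rle_lt_trans; [apply V_dist; auto|]. lra. }
      assert (bW : forall u v, sg * ht (V sg u v) = v) by (intros; rewrite ht_V, <- Rmult_assoc, S; ring).
      assert (HD : forall u v, Rabs (u - A) < d -> 0 < v < d -> slit gamma t (V sg u v)) by (intros; apply HB; auto; lra).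
      destruct (bump_chain Hc dd rca rcb cW (ca_V sg) bW (fun z => eq_sym (V_of z sg S)) HD (HN sg)) as (N & PE).
      rewrite V_0, GA in PE.
      destruct (bump_eventually Hc dd rca rcb cW (ca_V sg) bW (fun z => eq_sym (V_of z sg S)) HD (HN sg) P (HP _ N PE)) as (r & R0 & K).
      exists r. split; auto. intros z Hz Bz Dz. apply K; auto. rewrite V_0, GA. auto. }
    destruct (Ch 1 lra) as (r1 & R1 & K1). destruct (Ch (-1) lra) as (r2 & R2 & K2).
    exists (Rmin d (Rmin r1 r2)). split; [repeat apply Rmin_pos; auto|]. intros z Hz Dz.
    destruct (Rmin3 _ _ _ _ Dz) as (M1 & M2 & M3).
    destruct (Rtotal_order (ht z) 0) as [L|[E|L]]; [apply K2; auto; lra| |apply K1; auto; lra].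
    exfalso. assert (C1 := ca_lip th z (gamma s)). fold A in C1. apply (HN 1 (ca th z)); [lra|].
    rewrite V_0, <- (G_eq z E). auto.
Qed.

(** A crosscut near [gamma s] is connected and avoids height 0, so it lies on one side. If the
    neighbourhood it cuts off contained a point of the other side, it would contain everything
    joined to that point on the other side, including points at a definite distance from
    [gamma s]. *)
Lemma chain_one_side t s c : 0 < s < t -> t < t0 -> null_chain (slit gamma t) c -> prime_end_at (slit gamma t) c (gamma s) ->
  exists sg, sg * sg = 1 /\ prime_end (slit gamma t) c (side sg).
Proof.
  intros Hs Ht N PE. assert (Hop := slit_open CH t lra). assert (Hc := fun z w => D_conn t z w lra).
  destruct (side_box t s Hs lra) as (d & D & HB). set (A := ca th (gamma s)) in *.
  assert (GA : G A = gamma s) by (apply G_gamma; lra).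
  destruct (pe_at c (gamma s) (d / 4) PE lra) as (n & Hn & K).
  set (c1 := c (S n)). assert (K1 : forall z, arc c1 z -> slit gamma t z /\ <|z - gamma s|> < d / 4).
  { intros z Hz. apply (arc_in_nbhd c n z N Hn) in Hz. split; [apply Hz|apply K; auto]. }
  assert (NZ : forall z, slit gamma t z -> <|z - gamma s|> < d / 4 -> Rabs (ca th z - A) < d /\ ht z <> 0 /\ Rabs (ht z) < d).
  { intros z Hz Dz. assert (C1 := ca_lip th z (gamma s)). fold A in C1. assert (C2 := ht_lip z (gamma s)).
    rewrite <- GA, ht_G, GA, Rminus_0_r in C2. split; [lra|]. split; [|lra]. intros E.
    apply (proj2 Hz). apply trace_iff; [lra|]. split; auto.
    destruct (HB 1 (ca th z) (d / 2) lra lra lra) as (_ & B). lra. }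
  destruct (K1 _ (arc_mid c1)) as (M1 & M2). destruct (NZ _ M1 M2) as (_ & M3 & _).
  destruct (proj1 N (S n)) as (Cc & _). apply wcontC_within in Cc.
  assert (Ex : exists sg, sg * sg = 1 /\ 0 < sg * ht (c1 (1/2))).
  { destruct (Rtotal_order (ht (c1 (1/2))) 0) as [L|[E|L]]; [exists (-1); lra|contradiction|exists 1; lra]. }
  destruct Ex as (sg & Sg & M4).
  assert (Sn : sg <> 0) by (intros E; rewrite E in Sg; lra).
  assert (Arc : forall z, arc c1 z -> 0 < sg * ht z).
  { intros z (x & Hx & ->). set (e := Rmin x (1 - x) / 2). assert (E1 := Rmin_l x (1 - x)). assert (E2 := Rmin_r x (1 - x)).
    assert (E3 : 0 < Rmin x (1 - x)) by (apply Rmin_pos; lra).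
    assert (E4 : 0 < e < 1/2 /\ e <= x <= 1 - e) by (unfold e; lra). destruct E4 as (E4 & E5).
    apply (sign_const (fun x => sg * ht (c1 x)) e (1 - e)); [| |lra| |lra].
    - apply (wcont_mult _ _ (fun _ => sg)); [apply wcont_cst|]. apply (wcont_C2 _ _ ht).
      + intros y _ e' He'. exists (e' / 2). split; [lra|]. intros w Hw. eapply Rle_lt_trans; [apply ht_lip|]. lra.
      + apply (wcontC_sub 0 1); auto; lra.
    - intros y Hy. destruct (K1 (c1 y)) as (B1 & B2); [exists y; split; auto; lra|]. apply Rmult_integral_contrapositive. split; auto. apply (NZ _ B1 B2).
    - exists (1/2). split; [lra|auto]. }
  exists sg. split; auto. exists (S n). split; [lia|]. intros z Hz.
  assert (Dz := proj1 (proj1 Hz)). assert (Nz := K z (nbhd_nested Hop Hc c n z N Hn Hz)). destruct (NZ z Dz Nz) as (B1 & B2 & B3).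
  apply Rnot_le_lt. intros L.
  assert (L2 : 0 < - sg * ht z). { assert (sg * ht z <> 0) by (apply Rmult_integral_contrapositive; auto). lra. }
  (* [ht] is 2-Lipschitz, so height [d / 2] means distance at least [d / 4] from [gamma s], against
     the choice of [n]. *)
  set (y := V (- sg) A (d / 2)).
  assert (Hy : - sg * ht y = d / 2) by (unfold y; rewrite ht_V; replace (- sg * (- sg * (d / 2))) with (sg * sg * (d / 2)) by ring; rewrite Sg; ring).
  assert (Cy : ca th y = A) by apply ca_V.
  assert (J : joined (cut (slit gamma t) c1) z y).
  { apply (box_joined _ (- sg) A d); try lra.
    - intros a be Ha Hb. split; [apply HB; auto; lra|]. intros Aa. apply Arc in Aa. rewrite ht_V in Aa.
      replace (sg * (- sg * be)) with (- (sg * sg) * be) in Aa by ring. rewrite Sg in Aa. lra.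
    - split; auto. eapply Rle_lt_trans; [apply Rle_abs|]. rewrite Rabs_mult, Rabs_Ropp, (sg_abs sg Sg). lra.
    - rewrite Cy, Rminus_diag, Rabs_R0. auto. }
  assert (Ny : chain_nbhd (slit gamma t) c (S n) y).
  { destruct (joined_elim _ _ _ J) as (p & _ & Hp & _ & P1). split; [rewrite <- P1; apply Hp; lra|].
    intros w Hw J2. apply (proj2 Hz w Hw). apply joined_trans with y; auto. }
  assert (Ky := K y (nbhd_nested Hop Hc c n y N Hn Ny)).
  assert (C2 := ht_lip y (gamma s)). rewrite <- GA, ht_G, GA, Rminus_0_r in C2.
  assert (Ay : Rabs (ht y) = d / 2). { rewrite <- (Rabs_pos_eq (d / 2)) by lra. rewrite <- Hy, Rabs_mult, Rabs_Ropp, (sg_abs sg Sg). ring. }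
  lra.
Qed.

(** The values that [f] can approach at a boundary point other than the ends of the slit: one at a
    real point, one for each side at a point of the curve. *)
Definition bval (t : R) (ze : C) (l : R) : Prop :=
  (exists x, x <> 0 /\ ze = RtoC x /\ l = X x t) \/
  (exists s sg, 0 < s < t /\ sg * sg = 1 /\ ze = gamma s /\ lim_at t (side sg) ze l).

Lemma bval_cases t ze l : 0 < t < t0 -> bval t ze l ->
  (~ trace gamma t ze /\ (l < x2 t \/ x1 t < l)) \/ (trace gamma t ze /\ x2 t < l < x1 t /\ l <> lam t).
Proof.
  intros Ht [(x & Nx & -> & ->)|(s & sg & Hs & Sg & -> & HL)].
  - left. split.
    + intros (r & Hr & E). apply (real_not_gamma t x Nx lra r Hr). auto.
    + destruct (Rtotal_order x 0) as [L|[E|L]]; [left; apply X_left; lra|contradiction|right; apply X_right; lra].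
  - right. split; [exists s; split; auto; unfold Icc; lra|].
    split; [|apply (side_limit_neq s t sg l); auto; lra].
    assert (A1 := side_lt_ye 1 s t sg l lra Sg Hs lra HL). assert (A2 := side_lt_ye (-1) s t sg l lra Sg Hs lra HL).
    unfold x1, x2. lra.
Qed.

Lemma chain_limit t ze c : 0 < t < t0 -> null_chain (slit gamma t) c -> prime_end_at (slit gamma t) c ze -> ~ slit_ends gamma t ze ->
  exists l, filterlim (fun z => f z t) (prime_end (slit gamma t) c) (locally (RtoC l)) /\ bval t ze l.
Proof.
  intros Ht N PE NE. assert (Hop := slit_open CH t lra). assert (Hc := fun z w => D_conn t z w lra).
  assert (Lim : forall (P : C -> Prop) l, prime_end (slit gamma t) c P -> lim_at t P ze l -> filterlim (fun z => f z t) (prime_end (slit gamma t) c) (locally (RtoC l))).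
  { intros P l HP HL. apply Cmod_filterlim; [intros; eapply pe_mono; eauto|]. intros e He. destruct (HL e He) as (d & D & K).
    refine (pe_mono c _ _ _ (pe_and Hop Hc c _ _ N (pe_dom c N) (pe_and Hop Hc c _ _ N HP (pe_at c ze d PE D)))).
     intros z (Z1 & Z2 & Z3). auto. }
  assert (I0 : 0 <= Im ze).
  { apply Rnot_lt_le. intros L. destruct (pe_proper c _ N (pe_at c ze (- Im ze) PE lra)) as (z & Hz & Kz).
    assert (A := im_le_Cmod (z - ze)%C). rewrite im_minus in A. assert (B := @slit_H gamma t z Hz). rewrite Rabs_pos_eq in A by lra. lra. }
  destruct (boundary_cases t ze lra (pe_boundary Hop c ze N PE) I0 NE) as [(x & Nx & ->)|(s & Hs & ->)].
  - exists (X x t). split; [apply (Lim (fun _ => True)); [exists 1%nat; auto|apply X_lim; auto; lra]|]. left. exists x. auto.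
  - destruct (chain_one_side t s c Hs lra N PE) as (sg & Sg & HS). destruct (side_limit s t sg Sg Hs lra) as (l & HL).
    exists l. split; [apply (Lim (side sg)); auto|]. right. exists s, sg. auto.
Qed.

(** The form used in the comparisons: a property that holds near every possible boundary value at
    [ze] holds near [ze]. *)
Lemma near_boundary t ze (P : C -> Prop) : 0 < t < t0 -> ~ slit gamma t ze -> 0 <= Im ze -> ~ slit_ends gamma t ze ->
  (forall l, bval t ze l -> exists d, 0 < d /\ forall z, slit gamma t z -> <|z - ze|> < d -> <|f z t - RtoC l|> < d -> P z) ->
  exists r, 0 < r /\ forall z, slit gamma t z -> <|z - ze|> < r -> P z.
Proof.
  intros Ht ND I0 NE H. apply chains_fill; auto. intros c N PE. assert (Hop := slit_open CH t lra). assert (Hc := fun z w => D_conn t z w lra).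
  destruct (chain_limit t ze c Ht N PE NE) as (l & HL & Bv). destruct (H l Bv) as (d & D & K).
  refine (pe_mono c _ _ _ (pe_and Hop Hc c _ _ N (pe_dom c N) (pe_and Hop Hc c _ _ N (pe_at c ze d PE D) (filterlim_Cmod _ _ _ HL d D)))).
   intros z (Z1 & Z2 & Z3). auto.
Qed.

(** Harmonic measure of [[q, p]] in the half-plane, pulled back by [f]. *)
Definition pm (t p q : R) (z : C) : R := / PI * (argH (f z t - RtoC p)%C - argH (f z t - RtoC q)%C).

Lemma pm_harmonic t p q : 0 <= t <= T -> harmonic_on (slit gamma t) (pm t p q).
Proof.
  intros Ht.
  assert (E : pm t p q = fun z => Re ((- Ci) * (RtoC (/ PI) * (LogH (f z t - RtoC p) + - 1 * LogH (f z t - RtoC q))))%C).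
  { apply FunctionalExtensionality.functional_extensionality. intros z. unfold pm. rewrite <- !LogH_im. destruct (LogH (f z t - RtoC p)%C), (LogH (f z t - RtoC q)%C).  simpl. ring. }
  rewrite E. apply (holo_harmonic (slit_open CH t Ht) (fun z => RtoC (/ PI) * (LogH (f z t - RtoC p) + - 1 * LogH (f z t - RtoC q)))%C).
  assert (K : forall x : R, holo 2 (slit gamma t) (fun z => LogH (f z t - RtoC x)%C)).
  { intros x. apply (holo_comp 2 _ slitH (fun z => f z t - RtoC x)%C LogH).
    - intros z Hz. apply slitH_H. rewrite im_sub_R. apply (ch_map CH); auto.
    - apply (holo_plus 2 _ (fun z => f z t) (fun _ => - RtoC x)%C); [apply (f_holo CH); auto|apply holo_const].
    - apply holo_LogH. }
  apply (holo_mult 2 _ (fun _ => RtoC (/ PI))); [apply holo_const|]. apply holo_plus; [apply K|].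
  apply (holo_mult 2 _ (fun _ => - 1)%C); [apply holo_const|apply K].
Qed.

Lemma pm_bound t p q z : 0 <= t <= T -> slit gamma t z -> Rabs (pm t p q z) <= 1.
Proof.
  intros Ht Hz. assert (I := ch_map CH t z Ht Hz). unfold pm.
  assert (A := argH_H (f z t - RtoC p)%C ltac:(rewrite im_sub_R; auto)). assert (B := argH_H (f z t - RtoC q)%C ltac:(rewrite im_sub_R; auto)).
  rewrite Rabs_mult, Rabs_inv, (Rabs_pos_eq PI) by lra. apply Rmult_le_reg_l with PI; [lra|].
  rewrite <- Rmult_assoc, Rinv_r, Rmult_1_l, Rmult_1_r by lra. apply Rabs_le. lra.
Qed.

Lemma pm_limit t p q c l v : l <> p -> l <> q -> q < p ->
  filterlim (fun z => f z t) (prime_end (slit gamma t) c) (locally (RtoC l)) ->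
  (q < l < p -> v = 1) -> (l < q \/ p < l -> v = 0) -> filterlim (pm t p q) (prime_end (slit gamma t) c) (locally v).
Proof.
  intros N1 N2 Hpq HL V1 V0. apply Rabs_filterlim; [intros; eapply pe_mono; eauto|]. intros e He.
  set (k := fun w => / PI * (argH (w - RtoC p)%C - argH (w - RtoC q)%C)).
  assert (RC : forall x : R, l <> x -> rcont (fun w => argH (w - RtoC x)%C) (RtoC l)).
  { intros x Nx e' He'. destruct (rcont_argH (RtoC l - RtoC x)%C) with (eps := e') as (d & D & K); auto.
    - rewrite <- RtoC_minus. apply slitH_real. lra.
    - exists d. split; auto. intros w Hw. apply K. replace (w - RtoC x - (RtoC l - RtoC x))%C with (w - RtoC l)%C by ring. auto. }
  assert (Rk : rcont k (RtoC l)).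
  { apply (rcont_mult (fun _ => / PI)); [apply rcont_const|]. apply rcont_plus; auto.
    apply (rcont_ext (fun w => -1 * argH (w - RtoC q)%C)); [intros; ring|]. apply rcont_mult; [apply rcont_const|auto]. }
  assert (Vk : k (RtoC l) = v).
  { unfold k. rewrite <- !RtoC_minus.
    destruct (Rlt_le_dec l q) as [L|L]; [rewrite !argH_neg by lra; rewrite V0; [ring|lra]|].
    rewrite (argH_pos (l - q)) by lra. destruct (Rlt_le_dec l p) as [L2|L2].
    - rewrite argH_neg, V1 by lra. field. lra.
    - rewrite argH_pos, V0 by lra. ring. }
  destruct (Rk e He) as (d & D & K). apply (pe_mono c (fun z => <|f z t - RtoC l|> < d)); [|apply (filterlim_Cmod _ _ _ HL d D)].
  intros z Hz. rewrite <- Vk. apply (K (f z t) Hz).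
Qed.

(** Two candidates have the same limit along every chain ending off the ends of the slit, and both
    are bounded; the maximum principle with these two exceptional points makes them equal. This ties
    the [epsilon] choice in [harmonic_measure] to the explicit [pm]. *)
Lemma hm_unique t A u v : 0 < t < t0 -> is_harmonic_measure (slit gamma t) A (slit_ends gamma t) u ->
  is_harmonic_measure (slit gamma t) A (slit_ends gamma t) v -> forall z, slit gamma t z -> u z = v z.
Proof.
  assert (Half : forall A u v, 0 < t < t0 -> is_harmonic_measure (slit gamma t) A (slit_ends gamma t) u ->
    is_harmonic_measure (slit gamma t) A (slit_ends gamma t) v -> forall z, slit gamma t z -> u z - v z <= 0).
  { clear A u v. intros A u v Ht (U1 & (Mu & U2) & U3) (V1 & (Mv & V2) & V3).
    assert (Hop := slit_open CH t lra). assert (Hc := fun z w => D_conn t z w lra).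
    apply (max_principle (slit gamma t) (fun z => u z - v z) (Mu + Mv) (gamma 0 :: gamma t :: nil)); auto.
    - intros z Hz. apply (@slit_H gamma t). auto.
    - intros e [<-|[<-|[]]] (_ & K); apply K; [exists 0|exists t]; split; auto; unfold Icc; lra.
    - apply harm_minus; apply harmonic_harm; auto.
    - intros z Hz. assert (B1 := U2 z Hz). assert (B2 := V2 z Hz). assert (B3 := Rle_abs (u z)). assert (B4 := Rle_abs (- v z)). rewrite Rabs_Ropp in B4. lra.
    - intros ze e ND NI I0 He. apply (chains_fill t ze); auto.
      { intros [-> | ->]; apply NI; simpl; auto. }
      intros c N PE.
      assert (NE : ~ slit_ends gamma t ze) by (intros [-> | ->]; apply NI; simpl; auto).
      destruct (U3 c ze N PE NE) as (P1 & P2). destruct (V3 c ze N PE NE) as (Q1 & Q2).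
      assert (L : exists l, filterlim u (prime_end (slit gamma t) c) (locally l) /\ filterlim v (prime_end (slit gamma t) c) (locally l)).
      { destruct (classic (A c)) as [K|K]; [exists 1|exists 0]; auto. }
      destruct L as (l & L1 & L2).
      refine (pe_mono c _ _ _ (pe_and Hop Hc c _ _ N (filterlim_Rabs _ _ _ L1 (e / 2) lra) (filterlim_Rabs _ _ _ L2 (e / 2) lra))).
       intros z (Z1 & Z2). apply Rabs_def2 in Z1, Z2. lra. }
  intros Ht HU HV z Hz. assert (A1 := Half A u v Ht HU HV z Hz). assert (A2 := Half A v u Ht HV HU z Hz). lra.
Qed.

Lemma left_pm t : 0 < t < t0 -> is_harmonic_measure (slit gamma t) (left_side gamma t (fun z => f z t) (lam t)) (slit_ends gamma t) (pm t (lam t) (x2 t)).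
Proof.
  intros Ht. assert (B1 := x1_gt t Ht). assert (B2 := x2_lt t Ht).
  assert (Hop := slit_open CH t lra). assert (Hc := fun z w => D_conn t z w lra).
  split; [apply pm_harmonic; lra|]. split; [exists 1; intros; apply pm_bound; auto; lra|].
  intros c ze N PE NE. destruct (chain_limit t ze c Ht N PE NE) as (l & HL & Bv). assert (Cs := bval_cases t ze l Ht Bv). split.
  - intros (ze' & x & TR & PE' & Hx & Lx).
    assert (E1 := pe_lim_unique Hop Hc c _ _ _ N HL Hx). apply (f_equal Re) in E1. simpl in E1. subst x.
    assert (E2 := pe_lim_unique Hop Hc c _ _ _ N PE PE'). subst ze'.
    destruct Cs as [(NT & _)|(_ & Cs)]; [contradiction|]. apply (pm_limit t _ _ c l); auto; lra.
  - intros NA. apply (pm_limit t _ _ c l); auto; try lra.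
    intros Hl. destruct Cs as [Cs|(TR & _)]; [lra|]. exfalso. apply NA. exists ze, l. repeat split; auto; lra.
Qed.

Lemma right_pm t : 0 < t < t0 -> is_harmonic_measure (slit gamma t) (right_side gamma t (fun z => f z t) (lam t)) (slit_ends gamma t) (pm t (x1 t) (lam t)).
Proof.
  intros Ht. assert (B1 := x1_gt t Ht). assert (B2 := x2_lt t Ht).
  assert (Hop := slit_open CH t lra). assert (Hc := fun z w => D_conn t z w lra).
  split; [apply pm_harmonic; lra|]. split; [exists 1; intros; apply pm_bound; auto; lra|].
  intros c ze N PE NE. destruct (chain_limit t ze c Ht N PE NE) as (l & HL & Bv). assert (Cs := bval_cases t ze l Ht Bv). split.
  - intros (ze' & x & TR & PE' & Hx & Lx).
    assert (E1 := pe_lim_unique Hop Hc c _ _ _ N HL Hx). apply (f_equal Re) in E1. simpl in E1. subst x.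
    assert (E2 := pe_lim_unique Hop Hc c _ _ _ N PE PE'). subst ze'.
    destruct Cs as [(NT & _)|(_ & Cs)]; [contradiction|]. apply (pm_limit t _ _ c l); auto; lra.
  - intros NA. apply (pm_limit t _ _ c l); auto; try lra.
    intros Hl. destruct Cs as [Cs|(TR & _)]; [lra|]. exfalso. apply NA. exists ze, l. repeat split; auto; lra.
Qed.

Lemma measure_pm sid t p q : 0 < t < t0 ->
  is_harmonic_measure (slit gamma t) (sid gamma t (fun z => f z t) (lam t)) (slit_ends gamma t) (pm t p q) ->
  side_measure sid gamma f lam t = / PI * (argH (Ci - RtoC p)%C - argH (Ci - RtoC q)%C).
Proof.
  intros Ht HM.
  assert (Sp := epsilon_spec (inhabits (fun _ : C => 0)) _ (ex_intro _ _ HM)).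
  change (inverse_on (slit gamma t) (fun z => f z t) Ci) with (F t Ci).
  destruct (F_spec CH t Ci lra ltac:(simpl; lra)) as (S1 & S2).
  transitivity (pm t p q (F t Ci)); [exact (hm_unique t _ _ _ Ht Sp HM _ S1)|]. unfold pm. rewrite S2. auto.
Qed.

Lemma side_measures t : 0 < t < t0 ->
  side_measure left_side gamma f lam t = / PI * (argH (Ci - RtoC (lam t))%C - argH (Ci - RtoC (x2 t))%C) /\
  side_measure right_side gamma f lam t = / PI * (argH (Ci - RtoC (x1 t))%C - argH (Ci - RtoC (lam t))%C).
Proof. intros Ht. split; apply measure_pm; auto; [apply left_pm|apply right_pm]; auto. Qed.

(** * Width, centre of mass and time scales of the image segment *)

Section Asymptotics.
Context (Hsml : 2 * eps <= sin th) (Hth1 : eps < th) (Hth2 : eps < PI - th).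
Local Notation A := (fun t => ca th (gamma t)).

Lemma cb_gamma s : 0 < s <= t0 -> Rabs (cb th (gamma s)) <= eps * A s.
Proof.
  intros Hs. destruct (GL 0 s lra lra lra) as (_ & B). rewrite ca_g0, cb_g0, !Rminus_0_r in B. exact B.
Qed.

Lemma arg_gamma s : 0 < s <= t0 -> Rabs (argH (gamma s) - th) <= eps.
Proof.
  intros Hs. assert (P := gamma_ca s Hs). assert (B := cb_gamma s Hs).
  set (x := ca th (gamma s)) in *. set (y := cb th (gamma s)) in *. set (v := y / x). set (psi := atan v).
  assert (Pv : Rabs psi <= eps).
  { eapply Rle_trans; [apply atan_abs|]. unfold v, Rdiv. rewrite Rabs_mult, Rabs_inv, (Rabs_pos_eq x) by lra.
    apply Rmult_le_reg_r with x; auto. rewrite Rmult_assoc, Rinv_l by lra. lra. }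
  assert (S0 : 0 < sqrt (1 + v * v)) by (apply sqrt_lt_R0; nra).
  assert (C1 : cos psi = 1 / sqrt (1 + v * v)) by (unfold psi; rewrite cos_atan; unfold Rsqr; auto).
  assert (C2 : sin psi = v / sqrt (1 + v * v)) by (unfold psi; rewrite sin_atan; unfold Rsqr; auto).
  assert (E : gamma s = (RtoC (x * sqrt (1 + v * v)) * (cos (th + psi), sin (th + psi)))%C).
  { rewrite <- (pt_c th (gamma s)). fold x y. rewrite cos_plus, sin_plus, C1, C2. set (r := sqrt (1 + v * v)) in *.
    assert (Y : y = x * v) by (unfold v; field; lra).   apply Ceq.
    - transitivity (x * r * (cos th * (1 / r) - sin th * (v / r)) - 0 * (sin th * (1 / r) + cos th * (v / r))); [rewrite Y; simpl; field; lra|reflexivity].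
    - transitivity (x * r * (sin th * (1 / r) + cos th * (v / r)) + 0 * (cos th * (1 / r) - sin th * (v / r))); [rewrite Y; simpl; field; lra|reflexivity]. }
  apply Rabs_le_between in Pv. rewrite E, argH_scal by (apply Rmult_lt_0_compat; auto). rewrite argH_polar by lra. apply Rabs_le. lra.
Qed.

Lemma A_mono s t : 0 <= s <= t -> t <= t0 -> A s <= A t.
Proof. intros Hs Ht. apply ca_mono; lra. Qed.

Lemma gamma_size s t : 0 <= s <= t -> t <= t0 -> Cmod (gamma s) <= (1 + eps) * A t.
Proof.
  intros Hs Ht. assert (M := A_mono s t Hs Ht).  destruct (Req_dec s 0) as [->|N].
  - rewrite (ch_g0 CH), Cmod_0. rewrite ca_g0 in M. apply Rmult_le_pos; lra.
  - assert (B := cb_gamma s lra). assert (P := gamma_ca s lra).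
    assert (R1 := rot_le th (gamma s) (gamma 0)). rewrite ca_g0, cb_g0, !Rminus_0_r, (Rabs_pos_eq (ca th (gamma s))) in R1 by lra.
    rewrite (ch_g0 CH) in R1. replace (gamma s - 0)%C with (gamma s) in R1 by ring. nra.
Qed.

Lemma A_le_mod t : A t <= Cmod (gamma t).
Proof.
  assert (L := ca_lip th (gamma t) (gamma 0)). rewrite ca_g0, Rminus_0_r, (ch_g0 CH) in L.
  replace (gamma t - 0)%C with (gamma t) in L by ring. assert (Q := Rle_abs (ca th (gamma t))). lra.
Qed.

Lemma Im_gamma_ge t : 0 < t <= t0 -> sin th / 2 * A t <= Im (gamma t).
Proof.
  intros Ht. assert (B := cb_gamma t Ht). assert (P := gamma_ca t Ht).
  replace (Im (gamma t)) with (sin th * ca th (gamma t) + cos th * cb th (gamma t)) by (rewrite <- Im_pt, pt_c; auto).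
  assert (C1 : Rabs (cos th * cb th (gamma t)) <= eps * ca th (gamma t)).
  { rewrite Rabs_mult. assert (Q := COS_bound th). assert (Rabs (cos th) <= 1) by (apply Rabs_le; lra).
     assert (Q3 := Rabs_pos (cb th (gamma t))). nra. }
  apply Rabs_le_between in C1. nra.
Qed.

Lemma f_expand t c e : 0 <= t <= T -> 0 < e -> exists Y1, forall y, Y1 < y ->
  slit gamma t (0, y) /\ Rabs (y * (argH (f (0, y) t - RtoC c)%C - PI / 2) - c) < e.
Proof.
  intros Ht He. destruct (ch_hyd CH t Ht) as (M & K & M0 & HM).
  destruct (wcont_bounded 0 t (fun s => Cmod (gamma s))) as (B & B0 & HB); [lra| |].
  { apply (wcont_C2 0 t Cmod); [intros; apply rcont_Cmod_id|]. apply (wcontC_sub 0 T); try lra. apply (ch_gam CH). }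
  set (Y0 := Rmax 1 (Rmax M B)). assert (Y1 : 1 <= Y0) by apply Rmax_l.
  assert (Y2 : M <= Y0) by (eapply Rle_trans; [apply Rmax_l|apply Rmax_r]). assert (Y3 : B <= Y0) by (eapply Rle_trans; [apply Rmax_r|apply Rmax_r]).
  assert (Cy : forall y, Y0 < y -> Cmod (0, y) = y).
  { intros y Hy. replace (0, y) with (RtoC y * Ci)%C by (apply Ceq; unfold Re, Im; simpl; ring). rewrite Cmod_mult, Cmod_Ci, Cmod_R, Rabs_pos_eq; lra. }
  assert (Sl : forall y, Y0 < y -> slit gamma t (0, y)).
  { intros y Hy. split; [unfold Hplane, Im; simpl; lra|]. intros (s & Hs & E). specialize (HB s Hs). rewrite <- E, (Cy y Hy), Rabs_pos_eq in HB; lra. }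
  assert (K0 := Rabs_pos K).
  destruct (arg_expand (fun y => f (0, y) t) (2 * t + Rabs K) Y0 c) with (e := e) as (Z & HZ); auto; [lra| |].
  - intros y Hy. assert (H := HM (0, y) (Sl y Hy) ltac:(rewrite (Cy y Hy); lra)). rewrite (Cy y Hy) in H.
    replace ((0, y) + RtoC (2 * t) / (0, y))%C with ((0, (y - 2 * t / y)%R) : C) in H.
    2: { replace ((0, y) : C) with (Ci * RtoC y)%C by (apply Ceq; unfold Re, Im; simpl; ring).
         replace (RtoC (2 * t) / (Ci * RtoC y))%C with (- (Ci * RtoC (2 * t / y)))%C.
         - apply Ceq; unfold Re, Im; simpl; ring.
         - rewrite RtoC_div by lra. assert (RtoC y <> 0)%C by (intros E; apply (f_equal Re) in E; simpl in E; lra).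
           assert (Ci <> 0)%C by (intros E; apply (f_equal Im) in E; simpl in E; lra).
           assert (E2 : (Ci * Ci)%C = (- (1))%C) by (apply Ceq; unfold Re, Im; simpl; ring).
           transitivity (- (Ci * Ci) * (RtoC (2 * t) / (Ci * RtoC y)))%C; [field; auto|]. rewrite E2. field. auto. }
    assert (KK : K / y ^ 2 <= Rabs K / y).
    { assert (K1 := Rle_abs K). unfold Rdiv. assert (0 < / y) by (apply Rinv_0_lt_compat; lra).
      assert (/ y <= 1) by (rewrite <- Rinv_1; apply Rinv_le_contravar; lra). replace (/ y ^ 2) with (/ y * / y) by (field; lra).
      apply Rle_trans with (Rabs K * (/ y * / y)); [apply Rmult_le_compat_r; nra|apply Rmult_le_compat_l; nra]. }
    assert (A1 := re_le_Cmod (f (0, y) t - (0, (y - 2 * t / y)%R))%C). assert (A2 := im_le_Cmod (f (0, y) t - (0, (y - 2 * t / y)%R))%C).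
    rewrite re_minus in A1. rewrite im_minus in A2.  unfold Im at 2 in A2.  simpl snd in A2.
    rewrite Rminus_0_r in A1. assert (T0 : 0 <= 2 * t / y) by (apply Rmult_le_pos; [lra|apply Rlt_le, Rinv_0_lt_compat; lra]).
    replace ((2 * t + Rabs K) / y) with (2 * t / y + Rabs K / y) by (field; lra). split; [lra|].
    apply Rabs_le_between in A2. apply Rabs_le. lra.
  - exists (Rmax Y0 Z). intros y Hy. split; [apply Sl; eapply Rle_lt_trans; [apply Rmax_l|exact Hy]|].
    apply HZ. eapply Rle_lt_trans; [apply Rmax_r|exact Hy].
Qed.

Definition p : R := th / PI.

Lemma p_bound : 0 < p < 1 /\ p * PI = th.
Proof.
  assert (P := PI_RGT_0). unfold p. split; [|field; lra]. split; [apply Rdiv_lt_0_compat; lra|].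
  apply Rmult_lt_reg_r with PI; auto. unfold Rdiv. rewrite Rmult_assoc, Rinv_l; lra.
Qed.

Lemma harm_argf t (x : R) W : 0 <= t <= T -> copen W -> (forall z, W z -> slit gamma t z) -> harm W (fun z => argH (f z t - RtoC x)%C).
Proof.
  intros Ht Ho HW. apply (harm_sub W (slit gamma t)); auto.
  apply (harm_arg (slit gamma t) (fun z => f z t)); [apply (slit_open CH); auto|apply (f_holo CH); auto|].
  intros z Hz. apply (ch_map CH); auto.
Qed.

Lemma argf_bound t z (x : R) : 0 <= t <= T -> slit gamma t z -> 0 < argH (f z t - RtoC x)%C < PI.
Proof. intros Ht Hz. apply argH_H. rewrite im_sub_R. apply (ch_map CH); auto. Qed.

(** The maximum principle on the slit domain: the combination on the left vanishes on the real line and is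
    at most [eps] on the curve, where the bracket on the right equals [PI]. *)
Lemma arg_combination t s z : 0 < t < t0 -> s * s = 1 -> slit gamma t z ->
  s * (argH z - p * argH (f z t - RtoC (x1 t))%C - (1 - p) * argH (f z t - RtoC (x2 t))%C)
  <= eps / PI * (argH (f z t - RtoC (x1 t))%C - argH (f z t - RtoC (x2 t))%C).
Proof.
  intros Ht Hs Hz. assert (PP := PI_RGT_0). destruct p_bound as (P0 & P1).
  assert (EP : 0 <= eps / PI <= 1).
  { split; [apply Rmult_le_pos; [lra|apply Rlt_le, Rinv_0_lt_compat; auto]|]. apply Rmult_le_reg_r with PI; auto. unfold Rdiv. rewrite Rmult_assoc, Rinv_l; lra. }
  assert (B1 := x1_gt t Ht). assert (B2 := x2_lt t Ht).
  set (k := fun a b c => s * (a - p * b - (1 - p) * c) - eps / PI * (b - c)).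
  assert (Lip : forall a b c a' b' c' e, Rabs (a - a') < e -> Rabs (b - b') < e -> Rabs (c - c') < e -> k a b c <= k a' b' c' + 4 * e).
  { intros a b c a' b' c' e H1 H2 H3. unfold k. apply Rabs_def2 in H1, H2, H3.
    assert (As : Rabs s = 1) by (apply sg_abs; auto).
    assert (Q : s * ((a - a') - p * (b - b') - (1 - p) * (c - c')) <= 2 * e).
    { eapply Rle_trans; [apply Rle_abs|]. rewrite Rabs_mult, As, Rmult_1_l. apply Rabs_le. split; nra. }
    assert (Q2 : eps / PI * ((b' - b) - (c' - c)) <= 1 * (2 * e)) by (apply Rle_trans with (eps / PI * (2 * e)); [apply Rmult_le_compat_l; lra|apply Rmult_le_compat_r; lra]).
    lra. }
  enough (G : forall z, slit gamma t z -> k (argH z) (argH (f z t - RtoC (x1 t))%C) (argH (f z t - RtoC (x2 t))%C) <= 0) by (specialize (G z Hz); unfold k in G; lra).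
  clear z Hz. assert (Hop := slit_open CH t lra).
  assert (hz : harm (slit gamma t) argH).
  { apply (harm_ext _ (fun z => argH (z - RtoC 0)%C)); [intros z; f_equal; ring|].
    apply (harm_arg _ (fun z => z)); auto; [apply holo_id|]. intros z Hz. apply (@slit_H gamma t). auto. }
  apply (max_principle (slit gamma t) _ (4 * PI + 4 * PI) (gamma 0 :: gamma t :: nil)); auto.
  - intros z Hz. apply (@slit_H gamma t). auto.
  - intros e [<-|[<-|[]]] (_ & K); apply K; [exists 0|exists t]; split; auto; unfold Icc; lra.
  -  assert (h1 := harm_argf t (x1 t) _ lra Hop (fun z H => H)). assert (h2 := harm_argf t (x2 t) _ lra Hop (fun z H => H)).
    apply harm_minus; apply harm_scal; [|apply harm_minus; auto]. apply harm_minus; [apply harm_minus; auto|]; apply harm_scal; auto.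
  - intros z Hz. assert (A1 := argH_H z ltac:(apply (@slit_H gamma t); auto)). assert (A2 := argf_bound t z (x1 t) lra Hz). assert (A3 := argf_bound t z (x2 t) lra Hz).
    assert (K0 : k 0 0 0 = 0) by (unfold k; ring). assert (L := Lip (argH z) (argH (f z t - RtoC (x1 t))%C) (argH (f z t - RtoC (x2 t))%C) 0 0 0 PI).
    rewrite !Rminus_0_r, !Rabs_pos_eq in L by lra. lra.
  - intros ze e ND NI I0 He.
    assert (NE : ~ slit_ends gamma t ze) by (intros [-> | ->]; apply NI; simpl; auto).
    apply near_boundary; auto. intros l Bv.
    (* It remains to supply the limits of the three arguments: all [PI] on the negative axis, all 0
       on the positive axis, and [(arg (gamma r), PI, 0)] on the curve, whose image lies between
       [x2] and [x1]. *)
    assert (Fin : forall a b c, k a b c <= 0 -> slitH ze -> argH ze = a ->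
      (forall e, 0 < e -> exists d, 0 < d /\ forall w, <|w - RtoC l|> < d -> Rabs (argH (w - RtoC (x1 t))%C - b) < e) ->
      (forall e, 0 < e -> exists d, 0 < d /\ forall w, <|w - RtoC l|> < d -> Rabs (argH (w - RtoC (x2 t))%C - c) < e) ->
      exists d, 0 < d /\ forall z, slit gamma t z -> <|z - ze|> < d -> <|f z t - RtoC l|> < d ->
        k (argH z) (argH (f z t - RtoC (x1 t))%C) (argH (f z t - RtoC (x2 t))%C) <= e).
    { intros a b c K0 Sz Ea Hb Hc. destruct (rcont_argH ze Sz (e / 4) lra) as (d1 & D1 & K1). rewrite Ea in K1.
      destruct (Hb (e / 4) lra) as (d2 & D2 & K2). destruct (Hc (e / 4) lra) as (d3 & D3 & K3).
      exists (Rmin d1 (Rmin d2 d3)). split; [repeat apply Rmin_pos; auto|]. intros z Hz Z1 Z2.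
      assert (M1 := Rminl Z1). assert (M2 := Rminl (Rminr Z2)).
      assert (M3 := Rminr (Rminr Z2)).
      assert (L := Lip _ _ _ _ _ _ _ (K1 z M1) (K2 _ M2) (K3 _ M3)). lra. }
    assert (AR : forall x, x < l -> forall e, 0 < e -> exists d, 0 < d /\ forall w, <|w - RtoC l|> < d -> Rabs (argH (w - RtoC x)%C - 0) < e).
    { intros x Hx e' He'. destruct (arg_right l x Hx e' He') as (d & D & K). exists d. split; auto. intros w Hw. rewrite Rminus_0_r. auto. }
    assert (AL := arg_left l). assert (Cs := bval_cases t ze l Ht Bv). destruct Bv as [(x & Nx & -> & El)|(r & sg & Hr & Sg & -> & _)].
    + destruct (Rtotal_order x 0) as [L|[E|L]]; [|contradiction|].
      * assert (X0 := X_left t x L lra). rewrite <- El in X0.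
        apply (Fin PI PI PI); [unfold k; right; ring|apply slitH_real; auto|apply argH_neg; auto|apply AL; lra|apply AL; lra].
      * assert (X0 := X_right t x L lra). rewrite <- El in X0.
        apply (Fin 0 0 0); [unfold k; right; ring|apply slitH_real; auto|apply argH_pos; auto|apply AR; lra|apply AR; lra].
    + destruct Cs as [(NT & _)|(_ & Cs)]; [exfalso; apply NT; exists r; split; auto; unfold Icc; lra|].
      apply (Fin (argH (gamma r)) PI 0); [|apply slitH_H, (ch_gH CH); lra|auto|apply AL; lra|apply AR; lra].
      assert (G := arg_gamma r lra). unfold k.
      assert (Q : s * (argH (gamma r) - th) <= eps) by (eapply Rle_trans; [apply Rle_abs|]; rewrite Rabs_mult, (sg_abs s Hs); lra).
      replace (argH (gamma r) - p * PI - (1 - p) * 0) with (argH (gamma r) - th) by (rewrite P1; ring).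
      replace (eps / PI * (PI - 0)) with eps by (field; lra). lra.
Qed.

(** At [i y] the argument of [z] is exactly [PI / 2]. Subtracting [PI / 2] from all arguments,
    multiplying by [y] and letting [y] grow turns [arg_combination] into an inequality between [x1]
    and [x2]; the signs [s = 1] and [s = -1] give the two bounds. *)
Lemma centre_small t : 0 < t < t0 -> Rabs (p * x1 t + (1 - p) * x2 t) <= eps * (x1 t - x2 t).
Proof.
  intros Ht.  destruct p_bound as (P0 & P1). assert (B1 := x1_gt t Ht). assert (B2 := x2_lt t Ht).
  assert (Half : forall s, s * s = 1 -> - s * (p * x1 t + (1 - p) * x2 t) <= eps * (x1 t - x2 t)).
  { intros s Hs. assert (As := sg_abs s Hs). apply le_epsilon. intros e He.
    destruct (f_expand t (x1 t) (e / 4) lra lra) as (Y1 & H1). destruct (f_expand t (x2 t) (e / 4) lra lra) as (Y2 & H2).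
    set (y := Rmax 1 (Rmax Y1 Y2) + 1). assert (L1 := Rmax_l 1 (Rmax Y1 Y2)). assert (L2 := Rmax_r 1 (Rmax Y1 Y2)). assert (L3 := Rmax_l Y1 Y2). assert (L4 := Rmax_r Y1 Y2).
    destruct (H1 y ltac:(unfold y; lra)) as (S1 & E1). destruct (H2 y ltac:(unfold y; lra)) as (_ & E2).
    assert (C := arg_combination t s (0, y) Ht Hs S1).
    assert (Az : argH (0, y) = PI / 2).
    { rewrite argH_atan by (unfold Im; simpl; unfold y; lra).   unfold Rdiv at 2. rewrite Rmult_0_l, atan_0. lra. }
    rewrite Az in C. assert (y0 : 1 <= y) by (unfold y; lra).
    set (a := argH (f (0, y) t - RtoC (x1 t))%C) in *. set (b := argH (f (0, y) t - RtoC (x2 t))%C) in *.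
    set (a' := y * (a - PI / 2)) in *. set (b' := y * (b - PI / 2)) in *.
    assert (C2 : - s * (p * a' + (1 - p) * b') <= eps / PI * (a' - b')).
    { unfold a', b'. apply (Rmult_le_compat_l y) in C; [|lra]. lra. }
    apply Rabs_def2 in E1, E2.
    assert (EP : 0 <= eps / PI <= eps).
    { assert (PI1 := PI2_1). assert (I1 : 0 < / PI <= 1) by (split; [apply Rinv_0_lt_compat; lra|rewrite <- Rinv_1; apply Rinv_le_contravar; lra]).
       split; nra. }
    assert (Q1 : - s * (p * x1 t + (1 - p) * x2 t) <= - s * (p * a' + (1 - p) * b') + e / 4).
    { replace (- s * (p * x1 t + (1 - p) * x2 t)) with (- s * (p * a' + (1 - p) * b') + s * (p * (a' - x1 t) + (1 - p) * (b' - x2 t))) by ring.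
      apply Rplus_le_compat_l. eapply Rle_trans; [apply Rle_abs|]. rewrite Rabs_mult, As, Rmult_1_l. apply Rabs_le. split; nra. }
    assert (Q2 : eps / PI * (a' - b') <= eps / PI * (x1 t - x2 t) + e / 2).
    { replace (eps / PI * (a' - b')) with (eps / PI * (x1 t - x2 t) + eps / PI * ((a' - x1 t) - (b' - x2 t))) by ring. apply Rplus_le_compat_l.
      apply Rle_trans with (eps / PI * (e / 2)); [apply Rmult_le_compat_l; lra|]. nra. }
    assert (Q3 : eps / PI * (x1 t - x2 t) <= eps * (x1 t - x2 t)) by (apply Rmult_le_compat_r; lra).
    lra. }
  assert (G1 := Half 1 lra). assert (G2 := Half (-1) lra). apply Rabs_le. lra.
Qed.

(** * Comparison with a half-disc containing the curve *)

Section Exterior.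
Context {t R0 : R} (Ht : 0 < t < t0) (HR0 : 0 < R0) (HR : forall s, 0 <= s <= t -> Cmod (gamma s) <= R0).
Local Notation W := (fun z => 0 < Im z /\ R0 < Cmod z).

(** The Joukowski map, from the exterior of the half-disc of radius [R0] onto the half-plane; the
    half-circle goes to the segment [[-2 R0, 2 R0]]. *)
Definition jouk (z : C) : C := (z + RtoC (R0 * R0) * / z)%C.

Lemma ext_slit z : W z -> slit gamma t z.
Proof. intros (I & M). split; auto. intros (s & Hs & E). specialize (HR s Hs). rewrite <- E in HR. lra. Qed.

Lemma ext_open : copen W.
Proof.
  intros z (I & M). exists (Rmin (Im z) (Cmod z - R0)). split; [apply Rmin_pos; lra|]. intros w Hw.
  destruct (Rmin2 _ _ _ Hw) as (M1 & M2).
  assert (A1 := im_le_Cmod (w - z)%C). rewrite im_minus in A1. apply Rabs_le_between in A1.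
  assert (A2 := Cmod_rev z w). rewrite Cmod_sub_sym in A2. lra.
Qed.

Lemma jouk_im (z : C) : z <> 0%C -> Im (jouk z) = Im z * (1 - R0 * R0 / (Cmod z * Cmod z)).
Proof.
  intros N. assert (P := proj1 (Cmod_gt_0 z) N). assert (S := Cmod_sqr z).
  assert (E : Im (/ z)%C = - Im z / (Cmod z * Cmod z)) by (rewrite S; unfold Im, Re; simpl; f_equal; ring).
  transitivity (Im z + R0 * R0 * Im (/ z)%C).
  -  destruct z as (x, y).  simpl. ring.
  - rewrite E. field. lra.
Qed.

Lemma jouk_circle z : Cmod z = R0 -> jouk z = RtoC (2 * Re z).
Proof.
  intros M. assert (S := Cmod_sqr z). rewrite M in S.
  assert (N : z <> 0%C) by (intros ->; rewrite Cmod_0 in M; lra).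
  assert (E : (RtoC (R0 * R0) = z * (Re z, (- Im z)%R))%C) by (rewrite S; destruct z as (x, y); unfold Re, Im; apply Ceq; unfold Re, Im; simpl; ring).
  unfold jouk. rewrite E. transitivity (z + (Re z, (- Im z)%R))%C; [field; auto|].
  destruct z as (x, y).  apply Ceq; unfold Re, Im; simpl; ring.
Qed.

Lemma jouk_cont (z : C) : z <> 0%C -> ccont jouk z.
Proof.
  intros N. apply ccont_plus; [apply ccont_id|]. apply ccont_mult; [apply ccont_const|]. apply ccont_inv_id; auto.
Qed.

Lemma ext_neq (z : C) : R0 <= Cmod z -> z <> 0%C.
Proof. intros H ->. rewrite Cmod_0 in H. lra. Qed.

Lemma jouk_holo : holo 2 W jouk.
Proof.
  apply (holo_plus 2 W (fun z => z)); [apply holo_id|]. apply (holo_mult 2 W (fun _ => RtoC (R0 * R0))); [apply holo_const|].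
  apply (holo_sub 2 W (fun z => z <> 0%C)); [intros z (_ & H); apply ext_neq; lra|apply holo_inv_id].
Qed.

Lemma jouk_pos z : W z -> 0 < Im (jouk z).
Proof.
  intros (I & M). rewrite jouk_im by (apply ext_neq; lra). apply Rmult_lt_0_compat; auto.
  enough (R0 * R0 / (Cmod z * Cmod z) < 1) by lra. apply Rmult_lt_reg_r with (Cmod z * Cmod z); [nra|]. unfold Rdiv. rewrite Rmult_assoc, Rinv_l by nra. nra.
Qed.

Lemma ext_boundary ze : ~ W ze -> 0 <= Im ze -> (exists d, 0 < d /\ forall z, W z -> <|z - ze|> < d -> False) \/
  (0 < Im ze /\ Cmod ze = R0) \/ (exists x, ze = RtoC x /\ R0 <= Rabs x).
Proof.
  intros N I. destruct (Rlt_le_dec (Cmod ze) R0) as [L|L].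
  - left. exists (R0 - Cmod ze). split; [lra|]. intros z (_ & M) D. assert (A := Cmod_rev z ze). lra.
  - right. destruct (Req_dec (Im ze) 0) as [E|E].
    + right. exists (Re ze). assert (Q : ze = RtoC (Re ze)) by (apply Ceq; auto). split; auto. rewrite Q, Cmod_R in L. auto.
    + left. split; [lra|]. destruct L as [L|L]; auto. exfalso. apply N. lra.
Qed.

(** [Im (jouk z)] vanishes on the boundary of the exterior domain, where [Im f >= 0], and the
    difference is bounded because [f] is [z + O(1/z)]. It bounds from below the height of the image
    of a later tip. *)
Lemma im_f_ge z : W z -> Im (jouk z) <= Im (f z t).
Proof.
  intros Hz. enough (Im (jouk z) - Im (f z t) <= 0) by lra.
  destruct (ch_hyd CH t lra) as (M & K & M0 & HM).
  revert z Hz. apply (max_principle W (fun z => Im (jouk z) - Im (f z t)) (M + (2 * t / M + Rabs K / (M * M))) nil); auto.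
  - apply ext_open.
  - intros z (I & _). auto.
  - apply harm_minus; [apply harm_Im; [apply ext_open|apply jouk_holo]|].
    apply (harm_sub W (slit gamma t)); [apply ext_slit|]. apply (harm_Im (slit gamma t) (fun z => f z t)); [apply (slit_open CH); lra|apply (f_holo CH); lra].
  - intros z Hz. assert (Sz := ext_slit z Hz). destruct Hz as (I & Mz). assert (If := ch_map CH t z lra Sz).
    assert (Ij : Im (jouk z) <= Im z).
    { rewrite jouk_im by (apply ext_neq; lra). assert (0 <= R0 * R0 / (Cmod z * Cmod z)) by (apply Rmult_le_pos; [nra|apply Rlt_le, Rinv_0_lt_compat; nra]). nra. }
    assert (Q1 : 0 <= 2 * t / M) by (apply Rmult_le_pos; [lra|apply Rlt_le, Rinv_0_lt_compat; auto]).
    assert (Q2 : 0 <= Rabs K / (M * M)) by (apply Rmult_le_pos; [apply Rabs_pos|apply Rlt_le, Rinv_0_lt_compat; nra]).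
    destruct (Rle_lt_dec (Cmod z) M) as [L|L].
    + assert (A := im_le_Cmod z). rewrite Rabs_pos_eq in A by lra. lra.
    + assert (H := HM z Sz L). assert (N : z <> 0%C) by (apply ext_neq; lra).
      assert (T3 := Cmod_tri3 z (z + RtoC (2 * t) / z)%C (f z t)). rewrite (Cmod_sub_sym (z + RtoC (2 * t) / z) (f z t))%C in T3.
      replace (z - (z + RtoC (2 * t) / z))%C with (- (RtoC (2 * t) / z))%C in T3 by ring. rewrite Cmod_opp, Cmod_div, Cmod_R, Rabs_pos_eq in T3 by (auto; lra).
      assert (A := im_le_Cmod (z - f z t)%C). rewrite im_minus in A. assert (A2 := Rle_abs (Im z - Im (f z t))).
      assert (B1 : 2 * t / Cmod z <= 2 * t / M) by (apply Rmult_le_compat_l; [lra|apply Rinv_le_contravar; lra]).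
      assert (B2 : K / Cmod z ^ 2 <= Rabs K / (M * M)).
      { apply Rle_trans with (Rabs K / Cmod z ^ 2); [apply Rmult_le_compat_r; [apply Rlt_le, Rinv_0_lt_compat; nra|apply Rle_abs]|].
        apply Rmult_le_compat_l; [apply Rabs_pos|]. apply Rinv_le_contravar; nra. }
      lra.
  - intros ze e ND _ I0 He.
    assert (J0 : Im (jouk ze) = 0 -> ze <> 0%C -> exists d, 0 < d /\ forall z, W z -> <|z - ze|> < d -> Im (jouk z) - Im (f z t) <= e).
    { intros E N. destruct (jouk_cont ze N e He) as (d & D & Kd). exists d. split; auto. intros z Hz Hd. specialize (Kd z Hd).
      assert (A := im_le_Cmod (jouk z - jouk ze)%C). rewrite im_minus, E, Rminus_0_r in A. assert (A2 := Rle_abs (Im (jouk z))).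
      assert (If := ch_map CH t z lra (ext_slit z Hz)). lra. }
    destruct (ext_boundary ze ND I0) as [(d & D & Kd)|[(I & E)|(x & -> & Lx)]].
    + exists d. split; auto. intros z Hz Hd. destruct (Kd z Hz Hd).
    + apply J0; [rewrite jouk_circle by auto; auto|apply ext_neq; lra].
    + assert (N : RtoC x <> 0%C) by (apply ext_neq; rewrite Cmod_R; auto). apply J0; auto. rewrite jouk_im by auto. simpl. ring.
Qed.

(** Seen from outside, the curve has smaller harmonic measure than the half-disc that contains it;
    the expansion at infinity turns the two measures into the lengths [x1 - x2] and [4 R0]. *)
Lemma width_le : x1 t - x2 t <= 4 * R0.
Proof.
   assert (B1 := x1_gt t Ht). assert (B2 := x2_lt t Ht).
  assert (Main : forall z, W z -> (argH (f z t - RtoC (x1 t))%C - argH (f z t - RtoC (x2 t))%C)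
     - (argH (jouk z - RtoC (2 * R0))%C - argH (jouk z - RtoC (- (2 * R0)))%C) <= 0).
  { apply (max_principle W _ (2 * PI) (RtoC R0 :: RtoC (- R0) :: nil)).
    - apply ext_open.
    - intros z (I & _). auto.
    - intros e [<-|[<-|[]]] (I & _); simpl in I; lra.
    - assert (h1 := harm_argf t (x1 t) W lra ext_open ext_slit). assert (h2 := harm_argf t (x2 t) W lra ext_open ext_slit).
      assert (h3 := fun x => harm_arg W jouk x ext_open jouk_holo jouk_pos). apply harm_minus; apply harm_minus; auto.
    - intros z Hz. assert (A1 := argf_bound t z (x1 t) lra (ext_slit z Hz)). assert (A2 := argf_bound t z (x2 t) lra (ext_slit z Hz)).
      assert (J := jouk_pos z Hz). assert (A3 := argH_H (jouk z - RtoC (2 * R0))%C ltac:(rewrite im_sub_R; auto)).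
      assert (A4 := argH_H (jouk z - RtoC (- (2 * R0)))%C ltac:(rewrite im_sub_R; auto)). lra.
    - intros ze e ND NI I0 He. destruct (ext_boundary ze ND I0) as [(d & D & Kd)|[(I & E)|(x & -> & Lx)]].
      + exists d. split; auto. intros z Hz Hd. destruct (Kd z Hz Hd).
      + assert (S := Cmod_sqr ze). rewrite E in S. assert (Rn : - R0 < Re ze < R0) by (split; nra).
        destruct (arg_left (2 * Re ze) (2 * R0) lra (e / 2) lra) as (d1 & D1 & K1).
        destruct (arg_right (2 * Re ze) (- (2 * R0)) lra (e / 2) lra) as (d2 & D2 & K2).
        destruct (jouk_cont ze (ext_neq ze lra) (Rmin d1 d2) ltac:(apply Rmin_pos; auto)) as (d & D & Kd). rewrite (jouk_circle ze E) in Kd.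
        exists d. split; auto. intros z Hz Hd. specialize (Kd z Hd).
        specialize (K1 _ (Rminl Kd)). specialize (K2 _ (Rminr Kd)). apply Rabs_def2 in K1, K2.
        assert (A1 := argf_bound t z (x1 t) lra (ext_slit z Hz)). assert (A2 := argf_bound t z (x2 t) lra (ext_slit z Hz)). lra.
      + assert (Nx : x <> 0) by (intros ->; rewrite Rabs_R0 in Lx; lra).
        destruct (near_boundary t (RtoC x) (fun z => argH (f z t - RtoC (x1 t))%C - argH (f z t - RtoC (x2 t))%C <= e) Ht) as (r & R1 & K).
        * apply real_slit.
        *  lra.
        * intros [E|E]; [apply (real_not_gamma t x Nx lra 0)|apply (real_not_gamma t x Nx lra t)]; auto; lra.
        * intros l Bv. destruct (bval_cases t _ l Ht Bv) as [(_ & [L|L])|((r & Hr & E) & _)].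
          -- destruct (arg_left l (x1 t) lra (e / 2) lra) as (d1 & D1 & K1). destruct (arg_left l (x2 t) L (e / 2) lra) as (d2 & D2 & K2).
             exists (Rmin d1 d2). split; [apply Rmin_pos; auto|]. intros z _ _ Z. specialize (K1 _ (Rminl Z)). specialize (K2 _ (Rminr Z)).
             apply Rabs_def2 in K1, K2. lra.
          -- destruct (arg_right l (x1 t) L (e / 2) lra) as (d1 & D1 & K1). destruct (arg_right l (x2 t) lra (e / 2) lra) as (d2 & D2 & K2).
             exists (Rmin d1 d2). split; [apply Rmin_pos; auto|]. intros z _ _ Z. specialize (K1 _ (Rminl Z)). specialize (K2 _ (Rminr Z)).
             apply Rabs_def2 in K1, K2. lra.
          -- exfalso. apply (real_not_gamma t x Nx lra r Hr). auto.
        * exists r. split; auto. intros z Hz Hd. specialize (K z (ext_slit z Hz) Hd).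
          assert (Mo := argH_mono (jouk z) (- (2 * R0)) (2 * R0) (jouk_pos z Hz) lra). lra. }
  apply le_epsilon. intros e He.
  destruct (f_expand t (x1 t) (e / 4) lra lra) as (Y1 & H1). destruct (f_expand t (x2 t) (e / 4) lra lra) as (Y2 & H2).
  assert (Ej : forall y, y <> 0 -> jouk (0, y) = (0, (y - R0 * R0 / y)%R)).
  { intros y Ny. unfold jouk. apply Ceq; unfold Re, Im; simpl; field; lra. }
  assert (HJ : forall c, exists Y, forall y, Y < y -> Rabs (y * (argH (jouk (0, y) - RtoC c)%C - PI / 2) - c) < e / 4).
  { intros c. apply (arg_expand (fun y => jouk (0, y)) (R0 * R0) 1); [nra| |lra]. intros y Hy. rewrite Ej by lra.  simpl.
    assert (0 < R0 * R0 / y) by (apply Rdiv_lt_0_compat; nra). rewrite Rabs_R0. split; [lra|]. apply Rabs_le. lra. }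
  destruct (HJ (2 * R0)) as (Y3 & H3). destruct (HJ (- (2 * R0))) as (Y4 & H4).
  set (y := Rmax (Rmax R0 (Rmax Y1 Y2)) (Rmax Y3 Y4) + 1).
  assert (L1 := Rmax_l (Rmax R0 (Rmax Y1 Y2)) (Rmax Y3 Y4)). assert (L2 := Rmax_r (Rmax R0 (Rmax Y1 Y2)) (Rmax Y3 Y4)).
  assert (L3 := Rmax_l R0 (Rmax Y1 Y2)). assert (L4 := Rmax_r R0 (Rmax Y1 Y2)). assert (L5 := Rmax_l Y1 Y2). assert (L6 := Rmax_r Y1 Y2). assert (L7 := Rmax_l Y3 Y4). assert (L8 := Rmax_r Y3 Y4).
  assert (y0 : R0 < y) by (unfold y; lra).
  destruct (H1 y ltac:(unfold y; lra)) as (S1 & E1). destruct (H2 y ltac:(unfold y; lra)) as (_ & E2).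
  assert (E3 := H3 y ltac:(unfold y; lra)). assert (E4 := H4 y ltac:(unfold y; lra)).
  assert (Wy : W (0, y)).
  { split; [unfold Im; simpl; lra|]. eapply Rlt_le_trans; [exact y0|]. eapply Rle_trans; [|apply im_le_Cmod]. apply Rle_abs. }
  assert (C := Main _ Wy). apply (Rmult_le_compat_l y) in C; [|lra]. apply Rabs_def2 in E1, E2, E3, E4. lra.
Qed.

End Exterior.

(** With [a] and [b] the distances of the two trajectories from the driving function and
    [w = a + b], the derivative of [w^2] is [4 (a + b)^2 / (a b)], at least 16. *)
Lemma Y_width_ge u t : 0 < u -> 0 < t < t0 -> 4 * sqrt t <= Y 1 u t + Y (-1) u t.
Proof.
  intros Hu Ht. set (w := fun r => Y 1 u r + Y (-1) u r).
  destruct (rsol_elim _ _ _ _ (Y_rsol 1 lra u t Hu lra)) as (W1 & D1 & _).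
  destruct (rsol_elim _ _ _ _ (Y_rsol (-1) lra u t Hu lra)) as (W2 & D2 & _).
  assert (G : forall r, 0 <= r <= t -> 0 < Y 1 u r - 1 * lam r /\ 0 < Y (-1) u r - -1 * lam r).
  { intros r Hr. assert (A1 := Y_gt 1 lra u r Hu lra). assert (A2 := Y_gt (-1) lra u r Hu lra). lra. }
  assert (Ww : wcont 0 t w) by (apply wcont_plus; auto).
  assert (M := mvt_le (fun r => -1 * (w r * w r)) 0 t (-16) lra).
  assert (Sq : 16 * t <= w t * w t).
  { enough (-1 * (w t * w t) - -1 * (w 0 * w 0) <= -16 * (t - 0)) by (assert (Q := Rle_0_sqr (w 0)); unfold Rsqr in Q; lra). apply M.
    - apply (wcont_mult 0 t (fun _ => -1)); [apply wcont_cst|apply wcont_mult; auto].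
    - intros r Hr. destruct (G r lra) as (G1 & G2). set (a := Y 1 u r - 1 * lam r) in *. set (b := Y (-1) u r - -1 * lam r) in *.
      assert (Dw : is_derive w r (2 / a + 2 / b)) by (apply (is_derive_plus (Y 1 u) (Y (-1) u)); [apply D1|apply D2]; lra).
      exists (-1 * ((2 / a + 2 / b) * w r + w r * (2 / a + 2 / b))). split.
      + apply (is_derive_scal (fun r => w r * w r) r (-1)). apply (is_derive_mult w w); auto. intros; apply Rmult_comm.
      + assert (E : w r = a + b) by (unfold w, a, b; ring). rewrite E. replace ((2 / a + 2 / b) * (a + b) + (a + b) * (2 / a + 2 / b)) with (16 + 4 * ((a - b) * (a - b) / (a * b))) by (field; lra).
        assert (0 <= (a - b) * (a - b) / (a * b)) by (apply Rmult_le_pos; [apply Rle_0_sqr|apply Rlt_le, Rinv_0_lt_compat, Rmult_lt_0_compat; auto]). lra. }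
  fold (w t).  assert (S1 := sqrt_sqrt t lra).
  destruct (G t lra). assert (0 < w t) by (unfold w; lra). nra.
Qed.

Lemma width_ge t : 0 < t < t0 -> 4 * sqrt t <= x1 t - x2 t.
Proof.
  intros Ht. apply le_epsilon. intros e He. unfold x1, x2.
  destruct (proj2 (ye_spec 1 lra t lra) (e / 2) lra) as (u & U0 & HU).
  destruct (proj2 (ye_spec (-1) lra t lra) (e / 2) lra) as (v & V0 & HV).
  set (m := Rmin u v / 2). assert (M1 := Rmin_l u v). assert (M2 := Rmin_r u v). assert (M3 : 0 < Rmin u v) by (apply Rmin_pos; auto).
  specialize (HU m ltac:(unfold m; lra)). specialize (HV m ltac:(unfold m; lra)).
  assert (B := Y_width_ge m t ltac:(unfold m; lra) Ht). lra.
Qed.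

Lemma gamma_slit s t : 0 <= s < t -> t <= t0 -> slit gamma s (gamma t).
Proof.
  intros Hs Ht. split; [apply (ch_gH CH); lra|]. intros (r & (R1 & R2) & E). apply (ch_simple CH) in E; lra.
Qed.

Lemma tip_approach t : 0 < t <= t0 -> approachable t (fun _ => True) (gamma t).
Proof.
  intros Ht d D. assert (I := ch_gH CH t lra). set (be := Rmin d (Im (gamma t)) / 2).
  assert (M1 := Rmin_l d (Im (gamma t))). assert (M2 := Rmin_r d (Im (gamma t))). assert (M3 : 0 < Rmin d (Im (gamma t))) by (apply Rmin_pos; auto).
  assert (B : 0 < be < d /\ be < Im (gamma t)) by (unfold be; lra). clearbody be.
  assert (Dz : <|V 1 (ca th (gamma t)) be - gamma t|> <= be).
  { rewrite <- (G_gamma t) at 2 by lra. rewrite <- (V_0 1). eapply Rle_trans; [apply V_dist; lra|]. rewrite Rminus_diag, Rabs_R0, Rminus_0_r, Rabs_pos_eq; lra. }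
  exists (V 1 (ca th (gamma t)) be). split; [|split; auto; lra]. apply slit_of_ht; [lra| |rewrite ht_V; lra].
  assert (A1 := im_le_Cmod (V 1 (ca th (gamma t)) be - gamma t)%C). rewrite im_minus in A1. apply Rabs_le_between in A1. lra.
Qed.

(** The image of the later tip has to reach the real line at time [t], and the square of its height
    decreases at rate at most 4. The argument runs on points near [gamma t], since [gamma t] itself
    leaves the domain at time [t]. *)
Lemma tip_time s t : 0 <= s < t -> t <= t0 -> Im (f (gamma t) s) * Im (f (gamma t) s) <= 4 * (t - s).
Proof.
  intros Hs Ht. assert (Sl := gamma_slit s t Hs Ht). assert (I := ch_map CH s _ lra Sl). set (I0 := Im (f (gamma t) s)) in *.
  apply Rnot_lt_le. intros L. set (e := (I0 * I0 - 4 * (t - s)) / (4 * I0)).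
  assert (E0 : 0 < e) by (apply Rdiv_lt_0_compat; lra). assert (E1 : 4 * I0 * e = I0 * I0 - 4 * (t - s)) by (unfold e; field; lra).
  destruct (ch_cont CH s _ lra Sl e E0) as (d1 & D1 & K1).
  destruct (f_proper CH t (gamma t) e lra (gamma_not_slit t t lra) E0) as (d2 & D2 & K2).
  destruct (tip_approach t lra (Rmin d1 d2) ltac:(apply Rmin_pos; auto)) as (z & Z1 & _ & Z2).
  specialize (K1 z (Rminl Z2)). specialize (K2 z (conj Z1 (Rminr Z2))).
  assert (A1 := im_le_Cmod (f z s - f (gamma t) s)%C). rewrite im_minus in A1. fold I0 in A1. apply Rabs_le_between in A1.
  assert (It := ch_map CH t z lra Z1).
  assert (Q := Im_sqr_ge lam s t (f z) lra (f_sub_sol s t z t lra lra lra Z1 lra)).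
  assert (P : forall r, s <= r <= t -> 0 <= Im (f z r)).
  { intros r Hr. apply Rlt_le, (ch_map CH r z); [lra|]. apply (slit_mono r t); auto; lra. }
  specialize (Q P). assert (e <= I0) by nra.
  assert ((I0 - e) * (I0 - e) <= Im (f z s) * Im (f z s)) by (apply Rmult_le_compat; lra). nra.
Qed.

Lemma A_le_sqrt t : 0 < t <= t0 -> sin th * A t <= 4 * sqrt t.
Proof.
  intros Ht.  assert (H := tip_time 0 t lra lra).
  rewrite (ch_0 CH) in H by (apply (ch_gH CH); lra). assert (G := Im_gamma_ge t Ht). cbv beta in *.
  assert (S0 := sqrt_pos t). assert (S1 := sqrt_sqrt t lra).  nra.
Qed.

Lemma width_ge_A t : 0 < t < t0 -> sin th * A t <= x1 t - x2 t.
Proof. intros Ht. assert (H1 := A_le_sqrt t lra). assert (H2 := width_ge t Ht).  lra. Qed.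

Lemma width_le_A t : 0 < t < t0 -> x1 t - x2 t <= 5 * A t.
Proof.
  intros Ht. assert (P := gamma_ca t lra). assert (R0p : 0 < (1 + eps) * ca th (gamma t)) by (apply Rmult_lt_0_compat; lra).
  assert (H := width_le Ht R0p (fun s Hs => gamma_size s t Hs lra)).  nra.
Qed.

(** The arc up to time [t] lies in the half-disc of radius [(1 + eps) A t], and [gamma t'] lies
    outside by a proportion of order [d]. So [im_f_ge] gives its image at time [t] a height of order
    [d * A t], and [tip_time] converts this height into time. *)
Lemma duration t t' d : 0 < t < t' -> t' <= t0 -> 0 < d <= 1 -> 4 * eps <= d -> A t' = (1 + d) * A t -> (sin th * d * A t) * (sin th * d * A t) / 200 <= t' - t.
Proof.
  intros Ht Ht' Hd He E.  assert (P := gamma_ca t lra). set (a := ca th (gamma t)) in *.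
  assert (R0p : 0 < (1 + eps) * a) by (apply Rmult_lt_0_compat; lra).
  assert (M := A_le_mod t'). cbv beta in M. rewrite E in M.
  assert (Ig := Im_gamma_ge t' lra). cbv beta in Ig. rewrite E in Ig. set (m := Cmod (gamma t')) in *.
  assert (m0 : (1 + eps) * a < m) by (assert (eps * a < d * a) by (apply Rmult_lt_compat_r; lra); lra).
  assert (Htt : 0 < t < t0) by lra. assert (H := im_f_ge Htt R0p (fun s Hs => gamma_size s t Hs lra) (gamma t') (conj (ch_gH CH t' lra) m0)).
  rewrite jouk_im in H by (intros Z; unfold m in m0; rewrite Z, Cmod_0 in m0; lra). fold m in H.
  assert (S0 := sin_th).
  (* As [eps <= d / 4] and [d <= 1], one has [1 + eps <= (1 - 3 / 8 * d) * (1 + d)]. *)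
  assert (Q : 3 / 8 * d <= 1 - (1 + eps) * a * ((1 + eps) * a) / (m * m)).
  { set (v := (1 + eps) * a / m). assert (V1 : 0 < v) by (apply Rdiv_lt_0_compat; lra).
    replace ((1 + eps) * a * ((1 + eps) * a) / (m * m)) with (v * v) by (unfold v; field; lra).
    assert (V2 : v <= 1 - 3 / 8 * d).
    { apply Rmult_le_reg_r with m; [lra|]. unfold v, Rdiv at 1. rewrite Rmult_assoc, Rinv_l, Rmult_1_r by lra.
      apply Rle_trans with ((1 - 3 / 8 * d) * ((1 + d) * a)); [|apply Rmult_le_compat_l; lra].
      assert (0 <= (1 - d) * d) by (apply Rmult_le_pos; lra). rewrite <- Rmult_assoc. apply Rmult_le_compat_r; lra. }
    assert (v * v <= 1 * v) by (apply Rmult_le_compat_r; lra). lra. }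
  assert (sa : 0 < sin th / 2 * a) by (apply Rmult_lt_0_compat; lra).
  assert (I1 : sin th / 2 * a <= Im (gamma t')) by (assert (0 < sin th / 2 * a * d) by (apply Rmult_lt_0_compat; lra); lra).
  assert (I2 : sin th / 2 * a * (3 / 8 * d) <= Im (f (gamma t') t)).
  { eapply Rle_trans; [|exact H]. apply Rmult_le_compat; lra. }
  assert (TT := tip_time t t' lra lra). set (k := sin th * d * a) in *.
  assert (K0 : 0 < k) by (unfold k; repeat apply Rmult_lt_0_compat; lra).
  assert (I3 : 3 / 16 * k <= Im (f (gamma t') t)) by (unfold k; lra). nra.
Qed.

Section Barrier.
Context {t : R} (Ht : 0 < t < t0).

Definition zeta (z : C) : C := ((cos th, (- sin th)%R) * (z - gamma t))%C.

Lemma zeta_re z : Re (zeta z) = ca th z - ca th (gamma t).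
Proof. unfold zeta, ca. destruct z, (gamma t).  simpl. ring. Qed.

Lemma zeta_im z : Im (zeta z) = cb th z - cb th (gamma t).
Proof. unfold zeta, cb. destruct z, (gamma t). unfold Re, Im. simpl. ring. Qed.

Lemma zeta_mod z : Cmod (zeta z) = <|z - gamma t|>.
Proof.
  unfold zeta. rewrite Cmod_mult. replace (Cmod (cos th, (- sin th)%R)) with 1; [ring|].
  assert (S := Cmod_sqr (cos th, (- sin th)%R)). unfold Re, Im in S. simpl in S. assert (E := cs1 th). assert (P := Cmod_ge_0 (cos th, (- sin th)%R)). nra.
Qed.

Lemma zeta_holo W : holo 2 W zeta.
Proof.
  apply (holo_mult 2 W (fun _ => (cos th, (- sin th)%R) : C)); [apply holo_const|].
  apply (holo_plus 2 W (fun z => z) (fun _ => (- gamma t)%C)); [apply holo_id|apply holo_const].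
Qed.

(** Above the graph one branch of the logarithm of [zeta] is defined, below it the other. At height
    0 a point of the domain lies beyond the tip, because the graph before the origin is below the
    real axis; there both branches apply. *)
Lemma zeta_cases z : slit gamma t z -> (0 < ht z /\ slitH (zeta z)) \/ (ht z < 0 /\ slitH (- zeta z)%C) \/ (ht z = 0 /\ 0 < Re (zeta z)).
Proof.
  intros Hz. assert (HT : h (ca th (gamma t)) = cb th (gamma t)) by (apply h_gamma; lra).
  destruct (Rtotal_order (ht z) 0) as [L|[E|L]].
  - right. left. split; auto. apply slitH_intro. replace (Re (- zeta z)%C) with (- Re (zeta z)) by reflexivity. replace (Im (- zeta z)%C) with (- Im (zeta z)) by reflexivity.
    rewrite zeta_re, zeta_im. destruct (Req_dec (ca th z) (ca th (gamma t))) as [E|E]; [right|left; lra].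
    unfold ht in L. rewrite E, HT in L. lra.
  - right. right. split; auto. rewrite zeta_re. apply Rnot_le_lt. intros L. destruct Hz as (I & NT). unfold Hplane in I.
    destruct (Rle_lt_dec 0 (ca th z)) as [P|P]; [apply NT, trace_iff; lra|].
    unfold ht in E. rewrite h_neg in E by lra.  rewrite <- (pt_c th z), Im_pt in I. nra.
  - left. split; auto. apply slitH_intro. rewrite zeta_re, zeta_im.
    destruct (Req_dec (ca th z) (ca th (gamma t))) as [E|E]; [right|left; lra].
    unfold ht in L. rewrite E, HT in L. lra.
Qed.

Definition Eup (z : C) : C := cexp (RtoC (- / 4) * LogH (zeta z))%C.
(** The shift by [i PI] compensates the sign of [- zeta], so that this branch agrees with [Eup] on
    the continuation of the curve beyond the tip. *)
Definition Elow (z : C) : C := cexp (RtoC (- / 4) * (LogH (- zeta z) + - (Ci * RtoC PI)))%C.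

(** [Re (zeta ^ (-1/4))], with the branch cut along the curve and its continuation below the real line. *)
Definition Bq (z : C) : R := if Rlt_dec 0 (ht z) then Re (Eup z) else Re (Elow z).

Lemma Eup_re z : Re (Eup z) = / b4 (<|z - gamma t|>) * cos (argH (zeta z) / 4).
Proof.
  unfold Eup, b4. rewrite <- exp_Ropp, cexp_re.
  replace (Re (RtoC (- / 4) * LogH (zeta z))%C) with (- / 4 * Re (LogH (zeta z))) by (unfold Re, Im; simpl; ring).
  replace (Im (RtoC (- / 4) * LogH (zeta z))%C) with (- (Im (LogH (zeta z)) / 4)) by (unfold Re, Im; simpl; field).
  rewrite LogH_re, LogH_im, zeta_mod, cos_neg. f_equal. f_equal. ring.
Qed.

Lemma Elow_re z : Re (Elow z) = / b4 (<|z - gamma t|>) * cos ((argH (- zeta z)%C - PI) / 4).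
Proof.
  unfold Elow, b4. rewrite <- exp_Ropp, cexp_re.
  replace (Re (RtoC (- / 4) * (LogH (- zeta z) + - (Ci * RtoC PI)))%C) with (- / 4 * Re (LogH (- zeta z)%C)) by (unfold Re, Im; simpl; ring).
  replace (Im (RtoC (- / 4) * (LogH (- zeta z) + - (Ci * RtoC PI)))%C) with (- ((Im (LogH (- zeta z)%C) - PI) / 4)) by (unfold Re, Im; simpl; field).
  rewrite LogH_re, LogH_im, Cmod_opp, zeta_mod, cos_neg. f_equal. f_equal. ring.
Qed.

Lemma Bq_bound z : c0 * / b4 (<|z - gamma t|>) <= Bq z <= / b4 (<|z - gamma t|>).
Proof.
  assert (P : 0 < / b4 (<|z - gamma t|>)) by (apply Rinv_0_lt_compat, b4_pos).
  assert (A1 := argH_range (zeta z)). assert (A2 := argH_range (- zeta z)%C). assert (PP := PI_RGT_0).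
  unfold Bq. destruct Rlt_dec; [rewrite Eup_re; assert (C := cos_quarter (argH (zeta z)) lra)|rewrite Elow_re; assert (C := cos_quarter (argH (- zeta z)%C - PI) lra)]; split; nra.
Qed.

Lemma Bq_harm : harm (slit gamma t) Bq.
Proof.
  assert (Oht : forall sg, sg * sg = 1 -> copen (fun z => 0 < sg * ht z)).
  { intros sg S z Hz. exists (sg * ht z / 2). split; [lra|]. intros w Hw.
    assert (L := sg_ht_lip sg z w S). rewrite (Cmod_sub_sym z w) in L. lra. }
  assert (Os : forall k, (forall z, ccont k z) -> copen (fun z => slitH (k z))).
  { intros k Ck z Hz. unfold slitH in *. assert (R1 : rcont (fun w => Cmod (k w) + Im (k w)) z) by (apply rcont_plus; [apply rcont_Cmod|apply rcont_Im]; auto).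
    destruct (R1 _ Hz) as (d & D & K). exists d. split; auto. intros w Hw. specialize (K w Hw). apply Rabs_def2 in K. lra. }
  assert (Cz : forall z, ccont zeta z) by (intros z; apply (holo_cont 2 (fun _ => True) zeta z (zeta_holo _) I)).
  assert (Cn : forall z, ccont (fun z => - zeta z)%C z).
  { intros z. apply (ccont_ext_loc (fun z => (- 1) * zeta z)%C _ z 1); [lra|intros; ring|]. apply ccont_mult; [apply ccont_const|auto]. }
  assert (Hup : harm (fun z => slitH (zeta z)) (fun z => Re (Eup z))).
  { apply harm_Re; [apply Os; auto|]. apply (holo_comp 2 _ (fun _ => True) (fun z => RtoC (- / 4) * LogH (zeta z))%C cexp); auto; [|apply holo_cexp].
    apply (holo_mult 2 _ (fun _ => RtoC (- / 4))); [apply holo_const|]. apply (holo_comp 2 _ slitH zeta LogH); auto; [apply zeta_holo|apply holo_LogH]. }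
  assert (Hlo : harm (fun z => slitH (- zeta z)%C) (fun z => Re (Elow z))).
  { apply harm_Re; [apply (Os (fun z => - zeta z)%C); auto|]. apply (holo_comp 2 _ (fun _ => True) (fun z => RtoC (- / 4) * (LogH (- zeta z) + - (Ci * RtoC PI)))%C cexp); auto; [|apply holo_cexp].
    apply (holo_mult 2 _ (fun _ => RtoC (- / 4))); [apply holo_const|]. apply (holo_plus 2 _ (fun z => LogH (- zeta z)%C) (fun _ => (- (Ci * RtoC PI))%C)); [|apply holo_const].
    apply (holo_comp 2 _ slitH (fun z => - zeta z)%C LogH); auto; [|apply holo_LogH].
    apply (holo_comp 2 _ (fun _ => True) zeta (fun w => - w)%C); auto; [apply zeta_holo|].
    exists (fun _ => (- (1))%C). split; [|apply holo_const]. intros w _. exists (fun _ => (- (1))%C). split; [apply ccont_const|]. split; auto. intros; ring. }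
  apply harm_loc. intros z Hz. destruct (zeta_cases z Hz) as [(L & S)|[(L & S)|(E & S)]].
  - destruct (Oht 1 lra z lra) as (d & D & K). exists d, (fun z => slitH (zeta z)), (fun z => Re (Eup z)). split; [auto|split; [auto|split; [auto|]]].
    intros w Hw. specialize (K w Hw). unfold Bq. destruct Rlt_dec; auto; lra.
  - destruct (Oht (-1) lra z lra) as (d & D & K). exists d, (fun z => slitH (- zeta z)%C), (fun z => Re (Elow z)). split; [auto|split; [auto|split; [auto|]]].
    intros w Hw. specialize (K w Hw). unfold Bq. destruct Rlt_dec; auto; lra.
  - exists (Re (zeta z)), (fun z => slitH (zeta z)), (fun z => Re (Eup z)). split; auto. split; [apply slitH_intro; lra|]. split; auto.
    intros w Hw. unfold Bq. destruct Rlt_dec; auto. rewrite Eup_re, Elow_re, argH_opp.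
    + f_equal. f_equal. field.
    + assert (L := ca_lip th w z). rewrite zeta_re in *. apply Rabs_le_between in L. lra.
Qed.

End Barrier.

(** A boundary point that already exists at time [t] has its image on a definite side of [lam t]. By
    time [t'] the image has moved outwards and is on the same side of [lam t'], so it is not between
    the two. The harmonic measure of the segment from [lam t] to [lam t'] is thus carried by the new
    arc. *)
Lemma lam_boundary t t' sx ze l e : 0 < t < t' -> t' < t0 -> sx * sx = 1 -> 0 < sx * (lam t' - lam t) -> 0 < e ->
  ze <> gamma t -> bval t' ze l -> (exists s, t < s < t' /\ ze = gamma s) \/
  exists d, 0 < d /\ forall w, <|w - RtoC l|> < d -> sx * (argH (w - RtoC (lam t'))%C - argH (w - RtoC (lam t))%C) <= e.
Proof.
  intros Ht Ht' Sx Hl He Hze Bv. assert (Ab := sg_abs sx Sx).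
  assert (Sm : forall a b c, Rabs (a - c) < e / 2 -> Rabs (b - c) < e / 2 -> sx * (a - b) <= e).
  { intros a b c H1 H2. eapply Rle_trans; [apply Rle_abs|]. rewrite Rabs_mult, Ab, Rmult_1_l. apply Rabs_def2 in H1, H2. apply Rabs_le. lra. }
  assert (RR : lam t' < l -> lam t < l -> exists d, 0 < d /\ forall w, <|w - RtoC l|> < d -> sx * (argH (w - RtoC (lam t'))%C - argH (w - RtoC (lam t))%C) <= e).
  { intros L1 L2. destruct (arg_right l _ L1 (e / 2) lra) as (d1 & D1 & K1). destruct (arg_right l _ L2 (e / 2) lra) as (d2 & D2 & K2).
    exists (Rmin d1 d2). split; [apply Rmin_pos; auto|]. intros w Hw. apply (Sm _ _ 0); rewrite Rminus_0_r; [apply K1|apply K2]; eapply Rlt_le_trans; eauto; [apply Rmin_l|apply Rmin_r]. }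
  assert (LL : l < lam t' -> l < lam t -> exists d, 0 < d /\ forall w, <|w - RtoC l|> < d -> sx * (argH (w - RtoC (lam t'))%C - argH (w - RtoC (lam t))%C) <= e).
  { intros L1 L2. destruct (arg_left l _ L1 (e / 2) lra) as (d1 & D1 & K1). destruct (arg_left l _ L2 (e / 2) lra) as (d2 & D2 & K2).
    exists (Rmin d1 d2). split; [apply Rmin_pos; auto|]. intros w Hw. apply (Sm _ _ PI); [apply K1|apply K2]; eapply Rlt_le_trans; eauto; [apply Rmin_l|apply Rmin_r]. }
  destruct Bv as [(x & Nx & -> & ->)|(s & sg & Hs & Sg & -> & HL)].
  - right. destruct (Rtotal_order x 0) as [L|[E|L]]; [|contradiction|].
    + assert (M := Y_mono_t (-1) lra (- x) t t' lra lra Ht'). assert (G := Y_gt (-1) lra (- x) t lra lra).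
      unfold Y in M, G. replace (-1 * - x) with x in M, G by ring. assert (G2 := X_left t' x L lra). assert (G3 := x2_lt t' lra). apply LL; lra.
    + assert (M := Y_mono_t 1 lra x t t' lra lra Ht'). assert (G := Y_gt 1 lra x t lra lra).
      unfold Y in M, G. rewrite !Rmult_1_l in M, G. assert (G2 := X_right t' x L lra). assert (G3 := x1_gt t' lra). apply RR; lra.
  - destruct (Rtotal_order s t) as [L|[E|L]]; [right|subst s; contradiction|left; exists s; split; auto; lra].
    destruct (side_limit s t sg Sg lra lra) as (l0 & HL0). assert (N := side_limit_neq s t sg l0 Sg lra lra HL0).
    destruct (Rlt_le_dec l0 (lam t)) as [Q|Q].
    + destruct (side_limit_time s t t' sg (-1) l0 l Sg lra lra lra Ht' HL0 HL lra). apply LL; lra.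
    + destruct (side_limit_time s t t' sg 1 l0 l Sg lra lra lra Ht' HL0 HL lra). apply RR; lra.
Qed.

(** The harmonic measure of the segment between [lam t] and [lam t'] is carried by the new arc,
    which lies within about [d * A t'] of the tip, so [Bq] dominates it. From a point at height of
    order [A t'] it is at most a multiple of [d^(1/4)], while a segment longer than [k * A t'] would
    be seen under a larger angle. *)
Lemma lam_close t t' d k : 0 < t < t' -> t' < t0 -> 0 < d <= 1 -> A t' <= (1 + d) * A t -> 0 < k -> PI * b4 (3 * d) / c0 < atan (k / 40) ->
  Rabs (lam t' - lam t) <= k * A t'.
Proof.
  intros Ht Ht' Hd HA Hk Hsmall.  apply Rnot_lt_le. intros Big. assert (PP := PI_RGT_0). assert (Cp := c0_pos).
  assert (Pa := gamma_ca t lra). assert (Pa' := gamma_ca t' lra). set (a := ca th (gamma t')) in *.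
  assert (Ex : exists sx, sx * sx = 1 /\ sx * (lam t' - lam t) = Rabs (lam t' - lam t)).
  { destruct (Rle_lt_dec 0 (lam t' - lam t)); [exists 1|exists (-1)]; split; try ring; [rewrite Rabs_pos_eq|rewrite Rabs_left]; lra. }
  destruct Ex as (sx & Sx & Es). assert (Ab := sg_abs sx Sx).
  set (D := Rabs (lam t' - lam t)) in *. assert (D0 : 0 < D) by nra.
  set (K := PI * b4 (3 * d * a) / c0). assert (B4 := b4_pos (3 * d * a)). assert (K0 : 0 < K) by (apply Rdiv_lt_0_compat; [apply Rmult_lt_0_compat|]; auto).
  assert (Htt : 0 < t' < t0) by lra.
  assert (ub : forall z, slit gamma t' z -> sx * (argH (f z t' - RtoC (lam t'))%C - argH (f z t' - RtoC (lam t))%C) <= PI).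
  { intros z Hz. assert (A1 := argf_bound t' z (lam t') lra Hz). assert (A2 := argf_bound t' z (lam t) lra Hz).
    eapply Rle_trans; [apply Rle_abs|]. rewrite Rabs_mult, Ab, Rmult_1_l. apply Rabs_le. lra. }
  assert (Bp : forall z, 0 <= Bq (t := t') z).
  { intros z. assert (B := Bq_bound (t := t') z). assert (0 < / b4 (<|z - gamma t'|>)) by (apply Rinv_0_lt_compat, b4_pos).
    apply Rle_trans with (c0 * / b4 (<|z - gamma t'|>)); [apply Rmult_le_pos; lra|lra]. }
  assert (Hop := slit_open CH t' lra).
  assert (Main : forall z, slit gamma t' z -> sx * (argH (f z t' - RtoC (lam t'))%C - argH (f z t' - RtoC (lam t))%C) - K * Bq (t := t') z <= 0).
  { apply (max_principle (slit gamma t') _ PI (gamma 0 :: gamma t' :: gamma t :: nil)); auto.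
    - intros z Hz. apply (@slit_H gamma t'). auto.
    - intros e [<-|[<-|[<-|[]]]] (_ & KK); apply KK; [exists 0|exists t'|exists t]; split; auto; unfold Icc; lra.
    - assert (h1 := harm_argf t' (lam t') _ lra Hop (fun z H => H)). assert (h2 := harm_argf t' (lam t) _ lra Hop (fun z H => H)).
      apply harm_minus; apply harm_scal; [apply harm_minus; auto|apply (Bq_harm Htt)].
    - intros z Hz. assert (U := ub z Hz). assert (B := Bp z). nra.
    - intros ze e ND NI I0 He.
      assert (NE : ~ slit_ends gamma t' ze) by (intros [-> | ->]; apply NI; simpl; auto).
      apply near_boundary; auto. intros l Bv.
      destruct (lam_boundary t t' sx ze l e Ht Ht' Sx lra He ltac:(intros ->; apply NI; simpl; auto) Bv) as [(s & Hs & ->)|(d1 & D1 & K1)].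
      + exists (d * a). split; [nra|]. intros z Hz Z _. apply Rle_trans with 0; [|lra]. assert (U := ub z Hz).
        enough (PI <= K * Bq (t := t') z) by lra.
        (* The new arc has extent at most [d a] along the ray and a quarter of this across it; with
           the distance of [z] to [gamma s] this stays below [3 d a]. *)
        assert (Dz : <|z - gamma t'|> <= 3 * d * a).
        { assert (T3 := Cmod_tri3 z (gamma s) (gamma t')). assert (R1 := rot_le th (gamma s) (gamma t')).
          destruct (GL s t' lra lra lra) as (G1 & G2). rewrite Rabs_minus_sym in G2. fold a in G1, G2, R1.
          assert (G3 : ca th (gamma t) <= ca th (gamma s)) by (apply ca_mono; lra).
          rewrite (Rabs_left1 (ca th (gamma s) - a)) in R1 by lra.
          assert (G4 : a - ca th (gamma s) <= d * a) by nra.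
          assert (eps * (a - ca th (gamma s)) <= / 4 * (a - ca th (gamma s))) by (apply Rmult_le_compat_r; lra).
           lra. }
        assert (Pz : 0 < <|z - gamma t'|>).
        { apply Cmod_gt_0. intros E. apply Csub0 in E. subst z. apply (proj2 Hz). exists t'. split; auto. unfold Icc; lra. }
        assert (B := proj1 (Bq_bound (t := t') z)). assert (Lb := b4_le _ _ Pz Dz). assert (Pb := b4_pos (<|z - gamma t'|>)).
        assert (IB : / b4 (3 * d * a) <= / b4 (<|z - gamma t'|>)) by (apply Rinv_le_contravar; auto).
        apply Rle_trans with (K * (c0 * / b4 (3 * d * a))); [right; unfold K; field; lra|].
        apply Rmult_le_compat_l; [lra|]. eapply Rle_trans; [|exact B]. apply Rmult_le_compat_l; lra.
      + exists d1. split; auto. intros z Hz _ Z. specialize (K1 _ Z). assert (B := Bp z). nra. }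
  (* The preimage of a point of height [40 a] has height at least [40 a], while the tip has modulus
     at most [(1 + eps) a]; so the observer is at distance at least [a] from the tip. *)
  set (w0 := (RtoC (lam t') + Ci * RtoC (40 * a))%C).
  assert (Iw : Im w0 = 40 * a) by (unfold w0, Im; simpl; ring). assert (Rw : Re w0 = lam t') by (unfold w0, Re; simpl; ring).
  destruct (F_spec CH t' w0 lra lra) as (S1 & S2). set (z0 := F t' w0) in *.
  assert (M := Main z0 S1). rewrite S2, !argH_atan in M by (rewrite im_sub_R; lra). rewrite !im_sub_R, !re_sub_R, Iw, Rw in M.
  assert (Iz := Imf_le CH t' z0 lra S1). rewrite S2, Iw in Iz.
  assert (Gs := gamma_size t' t' lra lra). cbv beta in Gs. fold a in Gs.
  assert (Dz : a <= <|z0 - gamma t'|>).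
  { assert (A1 := Cmod_rev z0 (gamma t')). assert (A2 := im_le_Cmod z0). assert (A3 := Rle_abs (Im z0)). nra. }
  assert (Bu := proj2 (Bq_bound (t := t') z0)). assert (Lb := b4_le _ _ Pa' Dz). assert (Pb := b4_pos a).
  assert (IB : / b4 (<|z0 - gamma t'|>) <= / b4 a) by (apply Rinv_le_contravar; auto).
  assert (KB : K * Bq (t := t') z0 <= PI * b4 (3 * d) / c0).
  { apply Rle_trans with (K * / b4 a); [apply Rmult_le_compat_l; lra|]. right. unfold K. rewrite b4_mult by lra. field. lra. }
  unfold Rminus in M. rewrite Rplus_opp_r in M. unfold Rdiv at 2 in M. rewrite Rmult_0_l, atan_0 in M.
  assert (E2 : sx * atan ((lam t' + - lam t) / (40 * a)) = atan (D / (40 * a))).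
  { assert (Cs : sx = 1 \/ sx = -1) by (destruct (Rle_lt_dec 0 sx); [left|right]; nra).
    rewrite <- Es. destruct Cs as [-> | ->]; [rewrite !Rmult_1_l; auto|].
    replace (-1 * (lam t' - lam t) / (40 * a)) with (- ((lam t' + - lam t) / (40 * a))) by (field; lra). rewrite atan_opp. ring. }
  assert (Lt : atan (k / 40) < atan (D / (40 * a))).
  { apply atan_increasing. apply Rmult_lt_reg_r with (40 * a); [lra|]. unfold Rdiv at 2. rewrite Rmult_assoc, Rinv_l, Rmult_1_r by lra. lra. }
  lra.
Qed.

(** [ye] is only an infimum of trajectories, so the estimate is made for [Y sx u]. It lies beyond
    [ye], hence has speed at most [2 / a], and it starts within [e] of [ye] for small [u]. *)
Lemma ye_rise_le sx r1 r2 a : sx * sx = 1 -> 0 < r1 <= r2 -> r2 < t0 -> 0 < a -> (forall r, r1 <= r <= r2 -> a <= ye sx r - sx * lam r) ->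
  ye sx r2 <= ye sx r1 + 2 / a * (r2 - r1).
Proof.
  intros Sx Hr H2 Ha HA. apply le_epsilon. intros e He.
  destruct (ye_spec sx Sx r1 lra) as (_ & H). destruct (H e He) as (u0 & U0 & HU). set (u := u0 / 2). specialize (HU u ltac:(unfold u; lra)).
  assert (Hu : 0 < u) by (unfold u; lra).
  destruct (rsol_elim _ _ _ _ (Y_rsol sx Sx u r2 Hu lra)) as (W & D & _).
  assert (B : Y sx u r2 - Y sx u r1 <= 2 / a * (r2 - r1)).
  { apply mvt_le; [lra|apply (wcont_sub 0 r2); auto; lra|]. intros r Hrr. eexists. split; [apply D; lra|].
    assert (L := proj1 (ye_spec sx Sx r lra) u Hu). specialize (HA r lra).
    unfold Rdiv. apply Rmult_le_compat_l; [lra|]. apply Rinv_le_contravar; lra. }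
  assert (L := proj1 (ye_spec sx Sx r2 lra) u Hu). lra.
Qed.

(** Gaps between trajectories on one side shrink with time; letting the inner one start ever closer
    to the origin gives the same for the gap to [ye]. *)
Lemma Y_ye_gap sx u r1 r : sx * sx = 1 -> 0 < u -> 0 <= r1 <= r -> r < t0 -> Y sx u r - ye sx r <= Y sx u r1 - ye sx r1.
Proof.
  intros Sx Hu Hr H2. apply le_epsilon. intros e He.
  destruct (proj2 (ye_spec sx Sx r lra) e He) as (v0 & V0 & HV).
  set (v := Rmin u v0 / 2). assert (M1 := Rmin_l u v0). assert (M2 := Rmin_r u v0). assert (M3 : 0 < Rmin u v0) by (apply Rmin_pos; auto).
  assert (Hv : 0 < v < u /\ v < v0) by (unfold v; lra). specialize (HV v lra).
  destruct (Y_mono_u sx Sx v u r lra lra) as (_ & C). specialize (C r1 lra).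
  assert (L := proj1 (ye_spec sx Sx r1 lra) v lra). lra.
Qed.

(** Dual to [ye_rise_le]: by [Y_ye_gap] a trajectory that starts within [e] of [ye] stays within [e]
    of it, so its speed is at least [2 / (b + e)]. *)
Lemma ye_rise_ge sx r1 r2 b : sx * sx = 1 -> 0 < r1 <= r2 -> r2 < t0 -> 0 < b -> (forall r, r1 <= r <= r2 -> ye sx r - sx * lam r <= b) ->
  ye sx r1 + 2 / b * (r2 - r1) <= ye sx r2.
Proof.
  intros Sx Hr H2 Hb HB. apply le_epsilon. intros eta Heta.
  (* Chosen so that the loss from replacing [b] by [b + e] in the speed stays below [eta]. *)
  set (k := 1 + 2 * (r2 - r1) / (b * b)). assert (Bb : 0 < b * b) by (apply Rmult_lt_0_compat; auto).
  assert (K0 : 1 <= k). { unfold k. assert (0 <= 2 * (r2 - r1) / (b * b)) by (apply Rmult_le_pos; [lra|apply Rlt_le, Rinv_0_lt_compat; auto]). lra. }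
  set (e := eta / k). assert (E0 : 0 < e) by (apply Rdiv_lt_0_compat; lra).
  destruct (ye_spec sx Sx r1 lra) as (_ & H). destruct (H e E0) as (u0 & U0 & HU). set (u := u0 / 2). specialize (HU u ltac:(unfold u; lra)).
  assert (Hu : 0 < u) by (unfold u; lra). clearbody u.
  destruct (rsol_elim _ _ _ _ (Y_rsol sx Sx u r2 Hu lra)) as (W & D & _).
  assert (B : -1 * Y sx u r2 - -1 * Y sx u r1 <= - (2 / (b + e)) * (r2 - r1)).
  { apply (mvt_le (fun r => -1 * Y sx u r)); [lra|apply (wcont_mult r1 r2 (fun _ => -1)); [apply wcont_cst|apply (wcont_sub 0 r2); auto; lra]|]. intros r Hrr.
    exists (-1 * (2 / (Y sx u r - sx * lam r))). split; [apply (is_derive_scal (Y sx u) r (-1)); apply D; lra|].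
    assert (G := Y_gt sx Sx u r Hu lra). assert (Q := Y_ye_gap sx u r1 r Sx Hu lra lra). specialize (HB r lra).
    enough (2 / (b + e) <= 2 / (Y sx u r - sx * lam r)) by lra. unfold Rdiv. apply Rmult_le_compat_l; [lra|]. apply Rinv_le_contravar; lra. }
  assert (Q := Y_ye_gap sx u r1 r2 Sx Hu lra lra).
  assert (F1 : 2 / b * (r2 - r1) - 2 / (b + e) * (r2 - r1) <= 2 * (r2 - r1) / (b * b) * e).
  { replace (2 / b * (r2 - r1) - 2 / (b + e) * (r2 - r1)) with (2 * (r2 - r1) * e * / (b * (b + e))) by (field; lra).
    replace (2 * (r2 - r1) / (b * b) * e) with (2 * (r2 - r1) * e * / (b * b)) by (field; lra).
    apply Rmult_le_compat_l; [apply Rmult_le_pos; lra|]. apply Rinv_le_contravar; nra. }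
  assert (F2 : e + 2 * (r2 - r1) / (b * b) * e = eta) by (transitivity (k * e); [unfold k; ring|unfold e; field; lra]). lra.
Qed.

Lemma ye_mono sx r1 r2 : sx * sx = 1 -> 0 < r1 <= r2 -> r2 < t0 -> ye sx r1 <= ye sx r2.
Proof.
  intros Sx Hr H2. apply le_epsilon. intros e He. destruct (proj2 (ye_spec sx Sx r2 lra) e He) as (u0 & U0 & HU).
  specialize (HU (u0 / 2) lra). assert (M := Y_mono_t sx Sx (u0 / 2) r1 r2 lra lra H2).
  assert (L := proj1 (ye_spec sx Sx r1 lra) (u0 / 2) lra). lra.
Qed.

Local Notation width t := (ye 1 t + ye (-1) t).

(** If one side is too wide at time [t], the centre of mass drifts by a fixed proportion of the width
   during a comparable time, which [centre_small] forbids. *)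
Lemma balance sx P d k t t' : sx * sx = 1 -> 0 < P < 1 -> (forall r, 0 < r < t0 -> Rabs (P * ye sx r - (1 - P) * ye (- sx) r) <= eps * width r) ->
  0 < t < t' -> t' < t0 -> 0 < d <= 1 -> 4 * eps <= d -> 0 < k -> A t' = (1 + d) * A t ->
  PI * b4 (3 * d) / c0 < atan (k * sin th / 16 / 40) ->
  eps * (1 + 10 / sin th) < k / 2 * Rmin (sin th * d * (sin th * d) / 5000) (k * k / 8) ->
  ye sx t - sx * lam t < (P + k) * width t.
Proof.
  intros Sx HP HN Ht Ht' Hd He Hk HA Hsm Hep. cbv beta in *. apply Rnot_le_lt. intros Big.
  assert (S0 := sin_th). assert (S1 := SIN_bound th).
  assert (Pa := gamma_ca t lra). set (a := ca th (gamma t)) in *.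
  assert (Wge := width_ge_A t lra). assert (Wle := width_le_A t lra). cbv beta in Wge, Wle. fold a in Wge, Wle. unfold x1, x2 in Wge, Wle.
  set (L := width t) in *. assert (Lp : 0 < sin th * a) by (apply Rmult_lt_0_compat; auto).
  assert (WgL : sin th * a <= L) by (unfold L; lra). assert (WlL : L <= 5 * a) by (unfold L; lra).
  assert (L0 : 0 < L) by lra.
  assert (Lsum : forall r, ye sx r + ye (- sx) r = width r).
  { assert (Cs : sx = 1 \/ sx = -1) by (destruct (Rle_lt_dec 0 sx); [left|right]; nra). intros r.
    destruct Cs as [-> | ->]; [replace (- (1)) with (-1) by ring; auto|replace (- -1) with 1 by ring; ring]. }
  assert (Sn : - sx * - sx = 1) by lra.
  assert (Bp := ye_gt (- sx) Sn t lra). assert (Ls := Lsum t). fold L in Ls.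
  set (Q := 1 - P) in *. assert (Qk : k < Q) by (unfold Q; nra).
  (* The driving function moves by at most [k / 8] of the width. The factor 16 in the smallness
     hypothesis pays for this 8 and for [A t' <= 2 a]. *)
  assert (LC : forall r, t <= r <= t' -> Rabs (lam r - lam t) <= k / 8 * L).
  { intros r Hr. destruct (Req_dec r t) as [->|Nr]; [rewrite Rminus_diag, Rabs_R0; nra|].
    assert (Mo : ca th (gamma r) <= ca th (gamma t')) by (apply ca_mono; lra).
    assert (K1 : 0 < k * sin th / 16) by (apply Rdiv_lt_0_compat; [apply Rmult_lt_0_compat|]; lra).
    assert (Htr : t < r) by (destruct Hr as ([Hr|Hr] & _); [auto|congruence]).
    eapply Rle_trans; [exact (lam_close t r d (k * sin th / 16) lra lra Hd ltac:(cbv beta; fold a; lra) K1 Hsm)|]. cbv beta.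
    apply Rle_trans with (k * sin th / 16 * (2 * a)); [apply Rmult_le_compat_l; [lra|]|].
    { assert (d * a <= 1 * a) by (apply Rmult_le_compat_r; lra). lra. }
    replace (k * sin th / 16 * (2 * a)) with (k / 8 * (sin th * a)) by field. apply Rmult_le_compat_l; lra. }
  assert (Dur := duration t t' d Ht lra Hd He HA). cbv beta in Dur. fold a in Dur.
  (* The 200 of [duration] times 25, because [L <= 5 a]. *)
  set (c1 := sin th * d * (sin th * d) / 5000) in *.
  assert (Dur2 : c1 * (L * L) <= t' - t).
  { eapply Rle_trans; [|exact Dur]. replace (sin th * d * a * (sin th * d * a) / 200) with (c1 * (25 * (a * a))) by (unfold c1; field).
    apply Rmult_le_compat_l; [unfold c1; assert (0 <= sin th * d * (sin th * d)) by apply Rle_0_sqr; lra|].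
    assert (L * L <= 5 * a * (5 * a)) by (apply Rmult_le_compat; lra). lra. }
  (* The episode is cut at [k^2 / 8 * L^2], so that the gain [2 tau / L] of the wide side is at most
     [k^2 / 4 * L] when the narrow side jumps. *)
  set (tau := Rmin (t' - t) (k * k / 8 * (L * L))). assert (T1 : tau <= t' - t) by apply Rmin_l. assert (T2 : tau <= k * k / 8 * (L * L)) by apply Rmin_r.
  assert (LL : 0 < L * L) by (apply Rmult_lt_0_compat; auto).
  assert (C1p : 0 < c1) by (unfold c1; assert (0 < sin th * d) by (apply Rmult_lt_0_compat; lra); nra).
  assert (T0 : 0 < tau) by (apply Rmin_pos; [lra|apply Rmult_lt_0_compat; nra]).
  assert (T3 : Rmin c1 (k * k / 8) * (L * L) <= tau).
  { apply Rmin_glb; [eapply Rle_trans; [|exact Dur2]|]; apply Rmult_le_compat_r; try lra; [apply Rmin_l|apply Rmin_r]. }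
  set (t2 := t + tau). assert (Ab := sg_abs sx Sx).
  assert (SL : forall r, t <= r <= t2 -> - (k / 8 * L) <= sx * lam r - sx * lam t <= k / 8 * L).
  { intros r Hr. assert (B := LC r ltac:(unfold t2 in Hr; lra)). rewrite <- Rmult_minus_distr_l. apply Rabs_le_between. rewrite Rabs_mult, Ab. lra. }
  assert (PL : 0 < P * L) by (apply Rmult_lt_0_compat; lra).
  assert (Rise : ye sx t2 <= ye sx t + 2 / (P * L) * (t2 - t)).
  { apply ye_rise_le; auto; [unfold t2; lra|unfold t2; lra|]. intros r Hr. assert (M := ye_mono sx t r Sx lra ltac:(unfold t2 in Hr; lra)). specialize (SL r Hr). lra. }
  set (drop := ye (- sx) t2 - ye (- sx) t).
  assert (TL : 0 < tau / L) by (apply Rdiv_lt_0_compat; auto).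
  (* The wide side keeps a distance of at least [P L] from the driving function, so its weighted
     gain is at most [2 tau / L]. Here [drop] is the gain of the narrow side, which enters the
     centre of mass with a minus sign. *)
  assert (NC : P * ye sx t2 - Q * ye (- sx) t2 <= P * ye sx t - Q * ye (- sx) t + 2 * (tau / L) - Q * drop).
  { assert (P * ye sx t2 <= P * ye sx t + 2 * (tau / L)).
    { apply Rle_trans with (P * (ye sx t + 2 / (P * L) * (t2 - t))); [apply Rmult_le_compat_l; lra|]. right. unfold t2. field. lra. }
    unfold drop. lra. }
  assert (N1 := HN t lra). assert (N2 := HN t2 ltac:(unfold t2; lra)). apply Rabs_le_between in N1, N2. fold L in N1. fold Q in N1, N2.
  assert (W2 : width t2 <= 10 / sin th * L).
  { assert (H2 := width_le_A t2 ltac:(unfold t2; lra)).  unfold x1, x2 in H2.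
    assert (M : ca th (gamma t2) <= ca th (gamma t')) by (apply ca_mono; unfold t2; lra). rewrite HA in M.
    apply Rle_trans with (10 * a); [nra|]. apply Rmult_le_reg_l with (sin th); auto. replace (sin th * (10 / sin th * L)) with (10 * L) by (field; lra). nra. }
  assert (EL : eps * width t2 <= eps * (10 / sin th * L)) by (apply Rmult_le_compat_l; lra).
  assert (m2 := Rmin_r c1 (k * k / 8)).
  (* If the narrow side gains little, its distance stays below [(Q - k / 4) L]; it is then fast
     enough for its weighted gain to exceed that of the wide side by the factor [1 + k / 4]. If it
     gains more than [k / 2 * L], this alone outweighs the wide side. Either way the centre moves
     further than [eps] allows. *)
  destruct (Rle_lt_dec drop (k / 2 * L)) as [Sd|Sd].
  - assert (Qp : 0 < (Q - k / 4) * L) by (apply Rmult_lt_0_compat; lra).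
    assert (Fall : ye (- sx) t + 2 / ((Q - k / 4) * L) * (t2 - t) <= ye (- sx) t2).
    { apply ye_rise_ge; auto; [unfold t2; lra|unfold t2; lra|]. intros r Hr.
      assert (M := ye_mono (- sx) r t2 Sn lra ltac:(unfold t2; lra)). specialize (SL r Hr). unfold drop in Sd. unfold Q in *. nra. }
    assert (F2 : (1 + k / 4) * (2 * (tau / L)) <= Q * drop).
    { apply Rle_trans with (Q * (2 / ((Q - k / 4) * L) * tau)); [|apply Rmult_le_compat_l; [lra|]; unfold drop, t2 in *; lra].
      replace (Q * (2 / ((Q - k / 4) * L) * tau)) with (Q / (Q - k / 4) * (2 * (tau / L))) by (field; lra).
      apply Rmult_le_compat_r; [lra|]. apply Rmult_le_reg_r with (Q - k / 4); [lra|]. replace (Q / (Q - k / 4) * (Q - k / 4)) with Q by (field; lra).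
      assert (Q <= 1) by (unfold Q; lra). nra. }
    assert (F3 : Rmin c1 (k * k / 8) * L <= tau / L).
    { apply Rmult_le_reg_r with L; auto. replace (tau / L * L) with tau by (field; lra). lra. }
    assert (F4 : k / 2 * (Rmin c1 (k * k / 8) * L) <= eps * (1 + 10 / sin th) * L).
    { apply Rle_trans with (k / 2 * (tau / L)); [apply Rmult_le_compat_l; lra|lra]. }
    assert (F5 : k / 2 * Rmin c1 (k * k / 8) <= eps * (1 + 10 / sin th)) by (apply Rmult_le_reg_r with L; auto; lra).
    lra.
  - assert (F3 : tau / L <= k * k / 8 * L).
    { apply Rmult_le_reg_r with L; auto. replace (tau / L * L) with tau by (field; lra). lra. }
    assert (F2 : k * (k / 2 * L) <= Q * drop) by (apply Rmult_le_compat; nra).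
    assert (F5 : k * k / 4 <= eps * (1 + 10 / sin th)) by (apply Rmult_le_reg_r with L; auto; lra).
    assert (k / 2 * Rmin c1 (k * k / 8) <= k / 2 * (k * k / 8)) by (apply Rmult_le_compat_l; lra). unfold Q in Qk. nra.
Qed.

Lemma A_small e : 0 < e -> exists d, 0 < d /\ forall t, 0 < t < d -> t <= T -> A t < e.
Proof.
  intros He. destruct (ch_gam CH 0 e lra He) as (d & D & K). exists d. split; auto. intros t Ht HT. cbv beta.
  specialize (K t lra ltac:(rewrite Rabs_pos_eq; lra)). rewrite (ch_g0 CH) in K. assert (M := A_le_mod t). cbv beta in M.
  replace (gamma t - 0)%C with (gamma t) in K by ring. lra.
Qed.

Lemma measure_ratio k d : 0 < d <= 1 -> 4 * eps <= d -> 0 < k <= p / 2 ->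
  PI * b4 (3 * d) / c0 < atan (k * sin th / 16 / 40) ->
  eps * (1 + 10 / sin th) < k / 2 * Rmin (sin th * d * (sin th * d) / 5000) (k * k / 8) ->
  exists t1, 0 < t1 /\ forall t, 0 < t < t1 ->
    Rabs (side_measure left_side gamma f lam t / side_measure right_side gamma f lam t - (1 - p) / p) <= 8 * k / (p * p).
Proof.
  intros Hd He Hk Hsm Hep. destruct p_bound as (P0 & _). assert (PP := PI_RGT_0).
  assert (Pa := gamma_ca (t0 / 2) lra).
  (* The first bound makes the coordinate [(1 + d) a] attained by time [t0 / 2]. The second gives
     [|x| <= Rmin 1 k] between [x2] and [x1], hence [x * x <= k], so the arctangents are linear up
     to the factor [1 + k]. *)
  destruct (A_small (Rmin (ca th (gamma (t0 / 2)) / 2) (Rmin 1 k / 10))) as (t1 & T1 & HA1).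
  { assert (0 < Rmin 1 k) by (apply Rmin_pos; lra). apply Rmin_pos; lra. }
  exists (Rmin t1 (t0 / 2)). split; [apply Rmin_pos; lra|]. intros t Ht.
  assert (m1 := Rmin_l t1 (t0 / 2)). assert (m2 := Rmin_r t1 (t0 / 2)).
  specialize (HA1 t lra lra). cbv beta in HA1. set (a := ca th (gamma t)) in *. assert (Pt := gamma_ca t lra). fold a in Pt.
  destruct (Rmin2 _ _ _ HA1) as (a1 & a2).
  assert (O : exists t', 0 <= t' <= t0 / 2 /\ ca th (gamma t') = (1 + d) * a).
  { apply ca_onto; [lra|]. split; [apply Rmult_le_pos; lra|]. assert (d * a <= 1 * a) by (apply Rmult_le_compat_r; lra). lra. }
  destruct O as (t' & Ht' & E').
  assert (Tt : t < t').
  { apply Rnot_le_lt. intros K. assert (M := ca_mono t' t lra K lra). rewrite E' in M. fold a in M. nra. }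
  assert (C := fun t Ht => centre_small t Ht).
  assert (B1 := balance 1 p d k t t' lra P0). assert (B2 := balance (-1) (1 - p) d k t t' lra lra).
  replace (- (1)) with (-1) in B1 by ring. replace (- -1) with 1 in B2 by ring. replace (1 - (1 - p)) with p in B2 by ring.
  assert (D1 : ye 1 t - 1 * lam t < (p + k) * (ye 1 t + ye (-1) t)).
  { apply B1; auto; try lra. intros r Hr. assert (Cr := C r Hr). unfold x1, x2 in Cr.
    replace (p * ye 1 r - (1 - p) * ye (-1) r) with (p * ye 1 r + (1 - p) * - ye (-1) r) by ring. lra. }
  assert (D2 : ye (-1) t - -1 * lam t < (1 - p + k) * (ye 1 t + ye (-1) t)).
  { apply B2; auto; try lra. intros r Hr. assert (Cr := C r Hr). unfold x1, x2 in Cr. rewrite <- Rabs_Ropp.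
    replace (- ((1 - p) * ye (-1) r - p * ye 1 r)) with (p * ye 1 r + (1 - p) * - ye (-1) r) by ring. lra. }
  clear B1 B2. assert (Htt : 0 < t < t0) by lra. assert (G1 := x1_gt t Htt). assert (G2 := x2_lt t Htt).
  assert (Wle := width_le_A t Htt). cbv beta in Wle. fold a in Wle. assert (Ct := C t Htt). apply Rabs_le_between in Ct.
  destruct (side_measures t Htt) as (-> & ->). rewrite !argH_i.
  replace (ye 1 t + ye (-1) t) with ((x1 t - lam t) + (lam t - x2 t)) in D1, D2 by (unfold x1, x2; ring).
  change (ye 1 t) with (x1 t) in D1. replace (ye (-1) t) with (- x2 t) in D2 by (unfold x2; ring).
  set (u := x1 t) in *. set (v := x2 t) in *. set (l := lam t) in *.
  assert (Bd : forall x, v <= x <= u -> x * x <= k).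
  { intros x Hx. assert (Mu : - Rmin 1 k <= v /\ u <= Rmin 1 k).
    { assert (eps * (u - v) <= / 4 * (u - v)) by (apply Rmult_le_compat_r; lra).
      assert (p * (u - v) <= 1 * (u - v)) by (apply Rmult_le_compat_r; lra). assert (0 <= p * (u - v)) by (apply Rmult_le_pos; lra). split; lra. }
    assert (n1 := Rmin_l 1 k). assert (n2 := Rmin_r 1 k).
    assert (Xr : Rabs x <= Rmin 1 k) by (apply Rabs_le; lra).
    assert (X2 : Rabs x * Rabs x <= Rmin 1 k * 1) by (apply Rmult_le_compat; try apply Rabs_pos; lra).
    rewrite <- Rabs_mult, (Rabs_pos_eq (x * x)) in X2 by apply Rle_0_sqr. lra. }
  assert (NN := atan_lower v l k lra (Bd v lra) (Bd l lra)). assert (NU := atan_lip v l lra).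
  assert (MN := atan_lower l u k lra (Bd l lra) (Bd u lra)). assert (MU := atan_lip l u lra).
  replace (/ PI * (PI / 2 + atan l - (PI / 2 + atan v)) / (/ PI * (PI / 2 + atan u - (PI / 2 + atan l)))) with ((atan l - atan v) / (atan u - atan l)).
  - apply (ratio_close p k (u - l) (l - v)); lra.
  - assert (0 < (u - l) / (1 + k)) by (apply Rdiv_lt_0_compat; lra). field. lra.
Qed.

End Asymptotics.
End Graph.

(** * The curve in arc-length parametrization *)

Lemma within_derive_eps a b g x l : is_derive_within (Icc a b) g x l -> forall e, 0 < e -> exists d, 0 < d /\
  forall y, a <= y <= b -> Rabs (y - x) < d -> <|g y - g x - l * RtoC (y - x)|> <= e * Rabs (y - x).
Proof.
  intros H e He. assert (F := filterlim_Cmod _ _ _ H e He). destruct F as (d & K). exists d. split; [apply cond_pos|]. intros y Hy Hd.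
  destruct (Req_dec y x) as [->|N].
  - rewrite Rminus_diag, Rabs_R0, Rmult_0_r. replace (g x - g x - l * 0)%C with (0 : C)%C by ring. rewrite Cmod_0. lra.
  - specialize (K y Hd N Hy). cbv beta in K.
    assert (NC : RtoC (y - x) <> 0%C) by (intros E; apply (f_equal Re) in E; simpl in E; lra).
    replace (g y - g x - l * RtoC (y - x))%C with (((g y - g x) / RtoC (y - x) - l) * RtoC (y - x))%C by (field; auto).
    rewrite Cmod_mult, Cmod_R. apply Rmult_le_compat_r; [apply Rabs_pos|lra].
Qed.

Lemma within_derive_cont a b g x l e : is_derive_within (Icc a b) g x l -> 0 < e -> exists d, 0 < d /\
  forall y, a <= y <= b -> Rabs (y - x) < d -> <|g y - g x|> < e.
Proof.
  intros D He. destruct (within_derive_eps a b g x l D 1 lra) as (d & D0 & K).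
  assert (P := Cmod_ge_0 l). exists (Rmin d (e / (Cmod l + 2))). split; [apply Rmin_pos; auto; apply Rdiv_lt_0_compat; lra|].
  intros y Hy Hd. specialize (K y Hy (Rminl Hd)). assert (H2 := Rminr Hd).
  assert (T3 := Cmod_triangle (g y - g x - l * RtoC (y - x))%C (l * RtoC (y - x))%C).
  replace (g y - g x - l * RtoC (y - x) + l * RtoC (y - x))%C with (g y - g x)%C in T3 by ring. rewrite Cmod_mult, Cmod_R in T3.
  apply Rle_lt_trans with ((Cmod l + 1) * Rabs (y - x)); [lra|].
  apply Rle_lt_trans with ((Cmod l + 1) * (e / (Cmod l + 2))); [apply Rmult_le_compat_l; lra|].
  apply Rlt_le_trans with ((Cmod l + 2) * (e / (Cmod l + 2))); [apply Rmult_lt_compat_r; [apply Rdiv_lt_0_compat|]; lra|right; field; lra].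
Qed.

Lemma within_derive_parts a b g x l : a < x < b -> is_derive_within (Icc a b) g x l ->
  is_derive (fun y => Re (g y)) x (Re l) /\ is_derive (fun y => Im (g y)) x (Im l).
Proof.
  intros Hx D. split; apply eps_derive; intros e He; destruct (within_derive_eps a b g x l D e He) as (d & D0 & K);
    (exists (Rmin d (Rmin (x - a) (b - x))); split; [repeat apply Rmin_pos; lra|]; intros k Hk;
     assert (M1 := Rminl Hk); assert (M2 := Rminl (Rminr Hk));
     assert (M3 := Rminr (Rminr Hk)); apply Rabs_def2 in M2, M3;
     specialize (K (x + k) lra ltac:(replace (x + k - x) with k by ring; auto)); replace (x + k - x) with k in K by ring;
     eapply Rle_trans; [|exact K]).
  - eapply Rle_trans; [|apply re_le_Cmod]. right. f_equal. destruct (g (x + k)), (g x), l. unfold Re. simpl. ring.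
  - eapply Rle_trans; [|apply im_le_Cmod]. right. f_equal. destruct (g (x + k)), (g x), l. unfold Im. simpl. ring.
Qed.

Lemma polygon_grow g a t t' l : a <= t <= t' -> polygon_length g a t l -> exists l', l <= l' /\ polygon_length g a t' l'.
Proof.
  intros Ht (n & p & P0 & P1 & Pm & ->).
  set (p' := fun k => if Nat.leb k (S n) then p k else t').
  assert (E : forall k, (k <= S n)%nat -> p' k = p k).
  { intros k Hk. unfold p'. apply Nat.leb_le in Hk. rewrite Hk. auto. }
  assert (E2 : p' (S (S n)) = t').
  { unfold p'. replace (Nat.leb (S (S n)) (S n)) with false; auto. symmetry. apply Nat.leb_gt. lia. }
  exists (sum_n (fun k => <|g (p' (S k)) - g (p' k)|>) (S n)). split.
  - assert (Q : sum_n (fun k => <|g (p' (S k)) - g (p' k)|>) n = sum_n (fun k => <|g (p (S k)) - g (p k)|>) n).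
    { apply sum_n_ext_loc. intros k Hk. rewrite !E by lia. auto. }
    rewrite sum_Sn, Q. assert (P := Cmod_ge_0 (g (p' (S (S n))) - g (p' (S n)))%C). unfold plus; simpl. lra.
  - exists (S n), p'. split; [rewrite E by lia; auto|]. split; auto. split; auto. intros k Hk.
    destruct (Nat.eq_dec k (S n)) as [->|N]; [rewrite E2, E, P1 by lia; lra|rewrite !E by lia; apply Pm; lia].
Qed.

Section ArcLength.
Context {T Len : R} {gamma : R -> C} {tcap : R -> R} (HLen : 0 < Len) (HT : 0 < T).
Context (gcont : wcontC 0 T gamma) (gsimple : forall t t', 0 <= t <= T -> 0 <= t' <= T -> gamma t = gamma t' -> t = t').
Context (range : forall s, 0 <= s <= Len -> 0 <= tcap s <= T) (len : forall s, 0 <= s <= Len -> is_arc_length gamma 0 (tcap s) s).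
Context (tLen : tcap Len = T).

Lemma tcap_0 : tcap 0 = 0.
Proof.
  assert (R0 := range 0 lra). apply gsimple; auto; [lra|]. apply Csub0.
  destruct (Ceq_dec (gamma (tcap 0) - gamma 0)%C 0%C) as [E|N]; auto. exfalso.
  assert (P := proj1 (Cmod_gt_0 _) N). destruct (len 0 lra) as (UB & _).
  assert (Q : <|gamma (tcap 0) - gamma 0|> <= 0); [|lra]. apply UB.
  exists 0%nat, (fun k => match k with O => 0 | _ => tcap 0 end). repeat split; auto.
  - intros k Hk. replace k with 0%nat by lia. lra.
  - rewrite sum_O. auto.
Qed.

Lemma tcap_mono s s' : 0 <= s < s' -> s' <= Len -> tcap s < tcap s'.
Proof.
  intros Hs Hs'. apply Rnot_le_lt. intros L. assert (R1 := range s' lra).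
  destruct (len s lra) as (UB & _). destruct (len s' lra) as (_ & LB).
  assert (s' <= s); [|lra]. apply LB. intros l Hl. destruct (polygon_grow gamma 0 (tcap s') (tcap s) l lra Hl) as (l' & L1 & L2).
  specialize (UB l' L2). lra.
Qed.

(** A continuous injection of a compact interval has a continuous inverse: off an interval around
    [t] the distance to [gamma t] has a positive minimum. *)
Lemma gamma_inverse t e : 0 <= t <= T -> 0 < e -> exists d, 0 < d /\ forall t', 0 <= t' <= T -> <|gamma t' - gamma t|> < d -> Rabs (t' - t) < e.
Proof.
  intros Ht He.
  assert (Half : forall a b, 0 <= a -> b <= T -> (forall r, a <= r <= b -> r <> t) -> exists c, 0 < c /\ forall r, a <= r <= b -> c <= <|gamma r - gamma t|>).
  { intros a b Ha Hb N. destruct (Rle_lt_dec a b) as [L|L]; [|exists 1; split; [lra|]; intros; lra].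
    apply (wcont_min a b (fun r => <|gamma r - gamma t|>)); auto.
    - apply (wcont_C2 a b (fun w => <|w - gamma t|>)); [|apply (wcontC_sub 0 T); auto]. intros x _.
      apply (rcont_Cmod (fun w => w - gamma t)%C), ccont_plus; [apply ccont_id|apply ccont_const].
    - intros r Hr. apply Cmod_gt_0. intros E. apply (N r Hr), gsimple; try lra. apply Csub0; auto. }
  destruct (Half 0 (t - e) lra lra ltac:(intros; lra)) as (c1 & C1 & K1).
  destruct (Half (t + e) T lra lra ltac:(intros; lra)) as (c2 & C2 & K2).
  exists (Rmin c1 c2). split; [apply Rmin_pos; auto|]. intros t' Ht' Hd. assert (m1 := Rmin_l c1 c2). assert (m2 := Rmin_r c1 c2).
  apply Rabs_def1; apply Rnot_le_lt; intros L; [specialize (K2 t' lra)|specialize (K1 t' lra)]; lra.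
Qed.

(** [tcap] is continuous because [gamma] composed with it is and [gamma] has a continuous inverse;
    so it takes all values between 0 and [T]. *)
Lemma tcap_onto t : wcontC 0 Len (fun s => gamma (tcap s)) -> 0 <= t <= T -> exists s, 0 <= s <= Len /\ tcap s = t.
Proof.
  intros HG Ht. destruct (Req_dec t T) as [->|N]; [exists Len; split; [lra|auto]|]. apply NNPP. intros K.
  assert (W : wcont 0 Len tcap).
  { intros s e Hs He. destruct (gamma_inverse (tcap s) e (range s Hs) He) as (d & D & KI). destruct (HG s d Hs D) as (d2 & D2 & K2).
    exists d2. split; [auto|]. intros y Hy Hd. apply KI; [apply range; auto|apply K2; auto]. }
  assert (P : 0 < tcap 0 - t); [|rewrite tcap_0 in P; lra].
  apply (sign_const (fun s => tcap s - t) 0 Len); [| |lra| |lra].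
  - apply wcont_minus; auto. apply wcont_cst.
  - intros s Hs E. apply K. exists s. split; auto. lra.
  - exists Len. split; [lra|]. rewrite tLen. lra.
Qed.

(** Tangency makes the derivative at 0 the unit vector of angle [th], and continuity keeps the
    derivative within [eps / 2] of it for small [s]. The mean value inequality for the two rotated
    coordinates then bounds all secants. *)
Lemma curve_graphlike th eps : class_C 4 0 Len (fun s => gamma (tcap s)) -> gamma 0 = 0%C ->
  filterlim (fun s => <|gamma (tcap s) - (cos th, sin th) * RtoC s|> / s ^ 4) (at_right 0) (locally 0) ->
  0 < eps <= / 4 -> exists t0, 0 < t0 <= T /\ graphlike th eps t0 gamma.
Proof.
  intros (G & G0 & GD & _) g0 Tan He.
  assert (D0 : is_derive_within (Icc 0 Len) (G 0%nat) 0 (cos th, sin th)).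
  { apply Cmod_filterlim; [intros P Q; apply filter_imp|]. intros e Hpos.
    destruct (filterlim_Rabs _ _ _ Tan e Hpos) as (d & K).
    exists (mkposreal (Rmin d 1) ltac:(apply Rmin_pos; [apply cond_pos|lra])). simpl. intros y Hy Ny Iy.
    assert (Hy' : Rabs (y - 0) < Rmin d 1) by exact Hy. rewrite Rminus_0_r in Hy'. unfold Icc in Iy. rewrite Rabs_pos_eq in Hy' by lra.
    destruct (Rmin2 _ _ _ Hy') as (m1 & m2).
    assert (y0 : 0 < y) by lra.
    assert (K1 := K y ltac:(change (Rabs (y - 0) < d); rewrite Rminus_0_r, Rabs_pos_eq; lra) y0). cbv beta in K1.
    rewrite !G0, tcap_0, g0 by (unfold Icc; lra). rewrite Rminus_0_r in *.
    assert (NC : RtoC y <> 0%C) by (intros E; apply (f_equal Re) in E; simpl in E; lra).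
    set (w := (gamma (tcap y) - (cos th, sin th) * RtoC y)%C) in *.
    replace ((gamma (tcap y) - 0) / RtoC y - (cos th, sin th))%C with (w / RtoC y)%C by (unfold w; field; auto).
    rewrite Cmod_div, Cmod_R, Rabs_pos_eq by (auto; lra).
    assert (Py : 0 < y ^ 4) by (apply pow_lt; auto). assert (Pw := Cmod_ge_0 w).
    rewrite Rabs_pos_eq in K1 by (apply Rmult_le_pos; [auto|apply Rlt_le, Rinv_0_lt_compat; auto]).
    eapply Rle_lt_trans; [|exact K1]. apply Rmult_le_compat_l; auto. apply Rinv_le_contravar; auto.
    assert (y * y <= y) by nra. assert (y * (y * y) <= y) by nra. simpl. nra. }
  assert (DG : forall k x, (k < 4)%nat -> 0 <= x <= Len -> is_derive_within (Icc 0 Len) (G k) x (G (S k) x)) by (intros; apply GD; auto).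
  (* The derivative at 0 from the smoothness class and the one from the tangency condition must
     coincide. *)
  assert (E1 : G 1%nat 0 = (cos th, sin th)).
  { destruct (Ceq_dec (G 1%nat 0) (cos th, sin th)) as [E|N]; auto. exfalso.
    assert (P : 0 < <|G 1%nat 0 - (cos th, sin th)|>) by (apply Cmod_gt_0; intros E; apply N, Csub0; auto). set (m := <|G 1%nat 0 - (cos th, sin th)|>) in *.
    destruct (within_derive_eps _ _ _ _ _ (DG 0%nat 0 lia lra) (m / 4) lra) as (d1 & P1 & K1).
    destruct (within_derive_eps _ _ _ _ _ D0 (m / 4) lra) as (d2 & P2 & K2).
    set (y := Rmin (Rmin d1 d2) Len / 2). assert (M1 := Rmin_l (Rmin d1 d2) Len). assert (M2 := Rmin_r (Rmin d1 d2) Len). assert (M3 := Rmin_l d1 d2). assert (M4 := Rmin_r d1 d2).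
    assert (M5 : 0 < Rmin (Rmin d1 d2) Len) by (repeat apply Rmin_pos; auto).
    assert (Hy : 0 < y /\ y < d1 /\ y < d2 /\ y <= Len) by (unfold y; lra). clearbody y.
    specialize (K1 y lra ltac:(rewrite Rminus_0_r, Rabs_pos_eq; lra)). specialize (K2 y lra ltac:(rewrite Rminus_0_r, Rabs_pos_eq; lra)).
    rewrite Rminus_0_r, (Rabs_pos_eq y) in * by lra.
    assert (T3 := Cmod_tri3 ((G 1%nat 0) * RtoC y)%C (G 0%nat y - G 0%nat 0)%C ((cos th, sin th) * RtoC y)%C).
    rewrite (Cmod_sub_sym (G 1%nat 0 * RtoC y)%C (G 0%nat y - G 0%nat 0)%C) in T3.
    replace (G 1%nat 0 * RtoC y - (cos th, sin th) * RtoC y)%C with ((G 1%nat 0 - (cos th, sin th)) * RtoC y)%C in T3 by ring.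
    rewrite Cmod_mult, Cmod_R, (Rabs_pos_eq y) in T3 by lra. fold m in T3. nra. }
  assert (W1 : wcontC 0 Len (G 1%nat)) by (intros x e Hx He'; apply (within_derive_cont _ _ _ _ _ _ (DG 1%nat x lia Hx) He')).
  assert (W0 : wcontC 0 Len (G 0%nat)) by (intros x e Hx He'; apply (within_derive_cont _ _ _ _ _ _ (DG 0%nat x lia Hx) He')).
  destruct (W1 0 (eps / 2) lra lra) as (d & D & Kd). rewrite E1 in Kd.
  set (s0 := Rmin d Len / 2). assert (M1 := Rmin_l d Len). assert (M2 := Rmin_r d Len). assert (M3 : 0 < Rmin d Len) by (apply Rmin_pos; auto).
  assert (Hs0 : 0 < s0 /\ s0 < d /\ s0 < Len) by (unfold s0; lra). clearbody s0.
  assert (t0p := tcap_mono 0 s0 lra lra). rewrite tcap_0 in t0p.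
  exists (tcap s0). split; [split; auto; apply range; lra|]. intros r r' Hr Hrr Hr'.
  assert (Rs := range s0 lra).
  assert (WG : wcontC 0 Len (fun s => gamma (tcap s))).
  { intros x e Hx Hpos. destruct (W0 x e Hx Hpos) as (d1 & D1 & K1). exists d1. split; auto. intros y Hy Hd1. rewrite <- !G0 by auto. auto. }
  destruct (tcap_onto r WG lra) as (s & Hs & <-). destruct (tcap_onto r' WG lra) as (s' & Hs' & <-).
  assert (Lss : s < s'). { apply Rnot_le_lt. intros L. destruct L as [L| ->]; [assert (M := tcap_mono s' s lra lra)|]; lra. }
  assert (Ls0 : s' <= s0). { apply Rnot_lt_le. intros L. assert (M := tcap_mono s0 s' lra lra). lra. }
  assert (Near : forall x, s < x < s' -> <|G 1%nat x - (cos th, sin th)|> < eps / 2) by (intros x Hx; apply Kd; [lra|rewrite Rminus_0_r, Rabs_pos_eq; lra]).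
  assert (Dc : forall x, s < x < s' -> is_derive (fun y => ca th (G 0%nat y)) x (ca th (G 1%nat x)) /\ is_derive (fun y => cb th (G 0%nat y)) x (cb th (G 1%nat x))).
  { intros x Hx. destruct (within_derive_parts 0 Len _ x _ lra (DG 0%nat x lia lra)) as (A1 & A2).
    split; unfold ca, cb; apply (is_derive_plus (fun y => _ * Re (G 0%nat y)) (fun y => _ * Im (G 0%nat y))); apply is_derive_scal; auto. }
  assert (ca1 : ca th (cos th, sin th) = 1) by (unfold ca, Re, Im; simpl; assert (Q := cs1 th); lra).
  assert (cb1 : cb th (cos th, sin th) = 0) by (unfold cb, Re, Im; simpl; ring).
  assert (Wca : wcont s s' (fun y => ca th (G 0%nat y)) /\ wcont s s' (fun y => cb th (G 0%nat y))).
  { assert (W : wcontC s s' (G 0%nat)) by (apply (wcontC_sub 0 Len); auto; lra). unfold ca, cb.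
    split; apply wcont_plus; apply (wcont_mult s s' (fun _ => _)); try apply wcont_cst; try apply wcont_re; try apply wcont_im; auto. }
  rewrite <- !G0 by (unfold Icc; lra).
  assert (Low : -1 * ca th (G 0%nat s') - -1 * ca th (G 0%nat s) <= - (1 - eps / 2) * (s' - s)).
  { apply (mvt_le (fun y => -1 * ca th (G 0%nat y))); [lra|apply (wcont_mult s s' (fun _ => -1)); [apply wcont_cst|apply Wca]|].
    intros x Hx. exists (-1 * ca th (G 1%nat x)). split; [apply (is_derive_scal (fun y => ca th (G 0%nat y)) x (-1)); apply Dc; auto|].
    assert (L := ca_lip th (G 1%nat x) (cos th, sin th)). rewrite ca1 in L. specialize (Near x Hx). apply Rabs_le_between in L. lra. }
  assert (Up : Rabs (cb th (G 0%nat s') - cb th (G 0%nat s)) <= eps / 2 * (s' - s)).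
  { apply (mvt_abs (fun y => cb th (G 0%nat y))); [lra|apply Wca|]. intros x Hx. exists (cb th (G 1%nat x)). split; [apply Dc; auto|].
    assert (L := cb_lip th (G 1%nat x) (cos th, sin th)). rewrite cb1, Rminus_0_r in L. specialize (Near x Hx). lra. }
  assert (Q1 : eps / 2 * (s' - s) <= / 2 * (s' - s)) by (apply Rmult_le_compat_r; lra).
  assert (Q2 : / 2 * (s' - s) <= ca th (G 0%nat s') - ca th (G 0%nat s)) by lra. split; [lra|].
  eapply Rle_trans; [exact Up|]. apply (Rmult_le_compat_l eps) in Q2; lra.
Qed.

End ArcLength.

(** * From the hypotheses of the theorem to the chain, and the choice of parameters *)

Section Driver.
Context {T : R} {gamma : R -> C} {f : C -> R -> C} {lambda : R -> R} (hT : 0 < T).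

Lemma chain_intro
  (gamma_cont : forall t, Icc 0 T t -> continuous_within (Icc 0 T) gamma t)
  (gamma_simple : forall t t', Icc 0 T t -> Icc 0 T t' -> gamma t = gamma t' -> t = t')
  (gamma_0 : gamma 0 = RtoC 0)
  (gamma_H : forall t, 0 < t <= T -> Hplane (gamma t))
  (f_conf : forall t, Icc 0 T t -> conformal_onto (slit gamma t) Hplane (fun z => f z t))
  (f_hydro : forall t, Icc 0 T t -> hydrodynamic (slit gamma t) (fun z => f z t) t)
  (lambda_cont : forall t, Icc 0 T t -> filterlim lambda (within (Icc 0 T) (locally t)) (locally (lambda t)))
  (f_0 : forall z, Hplane z -> f z 0 = z)
  (f_loewner : forall t z, Icc 0 T t -> slit gamma t z ->
     is_derive_within (Icc 0 T) (fun t' => f z t') t (RtoC 2 / (f z t - RtoC (lambda t)))%C)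
  (f_tip : forall t, Icc 0 T t ->
     filterlim (fun z => f z t) (within (slit gamma t) (locally (gamma t))) (locally (RtoC (lambda t)))) :
  chain T lambda gamma f.
Proof.
  assert (Map : forall t z, 0 <= t <= T -> slit gamma t z -> 0 < Im (f z t)).
  { intros t z Ht Hz. apply (proj2 (proj2 (f_conf t Ht)) (f z t)). exists z. auto. }
  split; auto.
  - intros t e Ht He. destruct (within_eps _ _ _ (filterlim_Rabs _ _ _ (lambda_cont t Ht) e He)) as (d & D & K). exists d. auto.
  - apply wcontC_within. auto.
  - intros t z w Ht. apply (proj1 (proj2 (f_conf t Ht))).
  - intros t w Ht Hw. apply (proj2 (proj2 (f_conf t Ht)) w). auto.
  - intros t z Ht Hz e He. assert (D := proj1 (f_conf t Ht) z Hz). apply ex_derive_continuous in D.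
    destruct (D (fun w => <|w - f z t|> < e) (locally_Cmod (f z t) e He)) as (d & K).
    exists d. split; [apply cond_pos|]. intros w Hw. apply (K w Hw).
  - intros t z Ht Hz.
    assert (Mono : forall r, 0 <= r <= t -> slit gamma r z).
    { intros r Hr. destruct Hz as (I & N). split; auto. intros (x & Hx & E). apply N. exists x. split; auto. unfold Icc in *; lra. }
    split; [|split].
    + assert (W : wcontC 0 t (fun r => f z r)); [|exact W].
      intros r e Hr He. destruct (within_derive_cont _ _ _ _ _ e (f_loewner r z ltac:(unfold Icc; lra) (Mono r Hr)) He) as (d & D & K).
      exists d. split; auto. intros y Hy. apply K. lra.
    + intros r Hr. apply (within_derive_parts 0 T); [lra|]. apply f_loewner; [unfold Icc; lra|apply Mono; lra].
    + intros r Hr E. assert (I := Map r z lra (Mono r Hr)). rewrite E in I. simpl in I. lra.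
  - intros t e Ht He. assert (F := filterlim_Cmod _ _ _ (f_tip t Ht) e He). unfold within in F.
    destruct (locally_Cmod_inv _ _ F) as (d & D & K). exists d. split; auto.
Qed.
End Driver.

Theorem theorem1
  (beta theta T Len : R) (gamma : R -> C) (tcap : R -> R)
  (f : C -> R -> C) (lambda : R -> R)
  (hbeta : -1 < beta < 1)
  (htheta : theta = PI / 2 * (1 - beta))
  (hT : 0 < T)
  (* gamma is a simple continuous curve in H ∪ {0} starting at 0 *)
  (gamma_cont : forall t, Icc 0 T t -> continuous_within (Icc 0 T) gamma t)
  (gamma_simple : forall t t', Icc 0 T t -> Icc 0 T t' ->
     gamma t = gamma t' -> t = t')
  (gamma_0 : gamma 0 = RtoC 0)
  (gamma_H : forall t, 0 < t <= T -> Hplane (gamma t))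
  (* f(.,t) is the normalized conformal map; gamma is parametrized by
     half-plane capacity *)
  (f_conf : forall t, Icc 0 T t ->
     conformal_onto (slit gamma t) Hplane (fun z => f z t))
  (f_hydro : forall t, Icc 0 T t ->
     hydrodynamic (slit gamma t) (fun z => f z t) t)
  (* chordal Loewner equation with continuous driving function lambda *)
  (lambda_cont : forall t, Icc 0 T t ->
     filterlim lambda (within (Icc 0 T) (locally t)) (locally (lambda t)))
  (f_0 : forall z, Hplane z -> f z 0 = z)
  (f_loewner : forall t z, Icc 0 T t -> slit gamma t z ->
     is_derive_within (Icc 0 T) (fun t' => f z t') t
       (RtoC 2 / (f z t - RtoC (lambda t)))%C)
  (* f(.,t) extends continuously to the tip, with f(gamma(t),t) = lambda(t) *)
  (f_tip : forall t, Icc 0 T t ->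
     filterlim (fun z => f z t) (within (slit gamma t) (locally (gamma t)))
       (locally (RtoC (lambda t))))
  (* tcap s is the half-plane capacity of the initial piece of length s *)
  (hLen : 0 < Len)
  (tcap_range : forall s, Icc 0 Len s -> Icc 0 T (tcap s))
  (tcap_length : forall s, Icc 0 Len s -> is_arc_length gamma 0 (tcap s) s)
  (tcap_Len : tcap Len = T)
  (gamma_C4 : class_C 4 0 Len (fun s => gamma (tcap s)))
  (gamma_tangent :
     filterlim
       (fun s => Cmod (gamma (tcap s) - (cos theta, sin theta) * RtoC s)%C / s ^ 4)
       (at_right 0) (locally 0)) :
  filterlim
    (fun t => side_measure left_side gamma f lambda t
              / side_measure right_side gamma f lambda t)
    (at_right 0) (locally ((1 + beta) / (1 - beta))).
Proof.
  assert (CH : chain T lambda gamma f) by (apply chain_intro; auto).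
  assert (PP := PI_RGT_0). assert (Hth : 0 < theta < PI) by (rewrite htheta; split; nra).
  assert (S0 : 0 < sin theta) by (apply sin_gt_0; lra).
  assert (Pp : p (th := theta) = (1 - beta) / 2) by (unfold p; rewrite htheta; field; lra).
  set (P := (1 - beta) / 2) in *. assert (P0 : 0 < P < 1) by (unfold P; lra).
  apply Rabs_filterlim; [intros; eapply filter_imp; eauto|]. intros e He.
  assert (PP2 : 0 < P * P) by nra.
  (* Makes the error [8 k / P^2] of [measure_ratio] at most [e / 2]. *)
  set (k := Rmin (P / 2) (e * (P * P) / 16)). assert (k1 : k <= P / 2) by apply Rmin_l. assert (k2 : k <= e * (P * P) / 16) by apply Rmin_r.
  assert (k0 : 0 < k) by (apply Rmin_pos; [lra|apply Rdiv_lt_0_compat; [apply Rmult_lt_0_compat|]; lra]). clearbody k.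
  set (v := atan (k * sin theta / 16 / 40)). assert (v0 : 0 < v).
  { unfold v. rewrite <- atan_0. apply atan_increasing. repeat apply Rdiv_lt_0_compat; try lra. apply Rmult_lt_0_compat; auto. }
  assert (C0 := c0_pos).
  (* [d] is taken so small that the new arc, of relative size [d], cannot move the driving function
     by the amount tolerated by [k]. *)
  destruct (b4_small (c0 * v / PI)) as (d0 & D0 & Hd0); [apply Rdiv_lt_0_compat; [apply Rmult_lt_0_compat|]; lra|].
  set (d := Rmin 1 (d0 / 6)). assert (d1 : d <= 1) by apply Rmin_l. assert (d2 : d <= d0 / 6) by apply Rmin_r. assert (dp : 0 < d) by (apply Rmin_pos; lra). clearbody d.
  assert (Hsm : PI * b4 (3 * d) / c0 < v).
  { specialize (Hd0 (3 * d) lra). apply Rmult_lt_reg_r with (c0 / PI); [apply Rdiv_lt_0_compat; lra|].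
    replace (PI * b4 (3 * d) / c0 * (c0 / PI)) with (b4 (3 * d)) by (field; lra). replace (v * (c0 / PI)) with (c0 * v / PI) by (field; lra). auto. }
  set (c := k / 2 * Rmin (sin theta * d * (sin theta * d) / 5000) (k * k / 8)).
  assert (cp : 0 < c).
  { assert (0 < sin theta * d) by (apply Rmult_lt_0_compat; auto). apply Rmult_lt_0_compat; [lra|]. apply Rmin_pos; nra. }
  set (g := 1 + 10 / sin theta). assert (g0 : 0 < g) by (unfold g; assert (0 < 10 / sin theta) by (apply Rdiv_lt_0_compat; lra); lra).
  (* [eps] comes last: beyond the geometric conditions it must be small against [d], and against
     [c], the drift of the centre of mass that one episode forces, relative to the width. *)
  assert (Ep : exists eps, 0 < eps <= / 4 /\ 2 * eps <= sin theta /\ eps < theta /\ eps < PI - theta /\ 4 * eps <= d /\ eps * g < c).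
  { set (m := Rmin (Rmin (/ 4) (sin theta / 2)) (Rmin (Rmin (theta / 2) ((PI - theta) / 2)) (Rmin (d / 4) (c / (2 * g))))).
    assert (cg : 0 < c / (2 * g)) by (apply Rdiv_lt_0_compat; lra).
    exists m. assert (M0 : 0 < m) by (repeat apply Rmin_pos; lra).
    assert (B : m <= / 4 /\ m <= sin theta / 2 /\ m <= theta / 2 /\ m <= (PI - theta) / 2 /\ m <= d / 4 /\ m <= c / (2 * g)).
    { repeat split; unfold m; eauto 6 using Rle_trans, Rmin_l, Rmin_r, Rle_refl. }
    clearbody m. assert (m * g <= c / (2 * g) * g) by (apply Rmult_le_compat_r; lra). replace (c / (2 * g) * g) with (c / 2) in * by (field; lra). lra. }
  destruct Ep as (eps & Heps & E1 & E2 & E3 & E4 & E5).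
  destruct (curve_graphlike (T := T) (tcap := tcap) hLen hT (ch_gam CH) (ch_simple CH) tcap_range tcap_length tcap_Len theta eps gamma_C4 gamma_0 gamma_tangent Heps) as (t0 & Ht0 & GL).
  assert (Heps' : 0 <= eps <= / 4) by lra.
  destruct (exists_graph CH Heps' Ht0 GL) as (h & Hh).
  destruct (measure_ratio CH Hth Heps' Ht0 GL Hh E1 E2 E3 k d) as (t1 & T1 & HR); auto; [rewrite Pp; lra|].
  rewrite Pp in HR.
  exists (mkposreal t1 T1). intros t Bt Pt. assert (Bt' : Rabs (t - 0) < t1) by exact Bt. rewrite Rminus_0_r, Rabs_pos_eq in Bt' by lra.
  specialize (HR t lra). replace ((1 + beta) / (1 - beta)) with ((1 - P) / P) by (unfold P; field; lra).
  eapply Rle_lt_trans; [exact HR|]. apply Rle_lt_trans with (e / 2); [|lra].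
  apply Rmult_le_reg_r with (P * P); auto. replace (8 * k / (P * P) * (P * P)) with (8 * k) by (field; lra). lra.
Qed.
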